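(* Let $(X,d,\mu)$ be a doubling metric measure space. Then for $p_0,p_1\in[1,\infty]$ (not both equal to $\infty$), $q_0,q_1\in(1,\infty)$, $\theta\in[0,1]$ and $\alpha>0$, we have, up to equivalence of norms, $$[T^{p_0,q_0,\alpha}(X),T^{p_1,q_1,\alpha}(X)]_\theta = T^{p,q,\alpha}(X),$$ where $1/p=(1-\theta)/p_0+\theta/p_1$ and $1/q=(1-\theta)/q_0+\theta/q_1$ (with the convention $1/\infty=0$).
   Context: A metric measure space $(X,d,\mu)$ is a metric space $(X,d)$ with a Borel measure $\mu$. Write $B(x,r)=\{y\in X: d(x,y)<r\}$ and $V(x,r)=\mu(B(x,r))$; it is assumed throughout that $0<V(x,r)<\infty$ for all $x\in X$, $r>0$. $X$ is *doubling* if there is $C>0$ with $V(x,2r)\le C\,V(x,r)$ for all $x\in X$, $r>0$. Let $X^+:=X\times(0,\infty)$ with the product topology and the measure $d\mu(y)\,dt/t$. For $x\in X$, $\alpha>0$ the cone is $\Gamma^\alpha(x):=\{(y,t)\in X^+: d(x,y)<\alpha t\}$; for $F\subset X$, $\Gamma^\alpha(F):=\bigcup_{x\in F}\Gamma^\alpha(x)$; for $O\subset X$ the tent over $O$ is $T^\alpha(O):=X^+\setminus\Gamma^\alpha(X\setminus O)$. For $q\in(0,\infty)$ and measurable $f:X^+\to\mathbb{C}$, $$\mathcal{A}_q^\alpha(f)(x):=\left(\iint_{\Gamma^\alpha(x)}|f(y,t)|^q\,\frac{d\mu(y)}{V(y,\alpha t)}\,\frac{dt}{t}\right)^{1/q},\qquad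 \mathcal{C}_q^\alpha(f)(x):=\sup_{B\ni x}\left(\frac{1}{\mu(B)}\iint_{T^\alpha(B)}|f(y,t)|^q\,d\mu(y)\,\frac{dt}{t}\right)^{1/q},$$ the supremum being over all balls $B$ containing $x$. For $p\in(0,\infty)$, $\|f\|_{T^{p,q,\alpha}(X)}:=\|\mathcal{A}_q^\alpha(f)\|_{L^p(X)}$, and $\|f\|_{T^{\infty,q,\alpha}(X)}:=\|\mathcal{C}_q^\alpha(f)\|_{L^\infty(X)}$; $T^{p,q,\alpha}(X)$ ($p\in(0,\infty]$) is the space of measurable $f:X^+\to\mathbb{C}$ (modulo a.e. equality) with finite norm. Complex interpolation: an interpolation pair $(B_0,B_1)$ is a pair of complex Banach spaces which embed into a single complex Hausdorff topological vector space (here tent spaces, viewed inside the functions on $X^+$ integrable on all sets $B(x,r)\times(a,b)$ with $0<a<b<\infty$). $B_0+B_1$ has norm $\inf\{\|x_0\|_{B_0}+\|x_1\|_{B_1}: x_0\in B_0,\ x_1\in B_1,\ x=x_0+x_1\}$. $\mathcal{F}(B_0,B_1)$ is the space of functions $f:\{z\in\mathbb{C}:0\le\operatorname{Re}z\le1\}\to B_0+B_1$ that are continuous, analytic in the interior, with $f(z)\in B_j$ for $\operatorname{Re}z=j$, and whose traces $f|_{\operatorname{Re}z=j}$ are continuous into $B_j$ and vanish at infinity ($j=0,1$), normed by $\|f\|_{\mathcal{F}(B_0,B_1)}=\max_{j=0,1}\sup_{\operatorname{Re}z=j}\|f(z)\|_{B_j}$. For $\theta\in[0,1]$, $[B_0,B_1]_\theta:=\{f(\theta):f\in\mathcal{F}(B_0,B_1)\}$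 with norm $\|x\|_{[B_0,B_1]_\theta}=\inf_{f(\theta)=x}\|f\|_{\mathcal{F}(B_0,B_1)}$.
   Formalization: Functions in F(B_0,B_1) are also required to be bounded into B_0+B_1 (otherwise the interpolation norm vanishes on the intersection), and the endpoint cases with p=∞ (θ=0 with p_0=∞, θ=1 with p_1=∞), where the identity fails in general, are excluded. *)

(* Defs.v *)
From HB Require Import structures.
From mathcomp Require Import all_boot all_order all_algebra.
From mathcomp Require Import all_classical all_reals all_analysis.
From mathcomp Require Import complex.

Set Implicit Arguments.
Unset Strict Implicit.
Unset Printing Implicit Defensive.
Import Order.TTheory GRing.Theory Num.Theory.
Import numFieldNormedType.Exports.

Local Open Scope classical_set_scope.
Local Open Scope ring_scope.
Local Open Scope complex_scope.

HB.mixin Record isBorelMetric (d : measure_display) (R : realType) T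
    & Measurable d T & Metric R T := {
  borel_measurableE : @measurable d T = <<s [set U : set T | open U] >>
}.

(* a metric space equipped with its Borel sigma-algebra *)
#[short(type="borelMetricType")]
HB.structure Definition BorelMetric (d : measure_display) (R : realType) :=
  { T of Measurable d T & Metric R T & isBorelMetric d R T }.

Section complex_interpolation.
Context {R : realType} {V : lmodType R[i]}.
Implicit Types (N : V -> \bar R) (f : R[i]^o -> V) (x : V).
Local Open Scope ereal_scope.

(* A Banach space embedded in (a quotient of) V is presented by a [0, +oo]-valued
   seminorm N on V: its elements are the x with N x < +oo, two of them being the
   same element when N (x - y) = 0. *)
Definition fin_space N : set V := [set x | N x < +oo].

Definition sum_norm N0 N1 x : \bar R :=
  ereal_inf [set N0 u.1 + N1 u.2 | u in [set u : V * V | x = (u.1 + u.2)%R]].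

Definition strip : set R[i]^o := [set z | (0 <= complex.Re z <= 1)%R].

Definition strip_interior : set R[i]^o := [set z | (0 < complex.Re z < 1)%R].

Definition C0_trace N (g : R -> V) : Prop :=
  [/\ forall t, fin_space N (g t),
      forall t, N (g s - g t)%R @[s --> t] --> 0,
      N (g t) @[t --> +oo%R] --> 0 &
      N (g t) @[t --> -oo%R] --> 0].

(* The class F(B_0, B_1); only the values of f on the strip matter. Boundedness on
   the strip is part of Calderon's definition: without it the functions
   exp(n sin(pi z) + z ^ 2) x, with x in B_0 and B_1, would show that the
   interpolation norm vanishes at x for 0 < theta < 1. *)
Record calderon N0 N1 f : Prop := Calderon {
  calderon_range : forall z, strip z -> fin_space (sum_norm N0 N1) (f z) ;
  calderon_bounded :
    exists M : R, forall z, strip z -> sum_norm N0 N1 (f z) <= M%:E ;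
  calderon_continuous : forall z, strip z ->
    sum_norm N0 N1 (f w - f z)%R @[w --> within strip (nbhs z)] --> 0 ;
  calderon_analytic : forall z, strip_interior z ->
    exists2 f'z : V, fin_space (sum_norm N0 N1) f'z &
      sum_norm N0 N1 (h^-1 *: (f (z + h) - f z) - f'z)%R
        @[h --> (0%R : R[i]^o)^'] --> 0 ;
  calderon_trace0 : C0_trace N0 (fun t => f (0 +i* t)%R) ;
  calderon_trace1 : C0_trace N1 (fun t => f (1 +i* t)%R) }.

Definition calderon_norm N0 N1 f : \bar R :=
  maxe (ereal_sup (range (fun t : R => N0 (f (0 +i* t)%R))))
       (ereal_sup (range (fun t : R => N1 (f (1 +i* t)%R)))).

Definition interp_space N0 N1 (theta : R) : set V :=
  [set f (theta +i* 0)%R | f in [set f | calderon N0 N1 f]].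

Definition interp_norm N0 N1 (theta : R) x : \bar R :=
  ereal_inf [set calderon_norm N0 N1 f |
    f in [set f | calderon N0 N1 f /\ f (theta +i* 0)%R = x]].

End complex_interpolation.

Section tent_spaces.
Context {d : measure_display} {R : realType} {X : borelMetricType d R}.
Variable mu : {measure set X -> \bar R}.
Implicit Types (f : X * R -> R[i]^o) (x : X) (O F B : set X).
Local Open Scope ereal_scope.

Definition vol x (r : R) : \bar R := mu (ball x r).

Definition doubling : Prop :=
  exists2 C : R, (0 < C)%R &
    forall x (r : R), (0 < r)%R -> vol x (2 * r)%R <= C%:E * vol x r.

(* X^+ is the subset t > 0 of X * R; functions on X^+ are represented by functions
   on X * R whose values at t <= 0 are never used. *)
Definition upper : set (X * R) := [set z | (0 < z.2)%R].

Definition cone (alpha : R) x : set (X * R) :=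
  upper `&` [set z | (mdist x z.1 < alpha * z.2)%R].

Definition cones (alpha : R) F : set (X * R) := \bigcup_(x in F) cone alpha x.

Definition tent (alpha : R) O : set (X * R) := upper `\` cones alpha (~` O).

Definition upper_integral (D : set (X * R)) (g : X * R -> \bar R) : \bar R :=
  \int[mu \x lebesgue_measure]_(z in D) (g z * (z.2^-1)%:E).

Definition conical (q alpha : R) f x : \bar R :=
  (upper_integral (cone alpha x) (fun z =>
     (ComplexField.Normc.normc (f z) `^ q)%:E
     * (vol z.1 (alpha * z.2)%R)^-1)) `^ q^-1.

Definition carleson (q alpha : R) f x : \bar R :=
  ereal_sup [set ((mu B)^-1 * upper_integral (tent alpha B) (fun z =>
     (ComplexField.Normc.normc (f z) `^ q)%:E)) `^ q^-1 |
     B in [set B | B x /\ exists c r, (0 < r)%R /\ B = ball c r]].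

Definition measurable_upper f : Prop :=
  measurable_fun upper (fun z => complex.Re (f z)) /\
  measurable_fun upper (fun z => complex.Im (f z)).

(* +oo off the measurable functions, so that fin_space (tent_norm p q alpha) is the
   tent space T^{p,q,alpha}; the norm of f vanishes iff f = 0 a.e. on X^+ *)
Definition tent_norm (p : \bar R) (q alpha : R) f : \bar R :=
  if `[< measurable_upper f >] then
    if p == +oo then 'N[mu]_+oo[carleson q alpha f]
    else 'N[mu]_p[conical q alpha f]
  else +oo.

Definition tent_space (p : \bar R) (q alpha : R) : set (X * R -> R[i]^o) :=
  fin_space (tent_norm p q alpha).

End tent_spaces.

(* Main.v *)
From HB Require Import structures.
Require Import Defs.
From mathcomp Require Import all_boot all_order all_algebra.
From mathcomp Require Import all_classical all_reals all_analysis.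
From mathcomp Require Import complex ring lra.
From mathcomp Require Import measurable_realfun ess_sup_inf.

(** Write i = 1/p. For f of norm at most 1 in T^{p,q} choose A in L^p dominating the
    conical square function of f and put a = (average of A^rho)^{1/rho} over B(y, alpha t)
    with rho < p. By the maximal theorem a is comparable to A in L^p, and one has the key
    estimate: f^{q/r} a^{p j - q/r} lies in T^{1/j,r} for all j >= 0 and r > 0, the Carleson
    endpoint j = 0 included.

    Taking (j, r) = (1/p_0, q_0) and (1/p_1, q_1) gives functions G_0, G_1 in the two end
    spaces with f = G_0^{1-theta} G_1^theta, so that
    F(z) = f exp((z - theta) ln(G_1/G_0) + z^2 - theta^2) interpolates f, once f has been cut
    into pieces of geometrically decreasing norm on which ln(G_1/G_0) is bounded.

    Conversely, the same estimate applied to the dual exponents writes the test function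
    f^{q-1} a^{p-q}, which pairs with f to at least a constant, as w_0^{1-theta} w_1^theta
    with w_0, w_1 in the duals of the end spaces; the three lines theorem for the pairing
    of F(z) with w_0^{1-z} w_1^z then bounds the norm of F(theta). *)

Set Implicit Arguments.
Unset Strict Implicit.
Unset Printing Implicit Defensive.
Import Order.TTheory GRing.Theory Num.Theory.
Import numFieldNormedType.Exports.
Local Open Scope classical_set_scope.
Local Open Scope ring_scope.

(** * Doubling spaces *)

Section metric.
Context {d : measure_display} {R : realType} {X : borelMetricType d R}.

(** Behind the key estimate is one adjointness: averaging over B(y, alpha t) is dual to integrating
    over cones. A positive power of a is bounded on a whole cone by a maximal function at the
    vertex. A negative power of a is at most a constant times the average of the same power of A,
    with no restriction on the exponent; adjointness moves that power of A to the vertex, where it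
    meets the q-th power of the square function, which is at most A^q. Both mechanisms are needed,
    since p j - q/r takes either sign.

    For the lower bound, F(theta) is not known beforehand to belong to T^{p,q}. It is therefore
    restricted to sets on which it is bounded above and below; there the test function can be formed
    and all integrals are finite. The resulting bound does not depend on the set, and monotone
    convergence removes the restriction. Duality enters as the pairing inequality [tent_duality].

    The Carleson endpoint is allowed for the two end spaces but not for the intermediate one: the
    cutting into pieces rests on dominated convergence in L^p with p finite. *)

Lemma in_ball (x y : X) (r : R) : ball x r y <-> mdist x y < r.
Proof. by rewrite ballEmdist. Qed.

Lemma open_measurable_borel (U : set X) : open U -> measurable U.
Proof. by move=> oU; rewrite borel_measurableE; exact: sub_gen_smallest. Qed.

Lemma open_metric_ball (x : X) (r : R) : open (ball x r).
Proof.
rewrite openE => y /in_ball xy; rewrite /interior.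
apply/nbhs_ballP; exists (r - mdist x y) => /=; first by rewrite subr_gt0.
move=> z /in_ball yz; apply/in_ball.
by rewrite (le_lt_trans (metric_triangle x y z))// addrC -ltrBrDr.
Qed.

Lemma measurable_ball_borel (x : X) (r : R) : measurable (ball x r).
Proof. exact/open_measurable_borel/open_metric_ball. Qed.

Lemma subset_ball (x y : X) (r s : R) : mdist x y + r <= s -> ball y r `<=` ball x s.
Proof.
move=> rs z /in_ball yz; apply/in_ball.
by rewrite (le_lt_trans (metric_triangle x y z))// (lt_le_trans _ rs)// ltrD2l.
Qed.

End metric.

Section geometry.
Context {d : measure_display} {R : realType} {X : borelMetricType d R}.
Variable mu : {measure set X -> \bar R}.
Hypothesis mu_ball : forall (x : X) (r : R), 0 < r -> (0 < vol mu x r < +oo)%E.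
Variable o : X.

Lemma vol_fin (x : X) r : 0 < r -> vol mu x r \is a fin_num.
Proof. by move=> /(mu_ball x) /andP[a b]; rewrite ge0_fin_numE// ltW. Qed.

Lemma fine_vol_gt0 (x : X) r : 0 < r -> 0 < fine (vol mu x r).
Proof. by move=> /(mu_ball x) ab; exact: fine_gt0. Qed.

Lemma le_vol (x y : X) r s : mdist x y + r <= s -> (vol mu y r <= vol mu x s)%E.
Proof.
move=> h; apply: le_measure; rewrite ?inE; try exact: measurable_ball_borel.
exact: subset_ball.
Qed.

Lemma sigma_finite_balls : sigma_finite setT mu.
Proof.
exists (fun n => ball o n.+1%:R).
  apply/esym; rewrite -subTset => x _; exists (Num.truncn (mdist o x)) => //.
  by apply/in_ball; rewrite truncnS_gt.
move=> n; split; first exact: measurable_ball_borel.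
by have /andP[] := mu_ball o (ltr0Sn R n).
Qed.

Hypothesis mu_doubling : doubling mu.

Lemma doubling_iter : exists2 C : R, 1 <= C &
  forall (x : X) (r : R) n, 0 < r -> (vol mu x (2 ^+ n * r)%R <= (C ^+ n)%:E * vol mu x r)%E.
Proof.
have [C C0 dbl] := mu_doubling; exists (Num.max 1 C); first by rewrite le_max lexx.
move=> x r n r0; elim: n => [|n ih]; first by rewrite !expr0 mul1r mul1e.
rewrite !exprS -mulrA; have r1 : 0 < 2 ^+ n * r by rewrite mulr_gt0// exprn_gt0.
rewrite (le_trans (dbl _ _ r1))// EFinM -muleA.
apply: (@le_trans _ _ ((Num.max 1 C)%:E * vol mu x (2 ^+ n * r))%E).
  by rewrite lee_wpmul2r// ?lee_fin ?le_max ?lexx ?orbT.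
by rewrite lee_wpmul2l// lee_fin le_max ler01.
Qed.

Lemma doubling_scale (m : R) : exists2 C : R, 0 < C &
  forall (x : X) (r : R), 0 < r -> (vol mu x (m * r)%R <= C%:E * vol mu x r)%E.
Proof.
have [C C1 dbl] := doubling_iter.
pose n := Num.truncn m; exists (C ^+ n.+1).
  by rewrite exprn_gt0// (lt_le_trans _ C1).
move=> x r r0; apply: le_trans (dbl x r n.+1 r0); apply: le_vol.
rewrite mdistxx add0r ler_wpM2r ?(ltW r0)//.
rewrite (le_trans (ltW (truncnS_gt _)))// -natrX ler_nat.
exact/ltnW/ltn_expl.
Qed.

(** The balls of radius e / 2 around an e-separated family are disjoint, lie in one fixed ball, and
    by doubling each carries a fixed fraction of its volume. Hence the length of such families is
    bounded, and one of maximal length is a net. *)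
Lemma finite_net (n : nat) (e : R) : 0 < e -> exists s : seq X,
  forall x, ball o n.+1%:R x -> exists2 y, y \in s & mdist x y < e.
Proof.
move=> e0.
pose sep (s : seq X) := pairwise (fun x y => e <= mdist x y) s /\
  {in s, forall x, ball o n.+1%:R x}.
have [C C0 dbl] := doubling_scale (4 * (n.+1%:R + e) / (e / 2)).
pose N := Num.truncn C.
have bound s : sep s -> (size s <= N)%N.
  move=> [ps sB].
  pose V := fine (vol mu o (n.+1%:R + e)).
  have V0 : 0 < V by apply: fine_vol_gt0; rewrite addr_gt0.
  have VE : V%:E = vol mu o (n.+1%:R + e) by rewrite fineK// vol_fin// addr_gt0.
  have big x : x \in s -> (C^-1 * V <= fine (vol mu x (e / 2)))%R.
    move=> /sB /in_ball xs; rewrite ler_pdivrMl// -lee_fin EFinM !fineK ?vol_fin ?divr_gt0 ?addr_gt0//.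
    apply: le_trans (dbl x (e / 2) _); rewrite ?divr_gt0//; apply: le_vol.
    rewrite divfK ?gt_eqF ?divr_gt0// metric_sym.
    by move: xs e0 (ltr0Sn R n); set a := mdist o x; set b := n.+1%:R; lra.
  have sumE : (\sum_(x <- s) vol mu x (e / 2) <= V%:E)%E.
    have : (\sum_(x <- s) vol mu x (e / 2) = mu (\big[setU/set0]_(x <- s) ball x (e / 2)))%E.
      have : {in s, forall x, ball o n.+1%:R x} by [].
      elim: s ps {sB big} => [|x s ih]; first by rewrite !big_nil measure0.
      rewrite pairwise_cons => /andP[xs ps] sB.
      rewrite !big_cons ih//; last by move=> y ys; apply: sB; rewrite inE ys orbT.
      rewrite measureU//; [exact: measurable_ball_borel| |].
        by apply: bigsetU_measurable => y _; exact: measurable_ball_borel.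
      apply/seteqP; split => // z [/in_ball xz].
      rewrite -bigcup_seq => -[y /= ys /in_ball yz].
      have := allP xs _ ys; rewrite leNgt => /negP[].
      rewrite (le_lt_trans (metric_triangle x z y))//.
      by rewrite (metric_sym z y) (splitr e) ltrD.
    move=> ->; rewrite VE; apply: le_measure; rewrite ?inE.
    - by apply: bigsetU_measurable => y _; exact: measurable_ball_borel.
    - exact: measurable_ball_borel.
    - rewrite -bigcup_seq => z [y /= /sB /in_ball oy]; apply: subset_ball.
      by move: oy e0 (ltr0Sn R n); set a := mdist o y; set b := n.+1%:R; lra.
  have : ((size s)%:R * (C^-1 * V) <= V)%R.
    rewrite -lee_fin (le_trans _ sumE)//.
    rewrite (eq_big_seq (fun x => (fine (vol mu x (e / 2)))%:E)); last first.
      by move=> x xs; rewrite fineK// vol_fin// divr_gt0.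
    rewrite sumEFin lee_fin mulr_natl.
    rewrite -[X in X <= _](_ : \sum_(x <- s) (C^-1 * V) = _); last first.
      by rewrite big_const_seq count_predT iter_addr_0.
    by rewrite big_seq [leRHS]big_seq; apply: ler_sum.
  rewrite mulrA -[X in _ <= X]mul1r ler_pM2r// ler_pdivrMr// mul1r => h.
  by rewrite -ltnS -(ltr_nat R) (le_lt_trans h)// truncnS_gt.
pose P k := `[< exists2 s, sep s & size s = k >].
have exP : exists k, P k by exists 0%N; apply/asboolP; exists [::] => //; split.
have Pb k : P k -> (k <= N)%N by move=> /asboolP[s /bound sN <-].
case: (ex_maxnP exP Pb) => k /asboolP[s [ps sB] sk] kmax.
exists s => x xB; apply: contrapT => nx.
suff : P k.+1 by move/kmax; rewrite ltnn.
apply/asboolP; exists (x :: s); last by rewrite /= sk.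
split.
  rewrite pairwise_cons ps andbT; apply/allP => y ys.
  by rewrite leNgt; apply/negP => xy; apply: nx; exists y.
by move=> y; rewrite inE => /orP[/eqP -> //|/sB].
Qed.

Lemma dense_sequence : exists e : nat -> X, forall (x : X) (r : R), 0 < r ->
  exists i, mdist x (e i) < r.
Proof.
have /choice[s hs] : forall nm : nat * nat, exists s : seq X,
  forall x, ball o nm.1.+1%:R x -> exists2 y, y \in s & mdist x y < nm.2.+1%:R^-1.
  by move=> [n m]; apply: finite_net; rewrite invr_gt0.
(* The nets of all balls around [o] with all meshes are listed together: a code stands for (radius,
   mesh) and a position in that net. Integers that code nothing give [o], which is harmless. *)
exists (fun i => if unpickle i is Some (nm, k) then nth o (s nm) k else o).
move=> x r r0.
have ox : ball o (Num.truncn (mdist o x)).+1%:R x by apply/in_ball; rewrite truncnS_gt.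
have [y ys xy] := hs (_, Num.truncn r^-1) _ ox.
exists (pickle ((Num.truncn (mdist o x), Num.truncn r^-1), index y (s (Num.truncn (mdist o x), Num.truncn r^-1)))).
rewrite pickleK nth_index// (lt_trans xy)//= invf_plt ?posrE//.
by rewrite truncnS_gt.
Qed.

(** Reduces suprema over all balls to a countable supremum, which is measurable, at the price of a
    constant: every ball sits in a member of the family of comparable volume. *)
Lemma countable_ball_family : exists (c : nat -> X) (r : nat -> R) (C : R),
  [/\ 0 < C, forall n, 0 < r n &
  forall (y : X) (s : R), 0 < s -> exists n, ball y s `<=` ball (c n) (r n) /\
     (vol mu (c n) (r n) <= C%:E * vol mu y s)%E].
Proof.
have [e he] := dense_sequence.
have [C C0 dbl] := doubling_scale 4.
exists (fun n => if (unpickle n : option (nat * (nat * nat))) is Some (i, mj) then e i else o).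
exists (fun n => if (unpickle n : option (nat * (nat * nat))) is Some (i, mj) then
   mj.2.+1%:R / mj.1.+1%:R else 1).
exists C; split => //.
  by move=> n; case: unpickle => // -[i mj] /=; rewrite divr_gt0.
move=> y s s0.
have [i yi] := he y (s / 2) (divr_gt0 s0 (ltr0Sn R 1)).
(* The ratio (j + 1) / (m + 1) lies between 2 s and 3 s, and the centre is within s / 2 of y. So the
   new ball contains B(y, s) and is contained in B(y, 4 s), whence the doubling constant for the
   factor 4. *)
pose m := Num.truncn s^-1; pose j := Num.truncn (2 * s * m.+1%:R).
have ms : m.+1%:R^-1 < s by rewrite invf_plt ?posrE// truncnS_gt.
have j1 : 2 * s <= j.+1%:R / m.+1%:R by rewrite ler_pdivlMr// ltW// truncnS_gt.
have j2 : j.+1%:R / m.+1%:R <= 3 * s.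
  rewrite -natr1 mulrDl mul1r.
  have : j%:R / m.+1%:R <= 2 * s.
    by rewrite ler_pdivrMr// truncn_le// !mulr_ge0// ltW.
  move: ms; set u := _^-1; set v := _ / _; lra.
exists (pickle (i, (m, j))); rewrite pickleK /=; split.
  apply: subset_ball; rewrite metric_sym.
  by move: yi j1; set v := _ / m.+1%:R; set a := mdist _ _; lra.
apply: le_trans (dbl y s s0); apply: le_vol.
by move: yi j2; set v := _ / m.+1%:R; set a := mdist _ _; lra.
Qed.

Variable alpha : R.
Hypothesis alpha_gt0 : 0 < alpha.

Lemma measurable_upper_set : measurable (upper : set (X * R)).
Proof.
rewrite (_ : upper = setT `*` `]0, +oo[%classic).
  by apply: measurableX => //; exact: measurable_itv.
by apply/seteqP; split => -[y t]; rewrite /upper /= in_itv /= andbT // => -[].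
Qed.

(** F is arbitrary, yet the union of cones is measurable: over the ratios c = (j + 1) / (m + 1), it
    is the countable union of the open c-neighbourhood of F times the half-line alpha t >= c. *)
Lemma measurable_cones (F : set X) : measurable (cones alpha F).
Proof.
rewrite (_ : cones alpha F = upper `&` \bigcup_(m : nat) \bigcup_(j : nat)
   ((\bigcup_(x in F) ball x (j.+1%:R / m.+1%:R)) `*` `[j.+1%:R / m.+1%:R / alpha, +oo[%classic)).
  apply: measurableI; first exact: measurable_upper_set.
  apply: bigcup_measurable => m _; apply: bigcup_measurable => j _.
  apply: measurableX; last exact: measurable_itv.
  by apply/open_measurable_borel/bigcup_open => x _; exact: open_metric_ball.
apply/seteqP; split => -[y t].
  move=> [x Fx [/= t0 xy]]; split => //.
  pose m := Num.truncn (alpha * t - mdist x y)^-1; pose j := Num.truncn (mdist x y * m.+1%:R).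
  have ms : m.+1%:R^-1 < alpha * t - mdist x y.
    by rewrite invf_plt ?posrE ?subr_gt0// truncnS_gt.
  have j1 : mdist x y < j.+1%:R / m.+1%:R by rewrite ltr_pdivlMr// truncnS_gt.
  exists m => //; exists j => //; split; first by exists x => //; apply/in_ball.
  rewrite /= in_itv /= andbT ler_pdivrMr// (mulrC t).
  rewrite -natr1 mulrDl mul1r.
  have : j%:R / m.+1%:R <= mdist x y.
    by rewrite ler_pdivrMr// truncn_le// mulr_ge0// mdist_ge0.
  by move=> jm; rewrite (le_trans (lerD jm (ltW ms)))// addrC subrK.
move=> [/= t0 [m _ [j _ [[x Fx /in_ball xy]]]]].
rewrite /= in_itv /= andbT ler_pdivrMr// (mulrC t) => h.
by exists x => //; split => //=; exact: lt_le_trans h.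
Qed.

Lemma measurable_tent (B : set X) : measurable (tent alpha B : set (X * R)).
Proof.
by apply: measurableD; [exact: measurable_upper_set|exact: measurable_cones].
Qed.

(** Measurability is meant for the product sigma-algebra, which need not contain every open set
    unless the space is separable; the dense sequence exhibits the graph as a countable union of
    measurable rectangles. *)
Lemma measurable_cone_graph :
  measurable [set xz : X * (X * R) | cone alpha xz.1 xz.2].
Proof.
have [e he] := dense_sequence.
rewrite (_ : [set _ | _] = (setT `*` upper) `&` \bigcup_(i : nat) \bigcup_(m : nat) \bigcup_(j : nat)
   (ball (e i) m.+1%:R^-1 `*` (ball (e i) (j.+1%:R / m.+1%:R) `*` `[j.+2%:R / m.+1%:R / alpha, +oo[%classic))).
  apply: measurableI.
    by apply: measurableX => //; exact: measurable_upper_set.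
  do 3 (apply: bigcup_measurable => ? _).
  by do 2 (apply: measurableX; first exact: measurable_ball_borel); exact: measurable_itv.
apply/seteqP; split => -[x [y t]].
  move=> [/= t0 xy]; split; first by split.
  (* The gap has to absorb three errors of size 1 / (m + 1): one for replacing x by a point of the
     sequence, two for rounding its distance to y up to (j + 2) / (m + 1). *)
  pose m := Num.truncn (3 / (alpha * t - mdist x y)).
  have ms : 3 / m.+1%:R < alpha * t - mdist x y.
    by rewrite ltr_pdivrMr// mulrC -ltr_pdivrMr ?subr_gt0// truncnS_gt.
  have [i xi] := he x m.+1%:R^-1 ltac:(by rewrite invr_gt0).
  pose j := Num.truncn (mdist (e i) y * m.+1%:R).
  exists i => //; exists m => //; exists j => //; split => /=.
    by apply/in_ball; rewrite metric_sym.
  split => /=; first by apply/in_ball; rewrite ltr_pdivlMr// truncnS_gt.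
  rewrite in_itv /= andbT ler_pdivrMr// (mulrC t) -addn2 natrD mulrDl.
  have : j%:R / m.+1%:R <= mdist (e i) y.
    by rewrite ler_pdivrMr// truncn_le// mulr_ge0// mdist_ge0.
  have := metric_triangle (e i) x y; rewrite (metric_sym (e i) x).
  move: ms xi; set u := _^-1; set v := j%:R * u; set a := mdist x y.
  set b := mdist x (e i); set c := mdist (e i) y; set f := alpha * t; lra.
move=> [[_ /= t0] [i _ [m _ [j _ [/in_ball /= ix [/in_ball /= iy]]]]]].
rewrite /= in_itv /= andbT ler_pdivrMr// (mulrC t) => h.
split => //=; apply: le_lt_trans (metric_triangle x (e i) y) _.
rewrite metric_sym (lt_le_trans (ltrD ix iy))// (le_trans _ h)//.
by rewrite -{1}[m.+1%:R^-1]mul1r -mulrDl nat1r.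
Qed.

End geometry.

(** * Maximal function and Carleson embedding *)

Section nonnegative_integrals.
Context {d : measure_display} {T : measurableType d} {R : realType}.
Variable mu : {measure set T -> \bar R}.
Implicit Types f g : T -> \bar R.
Local Open Scope ereal_scope.

Lemma ge0_le_integralT f g : (forall x, 0 <= f x) -> measurable_fun setT f ->
  measurable_fun setT g -> (forall x, f x <= g x) ->
  \int[mu]_x f x <= \int[mu]_x g x.
Proof. by move=> f0 mf mg fg; apply: ge0_le_integral => // x _; rewrite ?fg ?f0. Qed.

Lemma ae_le_integralT f g : (forall x, 0 <= f x) -> (forall x, 0 <= g x) ->
  measurable_fun setT f -> measurable_fun setT g -> {ae mu, forall x, f x <= g x} ->
  \int[mu]_x f x <= \int[mu]_x g x.
Proof.
move=> f0 g0 mf mg fg; apply: ae_ge0_le_integral => //.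
by apply: filterS fg => x fgx _.
Qed.

Lemma ge0_integralDT f g : (forall x, 0 <= f x) -> (forall x, 0 <= g x) ->
  measurable_fun setT f -> measurable_fun setT g ->
  \int[mu]_x (f x + g x) = \int[mu]_x f x + \int[mu]_x g x.
Proof. by move=> f0 g0 mf mg; rewrite ge0_integralD. Qed.

Lemma ge0_integralZlT f (k : R) : (0 <= k)%R -> (forall x, 0 <= f x) ->
  measurable_fun setT f -> \int[mu]_x (k%:E * f x) = k%:E * \int[mu]_x f x.
Proof. by move=> k0 f0 mf; rewrite ge0_integralZl_EFin. Qed.

Lemma ge0_integral_indic (D : set T) f : measurable D -> (forall x, 0 <= f x) ->
  \int[mu]_(x in D) f x = \int[mu]_x (f x * (\1_D x)%:E).
Proof.
move=> mD f0; rewrite integral_mkcond; apply: eq_integral => x _.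
by rewrite patchE indicE; case: ifPn => _; rewrite ?mule1 ?mule0.
Qed.

End nonnegative_integrals.

(** * The layer-cake formula with exponential levels *)

Section layer_cake.
Context {R : realType}.
Local Open Scope ereal_scope.
Local Notation leb := (@lebesgue_measure R).

(* Levels are written e^{-s}, with s ranging over the whole line, so that the integral of
   [level eta g] is [g `^ eta] for every g in [0, +oo]. *)
Definition below (g : \bar R) : set R := [set s | (expR (- s)%R)%:E < g].

Definition level (eta : R) (g : \bar R) (s : R) : \bar R :=
  (eta * expR (- (eta * s)))%:E * (\1_(below g) s)%:E.

Lemma level_ge0 eta g s : (0 <= eta)%R -> 0 <= level eta g s.
Proof. by move=> eta0; rewrite mule_ge0// lee_fin// mulr_ge0// expR_ge0. Qed.

Lemma measurable_level eta g : measurable_fun setT (level eta g).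
Proof.
apply: emeasurable_funM; apply/measurable_EFinP.
  apply: measurable_funM => //; apply: measurableT_comp => //.
  by apply: measurable_funN; apply: measurable_funM.
apply: measurable_indic; rewrite -[X in measurable X]setTI.
apply: measurable_lte => //; apply/measurable_EFinP.
by apply: measurableT_comp => //; exact: measurable_funN.
Qed.

Lemma integral_expR_ray (eta b : R) : (0 < eta)%R ->
  \int[leb]_(s in `[b, +oo[) (eta * expR (- (eta * s)))%:E = (expR (- (eta * b)))%:E.
Proof.
move=> eta0.
have dE (x : R) : is_derive x (1%R : R) (fun s : R => - expR (- (eta * s)))%R (eta * expR (- (eta * x)))%R.
  apply: is_derive_eq; rewrite /GRing.scale /=; ring.
have cE (x : R) : {for x, continuous (fun s : R => (- expR (- (eta * s)))%R)}.
  by apply/differentiable_continuous/derivable1_diffP; have [] := dE x.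
rewrite (@ge0_continuous_FTC2y _ _ (fun s => - expR (- (eta * s)))%R _ 0%R).
- by rewrite EFinN oppeK add0e.
- by move=> x _; rewrite mulr_ge0 ?expR_ge0 ?ltW.
- apply: continuous_subspaceT => x.
  apply: cvgM; first exact: cvg_cst.
  by apply/cvgNP/cE.
- rewrite -oppr0; apply: cvgN.
  rewrite (_ : (fun x => _) = (fun z => expR (- z)) \o (fun z => (eta * z)%R)) //.
  apply: (@cvg_comp _ _ _ _ _ _ (pinfty_nbhs R)); last exact: cvgr_expR.
  by apply: gt0_cvgMry => //; exact: cvg_id.
- by move=> x _; have [] := dE x.
- exact/cvg_at_right_filter/cE.
- by move=> x _; rewrite derive1E; have [] := dE x.
Qed.

Lemma integral_level (eta : R) (g : \bar R) : (0 < eta)%R -> 0 <= g ->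
  \int[leb]_s level eta g s = g `^ eta.
Proof.
move=> eta0.
have fin (r : R) : (0 <= r)%R -> \int[leb]_s level eta r%:E s = r%:E `^ eta.
  rewrite le_eqVlt => /orP[/eqP <-|r0].
    rewrite poweR0r ?gt_eqF// integral0_eq// => s _.
    have nb : ~ below 0%:E s by rewrite /below /= lte_fin ltNge expR_ge0.
    by rewrite /level indicE memNset ?mule0.
  have E : below r%:E = `](- ln r)%R, +oo[%classic.
    apply/seteqP; split => s; rewrite /below /= in_itv /= andbT lte_fin.
      by rewrite -[X in (_ < X)%R](lnK r0) ltr_expR ltrNl.
    by rewrite -[X in _ -> (_ < X)%R](lnK r0) ltr_expR ltrNl.
  rewrite /level E -(ge0_integral_indic leb (D := `](- ln r)%R, +oo[) (f := fun s => (eta * expR (- (eta * s)))%:E))//.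
    rewrite integral_itv_obnd_cbnd.
      rewrite integral_expR_ray// mulrN opprK poweR_EFin; congr EFin.
      by rewrite /powR gt_eqF.
    apply/measurable_EFinP; apply: measurable_funM => //.
    by apply: measurableT_comp => //; apply: measurable_funN; apply: measurable_funM.
  by move=> s; rewrite lee_fin mulr_ge0 ?expR_ge0 ?ltW.
(* For g = +oo the level function dominates that of every real number, and the integrals of the
   latter take every positive value A. *)
case: g => [r|_|//]; first by rewrite lee_fin => /fin.
rewrite poweRyr ?gt_eqF//; apply/eqyP => A A0.
have -> : A%:E = (A `^ eta^-1)%:E `^ eta.
  by rewrite poweR_EFin -powRrM mulVf ?gt_eqF// powRr1// ltW.
rewrite -fin ?powR_ge0//; apply: ge0_le_integralT.
- by move=> s; rewrite level_ge0// ltW.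
- exact: measurable_level.
- exact: measurable_level.
- move=> s; rewrite lee_wpmul2l//; first by rewrite lee_fin mulr_ge0 ?expR_ge0 ?ltW.
  rewrite lee_fin !indicE ler_nat (_ : s \in below +oo); last by rewrite inE /below /= ltry.
  by case: (s \in _).
Qed.

End layer_cake.

(** * The Vitali covering lemma for finite families *)

Section vitali.
Context {d : measure_display} {R : realType} {X : borelMetricType d R}.
Variables (c : nat -> X) (r : nat -> R).
Hypothesis r_gt0 : forall n, 0 < r n.

(** Greedy choice: keep a ball of largest radius, discard all balls meeting it, which lie in its
    triple, and recurse on the rest. *)
Lemma finite_vitali (s : seq nat) : exists D : seq nat,
  [/\ uniq D, {subset D <= s}, trivIset [set` D] (fun i => ball (c i) (r i)) &
  forall i, i \in s -> exists2 j, j \in D & ball (c i) (r i) `<=` ball (c j) (3 * r j)].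
Proof.
have [n] := ubnP (size s); elim: n => // n ih in s *; rewrite ltnS => sn.
have [->|s0] := eqVneq s [::].
  by exists [::]; split => //; rewrite set_nil; exact: trivIset_set0.
have [j js jmax] : exists2 j, j \in s & forall i, i \in s -> r i <= r j.
  elim: s s0 {sn} => // a s ih' _; have [->|s0] := eqVneq s [::].
    by exists a; rewrite ?inE // => i; rewrite inE => /eqP ->.
  have [j js jmax] := ih' s0; have [raj|rja] := leP (r a) (r j).
    by exists j; rewrite ?inE ?js ?orbT // => i; rewrite inE => /orP[/eqP ->|/jmax].
  exists a; rewrite ?inE ?eqxx // => i; rewrite inE => /orP[/eqP -> //|/jmax h].
  exact: le_trans h (ltW rja).
pose s' := [seq i <- s | `[< ball (c i) (r i) `&` ball (c j) (r j) = set0 >] ].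
have cj : ball (c j) (r j) (c j) by apply/in_ball; rewrite mdistxx.
have js' : j \notin s'.
  rewrite mem_filter; apply/negP => /andP[/asboolP h _].
  by have : set0 (c j) by rewrite -h.
have [|D [uD Ds' tD cov]] := ih s'.
  rewrite (leq_trans _ sn)// size_filter -(count_predC (fun i => `[< ball (c i) (r i) `&` ball (c j) (r j) = set0 >]) s).
  rewrite -[X in (X < _)%N]addn0 ltn_add2l -has_count.
  by apply/hasP; exists j => //=; move: js'; rewrite mem_filter js andbT.
exists (j :: D); split => /=.
- by rewrite uD andbT; apply/negP => /Ds'; exact/negP.
- by move=> i; rewrite inE => /orP[/eqP -> //|/Ds']; rewrite mem_filter => /andP[].
- have jD i : i \in D -> ball (c i) (r i) `&` ball (c j) (r j) = set0.
    by move=> /Ds'; rewrite mem_filter => /andP[/asboolP].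
  move=> a b /=; rewrite !inE => /orP[/eqP ->|aD] /orP[/eqP ->|bD] // [x [xa xb]].
  + by have : set0 x by rewrite -(jD _ bD).
  + by have : set0 x by rewrite -(jD _ aD).
  + by apply: tD => //; exists x.
- move=> i si; have [ij|/set0P[x [/in_ball xi /in_ball xj]]] := eqVneq (ball (c i) (r i) `&` ball (c j) (r j)) set0.
    have /cov[k kD ik] : i \in s' by rewrite mem_filter si andbT; apply/asboolP.
    by exists k; rewrite ?inE ?kD ?orbT.
  exists j; first by rewrite inE eqxx.
  apply: subset_ball; have := metric_triangle (c j) x (c i).
  rewrite (metric_sym x); move: xi xj (jmax _ si).
  by set u := mdist _ _; set v := mdist _ _; set w := mdist _ _; set a := r i; set b := r j; lra.
Qed.

End vitali.

(** * Weak-type bounds, for the maximal function and for Carleson measures at once *)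

Section maximal.
Context {d : measure_display} {R : realType} {X : borelMetricType d R}.
Variable mu : {sigma_finite_measure set X -> \bar R}.
Hypothesis mu_ball : forall (x : X) (r : R), 0 < r -> (0 < vol mu x r < +oo)%E.
Variables (c : nat -> X) (r : nat -> R).
Hypothesis r_gt0 : forall n, 0 < r n.
Variable C3 : R.
Hypothesis C3_gt0 : 0 < C3.
Hypothesis vol3 : forall (x : X) (s : R), 0 < s -> (vol mu x (3 * s)%R <= C3%:E * vol mu x s)%E.

Definition mean (h : X -> R) (n : nat) : \bar R :=
  ((fine (vol mu (c n) (r n)))^-1%:E * \int[mu]_(x in ball (c n) (r n)) (h x)%:E)%E.

Context {d' : measure_display} {Y : measurableType d'}.
Variable rho : {sigma_finite_measure set Y -> \bar R}.
Variable omega : Y -> R.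
Hypothesis omega_ge0 : forall y, 0 <= omega y.
Hypothesis omega_meas : measurable_fun setT omega.
(* tau is the identity in the maximal theorem and B |-> T(B) in the Carleson embedding. *)
Variable tau : set X -> set Y.
Hypothesis tau_mono : forall A B : set X, A `<=` B -> tau A `<=` tau B.
Hypothesis tau_meas : forall (x : X) (s : R), measurable (tau (ball x s)).
Variable K : R.
Hypothesis K_ge0 : 0 <= K.
Hypothesis tau_carleson : forall (x : X) (s : R), 0 < s ->
  (\int[rho]_(y in tau (ball x s)) (omega y)%:E <= K%:E * vol mu x s)%E.

Definition maxmean (h : X -> R) (y : Y) : \bar R :=
  ereal_sup (range (fun n => (mean h n * (\1_(tau (ball (c n) (r n))) y)%:E)%E)).

(** Only the first N balls are used, so that the finite covering lemma applies; N tends to infinity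
    in [maxmean_weak]. *)
Definition overmean (h : X -> R) (l : R) (N : nat) : set Y :=
  \bigcup_(n in [set n | (n < N)%N /\ (l%:E < mean h n)%E]) tau (ball (c n) (r n)).

Local Open Scope ereal_scope.

Lemma mean_ge0 h n : (forall x, 0 <= h x)%R -> 0 <= mean h n.
Proof.
move=> h0; apply: mule_ge0; first by rewrite lee_fin invr_ge0 fine_ge0.
by apply: integral_ge0 => x _; rewrite lee_fin.
Qed.

Lemma measurable_overmean (h : X -> R) (l : R) (N : nat) : measurable (overmean h l N).
Proof. by apply: bigcup_measurable => n _; exact: tau_meas. Qed.

Lemma omega_bigsetU (s : seq nat) (F : nat -> set Y) : (forall n, measurable (F n)) ->
  \int[rho]_(y in \big[setU/set0]_(i <- s) F i) (omega y)%:E <=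
  \sum_(i <- s) \int[rho]_(y in F i) (omega y)%:E.
Proof.
move=> mF; elim: s => [|n s ih]; first by rewrite !big_nil integral_set0.
rewrite !big_cons; have mU : measurable (\big[setU/set0]_(i <- s) F i).
  by apply: bigsetU_measurable.
apply: le_trans (leeD2l _ ih).
have mE : measurable_fun setT (fun y => (omega y)%:E) by exact/measurable_EFinP.
have w0 y : 0 <= (omega y)%:E by rewrite lee_fin.
have mI (A : set Y) : measurable A -> measurable_fun setT (fun y => (omega y)%:E * (\1_A y)%:E).
  by move=> mA; apply: emeasurable_funM => //; apply/measurable_EFinP; exact: measurable_indic.
have I0 (A : set Y) y : 0 <= (omega y)%:E * (\1_A y)%:E by rewrite mule_ge0 ?lee_fin.
have mFU := measurableU _ _ (mF n) mU.
rewrite (ge0_integral_indic rho mFU w0) (ge0_integral_indic rho (mF n) w0) (ge0_integral_indic rho mU w0).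
rewrite -(ge0_integralDT rho (I0 _) (I0 _) (mI _ (mF n)) (mI _ mU)).
apply: ge0_le_integralT; first exact: I0.
- exact: mI.
- by apply: emeasurable_funD; exact: mI.
- move=> y; rewrite -!EFinM -EFinD lee_fin -mulrDr ler_wpM2l// !indicE in_setU.
  by case: (y \in F n) => /=; rewrite ?add0r// lerDl; case: (y \in _).
Qed.

(** Keep disjoint balls B whose triples cover the selected ones. The set [tau (3B)] has mass at most
    K C3 times the volume of B, this volume is at most 1 / l times the integral of h over B, and
    these integrals add up by disjointness. *)
Lemma overmean_weak (h : X -> R) (l : R) (N : nat) : (forall x, 0 <= h x)%R -> measurable_fun setT h -> (0 < l)%R ->
  \int[rho]_(y in overmean h l N) (omega y)%:E <=
  (C3 * K / l)%:E * \int[mu]_x (h x)%:E.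
Proof.
move=> h0 mh l0.
pose s := [seq n <- iota 0 N | l%:E < mean h n].
have [D [uD Ds tD cov]] := finite_vitali c r_gt0 s.
have mE : measurable_fun setT (fun y => (omega y)%:E) by exact/measurable_EFinP.
have m3 j : measurable (tau (ball (c j) (3 * r j)%R)) by exact: tau_meas.
apply: (@le_trans _ _ (\int[rho]_(y in \big[setU/set0]_(j <- D) tau (ball (c j) (3 * r j)%R)) (omega y)%:E)).
  apply: ge0_subset_integral => //.
  - exact: measurable_overmean.
  - exact: bigsetU_measurable.
  - exact: measurable_funTS.
  - by move=> y _; rewrite lee_fin.
  - move=> y [n [nN ln] yn]; rewrite -bigcup_seq.
    have /cov[j jD nj] : n \in s by rewrite mem_filter ln mem_iota.
    by exists j => //; apply: tau_mono yn.
apply: le_trans (omega_bigsetU _ m3) _.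
apply: (@le_trans _ _ (\sum_(j <- D) (C3 * K / l)%:E * \int[mu]_(x in ball (c j) (r j)) (h x)%:E)).
  rewrite big_seq [leRHS]big_seq; apply: lee_sum => j /Ds.
  rewrite mem_filter => /andP[lj _].
  have V0 := fine_vol_gt0 mu_ball (c j) (r_gt0 j).
  apply: le_trans (tau_carleson _ _) _; first by rewrite mulr_gt0.
  apply: (@le_trans _ _ (K%:E * (C3%:E * vol mu (c j) (r j)))).
    by rewrite lee_wpmul2l ?lee_fin// vol3.
  have lV : l%:E * vol mu (c j) (r j) <= \int[mu]_(x in ball (c j) (r j)) (h x)%:E.
    rewrite -(fineK (vol_fin mu_ball (c j) (r_gt0 j))).
    by rewrite muleC -lee_pdivlMl// ltW.
  have k0 : 0 <= (C3 * K / l)%:E by rewrite lee_fin divr_ge0 ?mulr_ge0 ?(ltW C3_gt0) ?(ltW l0).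
  apply: le_trans (lee_wpmul2l k0 lV); rewrite !muleA -!EFinM.
  by rewrite divfK ?gt_eqF// (mulrC C3).
rewrite -ge0_sume_distrr; last by move=> j _; apply: integral_ge0 => x _; rewrite lee_fin.
rewrite lee_wpmul2l ?lee_fin ?divr_ge0 ?mulr_ge0 ?(ltW C3_gt0) ?(ltW l0)//.
rewrite -ge0_integral_bigsetU//=.
- apply: ge0_subset_integral => //.
  + by apply: bigsetU_measurable => j _; exact: measurable_ball_borel.
  + exact/measurable_EFinP.
  + by move=> x _; rewrite lee_fin.
- by move=> j; exact: measurable_ball_borel.
- by apply: measurable_funTS; exact/measurable_EFinP.
- by move=> x _; rewrite lee_fin.
Qed.

Lemma maxmean_ge0 (h : X -> R) (y : Y) : (forall x, 0 <= h x)%R -> 0 <= maxmean h y.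
Proof.
move=> h0; apply: le_trans (ereal_sup_ubound _); last by exists 0%N.
by rewrite mule_ge0 ?mean_ge0// lee_fin.
Qed.

Lemma measurable_maxmean (h : X -> R) : measurable_fun setT (maxmean h).
Proof.
pose u n y := mean h n * (\1_(tau (ball (c n) (r n))) y)%:E.
rewrite (_ : maxmean h = fun y => esups (u ^~ y) 0%N).
  apply: measurable_fun_esups => n; apply: emeasurable_funM; first exact: measurable_cst.
  by apply/measurable_EFinP; apply: measurable_indic; exact: tau_meas.
apply/funext => y; rewrite /maxmean /esups; congr ereal_sup.
by apply/seteqP; split => [_ [n _ <-]|_ [n _ <-]]; exists n.
Qed.

Definition over (h : X -> R) (l : R) : set Y := [set y | l%:E < maxmean h y].

Lemma measurable_over (h : X -> R) (l : R) : measurable (over h l).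
Proof.
rewrite /over -[X in measurable X]setTI; apply: emeasurable_fun_o_infty => //.
exact: measurable_maxmean.
Qed.

Lemma lt_maxmean (h : X -> R) (l : R) (y : Y) : (0 < l)%R ->
  l%:E < maxmean h y <-> (\bigcup_N overmean h l N) y.
Proof.
move=> l0; split.
  move=> /ereal_sup_gt[_ [n _ <-]]; rewrite indicE; case: (boolP (y \in _)) => /= [yn|_].
    by rewrite mule1 => ln; exists n.+1 => //; exists n => //; rewrite inE in yn.
  by rewrite mule0 lte_fin ltNge (ltW l0).
move=> [N _ [n [nN ln] yn]]; apply: lt_le_trans ln _.
by apply: ereal_sup_ubound; exists n => //; rewrite indicE mem_set// mule1.
Qed.

Lemma maxmean_weak (h : X -> R) (l : R) : (forall x, 0 <= h x)%R -> measurable_fun setT h ->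
  (0 < l)%R ->
  \int[rho]_y ((omega y)%:E * (\1_(over h l) y)%:E) <=
  (C3 * K / l)%:E * \int[mu]_x (h x)%:E.
Proof.
move=> h0 mh l0.
have -> : over h l = \bigcup_N overmean h l N.
  by apply/seteqP; split => y; rewrite /over /= lt_maxmean.
have w0 y : 0 <= (omega y)%:E by rewrite lee_fin.
have mE : measurable_fun setT (fun y => (omega y)%:E) by exact/measurable_EFinP.
rewrite -(ge0_integral_indic rho _ w0); last first.
  by apply: bigcup_measurable => N _; exact: measurable_overmean.
have cv := @ge0_nondecreasing_set_cvg_integral _ _ _ (overmean h l) (fun y => (omega y)%:E) rho.
rewrite -(cvg_lim _ (cv _ _ _ _))//.
- apply: lime_le; last by apply: nearW => N; exact: overmean_weak.
  apply/cvg_ex; eexists; apply: cv.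
  + move=> m n mn; apply/subsetPset => y [i [im li] yi]; exists i => //; split => //.
    exact: leq_trans im mn.
  + exact: measurable_overmean.
  + by move=> i; exact: measurable_funTS.
  + by move=> i y _; rewrite lee_fin.
- move=> m n mn; apply/subsetPset => y [i [im li] yi]; exists i => //; split => //.
  exact: leq_trans im mn.
- exact: measurable_overmean.
- by move=> i; exact: measurable_funTS.
Qed.

(** Marcinkiewicz truncation: the part of h below l / 2 adds at most l / 2 to any mean, so a mean
    above l forces the mean of the remaining part above l / 2. *)
Lemma maxmean_weak_trunc (h : X -> R) (l : R) : (forall x, 0 <= h x)%R -> measurable_fun setT h ->
  (0 < l)%R ->
  \int[rho]_y ((omega y)%:E * (\1_(over h l) y)%:E) <=
  (2 * C3 * K / l)%:E * \int[mu]_x ((h x)%:E * (\1_[set x | (l < 2 * h x)%R] x)%:E).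
Proof.
move=> h0 mh l0.
have mA : measurable [set x | (l < 2 * h x)%R].
  have := @measurable_fun_ltr _ _ _ setT (cst l) (fun x => 2 * h x)%R.
  move=> /(_ (measurable_cst _) (measurable_funM (measurable_cst _) mh)) mlt.
  have := mlt measurableT [set true] I; rewrite setTI.
  by rewrite (_ : _ @^-1` _ = [set x | (l < 2 * h x)%R]).
pose g x := (h x * \1_[set x | (l < 2 * h x)%R] x)%R.
have g0 x : (0 <= g x)%R by rewrite mulr_ge0.
have mg : measurable_fun setT g by apply: measurable_funM => //; exact: measurable_indic.
have hg x : (h x <= g x + l / 2)%R.
  rewrite /g indicE; case: (boolP (x \in _)) => /= [_|]; first by rewrite mulr1 lerDl divr_ge0// ltW.
  by rewrite notin_setE /= => /negP; rewrite -leNgt mulr0 add0r ler_pdivlMr// mulrC.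
have hgm n : mean h n <= mean g n + (l / 2)%:E.
  have V0 := fine_vol_gt0 mu_ball (c n) (r_gt0 n).
  have mB : measurable (ball (c n) (r n)) by exact: measurable_ball_borel.
  have m0 : 0 <= mean g n by exact: mean_ge0.
  have l0' : 0 <= (l / 2)%:E by rewrite lee_fin divr_ge0// ltW.
  rewrite {1}/mean lee_pdivrMl// (ge0_muleDr _ m0 l0') /mean.
  rewrite muleA -EFinM divff ?gt_eqF// mul1e (fineK (vol_fin mu_ball _ (r_gt0 n))).
  rewrite muleC -[X in _ + X](integral_cst mu mB) -ge0_integralD//; last 2 first.
  - by move=> x _; rewrite lee_fin.
  - by apply: measurable_funTS; exact/measurable_EFinP.
  apply: ge0_le_integral => //.
  - by move=> x _; rewrite lee_fin.
  - by apply: measurable_funTS; exact/measurable_EFinP.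
  - by apply: measurable_funTS; apply/measurable_EFinP; apply: measurable_funD.
  - by move=> x _; rewrite -EFinD lee_fin.
have l2 : (0 < l / 2)%R by rewrite divr_gt0.
have mI (h' : X -> R) (l' : R) : measurable_fun setT (fun y => (omega y)%:E * (\1_(over h' l') y)%:E).
  apply: emeasurable_funM; apply/measurable_EFinP => //.
  by apply: measurable_indic; exact: measurable_over.
apply: (@le_trans _ _ (\int[rho]_y ((omega y)%:E * (\1_(over g (l / 2)) y)%:E))).
  apply: ge0_le_integralT.
  - by move=> y; rewrite mule_ge0 ?lee_fin.
  - exact: mI.
  - exact: mI.
  - move=> y; rewrite lee_wpmul2l ?lee_fin// !indicE ler_nat.
    case: (boolP (y \in over h l)) => //; rewrite inE /over /= lt_maxmean// => -[N _ [n [nN ln] yn]].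
    rewrite mem_set//= lt_maxmean//; exists N => //; exists n => //; split => //.
    move: (lt_le_trans ln (hgm n)); case: (mean g n) => [v| |]//; rewrite ?ltry// -EFinD !lte_fin; lra.
apply: le_trans (maxmean_weak g0 mg l2) _.
rewrite (_ : C3 * K / (l / 2) = 2 * C3 * K / l)%R; last first.
  by field; rewrite gt_eqF.
by rewrite /g; under eq_integral do rewrite EFinM.
Qed.

Lemma measurable_level2 (g : Y -> \bar R) (k : R) : measurable_fun setT g ->
  measurable_fun setT (fun ys : Y * R => level k (g ys.1) ys.2).
Proof.
move=> mg; apply: emeasurable_funM.
  apply/measurable_EFinP; apply: measurable_funM => //; apply: measurableT_comp => //.
  by apply: measurable_funN; apply: measurable_funM.
apply/measurable_EFinP.
rewrite (_ : (fun _ => _) = \1_[set ys : Y * R | (expR (- ys.2))%:E < g ys.1]).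
  apply: measurable_indic; rewrite -[X in measurable X]setTI.
  apply: measurable_lte => //; last by apply: measurableT_comp.
  by apply/measurable_EFinP; apply: measurableT_comp => //; exact: measurable_funN.
by apply/funext => -[y s].
Qed.

End maximal.

(** * The strong-type bound *)

Section maximal_strong.
Context {d : measure_display} {R : realType} {X : borelMetricType d R}.
Variable mu : {sigma_finite_measure set X -> \bar R}.
Hypothesis mu_ball : forall (x : X) (r : R), 0 < r -> (0 < vol mu x r < +oo)%E.
Variables (c : nat -> X) (r : nat -> R).
Hypothesis r_gt0 : forall n, 0 < r n.
Variable C3 : R.
Hypothesis C3_gt0 : 0 < C3.
Hypothesis vol3 : forall (x : X) (s : R), 0 < s -> (vol mu x (3 * s)%R <= C3%:E * vol mu x s)%E.
Context {d' : measure_display} {Y : measurableType d'}.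
Variable rho : {sigma_finite_measure set Y -> \bar R}.
Variable omega : Y -> R.
Hypothesis omega_ge0 : forall y, 0 <= omega y.
Hypothesis omega_meas : measurable_fun setT omega.
Variable tau : set X -> set Y.
Hypothesis tau_mono : forall A B : set X, A `<=` B -> tau A `<=` tau B.
Hypothesis tau_meas : forall (x : X) (s : R), measurable (tau (ball x s)).
Variable K : R.
Hypothesis K_ge0 : 0 <= K.
Hypothesis tau_carleson : forall (x : X) (s : R), 0 < s ->
  (\int[rho]_(y in tau (ball x s)) (omega y)%:E <= K%:E * vol mu x s)%E.
Local Open Scope ereal_scope.

(** The truncated weak bound is integrated over the levels l = e^{-s}. Dividing the density of the
    k-th power by e^{-s} leaves k / (k - 1) times the density of the (k - 1)-th power, whose
    integral over the levels l < 2 h is (2 h)^{k - 1}. *)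
Lemma maxmean_strong (h : X -> R) (k : R) : (forall x, 0 <= h x)%R -> measurable_fun setT h ->
  (1 < k)%R ->
  \int[rho]_y ((omega y)%:E * maxmean mu c r tau h y `^ k) <=
  (2 `^ k * C3 * K * (k / (k - 1)))%:E * \int[mu]_x ((h x `^ k)%R)%:E.
Proof.
move=> h0 mh k1.
have k0 : (0 < k)%R by lra.
have k10 : (0 < k - 1)%R by lra.
pose M := maxmean mu c r tau h.
have M0 y : 0 <= M y by exact: maxmean_ge0.
have mM : measurable_fun setT M by apply: measurable_maxmean.
have w0 y : 0 <= (omega y)%:E by rewrite lee_fin.
have mE : measurable_fun setT (fun y => (omega y)%:E) by exact/measurable_EFinP.
pose leb := @lebesgue_measure R.
have E1 y : (omega y)%:E * M y `^ k = \int[leb]_s ((omega y)%:E * level k (M y) s).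
  rewrite ge0_integralZlT//; [by rewrite integral_level| |exact: measurable_level].
  by move=> s; rewrite level_ge0// ltW.
under eq_integral do rewrite -/(M _) E1.
pose F (ys : Y * R) := (omega ys.1)%:E * level k (M ys.1) ys.2.
have mF : measurable_fun setT F.
  apply: emeasurable_funM; last exact: measurable_level2.
  by apply/measurable_EFinP; apply: measurableT_comp.
have F0 ys : 0 <= F ys by rewrite mule_ge0// level_ge0// ltW.
rewrite (fubini_tonelli (m1 := rho) (m2 := leb) F mF F0).
pose D := (2 * C3 * K * (k / (k - 1)))%R.
have D0 : (0 <= D)%R by rewrite !mulr_ge0 ?invr_ge0 ?(ltW C3_gt0) ?(ltW k0) ?(ltW k10).
pose G (xs : X * R) := (h xs.1)%:E * level (k - 1) (2 * h xs.1)%:E xs.2.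
have mG : measurable_fun setT G.
  apply: emeasurable_funM; first by apply/measurable_EFinP; apply: measurableT_comp.
  apply: (@measurable_level2 _ _ _ (fun x => (2 * h x)%:E)).
  by apply/measurable_EFinP; exact: measurable_funM.
have G0 xs : 0 <= G xs by rewrite /G mule_ge0 ?lee_fin//; apply: level_ge0; exact: ltW.
apply: (@le_trans _ _ (\int[leb]_s (D%:E * \int[mu]_x G (x, s)))).
  apply: ge0_le_integralT.
  - by move=> s; apply: integral_ge0.
  - exact: (measurable_fun_fubini_tonelli_G (m1 := rho) F).
  - apply: emeasurable_funM => //.
    exact: (measurable_fun_fubini_tonelli_G (m1 := mu) G).
  - move=> s; rewrite /F /level /=.
    have l0 : (0 < expR (- s))%R by exact: expR_gt0.
    have a0 : (0 <= k * expR (- (k * s)))%R by rewrite mulr_ge0 ?expR_ge0 ?ltW.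
    have IE y : \1_(below (M y)) s = \1_(over mu c r tau h (expR (- s))) y :> R.
      by rewrite !indicE; congr (_%:R); congr nat_of_bool; apply/idP/idP; rewrite !inE.
    under eq_integral do rewrite muleCA IE.
    rewrite ge0_integralZlT//; last 2 first.
    + by move=> y; rewrite mule_ge0 ?lee_fin.
    + apply: emeasurable_funM => //; apply/measurable_EFinP; apply: measurable_indic.
      exact: measurable_over.
    apply: (@le_trans _ _ ((k * expR (- (k * s)))%:E * ((2 * C3 * K / expR (- s))%:E *
        \int[mu]_x ((h x)%:E * (\1_[set x | (expR (- s) < 2 * h x)%R] x)%:E)))).
      by rewrite lee_wpmul2l// maxmean_weak_trunc.
    have IE' x : \1_(below (2 * h x)%:E) s = \1_[set x | (expR (- s) < 2 * h x)%R] x :> R.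
      by rewrite !indicE; congr (_%:R); congr nat_of_bool; apply/idP/idP; rewrite !inE.
    under [X in _ <= D%:E * X]eq_integral do rewrite /G /level /= muleCA IE'.
    rewrite [X in _ <= D%:E * X]ge0_integralZlT//; last 3 first.
    + by rewrite mulr_ge0 ?expR_ge0 ?ltW.
    + by move=> x; rewrite mule_ge0 ?lee_fin.
    + apply: emeasurable_funM; apply/measurable_EFinP => //; apply: measurable_indic.
      have := @measurable_fun_ltr _ _ _ setT (cst (expR (- s))) (fun x => 2 * h x)%R.
      move=> /(_ (measurable_cst _) (measurable_funM (measurable_cst _) mh)) mlt.
      by have := mlt measurableT [set true] I; rewrite setTI.
    rewrite !muleA -!EFinM (_ : k * expR (- (k * s)) * (2 * C3 * K / expR (- s)) = D * ((k - 1) * expR (- ((k - 1) * s))))%R//.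
    have -> : expR (- (k * s)) = (expR (- ((k - 1) * s)) * expR (- s))%R.
      by rewrite -expRD; congr expR; ring.
    by rewrite /D; field; rewrite !gt_eqF ?expR_gt0.
have mG2 := measurable_fun_fubini_tonelli_G (m1 := mu) G mG G0.
rewrite ge0_integralZlT//; last first.
  by move=> s; apply: integral_ge0.
rewrite -(fubini_tonelli (m1 := mu) (m2 := leb) G mG G0).
have E2 x : \int[leb]_s G (x, s) = (2 `^ (k - 1))%:E * (h x `^ k)%:E.
  rewrite /G /= ge0_integralZlT//; last 2 first.
  - by move=> s; apply: level_ge0; exact: ltW.
  - exact: measurable_level.
  rewrite integral_level// ?lee_fin ?mulr_ge0// poweR_EFin -!EFinM powRM//.
  by rewrite mulrCA mulr_powRB1.
under eq_integral do rewrite E2.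
rewrite ge0_integralZlT ?powR_ge0//; last 2 first.
- by move=> x; rewrite lee_fin powR_ge0.
- by apply/measurable_EFinP; apply: (measurableT_comp (measurable_powR k)).
rewrite muleA -EFinM (_ : D * 2 `^ (k - 1) = 2 `^ k * C3 * K * (k / (k - 1)))%R//.
by rewrite -(@mulr_powRB1 _ 2 k)// /D; ring.
Qed.

End maximal_strong.

Local Open Scope complex_scope.

Notation modc := ComplexField.Normc.normc.

(** * Cauchy's estimate and the maximum principle on a rectangle *)

Section modulus.
Context {R : realType}.
Implicit Types (z w : R[i]) (x : R).

Lemma modcE z : modc z = Num.sqrt (complex.Re z ^+ 2 + complex.Im z ^+ 2).
Proof. by case: z. Qed.

Lemma modc_ge0 z : 0 <= modc z.
Proof. by rewrite modcE sqrtr_ge0. Qed.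

Lemma modc0 : modc (0 : R[i]) = 0. Proof. exact: ComplexField.Normc.normc0. Qed.

Lemma modc1 : modc (1 : R[i]) = 1. Proof. exact: ComplexField.Normc.normc1. Qed.

Lemma modcM z w : modc (z * w) = modc z * modc w.
Proof. exact: ComplexField.Normc.normcM. Qed.

Lemma modcV z : modc z^-1 = (modc z)^-1.
Proof. exact: ComplexField.Normc.normcV. Qed.

Lemma modcD z w : modc (z + w) <= modc z + modc w.
Proof. exact: le_normcD. Qed.

Lemma modcN z : modc (- z) = modc z.
Proof. exact: normcN. Qed.

Lemma modcB z w : modc (z - w) <= modc z + modc w.
Proof. by rewrite (le_trans (modcD _ _))// modcN. Qed.

Lemma modc_distC z w : modc (z - w) = modc (w - z).
Proof. by rewrite -modcN opprB. Qed.

Lemma modcX z n : modc (z ^+ n) = modc z ^+ n.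
Proof. by elim: n => [|n IH]; rewrite ?expr0 ?modc1// !exprS modcM IH. Qed.

Lemma modc_real x : modc x%:C = `|x|.
Proof. by rewrite modcE /= expr0n addr0 sqrtr_sqr. Qed.

Lemma modc2 : modc (2 : R[i]) = 2.
Proof. by rewrite -[2](rmorph_nat (real_complex R)) modc_real ger0_norm. Qed.

Lemma modc_eq0 z : (modc z == 0) = (z == 0).
Proof. by apply/eqP/eqP => [/ComplexField.Normc.eq0_normc//|->]; rewrite modc0. Qed.

Lemma modc_gt0 z : (0 < modc z) = (z != 0).
Proof. by rewrite lt_neqAle modc_ge0 andbT eq_sym modc_eq0. Qed.

Lemma Re_le_modc z : `|complex.Re z| <= modc z.
Proof. by rewrite modcE -sqrtr_sqr ler_wsqrtr// lerDl sqr_ge0. Qed.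

Lemma Im_le_modc z : `|complex.Im z| <= modc z.
Proof. by rewrite modcE -sqrtr_sqr ler_wsqrtr// lerDr sqr_ge0. Qed.

Lemma modc_le_ReIm z : modc z <= `|complex.Re z| + `|complex.Im z|.
Proof.
have n0 : 0 <= `|complex.Re z| + `|complex.Im z| by rewrite addr_ge0.
rewrite modcE -[leRHS](ger0_norm n0) -sqrtr_sqr ler_wsqrtr// sqrrD !real_normK ?num_real//.
by rewrite -addrA lerD2l lerDr mulrn_wge0// mulr_ge0.
Qed.

End modulus.

Section contour.
Context {R : realType}.
Implicit Types (g h : R[i] -> R[i]) (z w a b : R[i]).

Lemma complex_half (x : R) : (x / 2)%:C = x%:C / 2.
Proof. by rewrite rmorphM fmorphV rmorph_nat. Qed.

(* Trapezoidal sums over 2 ^ k pieces stand for contour integrals: they are exact on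
   affine functions, and bounds valid for all large k replace the limit. *)
Fixpoint edge_sum (k : nat) g z w : R[i] :=
  if k is k'.+1 then edge_sum k' g z (w / 2) + edge_sum k' g (z + w / 2) (w / 2)
  else (g z + g (z + w)) / 2 * w.

Definition rect_sum k g z a b :=
  edge_sum k g z a + edge_sum k g (z + a) b - edge_sum k g (z + b) a - edge_sum k g z b.

Lemma half_addc w : w / 2 + w / 2 = w. Proof. by field. Qed.

(** Halving an edge splits its sum exactly, and the inner edges of the four quarters cancel, as they
    do for contour integrals. *)
Lemma rect_sum_split k g z a b : rect_sum k.+1 g z a b =
  rect_sum k g z (a / 2) (b / 2) + rect_sum k g (z + a / 2) (a / 2) (b / 2) +
  rect_sum k g (z + b / 2) (a / 2) (b / 2) +
  rect_sum k g (z + a / 2 + b / 2) (a / 2) (b / 2).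
Proof.
rewrite /rect_sum /= -!addrA !half_addc.
rewrite !(addrCA (a / 2)) !half_addc !(addrC (a / 2)) !(addrC a) !(addrC (b / 2)).
ring.
Qed.

Lemma eq_edge_sum k g h z w : (forall u, g u = h u) -> edge_sum k g z w = edge_sum k h z w.
Proof. by move=> gh; elim: k z w => [|k IH] z w /=; rewrite ?gh// !IH. Qed.

Lemma edge_sumD k g h z w :
  edge_sum k (fun u => g u + h u) z w = edge_sum k g z w + edge_sum k h z w.
Proof. by elim: k z w => [|k IH] z w /=; [ring|rewrite !IH; ring]. Qed.

Lemma edge_sumZ k g c z w :
  edge_sum k (fun u => c * g u) z w = c * edge_sum k g z w.
Proof. by elim: k z w => [|k IH] z w /=; [ring|rewrite !IH; ring]. Qed.

Lemma edge_sum_affine k c e z w :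
  edge_sum k (fun u => c * u + e) z w = (c * (z + w / 2) + e) * w.
Proof. by elim: k z w => [|k IH] z w /=; [field|rewrite !IH; field]. Qed.

Lemma edge_sum_bound k g z w (M : R) :
  (forall s : R, 0 <= s <= 1 -> modc (g (z + s%:C * w)) <= M) ->
  modc (edge_sum k g z w) <= M * modc w.
Proof.
elim: k z w => [|k IH] z w H /=.
  rewrite modcM ler_wpM2r ?modc_ge0// modcM modcV modc2.
  have h0 := H 0; have h1 := H 1; rewrite mul0r addr0 in h0; rewrite mul1r in h1.
  rewrite ler_pdivrMr// (le_trans (modcD _ _))// mulr2n mulrDr mulr1.
  by apply: lerD; [apply: h0|apply: h1]; rewrite ?lexx ?ler01.
have e2 (s : R) : s%:C * (w / 2) = (s / 2)%:C * w.
  by rewrite complex_half; ring.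
have m2 : modc w = modc (w / 2) + modc (w / 2) by rewrite modcM modcV modc2; field.
rewrite (le_trans (modcD _ _))// m2 mulrDr; apply: lerD; apply: IH => s /andP[s0 s1].
  by rewrite e2; apply: H; apply/andP; split; lra.
rewrite e2 -addrA (_ : w / 2 + _ = ((1 + s) / 2)%:C * w); first by apply: H; apply/andP; split; lra.
by rewrite !complex_half rmorphD rmorph1; ring.
Qed.

Lemma rect_sumD k g h z a b :
  rect_sum k (fun u => g u + h u) z a b = rect_sum k g z a b + rect_sum k h z a b.
Proof. rewrite /rect_sum !edge_sumD; ring. Qed.

Lemma rect_sum_affine k c e z a b : rect_sum k (fun u => c * u + e) z a b = 0.
Proof. by rewrite /rect_sum !edge_sum_affine; field. Qed.

Lemma eq_rect_sum k g h z a b : (forall u, g u = h u) -> rect_sum k g z a b = rect_sum k h z a b.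
Proof. by move=> gh; rewrite /rect_sum !(eq_edge_sum _ _ _ gh). Qed.

Lemma rect_sum_bound k g z a b (M : R) :
  (forall s t : R, 0 <= s <= 1 -> 0 <= t <= 1 -> modc (g (z + s%:C * a + t%:C * b)) <= M) ->
  modc (rect_sum k g z a b) <= M * ((modc a + modc b) *+ 2).
Proof.
move=> H.
have e0 : 0 <= (0 : R) <= 1 by rewrite lexx ler01.
have e1 : 0 <= (1 : R) <= 1 by rewrite lexx ler01.
have h1 : modc (edge_sum k g z a) <= M * modc a.
  by apply: edge_sum_bound => s s01; have := H s 0 s01 e0; rewrite mul0r addr0.
have h2 : modc (edge_sum k g (z + a) b) <= M * modc b.
  by apply: edge_sum_bound => s s01; have := H 1 s e1 s01; rewrite mul1r.
have h3 : modc (edge_sum k g (z + b) a) <= M * modc a.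
  by apply: edge_sum_bound => s s01; have := H s 1 s01 e1; rewrite mul1r addrAC.
have h4 : modc (edge_sum k g z b) <= M * modc b.
  by apply: edge_sum_bound => s s01; have := H 0 s e0 s01; rewrite mul0r addr0.
rewrite /rect_sum (le_trans (modcB _ _))//.
have := modcB (edge_sum k g z a + edge_sum k g (z + a) b) (edge_sum k g (z + b) a).
have := modcD (edge_sum k g z a) (edge_sum k g (z + a) b).
rewrite mulr2n !mulrDr; lra.
Qed.

(** Complex differentiability at z, expressed with the real-valued modulus so that every estimate
    stays in [R]. *)
Definition cdiff g z : Prop := exists c, forall e : R, 0 < e -> exists2 d : R, 0 < d &
  forall w, modc (w - z) < d -> modc (g w - g z - c * (w - z)) <= e * modc (w - z).

Lemma exists_half_lt (c d : R) : 0 < d -> exists n, c / 2 ^+ n < d.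
Proof.
move=> d0; exists (Num.truncn (c / d)).+1; rewrite ltr_pdivrMr ?exprn_gt0// mulrC.
rewrite -ltr_pdivrMr// (lt_le_trans (truncnS_gt _))//.
by rewrite -natrX ler_nat ltnW// ltn_expl.
Qed.

Section goursat.
Variables (g : R[i] -> R[i]) (z a b : R[i]).

Definition gpoint (s t : R) : R[i] := z + s%:C * a + t%:C * b.

Definition cell_sum (k : nat) (s t l : R) : R[i] :=
  rect_sum k g (gpoint s t) (l%:C * a) (l%:C * b).

Definition cell_small (e s t l : R) : Prop :=
  exists K : nat, forall k, (K <= k)%N -> modc (cell_sum k s t l) <= e.

Lemma cell_split k s t l : cell_sum k.+1 s t l =
  cell_sum k s t (l / 2) + cell_sum k (s + l / 2) t (l / 2) +
  cell_sum k s (t + l / 2) (l / 2) + cell_sum k (s + l / 2) (t + l / 2) (l / 2).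
Proof.
have e2 u : l%:C * u / 2 = (l / 2)%:C * u.
  by rewrite complex_half; ring.
rewrite /cell_sum rect_sum_split !e2 /gpoint !rmorphD /=.
by congr (rect_sum _ _ _ _ _ + rect_sum _ _ _ _ _ + rect_sum _ _ _ _ _ + rect_sum _ _ _ _ _); ring.
Qed.

Lemma cell_small_split e1 e2 e3 e4 s t l :
  cell_small e1 s t (l / 2) -> cell_small e2 (s + l / 2) t (l / 2) ->
  cell_small e3 s (t + l / 2) (l / 2) -> cell_small e4 (s + l / 2) (t + l / 2) (l / 2) ->
  cell_small (e1 + e2 + e3 + e4) s t l.
Proof.
move=> [K1 H1] [K2 H2] [K3 H3] [K4 H4]; exists (maxn (maxn K1 K2) (maxn K3 K4)).+1.
case=> [//|k]; rewrite ltnS !geq_max => /andP[/andP[k1 k2] /andP[k3 k4]].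
rewrite cell_split.
apply: le_trans (modcD _ _) (lerD _ (H4 k k4)).
apply: le_trans (modcD _ _) (lerD _ (H3 k k3)).
exact: le_trans (modcD _ _) (lerD (H1 k k1) (H2 k k2)).
Qed.

Lemma cell_bound k s t l (M : R) : 0 <= l ->
  (forall s' t', s <= s' <= s + l -> t <= t' <= t + l -> modc (g (gpoint s' t')) <= M) ->
  modc (cell_sum k s t l) <= M * (l * ((modc a + modc b) *+ 2)).
Proof.
move=> l0 H; have -> : l * ((modc a + modc b) *+ 2) = (modc (l%:C * a) + modc (l%:C * b)) *+ 2.
  by rewrite !modcM !modc_real ger0_norm// !mulr2n; ring.
apply: rect_sum_bound => s' t' /andP[s0 s1] /andP[t0 t1].
have -> : gpoint s t + s'%:C * (l%:C * a) + t'%:C * (l%:C * b) = gpoint (s + s' * l) (t + t' * l).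
  by rewrite /gpoint !rmorphD !rmorphM /=; ring.
by apply: H; rewrite lerDl mulr_ge0// lerD2l ler_piMl.
Qed.

Lemma modc_gpoint_dist s t s' t' (l : R) : `|s - s'| <= l -> `|t - t'| <= l ->
  modc (gpoint s t - gpoint s' t') <= l * (modc a + modc b).
Proof.
move=> sl tl; rewrite (_ : _ - _ = (s - s')%:C * a + (t - t')%:C * b); last first.
  by rewrite /gpoint !rmorphB /=; ring.
rewrite (le_trans (modcD _ _))// !modcM !modc_real mulrDr.
by rewrite lerD// ler_wpM2r// modc_ge0.
Qed.

(* The contour sums of affine functions vanish, so only the quadratically small
   remainder of [g] at the limit point of the nested cells contributes. *)
Lemma goursat s0 t0 l0 : 0 < l0 ->
  (forall s t, s0 <= s <= s0 + l0 -> t0 <= t <= t0 + l0 -> cdiff g (gpoint s t)) ->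
  forall e, 0 < e -> cell_small e s0 t0 l0.
Proof.
move=> l0p dg e e0; apply: contrapT => ns.
(* The error allowed to a cell is proportional to its area, hence additive under subdivision: a bad
   cell has a bad quarter. *)
pose eta := e / l0 ^+ 2.
have eta0 : 0 < eta by rewrite divr_gt0// exprn_gt0.
pose bad (x : R * R * R) := ~ cell_small (eta * x.2 ^+ 2) x.1.1 x.1.2 x.2.
pose step (x y : R * R * R) := bad x ->
  [/\ bad y, y.2 = x.2 / 2, y.1.1 = x.1.1 \/ y.1.1 = x.1.1 + x.2 / 2 &
      y.1.2 = x.1.2 \/ y.1.2 = x.1.2 + x.2 / 2].
have next (x : R * R * R) : {y | step x y}.
  apply: cid; have [bx|nbx] := pselect (bad x); last by exists x.
  apply: contrapT => H; apply: bx; case: x H => [[s t] l] H /=.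
  have sm s' t' : s' = s \/ s' = s + l / 2 -> t' = t \/ t' = t + l / 2 ->
      cell_small (eta * (l / 2) ^+ 2) s' t' (l / 2).
    by move=> hs ht; apply: contrapT => hb; apply: H; exists (s', t', l / 2).
  have := cell_small_split (sm s t (or_introl erefl) (or_introl erefl))
    (sm _ t (or_intror erefl) (or_introl erefl)) (sm s _ (or_introl erefl) (or_intror erefl))
    (sm _ _ (or_intror erefl) (or_intror erefl)).
  by congr cell_small; field.
have [f [f0 fS]] := dependent_choice next (s0, t0, l0).
have bf n : bad (f n).
  elim: n => [|n IH]; last by have [] := fS n IH.
  by rewrite f0 /bad /= /eta divfK// sqrf_eq0 gt_eqF.
pose s n := (f n).1.1; pose t n := (f n).1.2; pose l n := (f n).2.
have lE n : l n = l0 / 2 ^+ n.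
  elim: n => [|n IH]; first by rewrite /l f0 expr0 divr1.
  by have [_ h _ _] := fS n (bf n); rewrite /l h -/(l n) IH exprSr invfM mulrA.
have lp n : 0 < l n by rewrite lE divr_gt0// exprn_gt0.
have sS n : s n <= s n.+1 /\ s n.+1 + l n.+1 <= s n + l n.
  have [_ h1 h2 _] := fS n (bf n); have := lp n; rewrite /s /l h1 -/(l n).
  by case: h2 => ->; split; rewrite -/(l n) -/(s n); lra.
have tS n : t n <= t n.+1 /\ t n.+1 + l n.+1 <= t n + l n.
  have [_ h1 _ h2] := fS n (bf n); have := lp n; rewrite /t /l h1 -/(l n).
  by case: h2 => ->; split; rewrite -/(l n) -/(t n); lra.
have nested (u : nat -> R) : (forall n, u n <= u n.+1 /\ u n.+1 + l n.+1 <= u n + l n) ->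
    exists v : R, forall n, u n <= v <= u n + l n.
  move=> uS.
  have um n m : u n <= u (n + m)%N /\ u (n + m)%N + l (n + m)%N <= u n + l n.
    elim: m => [|m [h1 h2]]; first by rewrite addn0 !lexx.
    by rewrite addnS; have [h3 h4] := uS (n + m)%N; split; lra.
  have ub m n : u n <= u m + l m.
    case: (leqP n m) => nm.
      by have [h _] := um n (m - n)%N; rewrite subnKC// in h; have := lp m; lra.
    have [_ h] := um m (n - m)%N; rewrite subnKC ?(ltnW nm)// in h.
    by have := lp n; lra.
  have hs : has_sup (range u).
    by split; [exists (u 0%N), 0%N|exists (u 0%N + l 0%N) => _ [n _ <-]].
  exists (sup (range u)) => n; apply/andP; split.
    by apply: sup_upper_bound => //; exists n.
  by apply: ge_sup; [exists (u 0%N), 0%N|move=> _ [m _ <-]].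
have [S HS] := nested s sS; have [T HT] := nested t tS.
have S0 : s0 <= S <= s0 + l0 by have := HS 0%N; rewrite /s /l f0.
have T0 : t0 <= T <= t0 + l0 by have := HT 0%N; rewrite /t /l f0.
have [c Hc] := dg S T S0 T0.
pose D := modc a + modc b; have D0 : 0 <= D by rewrite addr_ge0 ?modc_ge0.
(* On a cell of side l the remainder is at most e1 l D and the perimeter is 2 l D, so the contour
   sum is at most 2 e1 D^2 l^2 <= eta l^2. The summand 1 covers D = 0. *)
pose e1 := eta / (D ^+ 2 *+ 2 + 1).
have De : 0 < D ^+ 2 *+ 2 + 1 by rewrite ltr_wpDl// mulrn_wge0// sqr_ge0.
have e10 : 0 < e1 by rewrite divr_gt0.
have [d d0 Hd] := Hc e1 e10.
have [n nd] : exists n, l n * D < d.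
  have [n nd] := exists_half_lt (l0 * D) d0.
  by exists n; rewrite lE mulrAC.
apply: (bf n); exists 0%N => k _; rewrite -/(s n) -/(t n) -/(l n).
pose r u := g u - g (gpoint S T) - c * (u - gpoint S T).
have -> : cell_sum k (s n) (t n) (l n) =
    rect_sum k r (gpoint (s n) (t n)) ((l n)%:C * a) ((l n)%:C * b).
  rewrite -[RHS]addr0 -(rect_sum_affine k c (g (gpoint S T) - c * gpoint S T)
    (gpoint (s n) (t n)) ((l n)%:C * a) ((l n)%:C * b)) -rect_sumD.
  by apply: eq_rect_sum => u; rewrite /r; ring.
have ln := lp n; have /andP[S1 S2] := HS n; have /andP[T1 T2] := HT n.
have rb (u v : R) : s n <= u <= s n + l n -> t n <= v <= t n + l n ->
    modc (r (gpoint u v)) <= e1 * (l n * D).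
  move=> /andP[u1 u2] /andP[v1 v2].
  have dist : modc (gpoint u v - gpoint S T) <= l n * D.
    by apply: modc_gpoint_dist; rewrite ler_norml; apply/andP; split; lra.
  by apply: le_trans (Hd _ (le_lt_trans dist nd)) _; rewrite ler_wpM2l// ltW.
have := @rect_sum_bound k r (gpoint (s n) (t n)) ((l n)%:C * a) ((l n)%:C * b) (e1 * (l n * D)).
rewrite !modcM !modc_real ger0_norm ?(ltW ln)// -mulrDr -/D => H.
apply: le_trans (H _) _ => [u v /andP[u0 u1] /andP[v0 v1]|].
  have -> : gpoint (s n) (t n) + u%:C * ((l n)%:C * a) + v%:C * ((l n)%:C * b) =
      gpoint (s n + u * l n) (t n + v * l n).
    by rewrite /gpoint !rmorphD !rmorphM /=; ring.
  by apply: rb; rewrite lerDl mulr_ge0 ?(ltW ln)// lerD2l ler_piMl ?(ltW ln).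
have e2 (x y u : R) : x * (u * y) * (u * y *+ 2) = x * (y ^+ 2 *+ 2) * u ^+ 2 by ring.
rewrite e2.
rewrite ler_wpM2r ?sqr_ge0// /e1 mulrAC ler_pdivrMr// ler_wpM2l ?(ltW eta0)//.
by rewrite lerDl.
Qed.

(* A corner is harmless: near it only boundedness of [g] is needed, since the
   perimeters of the cells shrinking to the corner tend to 0. *)
Lemma goursat_corner (M d : R) : 0 < d -> 0 <= M ->
  (forall s t, 0 <= s <= 1 -> 0 <= t <= 1 -> 0 < s + t -> cdiff g (gpoint s t)) ->
  (forall s t, 0 <= s <= d -> 0 <= t <= d -> modc (g (gpoint s t)) <= M) ->
  forall e, 0 < e -> cell_small e 0 0 1.
Proof.
move=> d0 M0 dg bg.
have corner n : forall e B, 0 < e -> cell_small B 0 0 (2 ^- n) -> cell_small (B + e) 0 0 1.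
  elim: n => [|n IH] e B e0.
    rewrite expr0 invr1 => -[K HK]; exists K => k Kk; apply: le_trans (HK k Kk) _.
    by rewrite lerDl ltW.
  move=> HB; have ln : 0 < 2 ^- n :> R by rewrite invr_gt0 exprn_gt0.
  have ln1 : 2 ^- n <= 1 :> R by rewrite invf_le1 ?exprn_gt0// exprn_ege1// ler1n.
  have e80 : 0 < e / 8 by rewrite divr_gt0.
  (* The three quarters away from the corner cost e / 8 each; the remaining 5 e / 8 pays for the
     scales still to be climbed. *)
  have -> : B + e = (B + e / 8 + e / 8 + e / 8) + e * (5 / 8) by field.
  apply: IH; first by rewrite mulr_gt0// divr_gt0.
  have h2 : 2 ^- n.+1 = 2 ^- n / 2 :> R by rewrite exprSr invfM.
  apply: cell_small_split; rewrite -?h2//; rewrite h2; apply: goursat => //; rewrite ?divr_gt0//.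
  - by move=> s t /andP[s0 s1] /andP[t0 t1]; apply: dg; first (apply/andP; split); lra.
  - by move=> s t /andP[s0 s1] /andP[t0 t1]; apply: dg; first (apply/andP; split); lra.
  - by move=> s t /andP[s0 s1] /andP[t0 t1]; apply: dg; first (apply/andP; split); lra.
move=> e e0; pose P := (modc a + modc b) *+ 2.
have P0 : 0 <= P by rewrite mulrn_wge0// addr_ge0 ?modc_ge0.
have -> : e = e / 2 + e / 2 by field.
have e20 : 0 < e / 2 by rewrite divr_gt0.
have [n ne] := exists_half_lt (M * P + e / 2 / d) e20.
apply: (corner n) => //; exists 0%N => k _.
have l0 : 0 < 2 ^- n :> R by rewrite invr_gt0 exprn_gt0.
have ed0 : 0 < e / 2 / d by rewrite divr_gt0.
have lM : 2 ^- n * (M * P) <= e / 2.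
  by apply: le_trans (ltW ne); rewrite mulrC ler_pM2r// lerDl ltW.
have ld : 2 ^- n <= d.
  rewrite -(ler_pM2l ed0) divfK ?gt_eqF// (le_trans _ (ltW ne))// ler_pM2r// lerDr.
  by rewrite mulr_ge0.
apply: le_trans (cell_bound k (M := M) (ltW l0) _) _.
  move: (2 ^- n) ld => l ld s t /andP[s0 s1] /andP[t0 t1].
  by apply: bg; apply/andP; split=> //; rewrite (le_trans s1, le_trans t1)// add0r.
by rewrite -/P mulrCA.
Qed.

End goursat.

Lemma cdiff_cst c z : cdiff (cst c) z.
Proof.
exists 0 => e e0; exists 1 => // w _.
by rewrite /= subrr mul0r subr0 modc0 mulr_ge0 ?(ltW e0) ?modc_ge0.
Qed.

Lemma cdiff_id z : cdiff id z.
Proof.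
exists 1 => e e0; exists 1 => // w _.
by rewrite mul1r subrr modc0 mulr_ge0 ?(ltW e0) ?modc_ge0.
Qed.

Lemma cdiffD g h z : cdiff g z -> cdiff h z -> cdiff (fun u => g u + h u) z.
Proof.
move=> [c Hc] [c' Hc']; exists (c + c') => e e0.
have e20 : 0 < e / 2 by rewrite divr_gt0.
have [d d0 Hd] := Hc _ e20; have [d' d'0 Hd'] := Hc' _ e20.
exists (Num.min d d'); first by rewrite lt_min d0.
move=> w; rewrite lt_min => /andP[/Hd h1 /Hd' h2].
rewrite (_ : _ - _ = (g w - g z - c * (w - z)) + (h w - h z - c' * (w - z))); last by ring.
apply: le_trans (modcD _ _) _; apply: le_trans (lerD h1 h2) _.
by rewrite -mulrDl -splitr.
Qed.

Lemma cdiff_lipschitz g z : cdiff g z -> exists L : R, exists2 d : R, 0 < d &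
  0 <= L /\ forall w, modc (w - z) < d -> modc (g w - g z) <= L * modc (w - z).
Proof.
move=> [c Hc]; have [d d0 Hd] := Hc 1 ltr01; exists (1 + modc c); exists d => //.
split; first by rewrite addr_ge0 ?modc_ge0.
move=> w /Hd h; rewrite (_ : g w - g z = (g w - g z - c * (w - z)) + c * (w - z)); last by ring.
by apply: le_trans (modcD _ _) _; rewrite mulrDl modcM lerD2r.
Qed.

Lemma cdiffM g h z : cdiff g z -> cdiff h z -> cdiff (fun u => g u * h u) z.
Proof.
move=> dg dh; have [L [d1 d10 [L0 HL]]] := cdiff_lipschitz dg.
move: dg dh => [c Hc] [c' Hc']; exists (c * h z + g z * c') => e e0.
pose K := modc (h z) + modc (g z) + 1 + L * (1 + modc c').
have K0 : 0 < K.
  by rewrite /K ltr_wpDr ?ltr_wpDl ?addr_ge0 ?mulr_ge0 ?addr_ge0 ?modc_ge0.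
have [e1 [e10 e11 e1K]] : exists e1, [/\ 0 < e1, e1 <= 1 & e1 <= e / K].
  by exists (Num.min 1 (e / K)); rewrite lt_min ltr01 divr_gt0// !ge_min !lexx orbT.
have [d2 d20 H2] := Hc _ e10; have [d3 d30 H3] := Hc' _ e10.
exists (Num.min (Num.min d1 e1) (Num.min d2 d3)); first by rewrite !lt_min d10 e10 d20 d30.
move=> w; rewrite !lt_min => /andP[/andP[w1 w2] /andP[/H2 h2 /H3 h3]].
have {}w1 := HL w w1.
have h4 : modc (h w - h z) <= (1 + modc c') * modc (w - z).
  rewrite (_ : h w - h z = (h w - h z - c' * (w - z)) + c' * (w - z)); last by ring.
  apply: le_trans (modcD _ _) _; rewrite mulrDl modcM lerD2r (le_trans h3)//.
  by rewrite ler_wpM2r ?modc_ge0.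
rewrite (_ : _ - _ = (g w - g z - c * (w - z)) * h z + g z * (h w - h z - c' * (w - z))
  + (g w - g z) * (h w - h z)); last by ring.
apply: le_trans (modcD _ _) _.
have -> : e * modc (w - z) = (e / K * (modc (h z) + modc (g z) + 1) + e / K * (L * (1 + modc c'))) * modc (w - z).
  by rewrite -mulrDr -/K divfK// gt_eqF.
have eK : 0 <= e / K by rewrite divr_ge0 ?ltW.
rewrite [leRHS]mulrDl; apply: lerD.
  move: (g w - _ - _) (h w - _ - _) h2 h3 => u v h2 h3.
  apply: le_trans (modcD _ _) _; rewrite !modcM (mulrAC _ _ (modc (w - z))).
  have uE : modc u <= e / K * modc (w - z).
    by apply: le_trans h2 _; rewrite ler_wpM2r ?modc_ge0.
  have vE : modc v <= e / K * modc (w - z).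
    by apply: le_trans h3 _; rewrite ler_wpM2r ?modc_ge0.
  rewrite !mulrDr (mulrC (modc (g z))) -[leLHS]addr0; apply: lerD.
    by apply: lerD; rewrite ler_wpM2r ?modc_ge0.
  by rewrite mulr1 mulr_ge0 ?modc_ge0.
rewrite modcM; apply: le_trans (ler_pM (modc_ge0 _) (modc_ge0 _) w1 h4) _.
have e4 (x y u : R) : x * u * (y * u) = u * (x * y) * u by ring.
rewrite e4.
rewrite ler_wpM2r ?modc_ge0// ler_wpM2r ?mulr_ge0 ?addr_ge0 ?modc_ge0//.
by rewrite (le_trans (ltW w2)).
Qed.

Lemma cdiffX g z n : cdiff g z -> cdiff (fun u => g u ^+ n) z.
Proof.
move=> dg; elim: n => [|n IH]; first exact: cdiff_cst.
have -> : (fun u => g u ^+ n.+1) = (fun u => g u * g u ^+ n) by apply/funext => u; rewrite exprS.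
exact: cdiffM.
Qed.

Lemma cdiffV z : z != 0 -> cdiff (fun u => u^-1) z.
Proof.
move=> z0; have m0 : 0 < modc z by rewrite modc_gt0.
exists (- z^-1 ^+ 2) => e e0.
exists (Num.min (modc z / 2) (e * modc z ^+ 3 / 2)).
  by rewrite lt_min !divr_gt0// mulr_gt0// exprn_gt0.
move=> w; rewrite lt_min => /andP[h1 h2].
have mw : modc z / 2 <= modc w.
  have := modcD (z - w) w; rewrite subrK modc_distC; lra.
have w0 : w != 0 by rewrite -modc_gt0 (lt_le_trans _ mw)// divr_gt0.
rewrite (_ : _ - _ = (w - z) ^+ 2 / (z ^+ 2 * w)); last by field; rewrite w0.
rewrite modcM modcX modcV modcM modcX expr2 -mulrA mulrC ler_wpM2r ?modc_ge0//.
rewrite ler_pdivrMr; last by rewrite mulr_gt0 ?exprn_gt0// (lt_le_trans _ mw)// divr_gt0.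
apply: le_trans (ltW h2) _.
rewrite (_ : _ / 2 = e * (modc z ^+ 2 * (modc z / 2))); last by ring.
by rewrite ler_wpM2l ?(ltW e0)// ler_wpM2l ?sqr_ge0.
Qed.

Lemma cdiff_shift g z c : cdiff g (z + c) -> cdiff (fun u => g (u + c)) z.
Proof.
move=> [k Hk]; exists k => e /Hk[d d0 Hd]; exists d => // w wz.
have E : w + c - (z + c) = w - z by ring.
by have := Hd (w + c); rewrite E; exact.
Qed.

Lemma eq_cdiff g h z (d : R) : 0 < d -> (forall w, modc (w - z) < d -> g w = h w) ->
  cdiff g z -> cdiff h z.
Proof.
move=> d0 gh [k Hk]; exists k => e /Hk[d' d'0 Hd]; exists (Num.min d d').
  by rewrite lt_min d0.
move=> w; rewrite lt_min => /andP[wd wd']; rewrite -!gh//; last by rewrite subrr modc0.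
exact: Hd.
Qed.

Section inverse_contour.

(** The imaginary part of conj(z) w, a signed area. It does not change when z moves along the
    direction w, so it is constant along an edge. *)
Definition cross z w : R := complex.Re z * complex.Im w - complex.Im z * complex.Re w.

Lemma Im_invM z w : complex.Im (z^-1 * w) = cross z w / modc z ^+ 2.
Proof.
rewrite modcE sqr_sqrtr ?addr_ge0 ?sqr_ge0//; case: z w => [x y] [u v] /=.
by rewrite /cross /=; ring.
Qed.

Lemma crossM z w (s : R) : cross (z + s%:C * w) w = cross z w.
Proof. by case: z w => [x y] [u v]; rewrite /cross /=; ring. Qed.

Lemma cross_half z w : cross z (w / 2) = cross z w / 2.
Proof.
have -> : w / 2 = (2^-1)%:C * w by rewrite fmorphV rmorph_nat mulrC.
by case: z w => [x y] [u v]; rewrite /cross /=; ring.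
Qed.

Lemma ImD z w : complex.Im (z + w) = complex.Im z + complex.Im w.
Proof. by case: z w => [? ?] [? ?]. Qed.

Lemma cross_shift z w : cross (z + w) w = cross z w.
Proof. by rewrite -{1}[w]mul1r (crossM _ _ 1). Qed.

(** Along an edge the imaginary part of dz / z has constant sign and is at least [cross z w] over
    the squared distance to 0. The factor c, used with the values 1 and -1, covers both
    orientations. *)
Lemma Im_edge_inv k z w (c D : R) : 0 <= c * cross z w -> 0 < D ->
  (forall s : R, 0 <= s <= 1 -> 0 < modc (z + s%:C * w) <= D) ->
  c * cross z w / D ^+ 2 <= c * complex.Im (edge_sum k (fun u => u^-1) z w).
Proof.
move=> J0 D0; elim: k z w J0 => [|k IH] z w J0 H /=.
  have h0 := H 0; have h1 := H 1; rewrite mul0r addr0 in h0; rewrite mul1r in h1.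
  have e01 : 0 <= (0 : R) <= 1 by rewrite lexx ler01.
  have e11 : 0 <= (1 : R) <= 1 by rewrite lexx ler01.
  have /andP[a1 a2] := h0 e01; have /andP[b1 b2] := h1 e11.
  have -> : (z^-1 + (z + w)^-1) / 2 * w = z^-1 * (w / 2) + (z + w)^-1 * (w / 2) by ring.
  rewrite ImD !Im_invM !cross_half.
  rewrite cross_shift.
  have hD (m : R) : 0 < m <= D -> c * cross z w / 2 / D ^+ 2 <= c * (cross z w / 2 / m ^+ 2).
    move=> /andP[m0 mD]; rewrite !mulrA ler_wpM2l ?divr_ge0// lef_pV2 ?posrE ?exprn_gt0//.
    by rewrite lerXn2r ?nnegrE ?(ltW m0) ?(ltW D0).
  have -> : c * cross z w / D ^+ 2 = c * cross z w / 2 / D ^+ 2 + c * cross z w / 2 / D ^+ 2.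
    by field; rewrite gt_eqF.
  by rewrite [leRHS]mulrDr; apply: lerD; apply: hD; apply/andP.
rewrite ImD.
have -> : c * cross z w / D ^+ 2 =
    c * cross z (w / 2) / D ^+ 2 + c * cross (z + w / 2) (w / 2) / D ^+ 2.
  have -> : cross (z + w / 2) (w / 2) = cross z (w / 2).
    exact: cross_shift.
  by rewrite cross_half; field; rewrite gt_eqF.
rewrite [leRHS]mulrDr; apply: lerD; apply: IH.
- by rewrite cross_half mulrA divr_ge0.
- move=> s /andP[s0 s1]; rewrite (_ : s%:C * (w / 2) = (s / 2)%:C * w); first by apply: H; apply/andP; split; lra.
  by rewrite complex_half; ring.
- by rewrite cross_shift cross_half mulrA divr_ge0.
- move=> s /andP[s0 s1]; rewrite -addrA (_ : w / 2 + _ = ((1 + s) / 2)%:C * w).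
    by apply: H; apply/andP; split; lra.
  by rewrite complex_half rmorphD rmorph1; ring.
Qed.

End inverse_contour.

(** The boundary of a rectangle around 0, divided into the eight outer edges of the four
    subrectangles that meet at 0: by [outer_sumE] the edges through 0 cancel. A singularity at 0
    thus always sits at a corner, where [goursat_corner] applies. *)
Definition outer_sum k g (a a' b : R[i]) : R[i] :=
  edge_sum k g a b - edge_sum k g b a - edge_sum k g a' b + edge_sum k g b a'
  + edge_sum k g a' (- b) - edge_sum k g (- b) a' - edge_sum k g a (- b) + edge_sum k g (- b) a.

Lemma outer_sumE k g a a' b : outer_sum k g a a' b =
  rect_sum k g 0 a b - rect_sum k g 0 a' b + rect_sum k g 0 a' (- b) - rect_sum k g 0 a (- b).
Proof. by rewrite /rect_sum /outer_sum !add0r; ring. Qed.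

Lemma outer_sumD k g h a a' b :
  outer_sum k (fun u => g u + h u) a a' b = outer_sum k g a a' b + outer_sum k h a a' b.
Proof. by rewrite !outer_sumE !rect_sumD; ring. Qed.

Lemma outer_sumZ k g c a a' b :
  outer_sum k (fun u => c * g u) a a' b = c * outer_sum k g a a' b.
Proof. by rewrite /outer_sum !edge_sumZ; ring. Qed.

Section cauchy_rectangle.
Variables (x0 x1 T : R).
Hypotheses (x00 : x0 < 0) (x10 : 0 < x1) (T0 : 0 < T).

Let a : R[i] := x1%:C.
Let a' : R[i] := x0%:C.
Let b : R[i] := 0 +i* T.

Definition box (u : R[i]) := x0 <= complex.Re u <= x1 /\ - T <= complex.Im u <= T.

Definition box_bd (u : R[i]) := box u /\
  [\/ complex.Re u = x0, complex.Re u = x1, complex.Im u = - T | complex.Im u = T].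

Lemma outer_bd (P : R[i] -> Prop) : (forall u, box_bd u -> P u) ->
  forall s : R, 0 <= s <= 1 -> [/\ P (a + s%:C * b), P (b + s%:C * a), P (a' + s%:C * b),
    P (b + s%:C * a') & [/\ P (a' + s%:C * - b), P (- b + s%:C * a'), P (a + s%:C * - b) &
    P (- b + s%:C * a)]].
Proof.
move=> HP s /andP[s0 s1].
have sT0 : 0 <= s * T by rewrite mulr_ge0// ltW.
have sT1 : s * T <= T by rewrite ler_piMl// ltW.
have sx0 : 0 <= s * x1 by rewrite mulr_ge0// ltW.
have sx1 : s * x1 <= x1 by rewrite ler_piMl// ltW.
have sy0 : s * x0 <= 0 by rewrite mulr_ge0_le0// ltW.
have sy1 : x0 <= s * x0 by rewrite ler_niMl// ltW.
have e (u : R[i]) x y : complex.Re u = x -> complex.Im u = y -> x0 <= x <= x1 -> - T <= y <= T ->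
    [\/ x = x0, x = x1, y = - T | y = T] -> P u.
  by move=> ux uy hx hy H; apply: HP; split; [split|]; rewrite ?ux ?uy.
split; last split.
- by apply: (e _ x1 (s * T)) => /=; [ring|ring|lra|lra|constructor 2].
- by apply: (e _ (s * x1) T) => /=; [ring|ring|lra|lra|constructor 4].
- by apply: (e _ x0 (s * T)) => /=; [ring|ring|lra|lra|constructor 1].
- by apply: (e _ (s * x0) T) => /=; [ring|ring|lra|lra|constructor 4].
- by apply: (e _ x0 (- (s * T))) => /=; [ring|ring|lra|lra|constructor 1].
- by apply: (e _ (s * x0) (- T)) => /=; [ring|ring|lra|lra|constructor 3].
- by apply: (e _ x1 (- (s * T))) => /=; [ring|ring|lra|lra|constructor 2].
- by apply: (e _ (s * x1) (- T)) => /=; [ring|ring|lra|lra|constructor 3].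
Qed.

Let L : R := (modc a + modc a' + modc b *+ 2) *+ 2.

Lemma outer_sum_bound k g (M : R) : (forall u, box_bd u -> modc (g u) <= M) ->
  modc (outer_sum k g a a' b) <= M * L.
Proof.
move=> H; have O := outer_bd H.
have h1 : modc (edge_sum k g a b) <= M * modc b by apply: edge_sum_bound => s /O[].
have h2 : modc (edge_sum k g b a) <= M * modc a by apply: edge_sum_bound => s /O[].
have h3 : modc (edge_sum k g a' b) <= M * modc b by apply: edge_sum_bound => s /O[].
have h4 : modc (edge_sum k g b a') <= M * modc a' by apply: edge_sum_bound => s /O[].
have h5 : modc (edge_sum k g a' (- b)) <= M * modc b.
  by rewrite -[modc b]modcN; apply: edge_sum_bound => s /O[_ _ _ _ []].
have h6 : modc (edge_sum k g (- b) a') <= M * modc a'.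
  by apply: edge_sum_bound => s /O[_ _ _ _ []].
have h7 : modc (edge_sum k g a (- b)) <= M * modc b.
  by rewrite -[modc b]modcN; apply: edge_sum_bound => s /O[_ _ _ _ []].
have h8 : modc (edge_sum k g (- b) a) <= M * modc a.
  by apply: edge_sum_bound => s /O[_ _ _ _ []].
have -> : M * L = M * modc b + M * modc a + M * modc b + M * modc a' + M * modc b + M * modc a'
    + M * modc b + M * modc a by rewrite /L; ring.
rewrite /outer_sum; apply: le_trans (modcD _ _) (lerD _ h8).
apply: le_trans (modcB _ _) (lerD _ h7); apply: le_trans (modcB _ _) (lerD _ h6).
apply: le_trans (modcD _ _) (lerD _ h5); apply: le_trans (modcD _ _) (lerD _ h4).
apply: le_trans (modcB _ _) (lerD _ h3); exact: le_trans (modcB _ _) (lerD h1 h2).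
Qed.

(** Replaces the value 2 pi of the winding integral: all eight edges contribute with the same sign,
    so the first one already gives a lower bound uniform in k. *)
Lemma Im_outer_inv : exists2 c : R, 0 < c &
  forall k, c <= complex.Im (outer_sum k (fun u => u^-1) a a' b).
Proof.
pose D : R := x1 - x0 + T; have D0 : 0 < D by rewrite /D addr_gt0// subr_gt0 (lt_trans x00).
exists (x1 * T / D ^+ 2); first by rewrite divr_gt0 ?exprn_gt0// mulr_gt0.
move=> k.
have HP u : box_bd u -> 0 < modc u <= D.
  have h1 := x00; have h2 := x10; have h3 := T0.
  case: u => u v [[/= /andP[u1 u2] /andP[v1 v2]] H]; apply/andP; split.
    rewrite (modc_gt0 (u +i* v)); apply/negP => /eqP[uE vE].
    by move: H; rewrite uE vE => -[]; lra.
  apply: le_trans (modc_le_ReIm (u +i* v)) _; rewrite /= /D.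
  by apply: lerD; rewrite ler_norml; lra.
have O := outer_bd HP.
have e1 : cross a b = x1 * T by rewrite /cross /=; ring.
have e2 : cross b a = - (x1 * T) by rewrite /cross /=; ring.
have e3 : cross a' b = x0 * T by rewrite /cross /=; ring.
have e4 : cross b a' = - (x0 * T) by rewrite /cross /=; ring.
have e5 : cross a' (- b) = - (x0 * T) by rewrite /cross /=; ring.
have e6 : cross (- b) a' = x0 * T by rewrite /cross /=; ring.
have e7 : cross a (- b) = - (x1 * T) by rewrite /cross /=; ring.
have e8 : cross (- b) a = x1 * T by rewrite /cross /=; ring.
have p1 : 0 <= x1 * T by rewrite mulr_ge0// ltW.
have p0 : x0 * T <= 0 by rewrite mulr_le0_ge0// ltW.
have DV : 0 <= (D ^+ 2)^-1 by rewrite invr_ge0 sqr_ge0.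
have pos (c : R) z w : 0 <= c * cross z w ->
    (forall s : R, 0 <= s <= 1 -> 0 < modc (z + s%:C * w) <= D) ->
    0 <= c * complex.Im (edge_sum k (fun u => u^-1) z w).
  by move=> J0 H; apply: le_trans (Im_edge_inv k J0 D0 H); rewrite mulr_ge0.
have i1 : x1 * T / D ^+ 2 <= complex.Im (edge_sum k (fun u => u^-1) a b).
  have := @Im_edge_inv k a b 1 D; rewrite !mul1r e1; apply => //.
  by move=> s /O[].
have i2 : 0 <= -1 * complex.Im (edge_sum k (fun u => u^-1) b a).
  by apply: pos; [rewrite e2; lra|move=> s /O[]].
have i3 : 0 <= -1 * complex.Im (edge_sum k (fun u => u^-1) a' b).
  by apply: pos; [rewrite e3; lra|move=> s /O[]].
have i4 : 0 <= 1 * complex.Im (edge_sum k (fun u => u^-1) b a').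
  by apply: pos; [rewrite e4; lra|move=> s /O[]].
have i5 : 0 <= 1 * complex.Im (edge_sum k (fun u => u^-1) a' (- b)).
  by apply: pos; [rewrite e5; lra|move=> s /O[_ _ _ _ []]].
have i6 : 0 <= -1 * complex.Im (edge_sum k (fun u => u^-1) (- b) a').
  by apply: pos; [rewrite e6; lra|move=> s /O[_ _ _ _ []]].
have i7 : 0 <= -1 * complex.Im (edge_sum k (fun u => u^-1) a (- b)).
  by apply: pos; [rewrite e7; lra|move=> s /O[_ _ _ _ []]].
have i8 : 0 <= 1 * complex.Im (edge_sum k (fun u => u^-1) (- b) a).
  by apply: pos; [rewrite e8; lra|move=> s /O[_ _ _ _ []]].
rewrite /outer_sum; move: i1 i2 i3 i4 i5 i6 i7 i8.
move: (edge_sum k _ a b) (edge_sum k _ b a) (edge_sum k _ a' b) (edge_sum k _ b a')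
  (edge_sum k _ a' (- b)) (edge_sum k _ (- b) a') (edge_sum k _ a (- b)) (edge_sum k _ (- b) a).
move=> [? r1] [? r2] [? r3] [? r4] [? r5] [? r6] [? r7] [? r8] /=.
set c := x1 * T / _; lra.
Qed.

(** Cauchy's formula as an inequality. The sum of g(u) / u around the rectangle differs by a small
    error from g(0) times the sum of 1 / u, and the latter is bounded below. The constant depends on
    the rectangle alone. *)
Lemma cauchy_bound : exists2 C : R, 0 <= C & forall g (M : R),
  (forall u, box u -> cdiff g u) -> (forall u, box_bd u -> modc (g u) <= M) ->
  modc (g 0) <= C * M.
Proof.
have [c c0 Hc] := Im_outer_inv.
pose dl := Num.min (Num.min (- x0) x1) T.
have dl0 : 0 < dl by rewrite !lt_min oppr_gt0 x00 x10.
have dlP u : box_bd u -> dl <= modc u.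
  case: u => u v [_ /= H].
  have hu : `|u| <= modc (u +i* v) := Re_le_modc (u +i* v).
  have hv : `|v| <= modc (u +i* v) := Im_le_modc (u +i* v).
  have [d1 d2 d3] : [/\ dl <= - x0, dl <= x1 & dl <= T].
    by rewrite /dl !ge_min !lexx !orbT.
  case: H => E.
  - by rewrite (le_trans _ hu)// E ltr0_norm.
  - by rewrite (le_trans _ hu)// E gtr0_norm.
  - by rewrite (le_trans _ hv)// E normrN gtr0_norm.
  - by rewrite (le_trans _ hv)// E gtr0_norm.
have L0 : 0 <= L by rewrite /L mulrn_wge0// addr_ge0 ?addr_ge0 ?mulrn_wge0 ?modc_ge0.
exists (L / dl / c); first by rewrite !divr_ge0 ?(ltW dl0) ?(ltW c0).
move=> g M dg bg.
have M0 : 0 <= M.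
  apply: le_trans (modc_ge0 (g a)) (bg a _); split; last by constructor 2.
  by have := x00; have := x10; have := T0; split=> /=; lra.
have b0 : box 0 by have := x00; have := x10; have := T0; split=> /=; lra.
have [K [d d0 [K0 HK]]] := cdiff_lipschitz (dg 0 b0).
(* This quotient is differentiable off 0 and, near 0, bounded by a Lipschitz constant of g at 0,
   which is what [goursat_corner] asks at the corner. *)
pose h u := (g u - g 0) * u^-1.
have hd : forall u, box u -> u != 0 -> cdiff h u.
  move=> u bu u0; apply: cdiffM; last exact: cdiffV.
  by apply: cdiffD; [exact: dg|exact: cdiff_cst].
pose dd := d / (modc a + modc a' + modc b + 1).
have A1 : 0 < modc a + modc a' + modc b + 1.
  by rewrite ltr_wpDl ?addr_ge0 ?modc_ge0.
have dd0 : 0 < dd by rewrite divr_gt0.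
have dP (a1 b1 : R[i]) (s t : R) : (a1 = a \/ a1 = a') -> (b1 = b \/ b1 = - b) ->
    0 <= s <= dd / 2 -> 0 <= t <= dd / 2 -> modc (0 + s%:C * a1 + t%:C * b1) < d.
  move=> ha hb /andP[s0 s1] /andP[t0 t1].
  have -> : d = dd * (modc a + modc a' + modc b + 1) by rewrite divfK// gt_eqF.
  rewrite add0r (le_lt_trans (modcD _ _))// !modcM (modc_real s) (modc_real t) (ger0_norm s0) (ger0_norm t0).
  apply: (@le_lt_trans _ _ (dd / 2 * (modc a + modc a') + dd / 2 * modc b)).
    apply: lerD; apply: ler_pM; rewrite ?modc_ge0//.
      by case: ha => ->; rewrite ?lerDl ?lerDr modc_ge0.
    by case: hb => ->; rewrite ?modcN.
  rewrite -mulrDr; apply: (@lt_le_trans _ _ (dd * (modc a + modc a' + modc b + 1))) => //.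
  have S0 : 0 <= modc a + modc a' + modc b by rewrite !addr_ge0 ?modc_ge0.
  rewrite -subr_gt0 (_ : _ - _ = dd / 2 * (modc a + modc a' + modc b) + dd); last by field.
  by rewrite ltr_wpDl// mulr_ge0// divr_ge0// ltW.
have boxP (a1 b1 : R[i]) (s t : R) : (a1 = a \/ a1 = a') -> (b1 = b \/ b1 = - b) ->
    0 <= s <= 1 -> 0 <= t <= 1 -> box (0 + s%:C * a1 + t%:C * b1).
  move=> ha hb /andP[s0 s1] /andP[t0 t1].
  have h1 := x00; have h2 := x10; have h3 := T0.
  have sT0 : 0 <= t * T by rewrite mulr_ge0// ltW.
  have sT1 : t * T <= T by rewrite ler_piMl// ltW.
  have sx0 : 0 <= s * x1 by rewrite mulr_ge0// ltW.
  have sx1 : s * x1 <= x1 by rewrite ler_piMl// ltW.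
  have sy0 : s * x0 <= 0 by rewrite mulr_ge0_le0// ltW.
  have sy1 : x0 <= s * x0 by rewrite ler_niMl// ltW.
  have reE (x y : R) : complex.Re (0 + s%:C * x%:C + t%:C * (0 +i* y)) = s * x.
    by rewrite /=; ring.
  have imE (x y : R) : complex.Im (0 + s%:C * x%:C + t%:C * (0 +i* y)) = t * y.
    by rewrite /=; ring.
  have bE : - b = 0 +i* (- T) by rewrite /b /=; congr (_ +i* _); rewrite oppr0.
  rewrite /box; case: ha hb => [->|->] [->|->]; rewrite ?bE reE imE; lra.
have nz (a1 b1 : R[i]) (s t : R) : (a1 = a \/ a1 = a') -> (b1 = b \/ b1 = - b) ->
    0 <= s <= 1 -> 0 <= t <= 1 -> 0 < s + t -> 0 + s%:C * a1 + t%:C * b1 != 0.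
  move=> ha hb /andP[s0 s1] /andP[t0 t1] st; apply/negP => /eqP E.
  have bE : - b = 0 +i* (- T) by rewrite /b /=; congr (_ +i* _); rewrite oppr0.
  have [x [xn0 xE]] : exists x, x != 0 /\ a1 = x%:C.
    by case: ha => ->; [exists x1|exists x0]; split=> //; [rewrite gt_eqF|rewrite lt_eqF].
  have [y [yn0 yE]] : exists y, y != 0 /\ b1 = 0 +i* y.
    by case: hb => ->; [exists T|exists (- T)]; split=> //; rewrite ?oppr_eq0 gt_eqF.
  have := congr1 (@complex.Re R) E; have := congr1 (@complex.Im R) E; rewrite xE yE /=.
  rewrite !mul0r !mulr0 !add0r !addr0 !subr0 => /eqP; rewrite mulf_eq0 (negbTE yn0) orbF => /eqP t00 /eqP.
  by rewrite mulf_eq0 (negbTE xn0) orbF => /eqP s00; move: st; rewrite s00 t00 addr0 ltxx.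
have small (a1 b1 : R[i]) : (a1 = a \/ a1 = a') -> (b1 = b \/ b1 = - b) ->
    forall e, 0 < e -> exists N : nat, forall k, (N <= k)%N -> modc (rect_sum k h 0 a1 b1) <= e.
  move=> ha hb e e0.
  have dd20 : 0 < dd / 2 by rewrite divr_gt0.
  have hcorner (s t : R) : 0 <= s <= 1 -> 0 <= t <= 1 -> 0 < s + t -> cdiff h (gpoint 0 a1 b1 s t).
    by move=> s01 t01 st; apply: hd; [exact: boxP|exact: nz].
  have hb0 (s t : R) : 0 <= s <= dd / 2 -> 0 <= t <= dd / 2 -> modc (h (gpoint 0 a1 b1 s t)) <= K.
    move=> s01 t01; rewrite /h; have [->|u0] := eqVneq (gpoint 0 a1 b1 s t) 0.
      by rewrite subrr mul0r modc0.
    rewrite modcM modcV ler_pdivrMr ?modc_gt0//.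
    by have := HK (gpoint 0 a1 b1 s t); rewrite subr0; apply; exact: dP.
  have [N HN] := goursat_corner dd20 K0 hcorner hb0 e0.
  exists N => k /HN; rewrite /cell_sum /gpoint !mul0r !addr0.
  by rewrite rmorph1 !mul1r.
have outer_small e : 0 < e -> exists k, modc (outer_sum k h a a' b) <= e *+ 4.
  move=> e0.
  have [N1 H1] := small a b (or_introl erefl) (or_introl erefl) e e0.
  have [N2 H2] := small a' b (or_intror erefl) (or_introl erefl) e e0.
  have [N3 H3] := small a' (- b) (or_intror erefl) (or_intror erefl) e e0.
  have [N4 H4] := small a (- b) (or_introl erefl) (or_intror erefl) e e0.
  pose k := maxn (maxn N1 N2) (maxn N3 N4); exists k.
  have : (k <= k)%N by []; rewrite {1}/k !geq_max => /andP[/andP[k1 k2] /andP[k3 k4]].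
  rewrite outer_sumE; have -> : e *+ 4 = e + e + e + e by ring.
  apply: le_trans (modcB _ _) (lerD _ (H4 k k4)).
  apply: le_trans (modcD _ _) (lerD _ (H3 k k3)).
  exact: le_trans (modcB _ _) (lerD (H1 k k1) (H2 k k2)).
have main e : 0 < e -> modc (g 0) * c <= M / dl * L + e *+ 4.
  move=> /outer_small[k Hk].
  have gE : (fun u => g u * u^-1) = (fun u => h u + g 0 * u^-1).
    by apply/funext => u; rewrite /h; ring.
  have := @outer_sum_bound k (fun u => g u * u^-1) (M / dl).
  rewrite gE outer_sumD outer_sumZ => B.
  have {}B : modc (outer_sum k h a a' b + g 0 * outer_sum k (fun u => u^-1) a a' b) <= M / dl * L.
    apply: B => u bu.
    rewrite modcM modcV ler_pM ?modc_ge0 ?invr_ge0 ?modc_ge0//; first exact: bg.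
    by rewrite lef_pV2 ?posrE// ?dlP// (lt_le_trans dl0)// dlP.
  apply: (@le_trans _ _ (modc (g 0 * outer_sum k (fun u => u^-1) a a' b))).
    rewrite modcM ler_wpM2l ?modc_ge0// (le_trans (Hc k))// (le_trans (ler_norm _))//.
    exact: Im_le_modc.
  rewrite -[X in modc X](addKr (outer_sum k h a a' b)) addrC.
  by apply: le_trans (modcB _ _) _; apply: lerD.
have -> : L / dl / c * M = M / dl * L / c by ring.
rewrite ler_pdivlMr//; apply/ler_addgt0Pr => e e0.
have := main (e / 4) (divr_gt0 e0 (ltr0n R 4)).
by rewrite -mulrnAl -mulr_natr mulfK.
Qed.

(** The constant of [cauchy_bound] is removed by applying it to the powers g^n, which gives |g(0)|^n
    <= C M^n; Bernoulli's inequality then excludes |g(0)| > M. *)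
Lemma max_principle0 g (M : R) :
  (forall u, box u -> cdiff g u) -> (forall u, box_bd u -> modc (g u) <= M) ->
  modc (g 0) <= M.
Proof.
move=> dg bg; have [C C0 HC] := cauchy_bound.
have M0 : 0 <= M.
  apply: le_trans (modc_ge0 (g a)) (bg a _); split; last by constructor 2.
  by have := x00; have := x10; have := T0; split=> /=; lra.
have pw n : modc (g 0) ^+ n <= C * M ^+ n.
  rewrite -modcX; apply: (HC (fun u => g u ^+ n)).
    by move=> u bu; apply: cdiffX; exact: dg.
  by move=> u bu; rewrite modcX lerXn2r ?nnegrE ?modc_ge0//; exact: bg.
rewrite leNgt; apply/negP => lt.
have [M00|Mn0] := eqVneq M 0.
  by have := pw 1%N; rewrite !expr1 M00 mulr0 leNgt -{1}M00 lt.
have Mp : 0 < M by rewrite lt_neqAle eq_sym Mn0.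
pose y := modc (g 0) / M - 1.
have y0 : 0 < y by rewrite subr_gt0 ltr_pdivlMr// mul1r.
have bern n : 1 + n%:R * y <= (1 + y) ^+ n.
  elim: n => [|n IH]; first by rewrite mul0r addr0 expr0.
  rewrite exprS; apply: le_trans (ler_wpM2l _ IH); last exact: (addr_ge0 ler01 (ltW y0)).
  rewrite -subr_ge0 (_ : _ - _ = n%:R * y ^+ 2); first by rewrite mulr_ge0 ?sqr_ge0.
  by rewrite -natr1; ring.
pose n := (Num.truncn (C / y)).+1.
have Cn : C < n%:R * y by rewrite -ltr_pdivrMr// truncnS_gt.
have := pw n; have -> : modc (g 0) = (1 + y) * M.
  by rewrite /y addrC subrK divfK.
rewrite exprMn ler_pM2r ?exprn_gt0// leNgt => /negP; apply.
by apply: lt_le_trans (bern n); rewrite (lt_le_trans Cn)// lerDr.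
Qed.

End cauchy_rectangle.

Lemma max_principle g (x0 x1 T M : R) (z : R[i]) :
  x0 < complex.Re z < x1 -> 0 < T ->
  (forall u, x0 <= complex.Re u <= x1 -> `|complex.Im u - complex.Im z| <= T -> cdiff g u) ->
  (forall u, x0 <= complex.Re u <= x1 -> `|complex.Im u - complex.Im z| <= T ->
    [\/ complex.Re u = x0, complex.Re u = x1 | `|complex.Im u - complex.Im z| = T] ->
    modc (g u) <= M) ->
  modc (g z) <= M.
Proof.
case: z => zr zi /= /andP[zx0 zx1] T0 dg bg.
have h0 : x0 - zr < 0 by rewrite subr_lt0.
have h1 : 0 < x1 - zr by rewrite subr_gt0.
rewrite -[zr +i* zi]add0r; apply: (@max_principle0 _ _ _ h0 h1 T0 (fun u => g (u + (zr +i* zi)))).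
  move=> [u v] [/= uu vv]; apply: cdiff_shift; apply: dg => /=; first lra.
  by rewrite addrK ler_norml.
move=> [u v] [[/= uu vv] H]; apply: bg => /=; first lra.
  by rewrite addrK ler_norml.
rewrite addrK; case: H => /= E.
- by constructor 1; rewrite E subrK.
- by constructor 2; rewrite E subrK.
- by constructor 3; rewrite E normrN gtr0_norm.
- by constructor 3; rewrite E gtr0_norm.
Qed.

End contour.

(** * The three lines theorem *)

Section complex_exponential.
Context {R : realType}.
Implicit Types (x y : R) (z w u : R[i]).

Definition cexp z : R[i] :=
  (expR (complex.Re z) * cos (complex.Im z)) +i* (expR (complex.Re z) * sin (complex.Im z)).

Lemma cexpD z w : cexp (z + w) = cexp z * cexp w.
Proof.
case: z w => [a b] [c d]; rewrite /cexp /= expRD cosD sinD.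
by apply/eqP; rewrite eq_complex /=; apply/andP; split; apply/eqP; ring.
Qed.

Lemma cexp_real x : cexp x%:C = (expR x)%:C.
Proof. by rewrite /cexp /= cos0 sin0 mulr1 mulr0. Qed.

Lemma cexp0 : cexp 0 = 1.
Proof. by rewrite (cexp_real 0) expR0. Qed.

Lemma modc_cexp z : modc (cexp z) = expR (complex.Re z).
Proof.
rewrite modcE /= !exprMn -mulrDr cos2Dsin2 mulr1 sqrtr_sqr ger0_norm// expR_ge0.
Qed.

Lemma expR_taylor x : `|x| <= 2^-1 -> `|expR x - 1 - x| <= 2 * x ^+ 2.
Proof.
rewrite ler_norml => /andP[x1 x2]; have h := expR_ge1Dx x.
rewrite ger0_norm; last by lra.
have h1 := expR_ge1Dx (- x); rewrite expRN in h1.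
have e0 := expR_gt0 x; have d0 : 0 < 1 - x by lra.
have : expR x <= (1 - x)^-1.
  by rewrite -[expR x]invrK lef_pV2 ?posrE ?invr_gt0.
move=> h2; have : (1 - x)^-1 - 1 - x <= 2 * x ^+ 2; last by lra.
rewrite (_ : _ - _ = x ^+ 2 / (1 - x)); last by field; rewrite gt_eqF.
rewrite ler_pdivrMr// mulrAC -subr_ge0 (_ : _ - _ = x ^+ 2 * (1 - 2 * x)); last by ring.
by rewrite mulr_ge0 ?sqr_ge0//; lra.
Qed.

Lemma sin_bound y : `|sin y| <= `|y|.
Proof.
have pos (x : R) : 0 <= x -> `|sin x| <= `|x|.
  move=> x0; have [c _] := @MVT_segment R (@sin R) (@cos R) 0 x x0 (fun x _ => is_derive_sin x)
    (continuous_subspaceT (@continuous_sin R)).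
  by rewrite sin0 !subr0 => ->; rewrite normrM ler_piMl// cos_max.
have [/pos//|/ltW y0] := leP 0 y.
by have := pos (- y); rewrite sinN !normrN; apply; rewrite oppr_ge0.
Qed.

Lemma cos_bound y : `|cos y - 1| <= y ^+ 2 / 2.
Proof.
have -> : cos y - 1 = - (2 * sin (y / 2) ^+ 2).
  by rewrite {1}(splitr y) cosD -!expr2 cos2sin2; ring.
rewrite normrN normrM (ger0_norm (ler0n R 2)) normrX -(real_normK (num_real y)).
have := sin_bound (y / 2); rewrite normrM (ger0_norm (x := 2^-1))// => h.
have : `|sin (y / 2)| ^+ 2 <= (`|y| / 2) ^+ 2 by rewrite lerXn2r ?nnegrE ?divr_ge0.
rewrite (_ : (`|y| / 2) ^+ 2 = `|y| ^+ 2 / 4); last by field.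
by move: (`|y| ^+ 2) (`|sin _| ^+ 2) => a b; lra.
Qed.

Lemma sin_taylor y : `|y| <= 2^-1 -> `|sin y - y| <= y ^+ 2.
Proof.
have pos (x : R) : 0 <= x -> x <= 2^-1 -> `|sin x - x| <= x ^+ 2.
  move=> x0 x2.
  have [c] := @MVT_segment R (@sin R) (@cos R) 0 x x0 (fun x _ => is_derive_sin x)
    (continuous_subspaceT (@continuous_sin R)).
  rewrite in_itv /= => /andP[c0 c1]; rewrite sin0 !subr0 => ->.
  rewrite -{2}[x]mul1r -mulrBl normrM (ger0_norm x0).
  have := cos_bound c; have : c ^+ 2 <= x ^+ 2 by rewrite lerXn2r ?nnegrE.
  move=> h1 h2; rewrite expr2; apply: ler_wpM2r => //.
  by apply: le_trans h2 _; nra.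
have [y0|/ltW y0] := leP 0 y; first by rewrite ger0_norm// => y2; exact: pos.
rewrite ler0_norm// => y2; have := pos (- y); rewrite sinN sqrrN -opprD normrN.
by apply => //; rewrite oppr_ge0.
Qed.

Lemma cexp_taylor_small u : modc u <= 2^-1 -> modc (cexp u - 1 - u) <= 6 * modc u ^+ 2.
Proof.
move=> m2; have := Re_le_modc u; have := Im_le_modc u; have m0 := modc_ge0 u.
move: (modc u) m0 m2 => m m0 m2; case: u => x y; rewrite [complex.Re _]/= [complex.Im _]/= => ym xm.
have ex := expR_taylor (le_trans xm m2).
have sy := sin_taylor (le_trans ym m2).
have sb := sin_bound y; have cb := cos_bound y.
have x2 : x ^+ 2 <= m ^+ 2 by rewrite -real_normK ?num_real// lerXn2r ?nnegrE.
have y2 : y ^+ 2 <= m ^+ 2 by rewrite -real_normK ?num_real// lerXn2r ?nnegrE.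
have xy : `|x| * `|y| <= m ^+ 2 by rewrite expr2 ler_pM.
have -> : cexp (x +i* y) - 1 - (x +i* y) = ((expR x - 1 - x) * cos y + (1 + x) * (cos y - 1)) +i*
    ((expR x - 1 - x) * sin y + x * sin y + (sin y - y)).
  by apply/eqP; rewrite eq_complex /=; apply/andP; split; apply/eqP; ring.
apply: le_trans (modc_le_ReIm (_ +i* _)) _; rewrite [complex.Re _]/= [complex.Im _]/=.
have nx : `|1 + x| <= 2 by rewrite ler_norml; move: (le_trans xm m2); rewrite ler_norml; lra.
have ny : `|y| <= 2^-1 := le_trans ym m2.
have a1 : `|(expR x - 1 - x) * cos y| <= 2 * x ^+ 2.
  by rewrite normrM (le_trans _ ex)// ler_piMr// cos_max.
have a2 : `|(1 + x) * (cos y - 1)| <= y ^+ 2.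
  rewrite normrM (le_trans (ler_pM _ _ nx cb))//; lra.
have a3 : `|(expR x - 1 - x) * sin y| <= x ^+ 2.
  rewrite normrM (le_trans (ler_pM _ _ ex (le_trans sb ny)))//; lra.
have a4 : `|x * sin y| <= `|x| * `|y| by rewrite normrM ler_wpM2l.
have := ler_normD ((expR x - 1 - x) * cos y) ((1 + x) * (cos y - 1)).
have := ler_normD ((expR x - 1 - x) * sin y + x * sin y) (sin y - y).
have := ler_normD ((expR x - 1 - x) * sin y) (x * sin y).
move: (x ^+ 2) (y ^+ 2) (m ^+ 2) x2 y2 xy a1 a2 a3 a4 sy => ? ? ?; lra.
Qed.

(** The factor [expR (modc u)] makes the second-order estimate hold for every u. In
    [cexp_quotient_small] the exponent contains the values of an unbounded function. *)
Lemma cexp_taylor2 u : modc (cexp u - 1 - u) <= 20 * modc u ^+ 2 * expR (modc u).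
Proof.
have m0 := modc_ge0 u; have e1 : 1 <= expR (modc u) by rewrite -expR0 ler_expR.
have [h|h] := leP (modc u) 2^-1.
  apply: le_trans (cexp_taylor_small h) _.
  apply: (@le_trans _ _ (20 * modc u ^+ 2)); first by have := sqr_ge0 (modc u); lra.
  by rewrite ler_peMr// mulr_ge0 ?sqr_ge0.
have : modc (cexp u - 1 - u) <= expR (modc u) + 1 + modc u.
  apply: le_trans (modcB _ _) _; rewrite lerD2r; apply: le_trans (modcB _ _) _.
  rewrite modc1 lerD2r modc_cexp ler_expR (le_trans (ler_norm _))//; exact: Re_le_modc.
have := expR_ge1Dx (modc u); have : 4^-1 <= modc u ^+ 2 by nra.
move: (modc u ^+ 2) => m2 h1 h2 /le_trans; apply.
have := mulr_ge0 (ltW (expR_gt0 (modc u))) (_ : 0 <= m2 - 4^-1); rewrite subr_ge0 => /(_ h1).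
by move: h2; rewrite mulrBr (mulrC _ m2); move: (expR _) => E; lra.
Qed.

Lemma cexp_taylor1 u : modc (cexp u - 1) <= 4 * modc u * expR (modc u).
Proof.
have m0 := modc_ge0 u; have e1 : 1 <= expR (modc u) by rewrite -expR0 ler_expR.
have [h|h] := leP (modc u) 2^-1.
  have := cexp_taylor_small h; have := modcD (cexp u - 1 - u) u; rewrite subrK.
  move=> h1 h2; apply: (@le_trans _ _ (4 * modc u)); last by rewrite ler_peMr// mulr_ge0.
  by nra.
have : modc (cexp u - 1) <= expR (modc u) + 1.
  apply: le_trans (modcB _ _) _.
  rewrite modc1 lerD2r modc_cexp ler_expR (le_trans (ler_norm _))//; exact: Re_le_modc.
move=> /le_trans; apply.
have : 2^-1 * expR (modc u) <= modc u * expR (modc u).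
  by rewrite ler_wpM2r ?expR_ge0// ltW.
by rewrite -mulrA; move: (modc u * _) => p; lra.
Qed.

Lemma cdiff_cexp z : cdiff cexp z.
Proof.
exists (cexp z) => e e0.
have K0 : 0 < 20 * expR 1 * expR (complex.Re z) :> R by rewrite !mulr_gt0 ?expR_gt0.
pose K := 20 * expR 1 * expR (complex.Re z); rewrite -/K in K0.
exists (Num.min 1 (e / K)); first by rewrite lt_min ltr01 divr_gt0.
move=> w; rewrite lt_min => /andP[w1 w2].
have -> : cexp w - cexp z - cexp z * (w - z) = cexp z * (cexp (w - z) - 1 - (w - z)).
  have -> : cexp w = cexp (w - z) * cexp z by rewrite -cexpD subrK.
  by ring.
rewrite modcM modc_cexp; move: (w - z) w1 w2 => u w1 w2.
have m0 := modc_ge0 u.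
apply: (@le_trans _ _ (expR (complex.Re z) * (20 * modc u ^+ 2 * expR 1))).
  rewrite ler_wpM2l ?expR_ge0// (le_trans (cexp_taylor2 _))// ler_wpM2l ?mulr_ge0 ?sqr_ge0//.
  by rewrite ler_expR ltW.
rewrite (_ : _ * _ = K * modc u * modc u); last by rewrite /K; ring.
by rewrite ler_wpM2r// mulrC -ler_pdivlMr// ltW.
Qed.

Lemma cdiff_comp (f g : R[i] -> R[i]) z : cdiff f z -> cdiff g (f z) -> cdiff (g \o f) z.
Proof.
move=> df dg; have [L [d1 d10 [L0 HL]]] := cdiff_lipschitz df.
move: df dg => [c Hc] [c' Hc']; exists (c' * c) => e e0.
have L1 : 0 < L + 1 by lra.
have K0 : 0 < modc c' + 1 by rewrite ltr_wpDl ?modc_ge0.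
have e10 : 0 < e / 2 / (modc c' + 1) by rewrite !divr_gt0.
have e20 : 0 < e / 2 / (L + 1) by rewrite !divr_gt0.
have [d2 d20 H2] := Hc _ e10; have [d3 d30 H3] := Hc' _ e20.
exists (Num.min (Num.min d1 d2) (d3 / (L + 1))); first by rewrite !lt_min d10 d20 divr_gt0.
move=> w; rewrite !lt_min => /andP[/andP[/HL w1 /H2 w2]].
rewrite ltr_pdivlMr// => w3; have m0 := modc_ge0 (w - z).
have fw : modc (f w - f z) < d3 by apply: le_lt_trans w1 _; nra.
have {}H3 := H3 _ fw.
rewrite (_ : _ - _ = (g (f w) - g (f z) - c' * (f w - f z)) + c' * (f w - f z - c * (w - z))); last by rewrite /=; ring.
apply: le_trans (modcD _ _) _.
have -> : e * modc (w - z) = e / 2 * modc (w - z) + e / 2 * modc (w - z) by field.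
apply: lerD.
  apply: le_trans H3 _; rewrite mulrAC ler_pdivrMr// -[leRHS]mulrA; apply: ler_wpM2l.
    by rewrite divr_ge0 ?(ltW e0).
  by apply: le_trans w1 _; nra.
rewrite modcM; apply: (@le_trans _ _ ((modc c' + 1) * (e / 2 / (modc c' + 1) * modc (w - z)))).
  by apply: ler_pM; rewrite ?modc_ge0// lerDl.
by rewrite le_eqVlt; apply/orP; left; apply/eqP; field; rewrite gt_eqF.
Qed.

End complex_exponential.

Section three_lines.
Context {R : realType}.
Implicit Types (g H : R[i] -> R[i]).

Definition strip_cont g (z : R[i]) : Prop := forall e : R, 0 < e -> exists2 d : R, 0 < d &
  forall w, 0 <= complex.Re w <= 1 -> modc (w - z) < d -> modc (g w - g z) <= e.

(** Differentiability holds in the open strip, so the maximum principle is applied on a slightly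
    narrower rectangle. Compactness of a vertical segment carries the bound from a boundary line to
    the nearby lines; s = 1 moves right from Re = 0 and s = -1 left from Re = 1. *)
Lemma strip_cont_uniform g (x M e T : R) (s : R) : 0 < e ->
  (forall t : R, strip_cont g (x +i* t)) -> (forall t : R, modc (g (x +i* t)) <= M) ->
  `|s| = 1 ->
  exists2 d : R, 0 < d & forall dl : R, 0 < dl < d -> 0 <= x + s * dl <= 1 ->
    forall t, - T <= t <= T -> modc (g ((x + s * dl) +i* t)) <= M + e.
Proof.
move=> e0 cg bg s1.
pose P (dl t : R) := 0 < dl -> 0 <= x + s * dl <= 1 -> modc (g ((x + s * dl) +i* t)) <= M + e.
have /compact_near_coveringP cov : compact (`[- T, T]%classic : set R) by exact: segment_compact.
have near0 (t0 : R) : `[- T, T]%classic t0 -> \forall t \near t0 & dl \near nbhs (0 : R), P dl t.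
  move=> _; have [d d0 Hd] := cg t0 e e0; have d20 : 0 < d / 2 by rewrite divr_gt0.
  exists (ball t0 (d / 2), ball (0 : R) (d / 2)); first by split; exact: nbhsx_ballx.
  move=> [t dl] [/=]; rewrite /ball /= sub0r normrN => ht hdl dl0 inx.
  rewrite -(subrK (g (x +i* t0)) (g (_ +i* t))) addrC; apply: le_trans (modcD _ _) _.
  apply: lerD => //; apply: Hd => //=.
  apply: le_lt_trans (modc_le_ReIm (_ +i* _)) _ => /=.
  rewrite addrAC subrr add0r normrM s1 mul1r distrC; lra.
have /nbhs_ballP[d /= d0 Hd] : nbhs (0 : R) [set dl | `[- T, T]%classic `<=` P dl].
  exact: cov near0.
exists d => // dl /andP[dl0 dld] inx t tT; apply: (Hd dl) => //=.
by rewrite /ball /= sub0r normrN gtr0_norm.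
Qed.

(** Multiplication by exp(ep (z^2 - theta^2)) leaves the value at theta unchanged, costs at most
    exp(ep) on the vertical sides and makes the horizontal sides of a tall rectangle negligible.
    Then ep and eta tend to 0. *)
Lemma three_lines g (B M theta : R) : 0 < theta < 1 ->
  (forall z, 0 < complex.Re z < 1 -> cdiff g z) ->
  (forall z, 0 <= complex.Re z <= 1 -> modc (g z) <= B) ->
  (forall t : R, strip_cont g (0 +i* t)) -> (forall t : R, strip_cont g (1 +i* t)) ->
  (forall t : R, modc (g (0 +i* t)) <= M) -> (forall t : R, modc (g (1 +i* t)) <= M) ->
  modc (g theta%:C) <= M.
Proof.
have half (m x : R) : 0 < m -> m <= x -> m / 2 < x by move=> ? ?; lra.
move=> /andP[th0 th1] dg gB c0 c1 g0 g1.
have M0 : 0 <= M by apply: le_trans (modc_ge0 _) (g0 0).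
have B0 : 0 <= B by apply: le_trans (modc_ge0 _) (gB 0 _); rewrite /= lexx ler01.
have main (eta ep : R) : 0 < eta -> 0 < ep -> modc (g theta%:C) <= (M + eta) * expR ep.
  move=> eta0 ep0.
  (* With this height B <= eta ep T^2, so that the a priori bound B, damped by exp(-ep T^2), falls
     below M + eta on the horizontal sides. *)
  pose T := Num.sqrt (B / (eta * ep)) + 1.
  have T0 : 0 < T by rewrite ltr_wpDl ?sqrtr_ge0.
  have TB : B * expR (- (ep * T ^+ 2)) <= M + eta.
    have h1 : B <= eta * ep * T ^+ 2.
      rewrite mulrC -ler_pdivrMr ?mulr_gt0// -[leLHS]sqr_sqrtr ?divr_ge0 ?mulr_ge0 ?(ltW eta0) ?(ltW ep0)//.
      by rewrite lerXn2r ?nnegrE ?sqrtr_ge0 ?(ltW T0)// lerDl.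
    rewrite expRN ler_pdivrMr ?expR_gt0//; apply: le_trans h1 _.
    have := expR_ge1Dx (ep * T ^+ 2).
    have : 0 <= ep * T ^+ 2 by rewrite mulr_ge0 ?sqr_ge0 ?ltW.
    rewrite -mulrA; move: (ep * T ^+ 2) => u u0; move: (expR u) => E h.
    have : 0 <= (M + eta) * (E - u) by rewrite mulr_ge0//; lra.
    by rewrite mulrBr mulrDl; nra.
  have [d1 d10 H1] := @strip_cont_uniform g 0 M eta T 1 eta0 c0 g0 (normr1 R).
  have [d2 d20 H2] := @strip_cont_uniform g 1 M eta T (-1) eta0 c1 g1 (normrN1 R).
  have [dl [dl0 dld1 dld2 dth dth1]] : exists dl, [/\ 0 < dl, dl < d1, dl < d2, dl < theta & dl < 1 - theta].
    exists (Num.min (Num.min d1 d2) (Num.min theta (1 - theta)) / 2).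
    have m0 : 0 < Num.min (Num.min d1 d2) (Num.min theta (1 - theta)).
      by rewrite !lt_min d10 d20 th0 subr_gt0.
    have le1 : Num.min (Num.min d1 d2) (Num.min theta (1 - theta)) <= d1 by rewrite !ge_min lexx.
    have le2 : Num.min (Num.min d1 d2) (Num.min theta (1 - theta)) <= d2 by rewrite !ge_min lexx !orbT.
    have le3 : Num.min (Num.min d1 d2) (Num.min theta (1 - theta)) <= theta by rewrite !ge_min lexx !orbT.
    have le4 : Num.min (Num.min d1 d2) (Num.min theta (1 - theta)) <= 1 - theta.
      by rewrite !ge_min lexx !orbT.
    by split; rewrite ?divr_gt0//; exact: half.
  pose G z := g z * cexp (ep%:C * (z * z - theta%:C * theta%:C)).
  have Gm z : modc (G z) = modc (g z) * expR (ep * (complex.Re z ^+ 2 - complex.Im z ^+ 2 - theta ^+ 2)).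
    rewrite /G modcM modc_cexp; congr (_ * expR _); case: z => x y /=; ring.
  have -> : modc (g theta%:C) = modc (G theta%:C).
    by rewrite Gm /= expr0n subr0 subrr mulr0 expR0 mulr1.
  have Mep0 : 0 <= (M + eta) by rewrite addr_ge0// ltW.
  have side (u v : R) : 0 <= u <= 1 -> - T <= v <= T -> modc (g (u +i* v)) <= M + eta ->
      modc (G (u +i* v)) <= (M + eta) * expR ep.
    move=> /andP[u0 u1] _ h; rewrite Gm /=; apply: ler_pM; rewrite ?modc_ge0 ?expR_ge0//.
    rewrite ler_expR; have h1 : u ^+ 2 <= 1 by rewrite exprn_ile1.
    have h2 := sqr_ge0 v; have h3 := sqr_ge0 theta.
    by rewrite -[leRHS]mulr1 ler_wpM2l ?(ltW ep0)//; lra.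
  apply: (@max_principle R G dl (1 - dl) T) => //=; first by lra.
    move=> u uu _; apply: cdiffM; first by apply: dg; lra.
    have -> : (fun z => cexp (ep%:C * (z * z - theta%:C * theta%:C))) =
        cexp \o (fun z => cst ep%:C z * (id z * id z + cst (- (theta%:C * theta%:C)) z)) by [].
    apply: cdiff_comp; last exact: cdiff_cexp.
    apply: cdiffM; first exact: cdiff_cst.
    by apply: cdiffD; [apply: cdiffM; exact: cdiff_id|exact: cdiff_cst].
  move=> [u v] /= uu; rewrite subr0 => vv [E|E|E].
  - apply: side; [lra|by rewrite -ler_norml|].
    have := H1 dl _ _ v; rewrite add0r mul1r -E; apply; rewrite -?ler_norml// E; first by rewrite dl0.
    lra.
  - apply: side; [lra|by rewrite -ler_norml|].
    have := H2 dl _ _ v; rewrite mulN1r -E; apply; rewrite -?ler_norml//; first by rewrite dl0.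
    lra.
  - rewrite Gm /=.
    have e1 : expR (ep * (u ^+ 2 - v ^+ 2 - theta ^+ 2)) <= expR ep * expR (- (ep * T ^+ 2)).
      rewrite -expRD ler_expR -E real_normK ?num_real//.
      have h1 : u ^+ 2 <= 1 by rewrite exprn_ile1//; lra.
      have h3 := sqr_ge0 theta.
      have : 0 <= ep * (1 - u ^+ 2 + theta ^+ 2) by rewrite mulr_ge0 ?(ltW ep0)//; lra.
      rewrite !mulrDr !mulrN mulr1; move: (ep * u ^+ 2) (ep * v ^+ 2) (ep * theta ^+ 2) => *; lra.
    have gb : modc (g (u +i* v)) <= B by apply: gB => /=; lra.
    apply: le_trans (ler_pM (modc_ge0 _) (expR_ge0 _) gb e1) _.
    by rewrite mulrCA mulrC ler_wpM2r ?expR_ge0.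
have lim (eta : R) : 0 < eta -> modc (g theta%:C) <= (M + eta) * (1 + eta).
  move=> eta0; have [ep ep0 epe] : exists2 ep : R, 0 < ep & expR ep <= 1 + eta.
    exists (ln (1 + eta)); first by rewrite ln_gt0// ltrDl.
    by rewrite lnK// posrE addr_gt0.
  apply: le_trans (main eta ep eta0 ep0) _.
  by apply: ler_wpM2l => //; rewrite addr_ge0// ltW.
apply/ler_addgt0Pr => e e0.
pose eta := Num.min 1 (e / (M + 2)).
have M2 : 0 < M + 2 by rewrite ltr_wpDl.
have eta0 : 0 < eta by rewrite lt_min ltr01 divr_gt0.
have eta1 : eta <= 1 by rewrite ge_min lexx.
have eta2 : eta * (M + 2) <= e by rewrite -ler_pdivlMr// ge_min lexx orbT.
apply: le_trans (lim eta eta0) _; nra.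
Qed.

End three_lines.

Local Close Scope complex_scope.

Lemma measurable_fun_powR {d} {T : measurableType d} {R : realType} (f : T -> R) (p : R) :
  measurable_fun setT f -> measurable_fun setT (fun x => f x `^ p).
Proof. by move=> mf; exact: (measurableT_comp (measurable_powR p) mf). Qed.

(** * Weighted inequalities in tent spaces *)

Section powers.
Context {R : realType}.
Implicit Types x y p e k r : R.

Lemma powR_add_le x y p : 0 <= x -> 0 <= y -> 0 <= p ->
  (x + y) `^ p <= 2 `^ p * (x `^ p + y `^ p).
Proof.
move=> x0 y0 p0; wlog xy : x y x0 y0 / x <= y.
  by move=> H; have [/H|/ltW/H] := leP x y; [|rewrite addrC [_ + y `^ p]addrC]; exact.
apply: (@le_trans _ _ ((2 * y) `^ p)).
  by rewrite ge0_ler_powR// ?nnegrE ?addr_ge0 ?mulr_ge0//; lra.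
by rewrite powRM// ler_wpM2l ?powR_ge0// lerDr powR_ge0.
Qed.

Lemma powR_mix_le x y k : 0 <= x -> 0 <= y -> 0 <= k <= 1 ->
  x `^ k * y `^ (1 - k) <= x + y.
Proof.
move=> x0 y0 /andP[k0 k1].
have [z0|z0] := eqVneq (Num.max x y) 0.
  have x00 : x = 0 by apply/eqP; rewrite eq_le x0 andbT -z0 le_max lexx.
  have y00 : y = 0 by apply/eqP; rewrite eq_le y0 andbT -z0 le_max lexx orbT.
  rewrite x00 y00 addr0; have [->|kn] := eqVneq k 0; first by rewrite subr0 powRr1 // mulr0.
  by rewrite powR0// mul0r.
have m0 : 0 <= Num.max x y by rewrite le_max x0.
apply: (@le_trans _ _ (Num.max x y)); last first.
  by rewrite ge_max lerDl y0 lerDr.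
apply: (@le_trans _ _ (Num.max x y `^ k * Num.max x y `^ (1 - k))).
  apply: ler_pM; rewrite ?powR_ge0// ge0_ler_powR ?nnegrE ?subr_ge0// le_max lexx//.
  by rewrite orbT.
rewrite -powRD; last by apply/implyP.
by rewrite (_ : k + (1 - k) = 1) ?powRr1//; ring.
Qed.

Lemma powR_le1D x e r : 0 <= x -> 0 <= e -> e <= r -> x `^ e <= 1 + x `^ r.
Proof.
move=> x0 e0 er; have [x1|x1] := leP x 1.
  rewrite (le_trans (y := 1)) ?lerDl ?powR_ge0//.
  have <- : 1 `^ e = 1 :> R by rewrite powR1.
  by rewrite ge0_ler_powR ?nnegrE.
by rewrite (le_trans (y := x `^ r)) ?lerDr// ler_powR// ltW.
Qed.

(** Young's inequality with a prescribed first constant: a small C lets the first term be absorbed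
    in [weighted_area_lt0_gt1]. *)
Lemma young_scaled (k : R) (C : R) : 1 < k -> 0 < C -> exists2 D : R, 0 <= D &
  forall x y, 0 <= x -> 0 <= y -> x * y <= C * x `^ (k / (k - 1)) + D * y `^ k.
Proof.
move=> k1 C0; pose k' := k / (k - 1).
have k0 : 0 < k by lra.
have k'0 : 0 < k' by rewrite divr_gt0// subr_gt0.
have kk : k'^-1 + k^-1 = 1 by rewrite /k' invf_div; field; lra.
pose e := C `^ k'^-1; have e0 : 0 < e by rewrite powR_gt0.
exists (e^-1 `^ k); first exact: powR_ge0.
move=> x y x0 y0.
have eV0 : 0 <= e^-1 by rewrite invr_ge0 ltW.
have := conjugate_powR (mulr_ge0 (ltW e0) x0) (mulr_ge0 eV0 y0) k'0 k0 kk.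
rewrite mulrACA divff ?gt_eqF// mul1r => /le_trans; apply.
rewrite !powRM ?(ltW e0)// /e -powRrM mulVf ?gt_eqF// powRr1 ?(ltW C0)//.
apply: lerD.
  rewrite ler_pdivrMr// ler_peMr ?mulr_ge0 ?powR_ge0 ?(ltW C0)//.
  by rewrite /k' ler_pdivlMr ?subr_gt0//; lra.
by rewrite ler_pdivrMr// ler_peMr ?mulr_ge0 ?powR_ge0// ltW.
Qed.

(** Either x^r >= 2 and the first term suffices, or x <= 2^{1/r} and the second does. If x^r has
    average 1, averaging absorbs one half and bounds the average of x^{-e} below. *)
Lemma powR_dual_ge1 x e r : 0 < x -> 0 <= e -> 0 < r ->
  1 <= 2^-1 * x `^ r + 2 `^ (e / r) * x `^ (- e).
Proof.
move=> x0 e0 r0; have [h|h] := leP 2 (x `^ r).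
  rewrite (le_trans (y := 2^-1 * x `^ r)) ?lerDl ?mulr_ge0 ?powR_ge0//.
  by rewrite mulrC ler_pdivlMr// mul1r.
rewrite (le_trans (y := 2 `^ (e / r) * x `^ (- e))) ?lerDr ?mulr_ge0 ?powR_ge0//.
rewrite powRN -[leLHS](@divff _ (x `^ e)) ?gt_eqF ?powR_gt0//.
rewrite ler_wpM2r ?invr_ge0 ?powR_ge0//.
rewrite (_ : x `^ e = (x `^ r) `^ (e / r)).
  by rewrite ge0_ler_powR ?nnegrE ?powR_ge0 ?divr_ge0 ?(ltW r0) ?(ltW h).
by rewrite -powRrM mulrC divfK// gt_eqF.
Qed.

Lemma powR_div x y e : 0 < x -> 0 < y -> (x / y) `^ e = x `^ e / y `^ e.
Proof.
move=> x0 y0; rewrite powRM ?invr_ge0 ?ltW// -(powR_inv1 (ltW y0)) -powRrM mulN1r.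
by rewrite powRN.
Qed.

Lemma powR_combr x y a b r :
  (x `^ a * y `^ b) `^ r = x `^ (a * r) * y `^ (b * r).
Proof. by rewrite powRM ?powR_ge0// -!powRrM. Qed.

Lemma powRgtD x r e : 0 < x -> x `^ (r + e) = x `^ r * x `^ e.
Proof. by move=> x0; rewrite powRD// (gt_eqF x0) implybT. Qed.

End powers.

(** * Cone integrals, averages over balls and their adjointness *)

Section tent_kernel.
Context {d : measure_display} {R : realType} {X : borelMetricType d R}.
Variable mu : {sigma_finite_measure set X -> \bar R}.
Hypothesis mu_ball : forall (x : X) (r : R), 0 < r -> (0 < vol mu x r < +oo)%E.
Hypothesis mu_doubling : doubling mu.
Variable o : X.
Variable alpha : R.
Hypothesis alpha_gt0 : 0 < alpha.

Implicit Types (x : X) (z : X * R) (h : X -> R) (g : X * R -> R).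
Local Notation lebR := (@lebesgue_measure R : set (measurableTypeR R) -> \bar R).

Lemma sigma_finite_product : sigma_finite setT (mu \x lebR)%E.
Proof.
have /sigma_finiteP[F [FT Fnd Ffin]] := sigma_finiteT lebR.
exists (fun n => ball o n.+1%:R `*` F n).
  apply/esym; rewrite -subTset => -[x t] _.
  have : setT t by []; rewrite FT => -[n _ Fn].
  pose m := maxn n (Num.truncn (mdist o x)); exists m => //; split => /=.
    apply/in_ball; rewrite (lt_le_trans (truncnS_gt _))// ler_nat ltnS.
    exact: leq_maxr.
  by move: t Fn; exact/subsetPset/Fnd/leq_maxl.
move=> n; have [mF Fn] := Ffin n; split.
  by apply: measurableX => //; exact: measurable_ball_borel.
have /andP[_ Bn] := mu_ball o (ltr0Sn R n).
rewrite product_measure1E//; last exact: measurable_ball_borel.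
by rewrite lte_mul_pinfty// ge0_fin_numE.
Qed.

Definition upper_measure : {sigma_finite_measure set (X * measurableTypeR R)%type -> \bar R} :=
  HB.pack (mu \x lebR)%E (Measure_isSigmaFinite.Build _ _ _ (mu \x lebR)%E sigma_finite_product).
Local Notation lam := upper_measure.

(** The density 1 / t of dt / t, cut off to t > 0, so that all integrals run over the whole product
    with the measure [lam]. *)
Definition dt_weight (z : X * R) : R := z.2 `^ (-1) * \1_(upper : set (X * R)) z.
Local Notation W := dt_weight.

Definition cone_ind (x : X) (z : X * R) : R := \1_(cone alpha x) z.

(** The volume of B(y, alpha t) for t > 0, written as an integral in order that Tonelli's theorem
    gives its measurability in (y, t). *)
Definition cone_vol (z : X * R) : R := fine (\int[mu]_x (cone_ind x z)%:E)%E.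

Definition cone_ker (x : X) (z : X * R) : R := cone_ind x z * cone_vol z `^ (-1).

(* The average of h over B(y, alpha t), z = (y, t); [cavg] and [cone_int] are adjoint. *)
Definition cavg (h : X -> R) (z : X * R) : \bar R := (\int[mu]_x (h x * cone_ker x z)%:E)%E.

Definition cone_int (g : X * R -> R) (x : X) : \bar R :=
  (\int[lam]_z (g z * cone_ker x z * W z)%:E)%E.

Lemma dt_weight_ge0 z : 0 <= W z.
Proof. by rewrite mulr_ge0 ?powR_ge0. Qed.

Lemma dt_weightE z : 0 < z.2 -> W z = z.2^-1.
Proof. by move=> z0; rewrite /W indicE mem_set// mulr1 powR_inv1// ltW. Qed.

Lemma dt_weight_out z : ~ 0 < z.2 -> W z = 0.
Proof. by move=> z0; rewrite /W indicE memNset// mulr0. Qed.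

Lemma measurable_dt_weight : measurable_fun setT W.
Proof.
apply: measurable_funM; last by apply: measurable_indic; exact: measurable_upper_set.
apply: (@measurable_fun_powR _ (X * R)%type R (fun z : X * R => z.2)).
exact: measurable_snd.
Qed.

Lemma cone_indE x z : 0 < z.2 -> cone_ind x z = \1_(ball z.1 (alpha * z.2)) x.
Proof.
move=> z0; rewrite /cone_ind !indicE; congr (_%:R); congr nat_of_bool.
apply/idP/idP; rewrite !inE.
  by move=> [_ xz]; apply/in_ball; rewrite metric_sym.
by move=> /in_ball zx; split => //=; rewrite metric_sym.
Qed.

Lemma cone_ind_out x z : ~ 0 < z.2 -> cone_ind x z = 0.
Proof. by move=> z0; rewrite /cone_ind indicE memNset// => -[]. Qed.

Lemma cone_ind_in x z : cone alpha x z -> cone_ind x z = 1.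
Proof. by move=> h; rewrite /cone_ind indicE mem_set. Qed.

Lemma cone_ind_ge0 x z : 0 <= cone_ind x z.
Proof. by rewrite /cone_ind. Qed.

Lemma measurable_cone_ind2 : measurable_fun setT (fun xz : X * (X * R) => cone_ind xz.1 xz.2).
Proof.
rewrite (_ : (fun _ => _) = \1_[set xz : X * (X * R) | cone alpha xz.1 xz.2]).
  by apply: measurable_indic; apply: (measurable_cone_graph mu_ball o).
by apply/funext => -[x z].
Qed.

Lemma cone_volE z : 0 < z.2 -> cone_vol z = fine (vol mu z.1 (alpha * z.2)).
Proof.
move=> z0; rewrite /cone_vol; under eq_integral do rewrite cone_indE//.
by rewrite integral_indic// ?setIT//; exact: measurable_ball_borel.
Qed.

Lemma cone_vol_gt0 z : 0 < z.2 -> 0 < cone_vol z.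
Proof. by move=> z0; rewrite cone_volE// fine_vol_gt0// mulr_gt0. Qed.

Lemma measurable_cone_vol : measurable_fun setT cone_vol.
Proof.
apply: measurableT_comp; first exact: fine_measurable.
apply: (measurable_fun_fubini_tonelli_G (m1 := mu) (fun xz : X * (X * R) => (cone_ind xz.1 xz.2)%:E)).
  apply/measurable_EFinP; exact: measurable_cone_ind2.
by move=> xz; rewrite lee_fin cone_ind_ge0.
Qed.

Lemma cone_ker_ge0 x z : 0 <= cone_ker x z.
Proof. by rewrite mulr_ge0 ?powR_ge0 ?cone_ind_ge0. Qed.

Lemma measurable_cone_ker2 : measurable_fun setT (fun xz : X * (X * R) => cone_ker xz.1 xz.2).
Proof.
apply: measurable_funM; first exact: measurable_cone_ind2.
apply: measurable_fun_powR.
by apply: measurableT_comp => //; exact: measurable_cone_vol.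
Qed.

Lemma measurable_cone_kerl z : measurable_fun setT (cone_ker ^~ z).
Proof. exact: measurableT_comp measurable_cone_ker2 (pair2_measurable z). Qed.

Lemma measurable_cone_kerr x : measurable_fun setT (cone_ker x).
Proof. exact: measurableT_comp measurable_cone_ker2 (pair1_measurable x). Qed.

Lemma cone_ker_out x z : ~ 0 < z.2 -> cone_ker x z = 0.
Proof. by move=> z0; rewrite /cone_ker cone_ind_out// mul0r. Qed.

Lemma cavg_out h z : ~ 0 < z.2 -> cavg h z = 0.
Proof.
by move=> z0; apply: integral0_eq => x _; rewrite cone_ker_out// mulr0.
Qed.

Lemma cavg_ge0 h z : (forall x, 0 <= h x) -> (0 <= cavg h z)%E.
Proof. by move=> h0; apply: integral_ge0 => x _; rewrite lee_fin mulr_ge0// cone_ker_ge0. Qed.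

Lemma measurable_cavg h : (forall x, 0 <= h x) -> measurable_fun setT h ->
  measurable_fun setT (cavg h).
Proof.
move=> h0 mh.
apply: (measurable_fun_fubini_tonelli_G (m1 := mu) (fun xz : X * (X * R) => (h xz.1 * cone_ker xz.1 xz.2)%:E)).
  apply/measurable_EFinP; apply: measurable_funM; last exact: measurable_cone_ker2.
  exact: measurableT_comp.
by move=> xz; rewrite lee_fin mulr_ge0// cone_ker_ge0.
Qed.

Lemma cone_integrand_ge0 g x z : 0 <= g z -> 0 <= g z * cone_ker x z * W z.
Proof. by move=> g0; rewrite mulr_ge0 ?dt_weight_ge0// mulr_ge0// cone_ker_ge0. Qed.

Lemma cone_int_ge0 g x : (forall z, 0 <= g z) -> (0 <= cone_int g x)%E.
Proof. by move=> g0; apply: integral_ge0 => z _; rewrite lee_fin cone_integrand_ge0. Qed.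

Lemma measurable_cone_integrand g x : measurable_fun setT g ->
  measurable_fun setT (fun z => (g z * cone_ker x z * W z)%:E).
Proof.
move=> mg; apply/measurable_EFinP; apply: measurable_funM; last exact: measurable_dt_weight.
by apply: measurable_funM => //; exact: measurable_cone_kerr.
Qed.

Lemma measurable_cone_int g : (forall z, 0 <= g z) -> measurable_fun setT g ->
  measurable_fun setT (cone_int g).
Proof.
move=> g0 mg.
pose F (xz : X * (X * R)) := (g xz.2 * cone_ker xz.1 xz.2 * W xz.2)%:E.
have mF : measurable_fun setT F; last first.
  have F0 xz : (0 <= F xz)%E by rewrite lee_fin cone_integrand_ge0.
  exact: (measurable_fun_fubini_tonelli_F (m2 := lam) F mF F0).
  apply/measurable_EFinP; apply: measurable_funM.
    by apply: measurable_funM; [exact: measurableT_comp|exact: measurable_cone_ker2].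
  by apply: measurableT_comp => //; exact: measurable_dt_weight.
Qed.

Lemma cone_fubini (h : X -> R) (g : X * R -> R) :
  (forall x, 0 <= h x) -> measurable_fun setT h ->
  (forall z, 0 <= g z) -> measurable_fun setT g ->
  (\int[mu]_x ((h x)%:E * cone_int g x) = \int[lam]_z ((g z * W z)%:E * cavg h z))%E.
Proof.
move=> h0 mh g0 mg.
pose F (xz : X * (X * R)) := (h xz.1 * (g xz.2 * cone_ker xz.1 xz.2 * W xz.2))%:E.
have mF : measurable_fun setT F.
  apply/measurable_EFinP; apply: measurable_funM; first exact: measurableT_comp.
  apply: measurable_funM.
    by apply: measurable_funM; [exact: measurableT_comp|exact: measurable_cone_ker2].
  by apply: measurableT_comp => //; exact: measurable_dt_weight.
have F0 xz : (0 <= F xz)%E.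
  by rewrite lee_fin mulr_ge0// cone_integrand_ge0.
transitivity (\int[mu]_x \int[lam]_z F (x, z))%E.
  apply: eq_integral => x _; rewrite -ge0_integralZlT//.
  - by move=> z; rewrite lee_fin cone_integrand_ge0.
  - exact: measurable_cone_integrand.
rewrite (fubini_tonelli (m1 := mu) (m2 := lam) F mF F0).
apply: eq_integral => z _; rewrite -ge0_integralZlT.
- by apply: eq_integral => x _; rewrite /F /= -EFinM; congr EFin; ring.
- by rewrite mulr_ge0 ?dt_weight_ge0.
- by move=> x; rewrite lee_fin mulr_ge0// cone_ker_ge0.
- by apply/measurable_EFinP; apply: measurable_funM => //; exact: measurable_cone_kerl.
Qed.

Lemma cavg1 z : 0 < z.2 -> cavg (cst 1) z = 1%E.
Proof.
move=> z0; rewrite /cavg /cone_ker.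
under eq_integral do rewrite mul1r mulrC EFinM.
rewrite ge0_integralZlT ?powR_ge0//; last 2 first.
- by move=> x; rewrite lee_fin cone_ind_ge0.
- apply/measurable_EFinP.
  exact: (measurableT_comp measurable_cone_ind2 (pair2_measurable z)).
have v0 := cone_vol_gt0 z0.
rewrite -[(\int[mu]_x _)%E]fineK.
  by rewrite -/(cone_vol z) powR_inv1 ?ltW// -EFinM mulVf// gt_eqF.
under eq_integral do rewrite cone_indE//.
rewrite integral_indic// ?setIT//; last exact: measurable_ball_borel.
by rewrite vol_fin// mulr_gt0.
Qed.

Lemma cavgZ (h : X -> R) (c : R) z : 0 <= c -> (forall x, 0 <= h x) -> measurable_fun setT h ->
  cavg (fun x => c * h x) z = (c%:E * cavg h z)%E.
Proof.
move=> c0 h0 mh; rewrite -ge0_integralZlT//.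
- by apply: eq_integral => x _; rewrite -EFinM -mulrA.
- by move=> x; rewrite lee_fin mulr_ge0// cone_ker_ge0.
- by apply/measurable_EFinP; apply: measurable_funM => //; exact: measurable_cone_kerl.
Qed.

Lemma cavgD (h h' : X -> R) z : (forall x, 0 <= h x) -> (forall x, 0 <= h' x) ->
  measurable_fun setT h -> measurable_fun setT h' ->
  cavg (fun x => h x + h' x) z = (cavg h z + cavg h' z)%E.
Proof.
move=> h0 h0' mh mh'; rewrite -ge0_integralDT//.
- by apply: eq_integral => x _; rewrite mulrDl EFinD.
- by move=> x; rewrite lee_fin mulr_ge0// cone_ker_ge0.
- by move=> x; rewrite lee_fin mulr_ge0// cone_ker_ge0.
- by apply/measurable_EFinP; apply: measurable_funM => //; exact: measurable_cone_kerl.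
- by apply/measurable_EFinP; apply: measurable_funM => //; exact: measurable_cone_kerl.
Qed.

Lemma cavg_cst (c : R) z : 0 <= c -> 0 < z.2 -> cavg (cst c) z = c%:E.
Proof.
move=> c0 z0; rewrite (_ : cst c = fun x => c * cst 1 x).
  by rewrite cavgZ// cavg1// mule1.
by apply/funext => x; rewrite mulr1.
Qed.

Lemma le_cavg (h h' : X -> R) z : (forall x, 0 <= h x) -> measurable_fun setT h ->
  measurable_fun setT h' -> (forall x, cone alpha x z -> h x <= h' x) ->
  (cavg h z <= cavg h' z)%E.
Proof.
move=> h0 mh mh' hh'; apply: ge0_le_integralT.
- by move=> x; rewrite lee_fin mulr_ge0// cone_ker_ge0.
- by apply/measurable_EFinP; apply: measurable_funM => //; exact: measurable_cone_kerl.
- by apply/measurable_EFinP; apply: measurable_funM => //; exact: measurable_cone_kerl.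
- move=> x; rewrite lee_fin /cone_ker /cone_ind indicE.
  case: (boolP (z \in _)) => [|_]; last by rewrite mul0r !mulr0.
  by rewrite inE => /hh' ?; rewrite ler_wpM2r// mulr_ge0 ?powR_ge0.
Qed.

Lemma ae_le_cavg (h h' : X -> R) z : (forall x, 0 <= h x) -> (forall x, 0 <= h' x) ->
  measurable_fun setT h -> measurable_fun setT h' ->
  {ae mu, forall x, cone alpha x z -> h x <= h' x} -> (cavg h z <= cavg h' z)%E.
Proof.
move=> h0 h0' mh mh' hh'; apply: ae_le_integralT.
- by move=> x; rewrite lee_fin mulr_ge0// cone_ker_ge0.
- by move=> x; rewrite lee_fin mulr_ge0// cone_ker_ge0.
- by apply/measurable_EFinP; apply: measurable_funM => //; exact: measurable_cone_kerl.
- by apply/measurable_EFinP; apply: measurable_funM => //; exact: measurable_cone_kerl.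
- apply: filterS hh' => x hx; rewrite lee_fin /cone_ker /cone_ind indicE.
  case: (boolP (z \in _)) => [|_]; last by rewrite mul0r !mulr0.
  by rewrite inE => /hx ?; rewrite ler_wpM2r// mulr_ge0 ?powR_ge0.
Qed.

Lemma tent_ballP (B : set X) z : tent alpha B z <-> (0 < z.2 /\ forall x, cone alpha x z -> B x).
Proof.
split => [[z0 nz]|[z0 nz]]; split => //.
  by move=> x xz; apply: contrapT => nB; apply: nz; exists x.
by move=> [x nB xz]; apply: nB; exact: nz.
Qed.

Lemma upper_integral_cone_int g : (forall z, 0 <= g z) -> measurable_fun setT g ->
  (\int[lam]_z (g z * W z)%:E = \int[mu]_x cone_int g x)%E.
Proof.
move=> g0 mg; have := cone_fubini (h := cst 1) (g := g) (fun _ => ler01) (measurable_cst _) g0 mg.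
under eq_integral do rewrite mul1e.
move=> ->; apply: eq_integral => z _.
have [z0|z0] := pselect (0 < z.2); first by rewrite cavg1// mule1.
by rewrite dt_weight_out// mulr0 mul0e.
Qed.

Lemma coneP x z : cone alpha x z <-> 0 < z.2 /\ ball z.1 (alpha * z.2) x.
Proof.
split=> [[z0 /= xz]|[z0 /in_ball xz]]; split => //=; last by rewrite metric_sym.
by apply/in_ball; rewrite metric_sym.
Qed.

Lemma cavgE h z : (forall x, 0 <= h x) -> measurable_fun setT h -> 0 < z.2 ->
  cavg h z = ((cone_vol z)^-1%:E * \int[mu]_(x in ball z.1 (alpha * z.2)%R) (h x)%:E)%E.
Proof.
move=> h0 mh z0; have v0 := cone_vol_gt0 z0.
rewrite ge0_integral_indic; last 2 first.
- exact: measurable_ball_borel.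
- by move=> x; rewrite lee_fin.
rewrite -ge0_integralZlT.
- apply: eq_integral => x _; rewrite -!EFinM /cone_ker cone_indE// powR_inv1 ?ltW//.
  by congr EFin; ring.
- by rewrite invr_ge0 ltW.
- by move=> x; rewrite mule_ge0 ?lee_fin.
- apply: emeasurable_funM; apply/measurable_EFinP => //.
  by apply: measurable_indic; exact: measurable_ball_borel.
Qed.

Lemma cavg_le_mean (c : nat -> X) (r : nat -> R) (C : R) h z n :
  (forall n, 0 < r n) -> 0 < C -> (forall x, 0 <= h x) -> measurable_fun setT h -> 0 < z.2 ->
  ball z.1 (alpha * z.2) `<=` ball (c n) (r n) ->
  (vol mu (c n) (r n) <= C%:E * vol mu z.1 (alpha * z.2)%R)%E ->
  (cavg h z <= C%:E * mean mu c r h n)%E.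
Proof.
move=> r0 C0 h0 mh z0 sub le; rewrite cavgE// /mean.
have az0 : 0 < alpha * z.2 by rewrite mulr_gt0.
have v0 := cone_vol_gt0 z0; have V0 := fine_vol_gt0 mu_ball (c n) (r0 n).
rewrite muleA -EFinM; apply: (@le_trans _ _ ((cone_vol z)^-1%:E * \int[mu]_(x in ball (c n) (r n)) (h x)%:E)%E).
  rewrite lee_wpmul2l ?lee_fin ?invr_ge0 ?(ltW v0)//.
  apply: ge0_subset_integral => //; try exact: measurable_ball_borel.
  - by apply: measurable_funTS; exact/measurable_EFinP.
  - by move=> x _; rewrite lee_fin.
rewrite lee_wpmul2r//; first by apply: integral_ge0 => x _; rewrite lee_fin.
rewrite lee_fin ler_pdivlMr// mulrC ler_pdivrMr//.
by rewrite -lee_fin EFinM cone_volE// !fineK// vol_fin.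
Qed.

(** The strong-type bound with [tau] the identity, in the form used later: at almost every x, g
    controls the averages attached to all points of the cone at x. The function g is a multiple of
    the maximal function, made finite by changing it on a null set. *)
Lemma maximal_bound (k : R) : 1 < k -> exists2 C : R, 0 <= C &
  forall h, (forall x, 0 <= h x) -> measurable_fun setT h ->
  (\int[mu]_x (h x `^ k)%:E < +oo)%E ->
  exists g : X -> R, [/\ forall x, 0 <= g x, measurable_fun setT g,
    {ae mu, forall x, forall z, cone alpha x z -> (cavg h z <= (g x)%:E)%E} &
    (\int[mu]_x (g x `^ k)%:E <= C%:E * \int[mu]_x (h x `^ k)%:E)%E].
Proof.
move=> k1; have k0 : 0 < k by lra.
have [c [r [C [C0 r0 fam]]]] := countable_ball_family mu_ball o mu_doubling.
have [C3 C30 vol3] := doubling_scale mu_doubling 3.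
pose D := 2 `^ k * C3 * 1 * (k / (k - 1)).
have D0 : 0 <= D.
  by rewrite /D !mulr_ge0 ?powR_ge0 ?(ltW C30) ?(ltW k0)// invr_ge0 subr_ge0 ltW.
exists (C `^ k * D); first by rewrite mulr_ge0 ?powR_ge0.
move=> h h0 mh hoo.
pose M := maxmean mu c r (fun B : set X => B) h.
have M0 x : (0 <= M x)%E by exact: maxmean_ge0.
have mM : measurable_fun setT M.
  by apply: measurable_maxmean => x s; exact: measurable_ball_borel.
have strong : (\int[mu]_x (M x `^ k) <= D%:E * \int[mu]_x (h x `^ k)%:E)%E.
  have := @maxmean_strong _ _ _ mu mu_ball c r r0 C3 C30 vol3 _ _ mu (cst 1) _ _ (fun B => B) _ _ 1 ler01 _ h k h0 mh k1.
  under eq_integral do rewrite mul1e; apply => //.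
  - by move=> x s; exact: measurable_ball_borel.
  - by move=> x s s0; rewrite [leLHS](integral_cst mu (measurable_ball_borel x s) 1%:E) mul1e.
have mMk : measurable_fun setT (fun x => M x `^ k)%E.
  exact: (measurableT_comp (measurable_poweR k) mM).
have Mfin : {ae mu, forall x, M x \is a fin_num}.
  have : mu.-integrable setT (fun x => M x `^ k)%E.
    apply/integrableP; split => //.
    under eq_integral do rewrite gee0_abs ?poweR_ge0//.
    apply: le_lt_trans strong _; move: hoo.
    have : (0 <= \int[mu]_x (h x `^ k)%:E)%E by apply: integral_ge0 => x _; rewrite lee_fin powR_ge0.
    by case: (\int[mu]_x _)%E => // v _ _; rewrite -EFinM ltry.
  move=> /(integrable_ae measurableT); apply: filterS => x /(_ I) fx.
  rewrite ge0_fin_numE//; apply: (@lty_poweRy _ _ k); first by rewrite gt_eqF.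
  by rewrite -ge0_fin_numE// poweR_ge0.
exists (fun x => C * fine (M x)); split.
- by move=> x; rewrite mulr_ge0 ?(ltW C0)// fine_ge0.
- by apply: measurable_funM => //; apply: measurableT_comp => //; exact: fine_measurable.
- apply: filterS Mfin => x fx z xz; have [z0 zx] := (coneP x z).1 xz.
  have [n [sub le]] := fam z.1 _ (mulr_gt0 alpha_gt0 z0).
  apply: le_trans (cavg_le_mean r0 C0 h0 mh z0 sub le) _.
  rewrite EFinM fineK// lee_wpmul2l ?lee_fin ?(ltW C0)//.
  apply: ereal_sup_ubound; exists n => //; rewrite indicE mem_set ?mule1//.
  exact: sub.
- rewrite EFinM -muleA; apply: le_trans (lee_wpmul2l _ strong); rewrite ?lee_fin ?powR_ge0//.
  rewrite -ge0_integralZlT//; last 2 first.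
  + by rewrite powR_ge0.
  + by move=> x; rewrite poweR_ge0.
  apply: ge0_le_integralT.
  + by move=> x; rewrite lee_fin powR_ge0.
  + apply/measurable_EFinP; apply: measurable_fun_powR.
    by apply: measurable_funM => //; apply: measurableT_comp => //; exact: fine_measurable.
  + by apply: emeasurable_funM => //.
  + move=> x; rewrite powRM ?(ltW C0) ?fine_ge0// EFinM lee_wpmul2l ?lee_fin ?powR_ge0//.
    move: (M0 x); case: (M x) => [v|_|]//=.
    by rewrite gt_eqF// powR0 ?gt_eqF// leey.
Qed.

(** The strong-type bound with [tau] the tent. A ball of the countable family containing B(y, alpha
    t) has (y, t) in its tent, so [maxmean] dominates the averages up to a constant. *)
Lemma carleson_embedding (k : R) : 1 < k -> exists2 C : R, 0 <= C &
  forall (w : X * R -> R) (K : R), (forall z, 0 <= w z) -> measurable_fun setT w -> 0 <= K ->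
  (forall x (s : R), 0 < s ->
    (\int[lam]_(z in tent alpha (ball x s)) (w z)%:E <= K%:E * vol mu x s)%E) ->
  forall h, (forall x, 0 <= h x) -> measurable_fun setT h ->
  (\int[lam]_z ((w z)%:E * cavg h z `^ k) <= (C * K)%:E * \int[mu]_x (h x `^ k)%:E)%E.
Proof.
move=> k1; have k0 : 0 < k by lra.
have [c [r [C [C0 r0 fam]]]] := countable_ball_family mu_ball o mu_doubling.
have [C3 C30 vol3] := doubling_scale mu_doubling 3.
exists (C `^ k * (2 `^ k * C3 * (k / (k - 1)))).
  by rewrite !mulr_ge0 ?powR_ge0 ?(ltW C30) ?(ltW k0)// invr_ge0 subr_ge0 ltW.
move=> w K w0 mw K0 carl h h0 mh.
pose M := maxmean mu c r (tent alpha) h.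
have mtent (x : X) (s : R) : @measurable _ (X * measurableTypeR R)%type (tent alpha (ball x s)).
  exact: measurable_tent.
have M0 z : (0 <= M z)%E by exact: maxmean_ge0.
have mM : measurable_fun setT M by apply: measurable_maxmean => x s; exact: measurable_tent.
have tm (A B : set X) : A `<=` B -> tent alpha A `<=` tent alpha B.
  by move=> AB z /tent_ballP[z0 zA]; apply/tent_ballP; split => // x /zA /AB.
have strong := @maxmean_strong _ _ _ mu mu_ball c r r0 C3 C30 vol3 _ _ lam w w0 mw (tent alpha) tm mtent K K0 carl h k h0 mh k1.
rewrite (_ : C `^ k * (2 `^ k * C3 * (k / (k - 1))) * K = C `^ k * (2 `^ k * C3 * K * (k / (k - 1)))); last by ring.
rewrite EFinM -muleA; apply: le_trans (lee_wpmul2l _ strong); rewrite ?lee_fin ?powR_ge0//.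
have mw' : measurable_fun setT (fun z => (w z)%:E) by exact/measurable_EFinP.
rewrite -ge0_integralZlT; last 3 first.
- by rewrite powR_ge0.
- by move=> z; rewrite mule_ge0 ?lee_fin ?poweR_ge0.
- by apply: emeasurable_funM => //; exact: (measurableT_comp (measurable_poweR k) mM).
apply: ge0_le_integralT.
- by move=> z; rewrite mule_ge0 ?lee_fin ?poweR_ge0.
- apply: emeasurable_funM => //; apply: (measurableT_comp (measurable_poweR k)).
  exact: measurable_cavg.
- apply: emeasurable_funM => //; apply: emeasurable_funM => //.
  exact: (measurableT_comp (measurable_poweR k) mM).
move=> z; rewrite muleCA lee_wpmul2l ?lee_fin// -poweR_EFin -poweRM ?lee_fin ?(ltW C0)//.
have CM : (0 <= C%:E * M z)%E by rewrite mule_ge0 ?lee_fin ?(ltW C0).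
apply: gt0_ler_poweR; rewrite ?in_itv /= ?andbT ?leey ?cavg_ge0 ?CM ?(ltW k0)//.
have [z0|z0] := pselect (0 < z.2); last by rewrite cavg_out.
have [n [sub le]] := fam z.1 _ (mulr_gt0 alpha_gt0 z0).
apply: le_trans (cavg_le_mean r0 C0 h0 mh z0 sub le) _.
rewrite lee_wpmul2l ?lee_fin ?(ltW C0)//.
apply: ereal_sup_ubound; exists n => //; rewrite indicE mem_set ?mule1//.
by apply/tent_ballP; split => // x /coneP[_ /sub].
Qed.

Lemma cavg_lty h z : (forall x, 0 <= h x) -> measurable_fun setT h -> 0 < z.2 ->
  (\int[mu]_x (h x)%:E < +oo)%E -> (cavg h z < +oo)%E.
Proof.
move=> h0 mh z0 hoo; rewrite cavgE//.
have : (\int[mu]_(x in ball z.1 (alpha * z.2)%R) (h x)%:E < +oo)%E.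
  apply: le_lt_trans hoo; apply: ge0_subset_integral => //.
  - exact: measurable_ball_borel.
  - exact/measurable_EFinP.
  - by move=> x _; rewrite lee_fin.
have : (0 <= \int[mu]_(x in ball z.1 (alpha * z.2)%R) (h x)%:E)%E.
  by apply: integral_ge0 => x _; rewrite lee_fin.
by case: (integral _ _ _) => //= v _ _; rewrite -EFinM ltry.
Qed.

(* For rho < p the maximal theorem with exponent p / rho > 1 compares [wgt rho A],
   a function on the upper half-space, with A itself in L^p. *)
Definition wgt (rho : R) (A : X -> R) z : R :=
  fine (cavg (fun x => A x `^ rho) z) `^ rho^-1.

Lemma wgt_ge0 rho A z : 0 <= wgt rho A z.
Proof. exact: powR_ge0. Qed.

Lemma measurable_wgt rho A : measurable_fun setT A -> measurable_fun setT (wgt rho A).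
Proof.
move=> mA; apply: measurable_fun_powR; apply: measurableT_comp; first exact: fine_measurable.
by apply: measurable_cavg => [x|]; [exact: powR_ge0|exact: measurable_fun_powR].
Qed.

Section weight.
Variables (p rho : R) (A : X -> R).
Hypothesis rho_gt0 : 0 < rho.
Hypothesis rho_le : rho < p.
Hypothesis A_gt0 : forall x, 0 < A x.
Hypothesis mA : measurable_fun setT A.
Hypothesis A_fin : (\int[mu]_x (A x `^ p)%:E < +oo)%E.

Let Ar_ge0 x : 0 <= A x `^ rho. Proof. exact: powR_ge0. Qed.

Lemma cavg_wgt z : 0 < z.2 -> cavg (fun x => A x `^ rho) z = (wgt rho A z `^ rho)%:E.
Proof.
move=> z0; rewrite /wgt -powRrM mulVf ?gt_eqF// powRr1.
  rewrite fineK// ge0_fin_numE; last exact: cavg_ge0.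
  (* Since rho < p, A^rho <= 1 + A^p; the averages are therefore finite and [fine] in [wgt] loses
     nothing. *)
  apply: (@le_lt_trans _ _ (cavg (fun x => cst 1 x + A x `^ p) z)).
    apply: le_cavg => //; first exact: measurable_fun_powR.
      by apply: measurable_funD => //; exact: measurable_fun_powR.
    by move=> x _; apply: powR_le1D; rewrite ?ltW.
  rewrite cavgD//; last 2 first.
  - by move=> x; exact: powR_ge0.
  - exact: measurable_fun_powR.
  rewrite cavg1// lte_add_pinfty ?ltry//; apply: cavg_lty => //.
  - by move=> x; exact: powR_ge0.
  - exact: measurable_fun_powR.
by rewrite fine_ge0// cavg_ge0.
Qed.

Lemma wgt_gt0 z : 0 < z.2 -> 0 < wgt rho A z.
Proof.
move=> z0; rewrite lt_neqAle wgt_ge0 andbT; apply/negP => /eqP w0.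
have := cavg_wgt z0; rewrite -w0 powR0 ?gt_eqF// => c0.
have mk : measurable_fun setT (fun x => (A x `^ rho * cone_ker x z)%:E).
  apply/measurable_EFinP; apply: measurable_funM; first exact: measurable_fun_powR.
  exact: measurable_cone_kerl.
have : (\int[mu]_x `|(A x `^ rho * cone_ker x z)%:E| = 0)%E.
  rewrite -[RHS]c0; apply: eq_integral => x _.
  by rewrite gee0_abs// lee_fin mulr_ge0// cone_ker_ge0.
move/(ae_eq_integral_abs mu measurableT mk) => ae0.
have := cavg1 z0; rewrite (_ : cavg _ z = 0%E); first by move=> /eqP; rewrite eqe eq_sym oner_eq0.
rewrite /cavg (ae_eq_integral (cst 0%E))//; first by rewrite integral0.
  by apply/measurable_EFinP; apply: measurable_funM => //; exact: measurable_cone_kerl.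
apply: filterS ae0 => x /(_ I) [] /eqP; rewrite mulf_eq0 gt_eqF ?powR_gt0//= => /eqP kx _.
by rewrite kx mulr0.
Qed.

(** With a = [wgt rho A z], the function (A / a)^rho has average 1 over the ball. Averaging
    [powR_dual_ge1] for x = A / a and absorbing one half gives the bound, for every e >= 0. *)
Lemma wgt_neg (e : R) z : 0 <= e -> 0 < z.2 ->
  ((wgt rho A z `^ (- e))%:E <= (2 * 2 `^ (e / rho))%:E * cavg (fun x => A x `^ (- e))%R z)%E.
Proof.
move=> e0 z0; have := cavg_wgt z0; have := wgt_gt0 z0.
move: (wgt rho A z) => a a0 cE.
have Ae0 x : 0 <= A x `^ (- e) by exact: powR_ge0.
have mAe : measurable_fun setT (fun x => A x `^ (- e)) by exact: measurable_fun_powR.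
have mAr : measurable_fun setT (fun x => A x `^ rho) by exact: measurable_fun_powR.
pose k1 := 2^-1 * (a `^ rho)^-1; pose k2 := 2 `^ (e / rho) * a `^ e.
have k10 : 0 <= k1 by rewrite mulr_ge0 ?invr_ge0 ?powR_ge0.
have k20 : 0 <= k2 by rewrite mulr_ge0 ?powR_ge0.
have : (cavg (cst 1%R) z <= cavg (fun x => k1 * A x `^ rho + k2 * A x `^ (- e))%R z)%E.
  apply: le_cavg => //.
    by apply: measurable_funD; apply: measurable_funM.
  move=> x _; apply: le_trans (powR_dual_ge1 (divr_gt0 (A_gt0 x) a0) e0 rho_gt0) _.
  rewrite !(powR_div _ (A_gt0 x) a0) [a `^ (- e)]powRN invrK /k1 /k2.
  by rewrite le_eqVlt; apply/orP; left; apply/eqP; ring.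
rewrite cavg1// cavgD//; last 4 first.
- by move=> x; rewrite mulr_ge0.
- by move=> x; rewrite mulr_ge0.
- exact: measurable_funM.
- exact: measurable_funM.
rewrite !cavgZ// cE.
rewrite (_ : k1%:E * _ = (2^-1)%:E)%E; last first.
  by rewrite -EFinM /k1 -mulrA mulVf ?mulr1// gt_eqF// powR_gt0.
have := cavg_ge0 z Ae0; case: (cavg _ z) => [v| |]//.
  rewrite lee_fin => v0; rewrite -!EFinM -EFinD !lee_fin /k2 powRN => h.
  rewrite -[leLHS]mul1r ler_pdivrMr ?powR_gt0//.
  move: h; set b := 2 `^ _; set c := a `^ e => h.
  by rewrite (_ : _ * c = 2 * (b * c * v)); [lra|ring].
by move=> _ _; rewrite gt0_muley ?leey// lte_fin mulr_gt0// powR_gt0.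
Qed.

Lemma wgt_pos (e : R) z : 0 <= e -> e <= rho -> 0 < z.2 ->
  (cavg (fun x => A x `^ e)%R z <= (2 * wgt rho A z `^ e)%:E)%E.
Proof.
move=> e0 er z0; have := cavg_wgt z0; have := wgt_gt0 z0.
move: (wgt rho A z) => a a0 cE.
have mAe : measurable_fun setT (fun x => A x `^ e) by exact: measurable_fun_powR.
have mAr : measurable_fun setT (fun x => A x `^ rho) by exact: measurable_fun_powR.
pose k1 := a `^ e * (a `^ rho)^-1.
have k10 : 0 <= k1 by rewrite mulr_ge0 ?invr_ge0 ?powR_ge0.
apply: (@le_trans _ _ (cavg (fun x => cst (a `^ e) x + k1 * A x `^ rho)%R z)).
  apply: le_cavg => //; first by move=> x; exact: powR_ge0.
    by apply: measurable_funD => //; apply: measurable_funM.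
  move=> x _; have := powR_le1D (ltW (divr_gt0 (A_gt0 x) a0)) e0 er.
  rewrite !(powR_div _ (A_gt0 x) a0).
  rewrite ler_pdivrMr ?powR_gt0// => /le_trans; apply.
  by rewrite /k1 /=; set b := a `^ e; rewrite (_ : b + _ = (1 + A x `^ rho / a `^ rho) * b)//; ring.
rewrite cavgD//; last 3 first.
- by move=> x; exact: powR_ge0.
- by move=> x; rewrite mulr_ge0.
- exact: measurable_funM.
rewrite cavg_cst ?powR_ge0// cavgZ// cE -EFinM -EFinD lee_fin /k1.
by rewrite mulfVK ?gt_eqF ?powR_gt0// mulr2n mulrDl mul1r.
Qed.

End weight.

(** With g the maximal majorant of A^rho in L^{p / rho}, the function B = A + g^{1 / rho} dominates
    A at its own point and [wgt rho A] on the whole cone above it. The condition rho < p makes the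
    exponent p / rho exceed 1. *)
Lemma wgt_majorant (p rho : R) : 0 < rho -> rho < p -> exists2 C : R, 0 <= C &
  forall A : X -> R, (forall x, 0 < A x) -> measurable_fun setT A ->
  (\int[mu]_x (A x `^ p)%:E < +oo)%E ->
  exists B : X -> R, [/\ forall x, A x <= B x, measurable_fun setT B,
    {ae mu, forall x, forall z, cone alpha x z -> wgt rho A z <= B x} &
    (\int[mu]_x (B x `^ p)%:E <= C%:E * \int[mu]_x (A x `^ p)%:E)%E].
Proof.
move=> rho0 rhop; have p0 : 0 < p by exact: lt_trans rhop.
have k1 : 1 < p / rho by rewrite ltr_pdivlMr// mul1r.
have [C C0 H] := maximal_bound k1.
exists (2 `^ p * (1 + C)); first by rewrite mulr_ge0 ?powR_ge0// addr_ge0.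
move=> A A0 mA Afin.
have Ap x : (A x `^ rho) `^ (p / rho) = A x `^ p.
  by rewrite -powRrM mulrC divfK// gt_eqF.
have mAr : measurable_fun setT (fun x => A x `^ rho) by exact: measurable_fun_powR.
have [|g [g0 mg gctl gint]] := H _ (fun x => powR_ge0 _ _) mAr.
  by under eq_integral do rewrite Ap.
have mg' : measurable_fun setT (fun x => g x `^ rho^-1) by exact: measurable_fun_powR.
exists (fun x => A x + g x `^ rho^-1); split.
- by move=> x; rewrite lerDl powR_ge0.
- exact: measurable_funD.
- apply: filterS gctl => x hx z xz; have /coneP[z0 _] := xz.
  apply: (@le_trans _ _ (g x `^ rho^-1)); last by rewrite lerDr ltW.
  have := hx z xz; rewrite (cavg_wgt rho0 rhop A0 mA Afin z0) lee_fin => h.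
  rewrite -[wgt rho A z]powRr1 ?wgt_ge0// -(@divff _ rho) ?gt_eqF// powRrM.
  by rewrite ge0_ler_powR ?nnegrE ?powR_ge0 ?invr_ge0// ltW.
have mAp : measurable_fun setT (fun x => (A x `^ p)%:E).
  by apply/measurable_EFinP; exact: measurable_fun_powR.
have mgp : measurable_fun setT (fun x => (g x `^ (p / rho))%:E).
  by apply/measurable_EFinP; exact: measurable_fun_powR.
apply: (@le_trans _ _ (\int[mu]_x ((2 `^ p)%:E * ((A x `^ p)%:E + (g x `^ (p / rho))%:E)))%E).
  apply: ge0_le_integralT.
  - by move=> x; rewrite lee_fin powR_ge0.
  - by apply/measurable_EFinP; apply: measurable_fun_powR; exact: measurable_funD.
  - by apply: emeasurable_funM => //; exact: emeasurable_funD.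
  - move=> x; rewrite -EFinD -EFinM lee_fin.
    have -> : p / rho = rho^-1 * p by rewrite mulrC.
    rewrite powRrM.
    by apply: powR_add_le; rewrite ?powR_ge0// ltW.
have Ap0 x : (0 <= (A x `^ p)%:E)%E by rewrite lee_fin powR_ge0.
have gp0 x : (0 <= (g x `^ (p / rho))%:E)%E by rewrite lee_fin powR_ge0.
rewrite (ge0_integralZlT mu (powR_ge0 _ _) (fun x => adde_ge0 (Ap0 x) (gp0 x)) (emeasurable_funD mAp mgp)).
rewrite (ge0_integralDT mu Ap0 gp0 mAp mgp).
have {}gint : (\int[mu]_x (g x `^ (p / rho))%:E <= C%:E * \int[mu]_x (A x `^ p)%:E)%E.
  by apply: le_trans gint _; under eq_integral do rewrite Ap.
have IA0 : (0 <= \int[mu]_x (A x `^ p)%:E)%E by apply: integral_ge0 => x _; exact: Ap0.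
clear -C0 gint IA0; move: gint IA0.
move: (\int[mu]_x (g x `^ (p / rho))%:E)%E (\int[mu]_x (A x `^ p)%:E)%E => Ig IA gint IA0.
rewrite EFinM -muleA; apply: lee_wpmul2l; first by rewrite lee_fin powR_ge0.
by rewrite EFinD ge0_muleDl ?lee_fin// mul1e leeD2l.
Qed.

#[local] Opaque wgt.

Lemma le_cone_int g g' x : (forall z, 0 <= g z) -> measurable_fun setT g ->
  measurable_fun setT g' -> (forall z, cone alpha x z -> g z <= g' z) ->
  (cone_int g x <= cone_int g' x)%E.
Proof.
move=> g0 mg mg' gg'; apply: ge0_le_integralT.
- by move=> z; rewrite lee_fin cone_integrand_ge0.
- exact: measurable_cone_integrand.
- exact: measurable_cone_integrand.
- move=> z; rewrite lee_fin ler_wpM2r ?dt_weight_ge0// /cone_ker /cone_ind indicE.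
  case: (boolP (z \in _)) => [|_]; last by rewrite mul0r !mulr0.
  by rewrite inE => /gg' ?; rewrite ler_wpM2r// mulr_ge0 ?powR_ge0.
Qed.

Lemma cone_intZ g x (c : R) : 0 <= c -> (forall z, 0 <= g z) -> measurable_fun setT g ->
  cone_int (fun z => c * g z) x = (c%:E * cone_int g x)%E.
Proof.
move=> c0 g0 mg; rewrite -ge0_integralZlT//.
- by apply: eq_integral => z _; rewrite -EFinM -!mulrA.
- by move=> z; rewrite lee_fin cone_integrand_ge0.
- exact: measurable_cone_integrand.
Qed.

Lemma eq_cone_int g g' x : g =1 g' -> cone_int g x = cone_int g' x.
Proof. by move=> gg'; apply: eq_integral => z _; rewrite gg'. Qed.

(** Adjointness in use: a weight b on the half-space is traded for a weight h' at the vertices of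
    the cones, provided b times the average of h is at most C times the average of h'. *)
Lemma weight_transfer (g b : X * R -> R) (h h' : X -> R) (C : R) : 0 <= C ->
  (forall z, 0 <= g z) -> measurable_fun setT g ->
  (forall z, 0 <= b z) -> measurable_fun setT b ->
  (forall x, 0 <= h x) -> measurable_fun setT h ->
  (forall x, 0 <= h' x) -> measurable_fun setT h' ->
  (forall z, 0 < z.2 -> ((b z)%:E * cavg h z <= C%:E * cavg h' z)%E) ->
  (\int[mu]_x ((h x)%:E * cone_int (fun z => g z * b z)%R x) <=
   C%:E * \int[mu]_x ((h' x)%:E * cone_int g x))%E.
Proof.
move=> C0 g0 mg b0 mb h0 mh h0' mh' H.
have gb0 z : 0 <= g z * b z by rewrite mulr_ge0.
have mgb : measurable_fun setT (fun z => g z * b z) by exact: measurable_funM.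
have mW := measurable_dt_weight.
rewrite !cone_fubini// -ge0_integralZlT//; last 2 first.
- by move=> z; rewrite mule_ge0 ?cavg_ge0// lee_fin mulr_ge0// dt_weight_ge0.
- apply: emeasurable_funM; last exact: measurable_cavg.
  by apply/measurable_EFinP; apply: measurable_funM.
apply: ge0_le_integralT.
- by move=> z; rewrite mule_ge0 ?cavg_ge0// lee_fin mulr_ge0// dt_weight_ge0.
- apply: emeasurable_funM; last exact: measurable_cavg.
  by apply/measurable_EFinP; apply: measurable_funM.
- apply: emeasurable_funM => //; apply: emeasurable_funM; last exact: measurable_cavg.
  by apply/measurable_EFinP; apply: measurable_funM.
move=> z; have [z0|z0] := pselect (0 < z.2); last by rewrite dt_weight_out// !mulr0 !mul0e mule0.
rewrite (_ : g z * b z * W z = g z * W z * b z); last by ring.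
rewrite EFinM -muleA [leRHS]muleCA; apply: lee_wpmul2l; last exact: H.
by rewrite lee_fin mulr_ge0// dt_weight_ge0.
Qed.

(* i is the reciprocal of the Lebesgue exponent, i = 0 being the Carleson endpoint:
   [tent_bd i r 1 g] says that g has norm at most 1 in T^{1/i,r}. *)
Definition tent_bd (i r c : R) (g : X * R -> R) : Prop :=
  if i == 0 then forall x (s : R), 0 < s ->
    (\int[lam]_(z in tent alpha (ball x s)) (g z `^ r * W z)%:E <= c%:E * vol mu x s)%E
  else (\int[mu]_x (cone_int (fun z => g z `^ r)%R x `^ (i * r)^-1) <= c%:E)%E.

(** * The key estimate: weighted Carleson and area bounds *)

Section weighted.
Variables (p q rho : R).
Hypothesis rho_gt0 : 0 < rho.
Hypothesis rho_lt : rho < p.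
Hypothesis q_gt0 : 0 < q.

Definition area_majorant (f : X * R -> R) (A : X -> R) : Prop :=
  [/\ forall x, 0 < A x, measurable_fun setT A, (\int[mu]_x (A x `^ p)%:E <= 1)%E &
  {ae mu, forall x, (cone_int (fun z => f z `^ q)%R x <= (A x `^ q)%:E)%E}].

Lemma area_majorant_lty f A : area_majorant f A -> (\int[mu]_x (A x `^ p)%:E < +oo)%E.
Proof. by move=> [_ _ h _]; apply: le_lt_trans h _; rewrite ltry. Qed.

(** The weight a^{-q} becomes A^{-q} at the vertex, where its product with the cone integral of f^q
    is at most 1. A cone with vertex outside the ball misses the tent, so integrating over the ball
    gives its volume. *)
Lemma weighted_carleson : exists2 C : R, 0 <= C & forall (f : X * R -> R) (A : X -> R),
  (forall z, 0 <= f z) -> measurable_fun setT f -> area_majorant f A ->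
  forall x (s : R), 0 < s ->
   (\int[lam]_(z in tent alpha (ball x s)) (f z `^ q * wgt rho A z `^ (- q) * W z)%:E
     <= C%:E * vol mu x s)%E.
Proof.
exists (2 * 2 `^ (q / rho)); first by rewrite mulr_ge0 ?powR_ge0.
move=> f A f0 mf AM y s s0; have Afin := area_majorant_lty AM.
have [A0 mA _ Ale] := AM.
set T := tent alpha (ball y s).
have mT : measurable T by exact: measurable_tent.
have mT' : @measurable _ (X * measurableTypeR R)%type T by exact: measurable_tent.
have mfq : measurable_fun setT (fun z => f z `^ q) by exact: measurable_fun_powR.
have mw := measurable_wgt rho mA.
have mW := measurable_dt_weight.
pose g z := f z `^ q * \1_T z.
have g0 z : 0 <= g z by rewrite mulr_ge0 ?powR_ge0.
have mg : measurable_fun setT g by apply: measurable_funM => //; exact: measurable_indic.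
have mgb : measurable_fun setT (fun z => g z * wgt rho A z `^ (- q)).
  by apply: measurable_funM => //; exact: measurable_fun_powR.
have C0 : 0 <= 2 * 2 `^ (q / rho) by rewrite mulr_ge0 ?powR_ge0.
have := @weight_transfer g (fun z => wgt rho A z `^ (- q)) (cst 1) (fun x => A x `^ (- q)) _ C0 g0 mg
  (fun z => powR_ge0 _ _) (measurable_fun_powR _ mw) (fun x => ler01) (measurable_cst _)
  (fun x => powR_ge0 _ _) (measurable_fun_powR _ mA).
have H z : 0 < z.2 -> ((wgt rho A z `^ (- q))%:E * cavg (cst 1%R) z <=
    (2 * 2 `^ (q / rho))%:E * cavg (fun x => A x `^ (- q))%R z)%E.
  by move=> z0; rewrite cavg1// mule1 (wgt_neg rho_gt0 rho_lt)// ltW.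
move=> /(_ H).
under eq_integral do rewrite mul1e.
rewrite -upper_integral_cone_int//; last by move=> z; rewrite mulr_ge0 ?powR_ge0.
move=> h; apply: (@le_trans _ _ (\int[lam]_z (g z * wgt rho A z `^ (- q) * W z)%:E)%E).
  rewrite (ge0_integral_indic lam mT'); last first.
    by move=> z; rewrite lee_fin !mulr_ge0 ?powR_ge0.
  apply: ge0_le_integralT.
  - by move=> z; rewrite -EFinM lee_fin !mulr_ge0 ?powR_ge0.
  - apply: emeasurable_funM; apply/measurable_EFinP; last exact: measurable_indic.
    by apply: measurable_funM => //; apply: measurable_funM => //; exact: measurable_fun_powR.
  - by apply/measurable_EFinP; apply: measurable_funM.
  - by move=> z; rewrite -EFinM lee_fin /g le_eqVlt; apply/orP; left; apply/eqP; ring.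
apply: le_trans h _; rewrite lee_wpmul2l ?lee_fin//.
rewrite /vol -[leRHS]mul1e -(integral_cst mu (measurable_ball_borel y s)).
rewrite (ge0_integral_indic mu (measurable_ball_borel y s))//.
apply: ae_le_integralT.
- by move=> x; rewrite mule_ge0 ?cone_int_ge0// lee_fin powR_ge0.
- by move=> x; rewrite mule_ge0// lee_fin.
- apply: emeasurable_funM; last exact: measurable_cone_int.
  by apply/measurable_EFinP; exact: measurable_fun_powR.
- apply: emeasurable_funM => //; apply/measurable_EFinP; apply: measurable_indic.
  exact: measurable_ball_borel.
- apply: filterS Ale => x hx; rewrite mul1e indicE.
  case: (boolP (x \in _)) => [_|xB].
    apply: (@le_trans _ _ ((A x `^ (- q))%:E * (A x `^ q)%:E)%E).
      rewrite lee_wpmul2l ?lee_fin ?powR_ge0//; apply: le_trans hx.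
      apply: le_cone_int => // z _; by rewrite /g ler_piMr ?powR_ge0// indicE.
    by rewrite -EFinM powRN mulVf// gt_eqF// powR_gt0.
  rewrite (_ : cone_int g x = 0%E) ?mule0//.
  apply: integral0_eq => z _; rewrite /g /cone_ker /cone_ind !indicE.
  case: (boolP (z \in T)) => [|_]; last by rewrite mulr0 !mul0r.
  case: (boolP (z \in cone alpha x)) => [|_ _]; last by rewrite mul0r mulr0 mul0r.
  rewrite !inE => xz /tent_ballP[_ /(_ x xz) Bx]; move: xB; rewrite notin_setE.
  by move/(_ Bx).
Qed.

(** On the cone at x the weight is at most B(x), so its nonnegative power leaves the cone integral;
    there remains B^{p/k - q} A^q <= B^{p/k}, whose k-th power is B^p. *)
Lemma weighted_area_ge0 (k : R) : 0 < k -> 0 <= p / k - q ->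
  exists2 C : R, 0 <= C & forall (f : X * R -> R) (A : X -> R),
  (forall z, 0 <= f z) -> measurable_fun setT f -> area_majorant f A ->
  (\int[mu]_x (cone_int (fun z => f z `^ q * wgt rho A z `^ (p / k - q))%R x `^ k) <= C%:E)%E.
Proof.
move=> k0 tau0; have [C C0 maj] := wgt_majorant rho_gt0 rho_lt.
exists C => // f A f0 mf AM; have Afin := area_majorant_lty AM.
have [A0 mA A1 Ale] := AM.
have [B [AB mB Bw Bint]] := maj A A0 mA Afin.
have mfq : measurable_fun setT (fun z => f z `^ q) by exact: measurable_fun_powR.
have mw := measurable_wgt rho mA.
have mfw : measurable_fun setT (fun z => f z `^ q * wgt rho A z `^ (p / k - q)).
  by apply: measurable_funM => //; exact: measurable_fun_powR.
have fw0 z : 0 <= f z `^ q * wgt rho A z `^ (p / k - q) by rewrite mulr_ge0 ?powR_ge0.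
apply: (@le_trans _ _ (\int[mu]_x (B x `^ p)%:E)%E); last first.
  apply: le_trans Bint _; rewrite -[leRHS]mule1; apply: lee_wpmul2l => //.
apply: ae_le_integralT.
- by move=> x; exact: poweR_ge0.
- by move=> x; rewrite lee_fin powR_ge0.
- by apply: (measurableT_comp (measurable_poweR k)); exact: measurable_cone_int.
- by apply/measurable_EFinP; exact: measurable_fun_powR.
apply: filterS2 Ale Bw => x hA hB.
have B0 : 0 < B x := lt_le_trans (A0 x) (AB x).
have -> : B x `^ p = (B x `^ (p / k)) `^ k by rewrite -powRrM divfK// gt_eqF.
rewrite -poweR_EFin; apply: gt0_ler_poweR; rewrite ?in_itv /= ?andbT ?leey ?cone_int_ge0 ?(ltW k0)//.
  by rewrite lee_fin powR_ge0.
apply: (@le_trans _ _ (cone_int (fun z => B x `^ (p / k - q) * f z `^ q)%R x)).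
  apply: le_cone_int => //; first exact: measurable_funM.
  move=> z xz; rewrite mulrC ler_wpM2r ?powR_ge0// ge0_ler_powR ?nnegrE ?wgt_ge0 ?(ltW B0)//.
  exact: hB.
rewrite cone_intZ ?powR_ge0//; last by move=> z; exact: powR_ge0.
apply: (@le_trans _ _ ((B x `^ (p / k - q))%:E * (B x `^ q)%:E)%E).
  rewrite lee_wpmul2l ?lee_fin ?powR_ge0//; apply: le_trans hA _.
  by rewrite lee_fin ge0_ler_powR ?nnegrE ?(ltW (A0 x)) ?(ltW B0) ?(ltW q_gt0).
by rewrite -EFinM -powRgtD// subrK.
Qed.

(** For k <= 1 the cone integral P satisfies P^k <= B^{-e'} P + B^p, with e' chosen so that the
    powers of B cancel in the weighted product. As B dominates the weight a on cones, the average of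
    B^{-e'} is at most a^{-e'}; what remains is a^{-e}, which moves to the vertex as A^{-e}, and q -
    e = p. *)
Lemma weighted_area_lt0_le1 (k : R) : 0 < k <= 1 -> p / k - q <= 0 ->
  exists2 C : R, 0 <= C & forall (f : X * R -> R) (A : X -> R),
  (forall z, 0 <= f z) -> measurable_fun setT f -> area_majorant f A ->
  (\int[mu]_x (cone_int (fun z => f z `^ q * wgt rho A z `^ (p / k - q))%R x `^ k) <= C%:E)%E.
Proof.
move=> /andP[k0 k1] tau0; have [C C0 maj] := wgt_majorant rho_gt0 rho_lt.
pose e' := p / k * (1 - k).
have p0 : 0 < p by exact: lt_trans rho_lt.
have e'0 : 0 <= e' by rewrite /e' !mulr_ge0 ?invr_ge0 ?(ltW p0) ?(ltW k0)// subr_ge0.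
pose e := e' - (p / k - q); have e0 : 0 <= e by rewrite /e; lra.
pose D := 2 * 2 `^ (e / rho); have D0 : 0 <= D by rewrite mulr_ge0 ?powR_ge0.
exists (D + C); first exact: addr_ge0.
move=> f A f0 mf AM; have Afin := area_majorant_lty AM.
have [A0 mA A1 Ale] := AM.
have [B [AB mB Bw Bint]] := maj A A0 mA Afin.
have B0 x : 0 < B x := lt_le_trans (A0 x) (AB x).
have mfq : measurable_fun setT (fun z => f z `^ q) by exact: measurable_fun_powR.
have mw := measurable_wgt rho mA.
have mwt : measurable_fun setT (fun z => wgt rho A z `^ (p / k - q)) by exact: measurable_fun_powR.
have mfw : measurable_fun setT (fun z => f z `^ q * wgt rho A z `^ (p / k - q)).
  exact: measurable_funM.
have fw0 z : 0 <= f z `^ q * wgt rho A z `^ (p / k - q) by rewrite mulr_ge0 ?powR_ge0.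
have mBe : measurable_fun setT (fun x => B x `^ (- e')) by exact: measurable_fun_powR.
have mAe : measurable_fun setT (fun x => A x `^ (- e)) by exact: measurable_fun_powR.
have mBp : measurable_fun setT (fun x => (B x `^ p)%:E).
  by apply/measurable_EFinP; exact: measurable_fun_powR.
pose P x := cone_int (fun z => f z `^ q * wgt rho A z `^ (p / k - q)) x.
have P0 x : (0 <= P x)%E by exact: cone_int_ge0.
have mP : measurable_fun setT P by exact: measurable_cone_int.
have BP0 x : (0 <= (B x `^ (- e'))%:E * P x)%E by rewrite mule_ge0 ?lee_fin ?powR_ge0.
have mBP : measurable_fun setT (fun x => (B x `^ (- e'))%:E * P x)%E.
  by apply: emeasurable_funM => //; apply/measurable_EFinP.
have Bp0 x : (0 <= (B x `^ p)%:E)%E by rewrite lee_fin powR_ge0.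
apply: (@le_trans _ _ (\int[mu]_x ((B x `^ (- e'))%:E * P x + (B x `^ p)%:E))%E).
  apply: ge0_le_integralT.
  - by move=> x; exact: poweR_ge0.
  - exact: (measurableT_comp (measurable_poweR k)).
  - exact: emeasurable_funD.
  move=> x; rewrite -/(P x); move: (P0 x); case: (P x) => [v|_|//]; last first.
    by rewrite gt0_muley ?lte_fin ?powR_gt0// addye// leey.
  rewrite lee_fin => v0; rewrite poweR_EFin -EFinM -EFinD lee_fin.
  have := powR_mix_le (mulr_ge0 (powR_ge0 (B x) (- e')) v0) (powR_ge0 (B x) p) (k := k).
  rewrite (ltW k0) k1 => /(_ isT); apply: le_trans.
  rewrite powRM ?powR_ge0// -!powRrM mulrAC -powRgtD//.
  rewrite (_ : - e' * k + p * (1 - k) = 0) ?powRr0 ?mul1r//.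
  by rewrite /e'; field; rewrite gt_eqF.
rewrite (ge0_integralDT mu BP0 Bp0 mBP mBp) EFinD; apply: leeD; last first.
  by apply: le_trans Bint _; rewrite -[leRHS]mule1; apply: lee_wpmul2l.
have tr := @weight_transfer (fun z => f z `^ q) (fun z => wgt rho A z `^ (p / k - q))
  (fun x => B x `^ (- e')) (fun x => A x `^ (- e)) D D0 (fun z => powR_ge0 _ _) mfq
  (fun z => powR_ge0 _ _) mwt (fun x => powR_ge0 _ _) mBe (fun x => powR_ge0 _ _) mAe.
apply: le_trans (tr _) _.
  move=> z z0; have w0 := wgt_gt0 rho_gt0 rho_lt A0 mA Afin z0.
  apply: le_trans (wgt_neg rho_gt0 rho_lt A0 mA Afin e0 z0).
  apply: (@le_trans _ _ ((wgt rho A z `^ (p / k - q))%:E * cavg (cst (wgt rho A z `^ (- e'))%R) z)%E).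
    apply: lee_wpmul2l; first by rewrite lee_fin powR_ge0.
    apply: ae_le_cavg.
    - by move=> x; exact: powR_ge0.
    - by move=> x; exact: powR_ge0.
    - exact: mBe.
    - exact: measurable_cst.
    - apply: filterS Bw => x hx xz /=; rewrite !powRN lef_pV2 ?posrE ?(powR_gt0 _ w0) ?(powR_gt0 _ (B0 x))//.
      by rewrite ge0_ler_powR ?nnegrE ?(ltW w0) ?(ltW (B0 x))//; exact: hx.
  rewrite cavg_cst ?powR_ge0// -EFinM -powRgtD//.
  by rewrite /e opprB.
rewrite -[leRHS]mule1; apply: lee_wpmul2l => //.
apply: le_trans A1; apply: ae_le_integralT.
- by move=> x; rewrite mule_ge0 ?cone_int_ge0 ?lee_fin ?powR_ge0// => z; exact: powR_ge0.
- by move=> x; rewrite lee_fin powR_ge0.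
- apply: emeasurable_funM; first exact/measurable_EFinP.
  by apply: measurable_cone_int => // z; exact: powR_ge0.
- by apply/measurable_EFinP; exact: measurable_fun_powR.
apply: filterS Ale => x hx.
apply: (@le_trans _ _ ((A x `^ (- e))%:E * (A x `^ q)%:E)%E).
  by rewrite lee_wpmul2l ?lee_fin ?powR_ge0.
rewrite -EFinM -powRgtD//.
rewrite (_ : - e + q = p)// /e /e'; field; by rewrite gt_eqF.
Qed.

(** For k > 1 the integral of P^k is the pairing of P with h = P^{k - 1}. If g is the maximal
    majorant of h, then a^{-e} times the average of h is at most a constant times the average of g
    A^{-e}, so the pairing moves to g A^{q - e} at the vertex. Young's inequality splits this into a
    multiple of A^p and a small multiple of g^{k'}, which the maximal theorem returns to P^k for
    absorption. *)
Lemma weighted_area_lt0_gt1 (k : R) : 1 < k -> p / k - q <= 0 ->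
  exists2 C : R, 0 <= C & forall (f : X * R -> R) (A : X -> R),
  (forall z, 0 <= f z) -> measurable_fun setT f -> area_majorant f A ->
  (\int[mu]_x (cone_int (fun z => f z `^ q * wgt rho A z `^ (p / k - q))%R x `^ k) <= C%:E)%E.
Proof.
move=> k1 tau0; have k0 : 0 < k by lra.
pose e := q - p / k; have e0 : 0 <= e by rewrite /e; lra.
have tauE : p / k - q = - e by rewrite /e opprB.
pose C1 := 2 * 2 `^ (e / rho); have C10 : 0 <= C1 by rewrite mulr_ge0 ?powR_ge0.
pose k' := k / (k - 1).
have k'1 : 1 < k' by rewrite ltr_pdivlMr ?subr_gt0//; lra.
have [CM CM0 maxb] := maximal_bound k'1.
(* Makes C1 dl CM at most 1 / 2, so that the returning term can be absorbed into the left-hand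
   side. *)
pose dl := (2 * C1 * CM + 1)^-1.
have den : 0 < 2 * C1 * CM + 1 by rewrite ltr_wpDl// !mulr_ge0.
have dl0 : 0 < dl by rewrite invr_gt0.
have [D D0 young] := young_scaled k1 dl0.
exists (2 * C1 * D); first by rewrite !mulr_ge0.
move=> f A f0 mf AM; have Afin := area_majorant_lty AM.
have [A0 mA A1 Ale] := AM.
have mfq : measurable_fun setT (fun z => f z `^ q) by exact: measurable_fun_powR.
have fq0 z : 0 <= f z `^ q by exact: powR_ge0.
have mw := measurable_wgt rho mA.
rewrite tauE.
have w0 z : 0 <= wgt rho A z `^ (- e) by exact: powR_ge0.
have mwt : measurable_fun setT (fun z => wgt rho A z `^ (- e)) by exact: measurable_fun_powR.
have mAe : measurable_fun setT (fun x => A x `^ (- e)) by exact: measurable_fun_powR.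
have Ae0 x : 0 <= A x `^ (- e) by exact: powR_ge0.
pose P x := cone_int (fun z => f z `^ q * wgt rho A z `^ (- e)) x.
have P0 x : (0 <= P x)%E by apply: cone_int_ge0 => z; rewrite mulr_ge0.
have mP : measurable_fun setT P.
  by apply: measurable_cone_int => [z|]; [rewrite mulr_ge0|exact: measurable_funM].
rewrite -/P.
(* Absorption requires a finite quantity: P is cut at height n and restricted to a ball, and
   monotone convergence removes both restrictions at the end. *)
pose Pn n x : R := fine (mine (P x) n%:R%:E).
have PnE n x : ((Pn n x)%:E = mine (P x) n%:R%:E)%E.
  rewrite /Pn fineK// ge0_fin_numE; first by rewrite gt_min ltry orbT.
  by rewrite le_min P0 lee_fin ler0n.
have Pn0 n x : 0 <= Pn n x by rewrite -lee_fin PnE le_min P0 lee_fin ler0n.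
have Pnn n x : Pn n x <= n%:R by rewrite -lee_fin PnE ge_min lexx orbT.
have mPn n : measurable_fun setT (Pn n).
  apply: measurableT_comp; first exact: fine_measurable.
  exact: measurable_mine.
pose In n : X -> R := \1_(ball o n.+1%:R).
have mIn n : measurable_fun setT (In n) by apply: measurable_indic; exact: measurable_ball_borel.
have In01 n x : In n x = 0 \/ In n x = 1.
  by rewrite /In indicE; case: (_ \in _); [right|left].
pose F n x := (Pn n x `^ k * In n x)%:E.
have F0 n x : (0 <= F n x)%E by rewrite lee_fin mulr_ge0 ?powR_ge0.
have mF n : measurable_fun setT (F n).
  by apply/measurable_EFinP; apply: measurable_funM => //; exact: measurable_fun_powR.
have bound n : (\int[mu]_x F n x <= (2 * C1 * D)%:E)%E.
  pose h x := Pn n x `^ (k - 1) * In n x.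
  have h0 x : 0 <= h x by rewrite mulr_ge0 ?powR_ge0.
  have mh : measurable_fun setT h by apply: measurable_funM => //; exact: measurable_fun_powR.
  have hk x : (h x `^ k')%:E = F n x.
    rewrite /h /F /k'; case: (In01 n x) => ->; first by rewrite !mulr0 powR0// gt_eqF// (lt_trans ltr01).
    by rewrite !mulr1 -powRrM mulrC divfK// subr_eq0 gt_eqF.
  have Qfin : (\int[mu]_x (h x `^ k')%:E < +oo)%E.
    under eq_integral do rewrite hk.
    apply: (@le_lt_trans _ _ (\int[mu]_x ((n%:R `^ k)%:E * (In n x)%:E))%E).
      apply: ge0_le_integralT => //.
        by apply: emeasurable_funM => //; exact/measurable_EFinP.
      move=> x; rewrite -EFinM lee_fin ler_wpM2r//.
      by rewrite ge0_ler_powR ?nnegrE ?(ltW k0).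
    rewrite ge0_integralZlT ?powR_ge0//; last 2 first.
    - by move=> x; rewrite lee_fin.
    - exact/measurable_EFinP.
    rewrite integral_indic ?setIT//; last exact: measurable_ball_borel.
    have /andP[_ Vo] := mu_ball o (ltr0Sn R n).
    by rewrite lte_mul_pinfty// ?lee_fin ?powR_ge0.
  have [g [g0 mg gctl gint]] := maxb h h0 mh Qfin.
  have {}gint : (\int[mu]_x (g x `^ k')%:E <= CM%:E * \int[mu]_x F n x)%E.
    by apply: le_trans gint _; under eq_integral do rewrite hk.
  have gA0 x : 0 <= g x * A x `^ (- e) by rewrite mulr_ge0.
  have mgA : measurable_fun setT (fun x => g x * A x `^ (- e)) by exact: measurable_funM.
  have tr := @weight_transfer (fun z => f z `^ q) (fun z => wgt rho A z `^ (- e))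
    h (fun x => g x * A x `^ (- e)) C1 C10 fq0 mfq w0 mwt h0 mh gA0 mgA.
  have {}tr : (\int[mu]_x ((h x)%:E * P x) <=
     C1%:E * \int[mu]_x ((g x * A x `^ (- e))%:E * cone_int (fun z => f z `^ q)%R x))%E.
    apply: tr => z z0.
    have hn x : h x <= n%:R `^ (k - 1).
      rewrite /h; case: (In01 n x) => ->; first by rewrite mulr0 powR_ge0.
      by rewrite mulr1 ge0_ler_powR ?nnegrE ?subr_ge0 ?(ltW k1).
    have : (cavg h z <= (n%:R `^ (k - 1))%:E)%E.
      by rewrite -(cavg_cst (powR_ge0 _ _) z0); apply: le_cavg => // x _; exact: hn.
    have := cavg_ge0 z h0; case cE : (cavg h z) => [c| |]// c0 _.
    rewrite lee_fin in c0.
    apply: (@le_trans _ _ ((C1%:E * cavg (fun x => A x `^ (- e))%R z) * c%:E)%E).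
      by rewrite lee_wpmul2r ?lee_fin// (wgt_neg rho_gt0 rho_lt).
    rewrite -muleA; apply: lee_wpmul2l; first by rewrite lee_fin.
    rewrite muleC -cavgZ//; apply: ae_le_cavg => //.
    - by move=> x; rewrite mulr_ge0.
    - exact: measurable_funM.
    - apply: filterS gctl => x hx xz; rewrite ler_wpM2r//.
      by have := hx z xz; rewrite cE lee_fin.
  have Q0 : (0 <= \int[mu]_x F n x)%E by apply: integral_ge0 => x _; exact: F0.
  have QfinF : (\int[mu]_x F n x < +oo)%E.
    by apply: le_lt_trans Qfin; under [leRHS]eq_integral do rewrite hk.
  have step1 : (\int[mu]_x F n x <= \int[mu]_x ((h x)%:E * P x))%E.
    apply: ge0_le_integralT => //.
      by apply: emeasurable_funM => //; exact/measurable_EFinP.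
    move=> x; rewrite /F /h; case: (In01 n x) => ->; first by rewrite !mulr0 mul0e.
    rewrite !mulr1 -mulr_powRB1// mulrC EFinM; apply: lee_wpmul2l; first by rewrite lee_fin powR_ge0.
    by rewrite PnE ge_min lexx.
  have pe : (q - e) * k = p by rewrite /e; field; rewrite gt_eqF.
  have mgk : measurable_fun setT (fun x => (g x `^ k')%:E).
    by apply/measurable_EFinP; exact: measurable_fun_powR.
  have mAp : measurable_fun setT (fun x => (A x `^ p)%:E).
    by apply/measurable_EFinP; exact: measurable_fun_powR.
  have gk0 x : (0 <= (g x `^ k')%:E)%E by rewrite lee_fin powR_ge0.
  have Ap0 x : (0 <= (A x `^ p)%:E)%E by rewrite lee_fin powR_ge0.
  have step2 : (\int[mu]_x ((g x * A x `^ (- e))%:E * cone_int (fun z => f z `^ q)%R x) <=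
      \int[mu]_x (dl%:E * (g x `^ k')%:E + D%:E * (A x `^ p)%:E))%E.
    apply: ae_le_integralT.
    - by move=> x; rewrite mule_ge0 ?cone_int_ge0 ?lee_fin.
    - by move=> x; rewrite adde_ge0// mule_ge0// lee_fin// ltW.
    - apply: emeasurable_funM; first exact/measurable_EFinP.
      exact: measurable_cone_int.
    - by apply: emeasurable_funD; exact: emeasurable_funM.
    apply: filterS Ale => x hx.
    apply: (@le_trans _ _ ((g x * A x `^ (- e))%:E * (A x `^ q)%:E)%E).
      by apply: lee_wpmul2l; rewrite ?lee_fin.
    rewrite -!EFinM -EFinD lee_fin -mulrA -powRgtD// [- e + q]addrC.
    by rewrite -pe powRrM; apply: young; rewrite ?powR_ge0.
  have step3 : (\int[mu]_x (dl%:E * (g x `^ k')%:E + D%:E * (A x `^ p)%:E) <=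
      (dl * CM)%:E * \int[mu]_x F n x + D%:E)%E.
    rewrite ge0_integralDT; first last.
    - exact: emeasurable_funM.
    - exact: emeasurable_funM.
    - by move=> x; rewrite mule_ge0// lee_fin.
    - by move=> x; rewrite mule_ge0// lee_fin ltW.
    rewrite (ge0_integralZlT mu (ltW dl0) gk0 mgk) (ge0_integralZlT mu D0 Ap0 mAp).
    apply: leeD; last by rewrite -[leRHS]mule1; apply: lee_wpmul2l.
    by rewrite EFinM -muleA; apply: lee_wpmul2l; rewrite // lee_fin ltW.
  have C1e : (0 <= C1%:E)%E by rewrite lee_fin.
  have := le_trans step1 (le_trans tr (lee_wpmul2l C1e (le_trans step2 step3))).
  clear -C10 CM0 D0 den Q0 QfinF; move: Q0 QfinF.
  case: (\int[mu]_x F n x)%E => // Q; rewrite lee_fin => Q0 _.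
  rewrite -(EFinM (dl * CM) Q) -(EFinD _ D) -(EFinM C1) !lee_fin => H.
  have h1 : C1 * (dl * CM) <= 2^-1.
    rewrite /dl mulrCA -ler_pdivlMl ?invr_gt0// invrK -mulrA.
    move: den; set b := C1 * CM; rewrite -mulrA -/b => den; lra.
  have : C1 * (dl * CM * Q + D) <= 2^-1 * Q + C1 * D.
    by rewrite mulrDr mulrA lerD2r ler_wpM2r.
  move=> /(le_trans H); rewrite -(mulrA 2 C1 D); set b := C1 * D; lra.
have ndF x : nondecreasing_seq (F ^~ x).
  move=> m n mn; rewrite /F lee_fin; apply: ler_pM; rewrite ?powR_ge0//.
    rewrite ge0_ler_powR ?nnegrE ?(ltW k0)// -lee_fin !PnE le_min ge_min lexx /=.
    by rewrite ge_min lee_fin ler_nat mn orbT.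
  rewrite /In !indicE ler_nat; case: (boolP (x \in (ball o m.+1%:R : set X))) => //.
  rewrite inE => /in_ball xm; rewrite mem_set//; apply/in_ball.
  by rewrite (lt_le_trans xm)// ler_nat.
have limF : (\int[mu]_x limn (F ^~ x) = limn (fun n => \int[mu]_x F n x))%E.
  by apply: monotone_convergence => // x _; exact: ndF.
apply: (@le_trans _ _ (\int[mu]_x limn (F ^~ x))%E); last first.
  rewrite limF; apply: lime_le; last by apply: nearW => n; exact: bound.
  by apply: ereal_nondecreasing_is_cvgn => m n mn; apply: ge0_le_integralT => // x; exact: ndF.
have limE x : limn (F ^~ x) = ereal_sup (range (F ^~ x)).
  by apply/cvg_lim => //; exact: ereal_nondecreasing_cvgn.
apply: ge0_le_integralT.
- by move=> x; exact: poweR_ge0.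
- exact: (measurableT_comp (measurable_poweR k)).
- apply: (emeasurable_fun_cvg F) => // x _; rewrite limE.
  exact: ereal_nondecreasing_cvgn.
move=> x; rewrite limE.
have ge n : (Num.truncn (mdist o x) <= n)%N -> ((Pn n x `^ k)%:E <= ereal_sup (range (F ^~ x)))%E.
  move=> hn; apply: ereal_sup_ubound; exists n => //; rewrite /F /In indicE mem_set ?mulr1//.
  by apply/in_ball; rewrite (lt_le_trans (truncnS_gt _))// ler_nat ltnS.
case E : (P x) => [v| |]; last by have := P0 x; rewrite E.
  pose n := maxn (Num.truncn (mdist o x)) (Num.truncn v).+1.
  apply: le_trans (ge n (leq_maxl _ _)).
  rewrite -/(P x) E poweR_EFin lee_fin ge0_ler_powR ?nnegrE ?(ltW k0)//.
    by have := P0 x; rewrite E lee_fin.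
  rewrite -lee_fin PnE E le_min lexx /= lee_fin.
  by rewrite (le_trans (ltW (truncnS_gt _)))// ler_nat leq_maxr.
rewrite -/(P x) E poweRyr ?gt_eqF// leye_eq; apply/eqP/eqyP => a a0.
pose n := maxn (Num.truncn (mdist o x)) (Num.truncn (a `^ k^-1)).+1.
apply: le_trans (ge n (leq_maxl _ _)).
have -> : a = (a `^ k^-1) `^ k by rewrite -powRrM mulVf ?gt_eqF// powRr1// ltW.
rewrite lee_fin ge0_ler_powR ?nnegrE ?powR_ge0 ?(ltW k0)//.
rewrite -lee_fin PnE E le_min leey /= lee_fin.
by rewrite (le_trans (ltW (truncnS_gt _)))// ler_nat leq_maxr.
Qed.

(** For i > 0 and k = 1 / (i r), the r-th power of the function carries the exponent p i r - q = p /
    k - q of the weight; its sign and the position of k relative to 1 select one of the three area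
    estimates. *)
Lemma weighted_tent_bd (i r : R) : 0 <= i -> 0 < r ->
  exists2 C : R, 0 <= C & forall (f : X * R -> R) (A : X -> R),
  (forall z, 0 <= f z) -> measurable_fun setT f -> area_majorant f A ->
  tent_bd i r C (fun z => f z `^ (q / r) * wgt rho A z `^ (p * i - q / r)).
Proof.
move=> i0 r0.
have E (f : X * R -> R) A z : (f z `^ (q / r) * wgt rho A z `^ (p * i - q / r)) `^ r =
    f z `^ q * wgt rho A z `^ (p * i * r - q).
  by rewrite powR_combr divfK ?(gt_eqF r0)// mulrBl divfK ?(gt_eqF r0).
rewrite /tent_bd; case: eqP => [i00|/eqP in0].
  have [C C0 H] := weighted_carleson; exists C => // f A f0 mf AM x s s0.
  apply: le_trans (H f A f0 mf AM x s s0).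
  rewrite le_eqVlt; apply/orP; left; apply/eqP/eq_integral => z _.
  by rewrite E i00 mulr0 mul0r add0r.
have {}i0 : 0 < i by rewrite lt_neqAle eq_sym in0.
have k0 : 0 < (i * r)^-1 by rewrite invr_gt0 mulr_gt0.
have kE : p / (i * r)^-1 - q = p * i * r - q by rewrite invrK mulrA.
have [C C0 H] : exists2 C : R, 0 <= C & forall (f : X * R -> R) (A : X -> R),
  (forall z, 0 <= f z) -> measurable_fun setT f -> area_majorant f A ->
  (\int[mu]_x (cone_int (fun z => f z `^ q * wgt rho A z `^ (p / (i * r)^-1 - q))%R x `^ (i * r)^-1) <= C%:E)%E.
  have [t0|/ltW t0] := leP 0 (p / (i * r)^-1 - q).
    exact: weighted_area_ge0.
  have [k1|k1] := leP (i * r)^-1 1.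
    by apply: weighted_area_lt0_le1 => //; rewrite k0.
  exact: weighted_area_lt0_gt1.
exists C; [exact: C0|move=> f A f0 mf AM; apply: le_trans (H f A f0 mf AM)].
rewrite kE; under eq_integral do under eq_cone_int do rewrite E.
exact: lexx.
Qed.

(** Let S be the cone integral of f^q. If q < p, then S^{p/q} <= A^{p - q} S, and the average of
    A^{p - q} is at most 2 a^{p - q}, which uses p - q <= rho. If p <= q, then a <= B on cones gives
    a^{p - q} >= B^{p - q}, and S^{p/q} is split into a multiple of B^{p - q} S and a small multiple
    of B^p. *)
Lemma weighted_pairing (eta : R) : 0 < eta -> p - q <= rho ->
  exists2 c : R, 0 < c & forall (f : X * R -> R) (A : X -> R),
  (forall z, 0 <= f z) -> measurable_fun setT f -> area_majorant f A ->
  (eta%:E <= \int[mu]_x (cone_int (fun z => f z `^ q)%R x `^ (p / q)))%E ->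
  (c%:E <= \int[lam]_z (f z `^ q * wgt rho A z `^ (p - q) * W z)%:E)%E.
Proof.
move=> eta0 pq; have p0 : 0 < p by exact: lt_trans rho_lt.
have k0 : 0 < p / q by rewrite divr_gt0.
have [qp|pq'] := ltP q p.
  exists (eta / 2); first by rewrite divr_gt0.
  move=> f A f0 mf AM; have Afin := area_majorant_lty AM.
  have [A0 mA A1 Ale] := AM.
  have mfq : measurable_fun setT (fun z => f z `^ q) by exact: measurable_fun_powR.
  have fq0 z : 0 <= f z `^ q by exact: powR_ge0.
  have mw := measurable_wgt rho mA.
  have mwt : measurable_fun setT (fun z => wgt rho A z `^ (p - q)) by exact: measurable_fun_powR.
  have mAe : measurable_fun setT (fun x => A x `^ (p - q)) by exact: measurable_fun_powR.
  have mW := measurable_dt_weight.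
  pose S x := cone_int (fun z => f z `^ q) x.
  have S0 x : (0 <= S x)%E by exact: cone_int_ge0.
  have mS : measurable_fun setT S by exact: measurable_cone_int.
  have E0 z : (0 <= (f z `^ q * wgt rho A z `^ (p - q) * W z)%:E)%E.
    by rewrite lee_fin mulr_ge0 ?dt_weight_ge0// mulr_ge0 ?powR_ge0.
  have mE : measurable_fun setT (fun z => (f z `^ q * wgt rho A z `^ (p - q) * W z)%:E).
    by apply/measurable_EFinP; apply: measurable_funM => //; apply: measurable_funM.
  move=> h; have : (eta%:E <= 2%:E * \int[lam]_z (f z `^ q * wgt rho A z `^ (p - q) * W z)%:E)%E.
    apply: le_trans h _.
    apply: (@le_trans _ _ (\int[mu]_x ((A x `^ (p - q))%:E * S x))%E).
      apply: ae_le_integralT.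
      - by move=> x; exact: poweR_ge0.
      - by move=> x; rewrite mule_ge0// lee_fin powR_ge0.
      - exact: (measurableT_comp (measurable_poweR _)).
      - by apply: emeasurable_funM => //; exact/measurable_EFinP.
      apply: filterS Ale => x; rewrite -/(S x); move: (S0 x); case: (S x) => [v|_|//]; last first.
        by rewrite leye_eq.
      move=> v0e vAe; have v0 : 0 <= v by rewrite -lee_fin.
      have vA : v <= A x `^ q by rewrite -lee_fin.
      rewrite poweR_EFin -EFinM lee_fin.
      rewrite -(mulr_powRB1 v0 k0) mulrC ler_wpM2r//.
      apply: (@le_trans _ _ ((A x `^ q) `^ (p / q - 1))).
        rewrite ge0_ler_powR ?nnegrE ?powR_ge0// subr_ge0 ler_pdivlMr// mul1r ltW//.
      by rewrite -powRrM mulrBr mulr1 mulrC divfK// gt_eqF.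
    rewrite (cone_fubini _ mAe fq0 mfq); last by move=> x; exact: powR_ge0.
    rewrite -(ge0_integralZlT lam (ler0n R 2) E0 mE).
    apply: ge0_le_integralT.
    - move=> z; apply: mule_ge0; first by rewrite lee_fin (mulr_ge0 (fq0 z) (dt_weight_ge0 z)).
      by apply: cavg_ge0 => x; exact: powR_ge0.
    - apply: emeasurable_funM; last by apply: measurable_cavg => // x; exact: powR_ge0.
      by apply/measurable_EFinP; apply: measurable_funM.
    - by apply: emeasurable_funM.
    move=> z; have [z0|z0] := pselect (0 < z.2); last by rewrite dt_weight_out// !mulr0 mul0e mule0.
    apply: (@le_trans _ _ ((f z `^ q * W z)%:E * (2 * wgt rho A z `^ (p - q))%:E)%E).
      apply: lee_wpmul2l; first by rewrite lee_fin mulr_ge0 ?dt_weight_ge0.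
      by apply: (wgt_pos rho_gt0 rho_lt) => //; rewrite subr_ge0 ltW.
    by rewrite -!EFinM lee_fin le_eqVlt; apply/orP; left; apply/eqP; ring.
  have : (0 <= \int[lam]_z (f z `^ q * wgt rho A z `^ (p - q) * W z)%:E)%E by exact: integral_ge0.
  move: (integral _ _ _) => [v|_ _|//]; last by rewrite leey.
  rewrite -EFinM !lee_fin => v0; lra.
have [C C0 maj] := wgt_majorant rho_gt0 rho_lt.
have k1 : p / q <= 1 by rewrite ler_pdivrMr// mul1r.
(* Here et C <= eta / 2, so the term with B^p uses at most half of eta; D is the matching constant,
   with D^k et^{1 - k} = 1. *)
pose k := p / q; pose et := eta / (2 * (C + 1)).
have et0 : 0 < et by rewrite divr_gt0// mulr_gt0// ltr_wpDl.
pose D := et `^ (- ((1 - k) / k)); have D0 : 0 < D by rewrite powR_gt0.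
exists (eta / (2 * D)); first by rewrite divr_gt0// mulr_gt0.
move=> f A f0 mf AM; have Afin := area_majorant_lty AM.
have [A0 mA A1 Ale] := AM.
have [B [AB mB Bw Bint]] := maj A A0 mA Afin.
have B0 x : 0 < B x := lt_le_trans (A0 x) (AB x).
have mfq : measurable_fun setT (fun z => f z `^ q) by exact: measurable_fun_powR.
have fq0 z : 0 <= f z `^ q by exact: powR_ge0.
have mw := measurable_wgt rho mA.
have mwt : measurable_fun setT (fun z => wgt rho A z `^ (p - q)) by exact: measurable_fun_powR.
have mfw : measurable_fun setT (fun z => f z `^ q * wgt rho A z `^ (p - q)) by exact: measurable_funM.
have fw0 z : 0 <= f z `^ q * wgt rho A z `^ (p - q) by rewrite mulr_ge0 ?powR_ge0.
have mBe : measurable_fun setT (fun x => B x `^ (p - q)) by exact: measurable_fun_powR.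
have mBp : measurable_fun setT (fun x => (B x `^ p)%:E).
  by apply/measurable_EFinP; exact: measurable_fun_powR.
pose S x := cone_int (fun z => f z `^ q) x.
have S0 x : (0 <= S x)%E by exact: cone_int_ge0.
have mS : measurable_fun setT S by exact: measurable_cone_int.
have mBS : measurable_fun setT (fun x => (B x `^ (p - q))%:E * S x)%E.
  by apply: emeasurable_funM => //; exact/measurable_EFinP.
have BS0 x : (0 <= (B x `^ (p - q))%:E * S x)%E by rewrite mule_ge0// lee_fin powR_ge0.
have Bp0 x : (0 <= (B x `^ p)%:E)%E by rewrite lee_fin powR_ge0.
move=> h; rewrite (upper_integral_cone_int fw0 mfw).
apply: (@le_trans _ _ (\int[mu]_x ((B x `^ (p - q))%:E * S x))%E); last first.
  apply: ae_le_integralT => //; first by move=> x; exact: cone_int_ge0.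
    exact: measurable_cone_int.
  apply: filterS Bw => x hx.
  rewrite -(cone_intZ x (powR_ge0 _ _) fq0 mfq); apply: le_cone_int => //.
  - by move=> z; rewrite mulr_ge0 ?powR_ge0.
  - exact: measurable_funM.
  move=> z xz; rewrite mulrC ler_wpM2l//.
  have [z0 _] := (coneP x z).1 xz; have w0 := wgt_gt0 rho_gt0 rho_lt A0 mA Afin z0.
  rewrite -(opprB q p) !powRN lef_pV2 ?posrE ?(powR_gt0 _ w0) ?(powR_gt0 _ (B0 x))//.
  by rewrite ge0_ler_powR ?nnegrE ?subr_ge0 ?(ltW w0) ?(ltW (B0 x))//; exact: hx.
have : (eta%:E <= D%:E * \int[mu]_x ((B x `^ (p - q))%:E * S x) + (eta / 2)%:E)%E.
  apply: le_trans h _.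
  apply: (@le_trans _ _ (\int[mu]_x (D%:E * ((B x `^ (p - q))%:E * S x) + et%:E * (B x `^ p)%:E))%E).
    apply: ge0_le_integralT.
    - by move=> x; exact: poweR_ge0.
    - exact: (measurableT_comp (measurable_poweR _)).
    - by apply: emeasurable_funD; exact: emeasurable_funM.
    move=> x; rewrite -/(S x); move: (S0 x); case: (S x) => [v|_|//]; last first.
      by rewrite (gt0_muley (x := (B x `^ (p - q))%:E)) ?lte_fin ?powR_gt0// gt0_muley ?lte_fin// addye// leey.
    rewrite lee_fin => v0; rewrite poweR_EFin -!EFinM -EFinD lee_fin.
    have x0 : 0 <= D * (B x `^ (p - q) * v) by rewrite !mulr_ge0 ?powR_ge0 ?(ltW D0).
    have y0 : 0 <= et * B x `^ p by rewrite mulr_ge0 ?powR_ge0 ?(ltW et0).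
    have := powR_mix_le x0 y0 (k := k); rewrite (ltW k0) k1 => /(_ isT); apply: le_trans.
    rewrite (powRM _ (ltW D0)) ?mulr_ge0 ?powR_ge0// (powRM k (powR_ge0 _ _) v0).
    rewrite (powRM _ (ltW et0)) ?powR_ge0// -/k /D -!powRrM.
    rewrite (_ : (_ * (_ * _)) * (_ * _) = (et `^ (- ((1 - k) / k) * k) * et `^ (1 - k)) * (B x `^ ((p - q) * k) * B x `^ (p * (1 - k))) * v `^ k); last by ring.
    rewrite -!powRgtD// (_ : - ((1 - k) / k) * k + (1 - k) = 0); last by field; rewrite gt_eqF.
    rewrite (_ : (p - q) * k + p * (1 - k) = 0); last by rewrite /k; field; rewrite gt_eqF.
    by rewrite !powRr0 !mul1r.
  rewrite ge0_integralDT; first last.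
  - exact: emeasurable_funM.
  - exact: emeasurable_funM.
  - by move=> x; rewrite mule_ge0// lee_fin ltW.
  - by move=> x; rewrite mule_ge0// lee_fin ltW.
  rewrite (ge0_integralZlT mu (ltW D0) BS0 mBS) (ge0_integralZlT mu (ltW et0) Bp0 mBp).
  apply: leeD2l; apply: (@le_trans _ _ (et%:E * C%:E)%E).
    apply: lee_wpmul2l; first by rewrite lee_fin ltW.
    by apply: le_trans Bint _; rewrite -[leRHS]mule1; apply: lee_wpmul2l.
  rewrite -EFinM lee_fin (_ : et * C = eta / 2 * (C / (C + 1))); last first.
    by rewrite /et; field; rewrite gt_eqF// ltr_wpDl.
  apply: ler_piMr; first by rewrite divr_ge0 ?(ltW eta0).
  by rewrite ler_pdivrMr ?ltr_wpDl// mul1r lerDl.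
have : (0 <= \int[mu]_x ((B x `^ (p - q))%:E * S x))%E by exact: integral_ge0.
clear -D0 eta0; move: (integral _ _ _) => [v|_ _|//]; last by rewrite leey.
rewrite -EFinM -EFinD !lee_fin => v0 h.
rewrite ler_pdivrMr ?mulr_gt0// (mulrC 2) mulrA (mulrC v).
by move: h; set b := D * v; lra.
Qed.

End weighted.

(** Added to a square function, w makes it strictly positive without spoiling integrability; the
    lower bounds on balls make the majorants of truncated functions bounded away from 0 where this
    matters. *)
Lemma localizing_weight : exists w : X -> R, [/\ measurable_fun setT w,
  forall x, 0 < w x <= 1, (\int[mu]_x (w x)%:E <= 1)%E &
  forall n : nat, exists2 c : R, 0 < c & forall x, ball o n.+1%:R x -> c <= w x].
Proof.
pose V n := fine (vol mu o n.+1%:R).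
have V0 n : 0 < V n by exact: fine_vol_gt0.
have VE n : (V n)%:E = vol mu o n.+1%:R by rewrite fineK// vol_fin.
(* Dividing by 1 + V n keeps both b n and b n V n below 2^{-(n + 1)}: the first bounds w by 1, the
   second its integral. *)
pose b n := (1 / (2 ^ (n + 1))%:R) / (1 + V n).
have V1 n : 0 < 1 + V n by rewrite addr_gt0.
have t0 n : 0 < 1 / (2 ^ (n + 1))%:R :> R by rewrite divr_gt0// ltr0n expn_gt0.
have b0 n : 0 < b n by rewrite divr_gt0.
have bt n : b n <= 1 / (2 ^ (n + 1))%:R.
  by rewrite ler_pdivrMr// ler_peMr ?(ltW (t0 n))// lerDl ltW.
have bV n : b n * V n <= 1 / (2 ^ (n + 1))%:R.
  by rewrite mulrAC ler_pdivrMr// ler_wpM2l ?(ltW (t0 n))// lerDr ler01.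
pose u n x : \bar R := (b n * \1_(ball o n.+1%:R) x)%:E.
have u0 n x : (0 <= u n x)%E by rewrite lee_fin mulr_ge0// ltW.
have mu_ n : measurable_fun setT (u n).
  apply/measurable_EFinP; apply: measurable_funM => //; apply: measurable_indic.
  exact: measurable_ball_borel.
have geo : (\sum_(n <oo) (1 / (2 ^ (n + 1))%:R : R)%:E = 1)%E.
  by apply/cvg_lim => //; have := @cvg_geometric_eseries_half R 1 0; rewrite expr0 divr1.
pose s x := (\sum_(n <oo) u n x)%E.
have s0 x : (0 <= s x)%E by apply: nneseries_ge0 => n _ _; exact: u0.
have s1 x : (s x <= 1)%E.
  rewrite -geo; apply: lee_nneseries => [n _ _|n _]; first exact: u0.
  by rewrite lee_fin (le_trans _ (bt n))// ler_piMr ?(ltW (b0 n))// indicE.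
have ms : measurable_fun setT s by apply: ge0_emeasurable_sum.
have sfin x : s x \is a fin_num.
  by rewrite ge0_fin_numE// (le_lt_trans (s1 x))// ltry.
have low n x : ball o n.+1%:R x -> b n <= fine (s x).
  move=> xn; rewrite -lee_fin fineK//; apply: (@le_trans _ _ (u n x)).
    by rewrite lee_fin indicE mem_set// mulr1.
  have := @nneseries_lim_ge R (u ^~ x) xpredT 0 n.+1 (fun k _ _ => u0 k x); apply: le_trans.
  by rewrite big_nat_recr//= leeDr// sume_ge0.
exists (fun x => fine (s x)); split.
- by apply: measurableT_comp => //; exact: fine_measurable.
- move=> x; apply/andP; split; last by rewrite -lee_fin fineK.
  apply: lt_le_trans (b0 (Num.truncn (mdist o x))) (low _ _ _).
  by apply/in_ball; rewrite truncnS_gt.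
- under eq_integral do rewrite fineK//.
  rewrite integral_nneseries//; rewrite -geo; apply: lee_nneseries => [n _ _|n _].
    by apply: integral_ge0 => x _; exact: u0.
  rewrite /u; under eq_integral do rewrite EFinM.
  rewrite ge0_integralZlT ?(ltW (b0 n))//; last first.
    by apply/measurable_EFinP; apply: measurable_indic; exact: measurable_ball_borel.
  rewrite integral_indic ?setIT//; last exact: measurable_ball_borel.
  by rewrite -/(vol mu o n.+1%:R) -VE -EFinM lee_fin.
- by move=> n; exists (b n) => // x; exact: low.
Qed.

Lemma cone_intD g g' x : (forall z, 0 <= g z) -> (forall z, 0 <= g' z) ->
  measurable_fun setT g -> measurable_fun setT g' ->
  cone_int (fun z => g z + g' z) x = (cone_int g x + cone_int g' x)%E.
Proof.
move=> g0 g0' mg mg'; rewrite -ge0_integralDT//.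
- by apply: eq_integral => z _; rewrite -EFinD -!mulrDl.
- by move=> z; rewrite lee_fin cone_integrand_ge0.
- by move=> z; rewrite lee_fin cone_integrand_ge0.
- exact: measurable_cone_integrand.
- exact: measurable_cone_integrand.
Qed.

(* The summand w only makes the majorant strictly positive. *)
Definition area_wgt (q : R) (w : X -> R) (f : X * R -> R) (x : X) : R :=
  4^-1 * (fine (cone_int (fun z => f z `^ q)%R x) `^ q^-1 + w x).

(** The factor 1 / 4 keeps the integral of the p-th power below 1: (s + w)^p <= 2^p (s^p + w^p),
    both integrals are at most 1 because w^p <= w, and 4^{-p} 2^p 2 <= 1 for p >= 1. *)
Lemma area_majorant_exists (p q : R) (w : X -> R) (f : X * R -> R) :
  1 <= p -> 0 < q -> measurable_fun setT w -> (forall x, 0 < w x <= 1) ->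
  (\int[mu]_x (w x)%:E <= 1)%E ->
  (forall z, 0 <= f z) -> measurable_fun setT f ->
  (\int[mu]_x (cone_int (fun z => f z `^ q)%R x `^ (p / q)) <= 1)%E ->
  area_majorant p q (fun z => 4^-1 * f z) (area_wgt q w f).
Proof.
move=> p1 q0 mw w01 wint f0 mf int1.
have p0 : 0 < p by lra.
have mfq : measurable_fun setT (fun z => f z `^ q) by exact: measurable_fun_powR.
have fq0 z : 0 <= f z `^ q by exact: powR_ge0.
pose S x := cone_int (fun z => f z `^ q) x.
have S0 x : (0 <= S x)%E by exact: cone_int_ge0.
have mS : measurable_fun setT S by exact: measurable_cone_int.
have mSp : measurable_fun setT (fun x => S x `^ (p / q))%E.
  exact: (measurableT_comp (measurable_poweR _)).
have Sfin : {ae mu, forall x, S x \is a fin_num}.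
  have : mu.-integrable setT (fun x => S x `^ (p / q))%E.
    apply/integrableP; split => //.
    under eq_integral do rewrite gee0_abs ?poweR_ge0//.
    by apply: le_lt_trans int1 _; rewrite ltry.
  move=> /(integrable_ae measurableT); apply: filterS => x /(_ I) fx.
  rewrite ge0_fin_numE//; apply: (@lty_poweRy _ _ (p / q)).
    by rewrite gt_eqF// divr_gt0.
  by rewrite -ge0_fin_numE// poweR_ge0.
have w0 x : 0 < w x by case/andP: (w01 x).
have w1 x : w x <= 1 by case/andP: (w01 x).
pose s x := fine (S x) `^ q^-1.
have s0 x : 0 <= s x by exact: powR_ge0.
have ms : measurable_fun setT s.
  by apply: measurable_fun_powR; apply: measurableT_comp => //; exact: fine_measurable.
have q4 : 0 < 4^-1 :> R by rewrite invr_gt0.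
split.
- by move=> x; rewrite /area_wgt mulr_gt0// -/(S x) -/(s x) ltr_wpDl.
- by apply: measurable_funM => //; apply: measurable_funD.
- have msp : measurable_fun setT (fun x => (s x `^ p)%:E).
    by apply/measurable_EFinP; exact: measurable_fun_powR.
  have mwE : measurable_fun setT (fun x => (w x)%:E) by exact/measurable_EFinP.
  have c0 : 0 <= 4^-1 `^ p * 2 `^ p :> R by rewrite mulr_ge0 ?powR_ge0.
  have D0 x : (0 <= (s x `^ p)%:E + (w x)%:E)%E.
    by rewrite adde_ge0 ?lee_fin ?powR_ge0// ltW.
  apply: (@le_trans _ _ (\int[mu]_x ((4^-1 `^ p * 2 `^ p)%:E * ((s x `^ p)%:E + (w x)%:E)))%E).
    apply: ge0_le_integralT.
    - by move=> x; rewrite lee_fin powR_ge0.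
    - apply/measurable_EFinP; apply: measurable_fun_powR.
      by apply: measurable_funM => //; exact: measurable_funD.
    - by apply: emeasurable_funM => //; exact: emeasurable_funD.
    move=> x; rewrite -EFinD -EFinM lee_fin /area_wgt -/(S x) -/(s x).
    rewrite (powRM _ (ltW q4)) ?addr_ge0 ?(ltW (w0 x))// -mulrA.
    apply: ler_wpM2l; first exact: powR_ge0.
    apply: le_trans (powR_add_le (s0 x) (ltW (w0 x)) (ltW p0)) _.
    apply: ler_wpM2l; first exact: powR_ge0.
    rewrite lerD2l -(subrKC 1 p) powRgtD// powRr1 ?(ltW (w0 x))//.
    rewrite ler_piMr ?(ltW (w0 x))//.
    rewrite -[leRHS](_ : 1 `^ (p - 1) = 1 :> R); last by rewrite powR1.
    by rewrite ge0_ler_powR ?nnegrE ?subr_ge0 ?(ltW (w0 x)).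
  rewrite (ge0_integralZlT mu c0 D0 (emeasurable_funD msp mwE)).
  rewrite (ge0_integralDT mu _ _ msp mwE); last 2 first.
  - by move=> x; rewrite lee_fin powR_ge0.
  - by move=> x; rewrite lee_fin ltW.
  apply: (@le_trans _ _ ((4^-1 `^ p * 2 `^ p)%:E * (1 + 1))%E).
    apply: lee_wpmul2l; first by rewrite lee_fin.
    apply: leeD wint; apply: le_trans int1; apply: ge0_le_integralT => //.
      by move=> x; rewrite lee_fin powR_ge0.
    move=> x; rewrite /s -/(S x); move: (S0 x); case: (S x) => [v|_|//].
      by rewrite lee_fin => v0; rewrite poweR_EFin lee_fin -powRrM mulrC.
    by rewrite poweRyr ?leey// gt_eqF// divr_gt0.
  rewrite -EFinD -EFinM lee_fin -powRM// ?invr_ge0//.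
  rewrite (_ : 4^-1 * 2 = 2^-1 :> R); last by field.
  rewrite -powR_inv1// -powRrM mulN1r powRN mulrC ler_pdivrMr ?powR_gt0// mul1r.
  by have := ler_powR (ler1n R 2) p1; rewrite powRr1.
- apply: filterS Sfin => x Sx.
  rewrite (_ : cone_int _ x = ((4^-1 `^ q)%:E * S x)%E); last first.
    rewrite -cone_intZ ?powR_ge0//; apply: eq_cone_int => z.
    by rewrite powRM ?invr_ge0.
  rewrite -(fineK Sx) -EFinM lee_fin /area_wgt -/(S x) -/(s x).
  rewrite (powRM _ (ltW q4)) ?addr_ge0 ?(ltW (w0 x))//.
  apply: ler_wpM2l; first exact: powR_ge0.
  apply: (@le_trans _ _ (s x `^ q)).
    by rewrite /s -powRrM mulVf ?gt_eqF// powRr1// fine_ge0.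
  by rewrite ge0_ler_powR ?nnegrE ?addr_ge0 ?(ltW q0) ?(ltW (w0 x))// lerDl ltW.
Qed.

Lemma area_majorant_tent_bd (i r : R) (w : X -> R) (f : X * R -> R) :
  0 < i <= 1 -> 0 < r -> measurable_fun setT w -> (forall x, 0 < w x <= 1) ->
  (\int[mu]_x (w x)%:E <= 1)%E ->
  (forall z, 0 <= f z) -> measurable_fun setT f -> tent_bd i r 1 f ->
  area_majorant i^-1 r (fun z => 4^-1 * f z) (area_wgt r w f).
Proof.
move=> /andP[i0 i1] r0 mw w01 wint f0 mf; rewrite /tent_bd gt_eqF// => tf.
apply: area_majorant_exists => //; first by rewrite invf_ge1.
by rewrite -invfM.
Qed.

(** * The pairing inequality between dual tent spaces *)

Lemma mul_le_powR_dual (r x y : R) : 1 < r -> 0 <= x -> 0 <= y ->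
  x * y <= x `^ r + y `^ (r / (r - 1)).
Proof.
move=> r1 x0 y0; have r0 : 0 < r by lra.
have k : 0 <= r^-1 <= 1 by rewrite invr_ge0 (ltW r0) invf_le1// ltW.
apply: le_trans (powR_mix_le (powR_ge0 x r) (powR_ge0 y (r / (r - 1))) k).
rewrite -!powRrM mulfV ?gt_eqF// powRr1//.
rewrite (_ : r / (r - 1) * (1 - r^-1) = 1) ?powRr1//.
by field; rewrite gt_eqF//= subr_eq0 gt_eqF.
Qed.

(** Young's inequality is used twice: inside the cone at x, after division by the majorants A(x) and
    B(x), and then for A and B themselves with the exponents 1 / i and 1 / (1 - i). *)
Lemma tent_duality_fin (r i : R) : 1 < r -> 0 < i < 1 ->
  forall F G : X * R -> R, (forall z, 0 <= F z) -> (forall z, 0 <= G z) ->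
  measurable_fun setT F -> measurable_fun setT G ->
  tent_bd i r 1 F -> tent_bd (1 - i) (r / (r - 1)) 1 G ->
  (\int[lam]_z (F z * G z * W z)%:E <= 64%:E)%E.
Proof.
move=> r1 /andP[i0 i1] F G F0 G0 mF mG tF tG.
have [w [mw w01 wint _]] := localizing_weight.
have r0 : 0 < r by lra.
have r'0 : 0 < r / (r - 1) by rewrite divr_gt0// subr_gt0.
pose r' := r / (r - 1); rewrite -/r' in tG r'0.
have j0 : 0 < 1 - i by rewrite subr_gt0.
have i1' : 0 < i <= 1 by rewrite i0 ltW.
have j1' : 0 < 1 - i <= 1 by rewrite j0 /=; lra.

have [A0 mA A1 Ale] := area_majorant_tent_bd i1' r0 mw w01 wint F0 mF tF.
have [B0 mB B1 Ble] := area_majorant_tent_bd j1' r'0 mw w01 wint G0 mG tG.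
move: (area_wgt r w F) (area_wgt r' w G) A0 mA A1 Ale B0 mB B1 Ble => A B A0 mA A1 Ale B0 mB B1 Ble.
have mFr : measurable_fun setT (fun z => (4^-1 * F z) `^ r).
  by apply: measurable_fun_powR; exact: measurable_funM.
have mGr : measurable_fun setT (fun z => (4^-1 * G z) `^ r').
  by apply: measurable_fun_powR; exact: measurable_funM.
have FG0 z : 0 <= F z * G z by exact: mulr_ge0.
have mFG : measurable_fun setT (fun z => F z * G z) by exact: measurable_funM.
have mAp : measurable_fun setT (fun x => (A x `^ i^-1)%:E).
  by apply/measurable_EFinP; exact: measurable_fun_powR.
have mBp : measurable_fun setT (fun x => (B x `^ (1 - i)^-1)%:E).
  by apply/measurable_EFinP; exact: measurable_fun_powR.
have Ap0 x : (0 <= (A x `^ i^-1)%:E)%E by rewrite lee_fin powR_ge0.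
have Bp0 x : (0 <= (B x `^ (1 - i)^-1)%:E)%E by rewrite lee_fin powR_ge0.
have AB0 x : (0 <= (A x `^ i^-1)%:E + (B x `^ (1 - i)^-1)%:E)%E by exact: adde_ge0.
rewrite (upper_integral_cone_int FG0 mFG).
apply: (@le_trans _ _ (\int[mu]_x (32%:E * ((A x `^ i^-1)%:E + (B x `^ (1 - i)^-1)%:E)))%E); last first.
  rewrite (ge0_integralZlT mu (ler0n R 32) AB0 (emeasurable_funD mAp mBp)).
  rewrite (ge0_integralDT mu Ap0 Bp0 mAp mBp).
  rewrite (_ : 64%:E = (32%:E * (1 + 1))%E); last by rewrite -EFinD -EFinM; congr EFin; ring.
  by apply: lee_wpmul2l; [rewrite lee_fin ler0n|exact: leeD A1 B1].
apply: ae_le_integralT.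
- by move=> x; exact: cone_int_ge0.
- by move=> x; apply: mule_ge0 (AB0 x); rewrite lee_fin ler0n.
- exact: measurable_cone_int.
- by apply: emeasurable_funM => //; exact: emeasurable_funD.
apply: filterS2 Ale Ble => x hA hB.
pose a := A x; pose b := B x; have a0 : 0 < a := A0 x; have b0 : 0 < b := B0 x.
(* These are the coefficients of Young's inequality for F / (4 a) and G / (4 b), multiplied back by
   16 a b. *)
pose c1 := 16 * a * b * a `^ (- r); pose c2 := 16 * a * b * b `^ (- r').
have c10 : 0 <= c1 by rewrite /c1 !mulr_ge0 ?powR_ge0 ?(ltW a0) ?(ltW b0).
have c20 : 0 <= c2 by rewrite /c2 !mulr_ge0 ?powR_ge0 ?(ltW a0) ?(ltW b0).
apply: (@le_trans _ _ (cone_int (fun z => c1 * (4^-1 * F z) `^ r + c2 * (4^-1 * G z) `^ r')%R x)).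
  apply: le_cone_int => //.
    by apply: measurable_funD; exact: measurable_funM.
  move=> z _; have F4 : 0 <= 4^-1 * F z / a by rewrite mulr_ge0 ?mulr_ge0 ?invr_ge0 ?(ltW a0).
  have G4 : 0 <= 4^-1 * G z / b by rewrite mulr_ge0 ?mulr_ge0 ?invr_ge0 ?(ltW b0).
  have := mul_le_powR_dual r1 F4 G4; rewrite -/r'.
  rewrite (powRM _ (mulr_ge0 _ (F0 z))) ?invr_ge0 ?(ltW a0)//.
  rewrite (powRM _ (mulr_ge0 _ (G0 z))) ?invr_ge0 ?(ltW b0)//.
  rewrite -(powR_inv1 (ltW a0)) -(powR_inv1 (ltW b0)) -!powRrM !mulN1r => H.
  have ab0 : 0 <= 16 * a * b by rewrite !mulr_ge0 ?(ltW a0) ?(ltW b0).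
  have := ler_wpM2l ab0 H; rewrite !powRN !powRr1 ?(ltW a0) ?(ltW b0)// /c1 /c2 !powRN.
  move: (_ `^ r) (_ `^ r') (a `^ r) (b `^ r') => u v u' v'.
  have e16 (f g x' y' : R) : 0 < x' -> 0 < y' ->
      16 * x' * y' * (4^-1 * f / x' * (4^-1 * g / y')) = f * g.
    by move=> x'0 y'0; field; rewrite !gt_eqF.
  rewrite e16//.
  move=> /le_trans; apply; rewrite le_eqVlt; apply/orP; left; apply/eqP; ring.
rewrite cone_intD; first last.
- exact: measurable_funM.
- exact: measurable_funM.
- by move=> z; rewrite mulr_ge0 ?powR_ge0.
- by move=> z; rewrite mulr_ge0 ?powR_ge0.
rewrite (cone_intZ x c10 _ mFr); last by move=> z; exact: powR_ge0.
rewrite (cone_intZ x c20 _ mGr); last by move=> z; exact: powR_ge0.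
apply: (@le_trans _ _ (c1%:E * (a `^ r)%:E + c2%:E * (b `^ r')%:E)%E).
  by apply: leeD; apply: lee_wpmul2l; rewrite ?lee_fin.
rewrite -(EFinM c1) -(EFinM c2) -(EFinD (c1 * _)) -(EFinD (A x `^ _)) -(EFinM 32) lee_fin.
rewrite /c1 /c2 !powRN !mulfVK ?gt_eqF ?powR_gt0//.
have k : 0 <= i <= 1 by rewrite !ltW.
have := powR_mix_le (powR_ge0 a i^-1) (powR_ge0 b (1 - i)^-1) k.
rewrite -!powRrM !mulVf ?gt_eqF// !powRr1 ?(ltW a0) ?(ltW b0)//.
rewrite -/a -/b; move: (a `^ _) (b `^ _) => u v; set ab := a * b; rewrite -mulrA -/ab; lra.
Qed.

(** With the weight a of F, F G is at most a constant times F^r a^{1 - r} + G^{r'} a. The first term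
    is the weighted area estimate with k = 1. The second is the Carleson embedding with exponent 2
    for A^{1/2}: the choice rho = 1 / 2 makes a the square of the average of A^{1/2}. *)
Lemma tent_duality1 (r : R) : 1 < r -> exists2 C : R, 0 <= C &
  forall F G : X * R -> R, (forall z, 0 <= F z) -> (forall z, 0 <= G z) ->
  measurable_fun setT F -> measurable_fun setT G ->
  tent_bd 1 r 1 F -> tent_bd 0 (r / (r - 1)) 1 G ->
  (\int[lam]_z (F z * G z * W z)%:E <= C%:E)%E.
Proof.
move=> r1; have r0 : 0 < r by lra.
have h0 : 0 < 2^-1 :> R by rewrite invr_gt0.
have h1 : 2^-1 < 1 :> R by rewrite invf_lt1// ltr1n.
have k11 : 0 < (1:R) <= 1 by rewrite ltr01 lexx.
have tau0 : 1 / 1 - r <= 0 by rewrite divr1 subr_le0 ltW.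
have [C1 C10 H1] := weighted_area_lt0_le1 h0 h1 k11 tau0.
have [C2 C20 H2] := carleson_embedding (ltr1n R 2 : 1 < 2 :> R).
exists (4 * (C1 + C2)); first by rewrite mulr_ge0// addr_ge0.
move=> F G F0 G0 mF mG tF tG.
have [w [mw w01 wint _]] := localizing_weight.
have := area_majorant_tent_bd k11 r0 mw w01 wint F0 mF tF; rewrite invr1.
move: (area_wgt r w F) => A AM; have Afin := area_majorant_lty AM.
have [A0 mA A1 _] := AM.
pose F4 z := 4^-1 * F z.
have F40 z : 0 <= F4 z by rewrite mulr_ge0 ?invr_ge0.
have mF4 : measurable_fun setT F4 by exact: measurable_funM.
have mwg := measurable_wgt 2^-1 mA.
pose r' := r / (r - 1); rewrite -/r' in tG.
pose P z := F4 z `^ r * wgt 2^-1 A z `^ (1 - r).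
pose Q z := G z `^ r' * wgt 2^-1 A z.
have P0 z : 0 <= P z by rewrite mulr_ge0 ?powR_ge0.
have Q0 z : 0 <= Q z by rewrite mulr_ge0 ?powR_ge0 ?wgt_ge0.
have mP : measurable_fun setT P.
  by apply: measurable_funM; [exact: measurable_fun_powR|exact: measurable_fun_powR].
have mQ : measurable_fun setT Q by apply: measurable_funM => //; exact: measurable_fun_powR.
have mW := measurable_dt_weight.
have mPW : measurable_fun setT (fun z => (P z * W z)%:E).
  by apply/measurable_EFinP; exact: measurable_funM.
have mQW : measurable_fun setT (fun z => (Q z * W z)%:E).
  by apply/measurable_EFinP; exact: measurable_funM.
have PW0 z : (0 <= (P z * W z)%:E)%E by rewrite lee_fin (mulr_ge0 (P0 z) (dt_weight_ge0 z)).
have QW0 z : (0 <= (Q z * W z)%:E)%E by rewrite lee_fin (mulr_ge0 (Q0 z) (dt_weight_ge0 z)).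
have IP : (\int[lam]_z (P z * W z)%:E <= C1%:E)%E.
  rewrite (upper_integral_cone_int P0 mP); have := H1 F4 A F40 mF4 AM.
  apply: le_trans; rewrite le_eqVlt; apply/orP; left; apply/eqP/eq_integral => x _.
  by rewrite poweRe1 ?cone_int_ge0 ?divr1// => z; rewrite mulr_ge0 ?powR_ge0.
have IQ : (\int[lam]_z (Q z * W z)%:E <= C2%:E)%E.
  have g0 z : 0 <= G z `^ r' * W z by rewrite mulr_ge0 ?powR_ge0 ?dt_weight_ge0.
  have mg : measurable_fun setT (fun z => G z `^ r' * W z).
    by apply: measurable_funM => //; exact: measurable_fun_powR.
  rewrite /tent_bd eqxx in tG.
  have := H2 _ 1 g0 mg ler01 tG (fun x => A x `^ 2^-1) (fun x => powR_ge0 _ _) (measurable_fun_powR _ mA).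
  under [X in (_ <= _ * X)%E]eq_integral do rewrite -powRrM mulVf// powRr1 ?(ltW (A0 _))//.
  move=> h; apply: (@le_trans _ _ (C2%:E * 1)%E); last by rewrite mule1.
  have {}A1 : (\int[mu]_x (A x)%:E <= 1)%E.
    by apply: le_trans A1; under [leRHS]eq_integral do rewrite powRr1 ?(ltW (A0 _))//.
  apply: le_trans (lee_wpmul2l _ A1); last by rewrite lee_fin.
  rewrite mulr1 in h; apply: le_trans h.
  rewrite le_eqVlt; apply/orP; left; apply/eqP/eq_integral => z _.
  have [z0|z0] := pselect (0 < z.2); last by rewrite dt_weight_out// !mulr0 mul0e.
  rewrite (cavg_wgt h0 h1 A0 mA Afin z0) poweR_EFin -powRrM mulVf// powRr1 ?wgt_ge0//.
  by rewrite -EFinM /Q mulrAC.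
have PQ0 z : (0 <= (P z * W z)%:E + (Q z * W z)%:E)%E by exact: adde_ge0.
apply: (@le_trans _ _ (\int[lam]_z (4%:E * ((P z * W z)%:E + (Q z * W z)%:E)))%E); last first.
  rewrite (ge0_integralZlT lam (ler0n R 4) PQ0 (emeasurable_funD mPW mQW)).
  rewrite (ge0_integralDT lam PW0 QW0 mPW mQW) (EFinM 4) (EFinD C1).
  by apply: lee_wpmul2l; [rewrite lee_fin ler0n|exact: leeD IP IQ].
apply: ge0_le_integralT.
- by move=> z; rewrite lee_fin (mulr_ge0 (mulr_ge0 (F0 z) (G0 z)) (dt_weight_ge0 z)).
- by apply/measurable_EFinP; apply: measurable_funM => //; exact: measurable_funM.
- by apply: emeasurable_funM => //; exact: emeasurable_funD.
move=> z; have [z0|z0] := pselect (0 < z.2); last by rewrite dt_weight_out// !mulr0 addr0 mule0.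
rewrite -EFinD -EFinM lee_fin -mulrDl mulrA; apply: ler_wpM2r; first exact: dt_weight_ge0.
have := wgt_gt0 h0 h1 A0 mA Afin z0; rewrite /P /Q; move: (wgt _ A z) => a a0.
have r1' : 0 < r - 1 by rewrite subr_gt0.
pose e := r'^-1.
have r'0 : 0 < r' by rewrite divr_gt0.
have x0 : 0 <= F4 z * a `^ (- e) by rewrite mulr_ge0 ?powR_ge0.
have y0 : 0 <= G z * a `^ e by rewrite mulr_ge0 ?powR_ge0.
have := mul_le_powR_dual r1 x0 y0; rewrite -/r'.
rewrite !powRM ?powR_ge0// -!powRrM.
rewrite /e mulVf ?gt_eqF// powRr1 ?(ltW a0)//.
rewrite (_ : - r'^-1 * r = 1 - r); last by rewrite /r'; field; rewrite !gt_eqF.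
rewrite mulrACA -powRgtD// addNr powRr0 mulr1 /F4 => H.
have := ler_wpM2l (ler0n R 4) H; apply: le_trans.
by rewrite !mulrA divff// mul1r.
Qed.

Lemma tent_duality (r i : R) : 1 < r -> 0 <= i <= 1 -> exists2 C : R, 0 <= C &
  forall F G : X * R -> R, (forall z, 0 <= F z) -> (forall z, 0 <= G z) ->
  measurable_fun setT F -> measurable_fun setT G ->
  tent_bd i r 1 F -> tent_bd (1 - i) (r / (r - 1)) 1 G ->
  (\int[lam]_z (F z * G z * W z)%:E <= C%:E)%E.
Proof.
move=> r1 /andP[i0 i1]; have r10 : 0 < r - 1 by rewrite subr_gt0.
have [->|in0] := eqVneq i 0.
  have r'1 : 1 < r / (r - 1) by rewrite ltr_pdivlMr//; lra.
  have [C C0 H] := tent_duality1 r'1; exists C => // F G F0 G0 mF mG tF tG.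
  rewrite subr0 in tG; have := H G F G0 F0 mG mF tG.
  rewrite (_ : r / (r - 1) / (r / (r - 1) - 1) = r); last first.
    rewrite (_ : r / (r - 1) - 1 = (r - 1)^-1) ?invrK ?divfK ?gt_eqF//.
    by field; rewrite gt_eqF.
  move=> /(_ tF); apply: le_trans.
  rewrite le_eqVlt; apply/orP; left; apply/eqP/eq_integral => z _.
  by rewrite (mulrC (F z)).
have [->|in1] := eqVneq i 1.
  have [C C0 H] := tent_duality1 r1; exists C => // F G F0 G0 mF mG tF.
  by rewrite subrr; exact: H.
exists 64 => // F G; apply: tent_duality_fin => //.
by rewrite !lt_neqAle i0 i1 eq_sym in0 in1.
Qed.

(** * Bounded truncations of the half-space *)

Definition cylinder (n : nat) : set (X * R) :=
  ball o n.+1%:R `*` `[n.+1%:R^-1, n.+1%:R]%classic.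

Lemma cylinderP n z : cylinder n z <->
  [/\ mdist o z.1 < n.+1%:R, n.+1%:R^-1 <= z.2 & z.2 <= n.+1%:R].
Proof.
split=> [[/in_ball h]|[h a b]]; first by rewrite /= in_itv /= => /andP[].
by split; [exact/in_ball|rewrite /= in_itv /= a b].
Qed.

Lemma cylinder_gt0 n z : cylinder n z -> 0 < z.2.
Proof. by move=> /cylinderP[_ h _]; apply: lt_le_trans h; rewrite invr_gt0. Qed.

Lemma le_cylinder m n : (m <= n)%N -> cylinder m `<=` cylinder n.
Proof.
move=> mn z /cylinderP[a b c]; have h : m.+1%:R <= n.+1%:R :> R by rewrite ler_nat.
apply/cylinderP; split; [exact: lt_le_trans h| |exact: le_trans h].
by rewrite (le_trans _ b)// lef_pV2 ?posrE.
Qed.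

Lemma cylinder_cover z : 0 < z.2 -> exists n, cylinder n z.
Proof.
move=> z0; pose n := maxn (Num.truncn (mdist o z.1)) (maxn (Num.truncn z.2) (Num.truncn z.2^-1)).
exists n; have : (n <= n)%N by []; rewrite {1}/n !geq_max => /and3P[h1 h2 h3].
have lt (x : R) : (Num.truncn x <= n)%N -> x < n.+1%:R.
  by move=> xn; rewrite (lt_le_trans (truncnS_gt _))// ler_nat ltnS.
apply/cylinderP; split; [exact: lt| |exact/ltW/lt].
by rewrite -[leRHS]invrK lef_pV2 ?posrE ?invr_gt0//; exact/ltW/lt.
Qed.

Lemma measurable_cylinder n : measurable (cylinder n).
Proof. by apply: measurableX => //; exact: measurable_ball_borel. Qed.

Lemma measurable_cylinder' n : @measurable _ (X * measurableTypeR R)%type (cylinder n).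
Proof. by apply: measurableX => //; exact: measurable_ball_borel. Qed.

Lemma lam_cylinder n : (lam (cylinder n) < +oo)%E.
Proof.
rewrite /upper_measure /= product_measure1E//; last exact: measurable_ball_borel.
have /andP[_ Bn] := mu_ball o (ltr0Sn R n).
have H : (lebesgue_measure (`[(n.+1%:R^-1)%R, (n.+1%:R)%R]%classic : set R) < +oo)%E.
  by rewrite lebesgue_measure_itv /=; case: ifP => _; rewrite ?ltry// -EFinB ltry.
by apply: lte_mul_pinfty => //; rewrite ge0_fin_numE.
Qed.

Lemma cone_vol_cylinder n : exists2 c : R, 0 < c & forall z, cylinder n z -> c <= cone_vol z.
Proof.
pose m := n.+1%:R * (n.+1%:R + 1) / alpha : R.
have [C C0 HC] := doubling_scale mu_doubling m.
have V0 := fine_vol_gt0 mu_ball o (ltr0Sn R 0).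
exists (fine (vol mu o 1) / C); first by rewrite divr_gt0.
move=> z zn; have [h1 h2 h3] := (cylinderP n z).1 zn; have z0 := cylinder_gt0 zn.
have az : 0 < alpha * z.2 by rewrite mulr_gt0.
rewrite ler_pdivrMr// mulrC -lee_fin EFinM cone_volE// !fineK ?vol_fin//.
have n0 : 0 < n.+1%:R^-1 :> R by rewrite invr_gt0.
apply: le_trans (HC z.1 _ az); apply: le_vol => //.
rewrite metric_sym (_ : m * _ = (n.+1%:R + 1) * (n.+1%:R * z.2)); last by rewrite /m; field; rewrite gt_eqF.
have h4 : 1 <= n.+1%:R * z.2 by rewrite mulrC -ler_pdivrMr// mul1r.
apply: (@le_trans _ _ (n.+1%:R + 1)); first by rewrite lerD2r ltW.
by rewrite ler_peMr// addr_ge0.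
Qed.

Lemma cone_cylinder n : exists N : nat, forall x z, cylinder n z -> cone alpha x z -> ball o N.+1%:R x.
Proof.
exists (Num.truncn (n.+1%:R + alpha * n.+1%:R)) => x z /cylinderP[h1 _ h3] [_ /= h].
apply/in_ball; rewrite (le_lt_trans (metric_triangle o z.1 x))//.
apply: le_lt_trans (truncnS_gt (n.+1%:R + alpha * n.+1%:R)).
apply: lerD; first exact: ltW.
by rewrite metric_sym (le_trans (ltW h))// ler_wpM2l// ltW.
Qed.

Lemma indic_cylinder_weight n : exists2 C : R, 0 <= C &
  (\int[lam]_z (\1_(cylinder n) z * W z)%:E <= C%:E)%E.
Proof.
have fin : lam (cylinder n) \is a fin_num by rewrite ge0_fin_numE// lam_cylinder.
exists (n.+1%:R * fine (lam (cylinder n))); first by rewrite mulr_ge0// fine_ge0.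
apply: (@le_trans _ _ (\int[lam]_z (n.+1%:R%:E * (\1_(cylinder n) z)%:E))%E).
  apply: ge0_le_integralT.
  - by move=> z; rewrite lee_fin (mulr_ge0 _ (dt_weight_ge0 z)).
  - apply/measurable_EFinP; apply: measurable_funM; last exact: measurable_dt_weight.
    exact: measurable_indic (measurable_cylinder n).
  - apply: emeasurable_funM => //; apply/measurable_EFinP.
    exact: measurable_indic (measurable_cylinder n).
  move=> z; rewrite -EFinM lee_fin indicE; case: (boolP (z \in _)) => [|_]; last by rewrite mul0r mulr0.
  rewrite inE => zn; have [_ h2 _] := (cylinderP n z).1 zn; have z0 := cylinder_gt0 zn.
  by rewrite mul1r mulr1 dt_weightE// invf_ple ?posrE.
rewrite ge0_integralZlT//; last first.
  by apply/measurable_EFinP; exact: measurable_indic (measurable_cylinder n).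
by rewrite (integral_indic lam measurableT (measurable_cylinder' n)) setIT EFinM fineK.
Qed.

Lemma cone_int_cylinder n : exists N : nat, exists2 C : R, 0 <= C & forall x,
  (cone_int (\1_(cylinder n)) x <= (C * \1_(ball o N.+1%:R) x)%:E)%E.
Proof.
have [c c0 Hc] := cone_vol_cylinder n; have [N HN] := cone_cylinder n.
have [C C0 HC] := indic_cylinder_weight n.
exists N, (c^-1 * C); first by rewrite mulr_ge0// invr_ge0 ltW.
move=> x; have mI : measurable_fun setT (\1_(cylinder n) : X * R -> R).
  exact: measurable_indic (measurable_cylinder n).
case: (pselect (ball o N.+1%:R x)) => [xN|xN].
  rewrite [X in _ * X](_ : _ = 1) ?mulr1; last by rewrite indicE mem_set.
  apply: (@le_trans _ _ (\int[lam]_z (c^-1%:E * (\1_(cylinder n) z * W z)%:E))%E).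
    apply: ge0_le_integralT.
    - by move=> z; rewrite lee_fin cone_integrand_ge0.
    - exact: measurable_cone_integrand.
    - apply: emeasurable_funM => //; apply/measurable_EFinP; apply: measurable_funM => //.
      exact: measurable_dt_weight.
    move=> z; rewrite -EFinM lee_fin indicE; case: (boolP (z \in _)) => [|_]; last by rewrite !mul0r mulr0.
    rewrite inE => zn; rewrite !mul1r; apply: ler_wpM2r; first exact: dt_weight_ge0.
    have v0 := lt_le_trans c0 (Hc z zn).
    rewrite /cone_ker powR_inv1 ?(ltW v0)//.
    apply: (@le_trans _ _ (1 * (cone_vol z)^-1)).
      by rewrite ler_wpM2r ?invr_ge0 ?(ltW v0)// /cone_ind indicE; case: (z \in _).
    by rewrite mul1r lef_pV2 ?posrE// Hc.
  rewrite ge0_integralZlT; first last.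
  - by apply/measurable_EFinP; apply: measurable_funM => //; exact: measurable_dt_weight.
  - by move=> z; rewrite lee_fin (mulr_ge0 _ (dt_weight_ge0 z)).
  - by rewrite invr_ge0 ltW.
  by rewrite EFinM; apply: lee_wpmul2l HC; rewrite lee_fin invr_ge0 ltW.
rewrite [X in _ * X](_ : _ = 0) ?mulr0; last by rewrite indicE memNset.
rewrite (_ : cone_int _ x = 0%E)//; apply: integral0_eq => z _.
rewrite indicE; case: (boolP (z \in _)) => [|_]; last by rewrite !mul0r.
rewrite inE => zn; rewrite /cone_ker /cone_ind indicE memNset ?mul0r ?mulr0 ?mul0r//.
by move=> xz; apply: xN; exact: HN xz.
Qed.

Lemma tent_bd_cylinder n (i r : R) : 0 <= i -> 0 < r -> exists2 C : R, 0 <= C &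
  tent_bd i r C (\1_(cylinder n)).
Proof.
move=> i0 r0; have mI : measurable_fun setT (\1_(cylinder n) : X * R -> R).
  exact: measurable_indic (measurable_cylinder n).
have pwI : (fun z => \1_(cylinder n) z `^ r) = \1_(cylinder n) :> (X * R -> R).
  apply/funext => z; rewrite indicE; case: (z \in _); first by rewrite powR1.
  by rewrite powR0// gt_eqF.
rewrite /tent_bd; case: eqP => [_|/eqP in0].
  have [c c0 Hc] := cone_vol_cylinder n; have [C C0 HC] := indic_cylinder_weight n.
  exists (C / c); first by rewrite divr_ge0// ltW.
  move=> x s s0; have mT : @measurable _ (X * measurableTypeR R)%type (tent alpha (ball x s)).
    exact: measurable_tent.
  have mIW : measurable_fun setT (fun z => (\1_(cylinder n) z * W z)%:E).
    by apply/measurable_EFinP; apply: measurable_funM => //; exact: measurable_dt_weight.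
  rewrite (_ : (fun z => _) = (fun z => (\1_(cylinder n) z * W z)%:E)); last first.
    by apply/funext => z; rewrite -[in RHS]pwI.
  (* A ball whose tent meets the cylinder at (y, t) contains B(y, alpha t), so its volume is bounded
     below; all other tents contribute 0. *)
  have [[z [zn /tent_ballP[z0 zB]]]|none] := pselect (exists z, cylinder n z /\ tent alpha (ball x s) z).
    apply: le_trans.
      apply: (@ge0_subset_integral _ _ _ lam _ setT) => // u _.
      by rewrite lee_fin (mulr_ge0 _ (dt_weight_ge0 u)).
    apply: le_trans HC _; rewrite -(fineK (vol_fin mu_ball x s0)) -EFinM lee_fin.
    rewrite mulrAC ler_pdivlMr// ler_wpM2l// (le_trans (Hc z zn))// cone_volE//.
    rewrite -lee_fin !fineK ?vol_fin ?mulr_gt0//; apply: le_measure; rewrite ?inE.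
    - exact: measurable_ball_borel.
    - exact: measurable_ball_borel.
    - by move=> y yz; apply: zB; exact/coneP.
  rewrite (_ : integral _ _ _ = 0%E); first by rewrite mule_ge0// lee_fin divr_ge0// ltW.
  apply: integral0_eq => z zt; rewrite indicE memNset ?mul0r// => zn.
  by apply: none; exists z.
have i1 : 0 < i by rewrite lt_neqAle eq_sym in0.
have k0 : 0 < (i * r)^-1 by rewrite invr_gt0 mulr_gt0.
have [N [C C0 HC]] := cone_int_cylinder n.
have VN : vol mu o N.+1%:R \is a fin_num by exact: vol_fin.
exists (C `^ (i * r)^-1 * fine (vol mu o N.+1%:R)); first by rewrite mulr_ge0 ?powR_ge0 ?fine_ge0.
rewrite pwI.
have mB := measurable_ball_borel o N.+1%:R.
apply: (@le_trans _ _ (\int[mu]_x ((C `^ (i * r)^-1)%:E * (\1_(ball o N.+1%:R) x)%:E))%E).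
  apply: ge0_le_integralT.
  - by move=> x; exact: poweR_ge0.
  - by apply: (measurableT_comp (measurable_poweR _)); apply: measurable_cone_int.
  - by apply: emeasurable_funM => //; apply/measurable_EFinP; exact: measurable_indic.
  move=> x; rewrite -EFinM.
  have -> : C `^ (i * r)^-1 * \1_(ball o N.+1%:R) x = (C * \1_(ball o N.+1%:R) x) `^ (i * r)^-1.
    rewrite powRM// indicE; case: (x \in _); first by rewrite powR1.
    by rewrite powR0// gt_eqF.
  rewrite -poweR_EFin; apply: gt0_ler_poweR; rewrite ?in_itv /= ?andbT ?leey ?cone_int_ge0 ?(ltW k0)//.
  by rewrite lee_fin mulr_ge0.
rewrite ge0_integralZlT ?powR_ge0//; last by apply/measurable_EFinP; exact: measurable_indic.
by rewrite integral_indic// setIT EFinM fineK.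
Qed.

Lemma ge0_le_poweR (x y : \bar R) (r : R) : 0 <= r -> (0 <= x)%E -> (x <= y)%E ->
  (x `^ r <= y `^ r)%E.
Proof.
move=> r0 x0 xy; apply: gt0_ler_poweR; rewrite ?in_itv /= ?leey ?andbT//.
exact: le_trans xy.
Qed.

Lemma le_tent_bd (i r c : R) (g g' : X * R -> R) : 0 <= i -> 0 <= r ->
  (forall z, 0 <= g z) -> measurable_fun setT g -> measurable_fun setT g' ->
  (forall z, 0 < z.2 -> g z <= g' z) -> tent_bd i r c g' -> tent_bd i r c g.
Proof.
move=> i0 r0 g0 mg mg' gg'.
have mgr : measurable_fun setT (fun z => g z `^ r) by exact: measurable_fun_powR.
have mgr' : measurable_fun setT (fun z => g' z `^ r) by exact: measurable_fun_powR.
have mW := measurable_dt_weight.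
have k0 : 0 <= (i * r)^-1 by rewrite invr_ge0 mulr_ge0.
have pw z : 0 < z.2 -> g z `^ r <= g' z `^ r.
  by move=> z0; rewrite ge0_ler_powR ?nnegrE// ?gg'// (le_trans (g0 z))// gg'.
rewrite /tent_bd; case: eqP => _ H; last first.
  apply: le_trans H; apply: ge0_le_integralT.
  - by move=> x; exact: poweR_ge0.
  - by apply: (measurableT_comp (measurable_poweR _)); apply: measurable_cone_int => // z; exact: powR_ge0.
  - by apply: (measurableT_comp (measurable_poweR _)); apply: measurable_cone_int => // z; exact: powR_ge0.
  move=> x; apply: (ge0_le_poweR k0).
    by apply: cone_int_ge0 => z; exact: powR_ge0.
  by apply: le_cone_int => // [z|z /coneP[z0 _]]; [exact: powR_ge0|exact: pw].
move=> x s s0; apply: le_trans (H x s s0).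
have mT : @measurable _ (X * measurableTypeR R)%type (tent alpha (ball x s)).
  exact: measurable_tent.
have mT0 : measurable (tent alpha (ball x s)) by exact: measurable_tent.
rewrite !(ge0_integral_indic lam mT); last 2 first.
- by move=> z; rewrite lee_fin (mulr_ge0 (powR_ge0 _ _) (dt_weight_ge0 z)).
- by move=> z; rewrite lee_fin (mulr_ge0 (powR_ge0 _ _) (dt_weight_ge0 z)).
have mgW : measurable_fun setT (fun z => (g z `^ r * W z)%:E * (\1_(tent alpha (ball x s)) z)%:E)%E.
  apply: emeasurable_funM; apply/measurable_EFinP; first exact: measurable_funM.
  exact: measurable_indic mT0.
have mgW' : measurable_fun setT (fun z => (g' z `^ r * W z)%:E * (\1_(tent alpha (ball x s)) z)%:E)%E.
  apply: emeasurable_funM; apply/measurable_EFinP; first exact: measurable_funM.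
  exact: measurable_indic mT0.
apply: ge0_le_integralT => //.
- by move=> z; rewrite mule_ge0 ?lee_fin// (mulr_ge0 (powR_ge0 _ _) (dt_weight_ge0 z)).
move=> z; apply: lee_wpmul2r; first by rewrite lee_fin.
have [z0|z0] := pselect (0 < z.2); last by rewrite dt_weight_out// !mulr0.
by rewrite lee_fin ler_wpM2r ?dt_weight_ge0// pw.
Qed.

Lemma powRX (x : R) k r : 0 <= x -> (x ^+ k) `^ r = (x `^ r) ^+ k.
Proof.
move=> x0; elim: k => [|k IH]; first by rewrite !expr0 powR1.
by rewrite !exprS powRM ?exprn_ge0// IH.
Qed.

Lemma powR_ge_id (x k : R) : 1 <= x -> 1 <= k -> x <= x `^ k.
Proof. by move=> x1 k1; rewrite -{1}[x]powRr1 ?(le_trans ler01)// ler_powR. Qed.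

(** The bound scales with the exponent r at i = 0 and 1 / i otherwise. Both are at least 1, so
    dividing by 1 + C already brings C below 1. *)
Lemma tent_bd_normalize (i r C : R) g : 0 <= i <= 1 -> 1 <= r -> 0 <= C ->
  (forall z, 0 <= g z) -> measurable_fun setT g ->
  tent_bd i r C g -> tent_bd i r 1 (fun z => (1 + C)^-1 * g z).
Proof.
move=> /andP[i0 i1] r1 C0 g0 mg.
have r0 : 0 < r by lra.
have K0 : 0 < 1 + C by lra.
have KV : 0 <= (1 + C)^-1 by rewrite invr_ge0 ltW.
have mgr : measurable_fun setT (fun z => g z `^ r) by exact: measurable_fun_powR.
have gr0 z : 0 <= g z `^ r by exact: powR_ge0.
have mW := measurable_dt_weight.
have E z : ((1 + C)^-1 * g z) `^ r = (1 + C)^-1 `^ r * g z `^ r by rewrite powRM.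
have CK (k : R) : 1 <= k -> (1 + C)^-1 `^ k * C <= 1.
  move=> k1; rewrite -powR_inv1 ?(ltW K0)// -powRrM mulN1r powRN mulrC ler_pdivrMr ?powR_gt0// mul1r.
  by apply: le_trans (powR_ge_id _ k1); lra.
rewrite /tent_bd; case: eqP => [_|/eqP in0] H.
  move=> x s s0.
  have mT : @measurable _ (X * measurableTypeR R)%type (tent alpha (ball x s)).
    exact: measurable_tent.
  have E' z : (((1 + C)^-1 * g z) `^ r * W z)%:E = (((1 + C)^-1 `^ r)%:E * (g z `^ r * W z)%:E)%E.
    by rewrite E -EFinM -mulrA.
  under eq_integral do rewrite E'.
  rewrite ge0_integralZl_EFin ?powR_ge0//; last 2 first.
  - by move=> z _; rewrite lee_fin (mulr_ge0 (gr0 z) (dt_weight_ge0 z)).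
  - by apply: measurable_funTS; apply/measurable_EFinP; exact: measurable_funM.
  apply: le_trans (lee_wpmul2l _ (H x s s0)) _; first by rewrite lee_fin powR_ge0.
  by rewrite muleA; apply: lee_wpmul2r => //; rewrite -EFinM lee_fin; exact: CK.
have {}i0 : 0 < i by rewrite lt_neqAle eq_sym in0.
have ii : 1 <= i^-1 by rewrite invf_ge1.
have E' x : (cone_int (fun z => ((1 + C)^-1 * g z) `^ r)%R x `^ (i * r)^-1 =
    ((1 + C)^-1 `^ i^-1)%:E * cone_int (fun z => g z `^ r)%R x `^ (i * r)^-1)%E.
  rewrite (eq_cone_int _ E) cone_intZ ?powR_ge0// poweRM ?lee_fin ?powR_ge0 ?cone_int_ge0//.
  by rewrite poweR_EFin -powRrM; congr (_%:E * _)%E; congr (_ `^ _); field; rewrite !gt_eqF.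
under eq_integral do rewrite E'.
rewrite ge0_integralZlT ?powR_ge0//; last 2 first.
- by move=> x; exact: poweR_ge0.
- by apply: (measurableT_comp (measurable_poweR _)); exact: measurable_cone_int.
apply: le_trans (lee_wpmul2l _ H) _; first by rewrite lee_fin powR_ge0.
by rewrite -EFinM lee_fin; exact: CK.
Qed.

(** * Series of pieces with geometric coefficients *)

Lemma nneseries_half : (\sum_(n <oo) ((2^-1) ^+ n.+1 : R)%:E = 1)%E.
Proof.
apply/cvg_lim => //; have := @cvg_geometric_eseries_half R 1 0; rewrite expr0 divr1.
apply: cvg_trans; apply: near_eq_cvg; apply: nearW => n.
apply: eq_bigr => k _; congr EFin.
by rewrite addn1 exprVn natrX mul1r.
Qed.

(** One argument serves k < 1 and k >= 1: if Q is the right-hand side and is finite, each T n is at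
    most 2^{-(n + 1)} Q^{1/k}, and these bounds sum to Q^{1/k}. *)
Lemma nneseries_power (T : nat -> \bar R) (k : R) : 0 < k -> (forall n, (0 <= T n)%E) ->
  ((\sum_(n <oo) T n) `^ k <= \sum_(n <oo) ((2 ^+ n.+1)%:E * T n) `^ k)%E.
Proof.
move=> k0 T0; set Q := (leRHS)%E.
have Q0 : (0 <= Q)%E by apply: nneseries_ge0 => n _ _; exact: poweR_ge0.
have Qn n : (((2 ^+ n.+1)%:E * T n) `^ k <= Q)%E.
  have h0 m : (0 <= ((2 ^+ m.+1)%:E * T m) `^ k)%E by exact: poweR_ge0.
  have := @nneseries_lim_ge R _ xpredT 0 n.+1 (fun m _ _ => h0 m); apply: le_trans.
  by rewrite big_nat_recr//= leeDr// sume_ge0.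
move: Q Q0 Qn => [v| |//]; last by move=> _ _; rewrite leey.
rewrite lee_fin => v0 Qn.
pose y := v `^ k^-1; have y0 : 0 <= y by exact: powR_ge0.
have Ty n : (T n <= y%:E * ((2^-1) ^+ n.+1)%:E)%E.
  have p0 : 0 < 2 ^+ n.+1 :> R by rewrite exprn_gt0.
  have h0 : (0 <= (2 ^+ n.+1)%:E * T n)%E by rewrite mule_ge0// lee_fin ltW.
  have : ((2 ^+ n.+1)%:E * T n <= y%:E)%E.
    have pK (x : \bar R) : (0 <= x)%E -> ((x `^ k) `^ k^-1 = x)%E.
      by move=> x0; rewrite -poweRrM mulfV ?gt_eqF// poweRe1.
    rewrite -[leLHS]pK//.
    rewrite /y -poweR_EFin; apply: ge0_le_poweR => //; rewrite ?invr_ge0 ?(ltW k0)//.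
    exact: poweR_ge0.
  case: (T n) (T0 n) => [t| |//]; last by rewrite gt0_muley ?lte_fin.
  by rewrite -!EFinM !lee_fin exprVn ler_pdivlMr// mulrC.
have -> : v = y `^ k by rewrite /y -powRrM mulVf ?gt_eqF// powRr1.
rewrite -poweR_EFin; apply: ge0_le_poweR; rewrite ?(ltW k0)//.
  by apply: nneseries_ge0 => n _ _; exact: T0.
apply: le_trans (lee_nneseries (fun n _ _ => T0 n) (fun n _ => Ty n)) _.
rewrite nneseriesZl; last by move=> n _; rewrite lee_fin exprn_ge0.
by rewrite nneseries_half mule1.
Qed.

Lemma nneseries_ge_term (u : nat -> \bar R) n : (forall m, (0 <= u m)%E) ->
  (u n <= \sum_(m <oo) u m)%E.
Proof.
move=> u0; have := @nneseries_lim_ge R u xpredT 0 n.+1 (fun m _ _ => u0 m); apply: le_trans.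
by rewrite big_nat_recr//= leeDr// sume_ge0.
Qed.

(** At each point a single index kk is active, so the r-th power of the function is at most the
    series of the r-th powers of the scaled terms. The coefficients 4^{-k} outweigh the factors 2^{k
    + 1} lost in [nneseries_power], because r >= 1 and 1 / i >= 1. *)
Lemma tent_bd_sum (i r : R) : 0 <= i <= 1 -> 1 <= r -> exists2 C : R, 0 <= C &
  forall (K : R) (u : nat -> X * R -> R) (kk : X * R -> nat), 0 <= K ->
  (forall k z, 0 <= u k z) -> (forall k, measurable_fun setT (u k)) ->
  measurable_fun setT (fun z => (4^-1) ^+ kk z * u (kk z) z) ->
  (forall k, tent_bd i r K (u k)) ->
  tent_bd i r (C * K) (fun z => (4^-1) ^+ kk z * u (kk z) z).
Proof.
move=> /andP[i0 i1] r1; have r0 : 0 < r by lra.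
pose c k : R := ((4^-1) ^+ k) `^ r.
have q0 : 0 <= 4^-1 :> R by rewrite invr_ge0.
have c0 k : 0 <= c k by exact: powR_ge0.
have cE k : c k = ((4^-1) `^ r) ^+ k by rewrite /c powRX.
have q4 : 4^-1 `^ r <= 2^-1 * 2^-1 `^ r :> R.
  rewrite (_ : 4^-1 = 2^-1 * 2^-1 :> R); last by field.
  rewrite powRM ?invr_ge0//; apply: ler_wpM2r; first exact: powR_ge0.
  rewrite -{1}(powR_inv1 (ler0n R 2)) -[leRHS](powR_inv1 (ler0n R 2)) -powRrM mulN1r.
  by rewrite ler_powR ?ler1n// lerN2.
have h2 : 2^-1 `^ r <= 2^-1 :> R.
  rewrite -{1}(powR_inv1 (ler0n R 2)) -[leRHS](powR_inv1 (ler0n R 2)) -powRrM mulN1r.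
  by rewrite ler_powR ?ler1n// lerN2.
have main (u : nat -> X * R -> R) (kk : X * R -> nat) z : (forall k z, 0 <= u k z) ->
    ((((4^-1) ^+ kk z * u (kk z) z) `^ r)%:E <= \sum_(k <oo) (c k * u k z `^ r)%:E)%E.
  move=> u0; have t0 m : (0 <= (c m * u m z `^ r)%:E)%E by rewrite lee_fin mulr_ge0 ?powR_ge0.
  by rewrite powRM ?exprn_ge0//; exact: (nneseries_ge_term (kk z) t0).
have mW := measurable_dt_weight.
rewrite /tent_bd; case: eqP => [_|/eqP in0].
  exists 2 => // K u kk K0 u0 mu_ mf H x s s0.
  set T := tent alpha (ball x s).
  have mT : measurable T by exact: measurable_tent.
  have mT' : @measurable _ (X * measurableTypeR R)%type T by exact: measurable_tent.
  have muW k : measurable_fun setT (fun z => (c k * (u k z `^ r * W z))%:E).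
    apply/measurable_EFinP; apply: measurable_funM => //; apply: measurable_funM => //.
    exact: measurable_fun_powR.
  have murW k : measurable_fun setT (fun z => (u k z `^ r * W z)%:E).
    by apply/measurable_EFinP; apply: measurable_funM => //; exact: measurable_fun_powR.
  have uW0 k z : (0 <= (c k * (u k z `^ r * W z))%:E)%E.
    by rewrite lee_fin (mulr_ge0 (c0 k) (mulr_ge0 (powR_ge0 _ _) (dt_weight_ge0 z))).
  have msum : measurable_fun setT (fun z => \sum_(k <oo) (c k * (u k z `^ r * W z))%:E)%E.
    by apply: ge0_emeasurable_sum => // k z _ _; exact: uW0.
  apply: (@le_trans _ _ (\int[lam]_(z in T) \sum_(k <oo) (c k * (u k z `^ r * W z))%:E)%E).
    apply: ge0_le_integral => //.
    - by move=> z _; rewrite lee_fin (mulr_ge0 (powR_ge0 _ _) (dt_weight_ge0 z)).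
    - apply: measurable_funTS; apply/measurable_EFinP; apply: measurable_funM => //.
      exact: measurable_fun_powR.
    - exact: (measurable_funTS msum).
    move=> z _; have W0 := dt_weight_ge0 z.
    rewrite (_ : \sum_(k <oo) _ = (W z)%:E * \sum_(k <oo) (c k * u k z `^ r)%:E)%E; last first.
      rewrite -nneseriesZl; last by move=> k _; rewrite lee_fin mulr_ge0 ?powR_ge0.
      by apply: eq_eseriesr => k _; rewrite -EFinM; congr EFin; rewrite mulrA mulrC.
    by rewrite mulrC EFinM; apply: lee_wpmul2l; [rewrite lee_fin|exact: main].
  rewrite (integral_nneseries lam mT' (fun k => measurable_funTS (muW k)) (fun k z _ => uW0 k z)).
  have V0 : (0 <= vol mu x s)%E by exact: measure_ge0.
  apply: (@le_trans _ _ (\sum_(k <oo) ((2 * K)%:E * vol mu x s) * ((2^-1) ^+ k.+1 : R)%:E)%E); last first.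
    rewrite -(fineK (vol_fin mu_ball x s0)) -EFinM nneseriesZl; last by move=> k _; rewrite lee_fin exprn_ge0.
    by rewrite nneseries_half mule1.
  apply: lee_nneseries => [k _ _|k _]; first by apply: integral_ge0 => z _; exact: uW0.
  under eq_integral do rewrite EFinM.
  rewrite ge0_integralZl_EFin//; last 2 first.
  - by move=> z _; rewrite lee_fin (mulr_ge0 (powR_ge0 _ _) (dt_weight_ge0 z)).
  - exact: (measurable_funTS (murW k)).
  have ck : c k <= 2 * (2^-1) ^+ k.+1.
    rewrite exprS mulrA mulfV// mul1r cE lerXn2r ?nnegrE ?powR_ge0//.
    by apply: le_trans q4 _; rewrite ler_piMr// (le_trans h2)// invf_le1// ler1n.
  apply: (@le_trans _ _ ((c k)%:E * (K%:E * vol mu x s))%E).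
    by apply: lee_wpmul2l; [rewrite lee_fin|exact: H].
  rewrite -(fineK (vol_fin mu_ball x s0)) -!EFinM lee_fin.
  rewrite (_ : 2 * K * _ * _ = 2 * (2^-1) ^+ k.+1 * (K * fine (vol mu x s))); last by ring.
  by rewrite ler_wpM2r// mulr_ge0// fine_ge0.
have {}i0 : 0 < i by rewrite lt_neqAle eq_sym in0.
pose kp := (i * r)^-1; have k0 : 0 < kp by rewrite invr_gt0 mulr_gt0.
exists (2 * 2 `^ kp); first by rewrite mulr_ge0 ?powR_ge0.
move=> K u kk K0 u0 mu_ mf H.
have mur k : measurable_fun setT (fun z => u k z `^ r) by exact: measurable_fun_powR.
have ur0 k z : 0 <= u k z `^ r by exact: powR_ge0.
pose S k x := cone_int (fun z => u k z `^ r) x.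
have S0 k x : (0 <= S k x)%E by exact: cone_int_ge0.
have mS k : measurable_fun setT (S k) by exact: measurable_cone_int.
have mcS k : measurable_fun setT (fun x => ((2 ^+ k.+1)%:E * ((c k)%:E * S k x)) `^ kp)%E.
  by apply: (measurableT_comp (measurable_poweR _)); do 2! apply: emeasurable_funM => //.
apply: (@le_trans _ _ (\int[mu]_x \sum_(k <oo) ((2 ^+ k.+1)%:E * ((c k)%:E * S k x)) `^ kp)%E).
  apply: ge0_le_integralT.
  - by move=> x; exact: poweR_ge0.
  - apply: (measurableT_comp (measurable_poweR _)); apply: measurable_cone_int.
      by move=> z; exact: powR_ge0.
    exact: measurable_fun_powR.
  - by apply: ge0_emeasurable_sum => // k x _ _; exact: poweR_ge0.
  move=> x; apply: le_trans (nneseries_power k0 _); last by move=> k; rewrite mule_ge0 ?lee_fin.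
  apply: ge0_le_poweR; rewrite ?(ltW k0)//.
    by apply: cone_int_ge0 => z; exact: powR_ge0.
  have cont k z : (0 <= (c k * u k z `^ r * cone_ker x z * W z)%:E)%E.
    rewrite lee_fin.
    exact: (@cone_integrand_ge0 (fun z => c k * u k z `^ r) x z (mulr_ge0 (c0 k) (ur0 k z))).
  have mcont k : measurable_fun setT (fun z => (c k * u k z `^ r * cone_ker x z * W z)%:E).
    by apply: (@measurable_cone_integrand (fun z => c k * u k z `^ r)); exact: measurable_funM.
  have msum : measurable_fun setT
      (fun z => \sum_(k <oo) (c k * u k z `^ r * cone_ker x z * W z)%:E)%E.
    by apply: ge0_emeasurable_sum => // k z _ _; exact: cont.
  rewrite (_ : \sum_(k <oo) _ = \int[lam]_z \sum_(k <oo) (c k * u k z `^ r * cone_ker x z * W z)%:E)%E; last first.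
    rewrite integral_nneseries//; apply: eq_eseriesr => k _.
    by rewrite /S -(cone_intZ x (c0 k) (ur0 k) (mur k)).
  apply: ge0_le_integralT.
  - move=> z; rewrite lee_fin.
    exact: (@cone_integrand_ge0 (fun z => _ `^ r) x z (powR_ge0 _ _)).
  - apply: (@measurable_cone_integrand (fun z => _ `^ r)); exact: measurable_fun_powR.
  - exact: msum.
  move=> z; have KW0 : 0 <= cone_ker x z * W z.
    exact: mulr_ge0 (cone_ker_ge0 x z) (dt_weight_ge0 z).
  rewrite (_ : \sum_(k <oo) _ = (cone_ker x z * W z)%:E * \sum_(k <oo) (c k * u k z `^ r)%:E)%E; last first.
    rewrite -nneseriesZl; last by move=> k _; rewrite lee_fin mulr_ge0.
    by apply: eq_eseriesr => k _; rewrite -EFinM; congr EFin; rewrite -mulrA mulrC.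
  rewrite -mulrA EFinM muleC; apply: lee_wpmul2l; [by rewrite lee_fin|exact: main].
rewrite integral_nneseries//; last by move=> k x _; exact: poweR_ge0.
apply: (@le_trans _ _ (\sum_(k <oo) (2 * 2 `^ kp * K)%:E * ((2^-1) ^+ k.+1 : R)%:E)%E); last first.
  rewrite nneseriesZl; last by move=> k _; rewrite lee_fin exprn_ge0.
  by rewrite nneseries_half mule1.
apply: lee_nneseries => [k _ _|k _]; first by apply: integral_ge0 => x _; exact: poweR_ge0.
pose D := (2 ^+ k.+1 * c k) `^ kp.
have DE x : (((2 ^+ k.+1)%:E * ((c k)%:E * S k x)) `^ kp = D%:E * S k x `^ kp)%E.
  by rewrite muleA -EFinM poweRM ?lee_fin ?mulr_ge0 ?exprn_ge0.
under eq_integral do rewrite DE.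
rewrite ge0_integralZlT ?powR_ge0//; last 2 first.
- by move=> x; exact: poweR_ge0.
- exact: (measurableT_comp (measurable_poweR _)).
have Dk : D <= 2 `^ kp * 2 * (2^-1) ^+ k.+1.
  have b0 : 0 <= 2 * 4^-1 `^ r :> R by rewrite mulr_ge0 ?powR_ge0.
  rewrite /D cE (_ : 2 ^+ k.+1 * _ = 2 * (2 * 4^-1 `^ r) ^+ k); last by rewrite exprMn exprS mulrA.
  rewrite powRM ?exprn_ge0// -[leRHS]mulrA; apply: ler_wpM2l; first exact: powR_ge0.
  rewrite exprS mulrA mulfV// mul1r powRX// lerXn2r ?nnegrE ?powR_ge0//.
  apply: (@le_trans _ _ ((2^-1 `^ r) `^ kp)).
    rewrite ge0_ler_powR ?nnegrE ?powR_ge0 ?(ltW k0)//.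
    by apply: le_trans (ler_wpM2l _ q4) _ => //; rewrite mulrA mulfV// mul1r.
  rewrite -powRrM /kp (_ : r * (i * r)^-1 = i^-1); last by field; rewrite !gt_eqF.
  rewrite -{1}(powR_inv1 (ler0n R 2)) -[leRHS](powR_inv1 (ler0n R 2)) -powRrM mulN1r.
  by rewrite ler_powR ?ler1n// lerN2 invf_ge1.
apply: (@le_trans _ _ (D%:E * K%:E)%E).
  by apply: lee_wpmul2l; [rewrite lee_fin powR_ge0|exact: H].
rewrite -(EFinM D) -(EFinM (2 * _ * _)) lee_fin; apply: le_trans (ler_wpM2r K0 Dk) _.
by rewrite le_eqVlt; apply/orP; left; apply/eqP; ring.
Qed.

(** * Convergence of truncations and measurable selection of an index *)

Lemma cvg0_ereal {T : Type} {F : set_system T} {FF : Filter F} (f : T -> \bar R) :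
  (forall t : T, (0 <= f t)%E) ->
  (f t @[t --> F] --> 0%E) <-> (forall e : R, 0 < e -> \forall t \near F, (f t <= e%:E)%E).
Proof.
move=> f0; split.
  move=> /fine_cvgP[ffin /cvgrPdist_le cf] e e0; near=> t.
  have fx : f t \is a fin_num by near: t.
  rewrite -(fineK fx) lee_fin; apply: le_trans (ler_norm _) _.
  by rewrite -normrN -sub0r; near: t; exact: cf.
move=> H; apply/fine_cvgP; split.
  apply: filterS (H 1 ltr01) => t h.
  by rewrite ge0_fin_numE// (le_lt_trans h)// ltry.
apply/cvgrPdist_le => e e0; apply: filterS (H e e0) => t h.
rewrite sub0r normrN ger0_norm ?fine_ge0//= -lee_fin fineK//.
by rewrite ge0_fin_numE// (le_lt_trans h)// ltry.
Unshelve. all: by end_near.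
Qed.

Lemma cvg0_poweR (u : nat -> \bar R) (k : R) : 0 < k -> (forall n, (0 <= u n)%E) ->
  (u n @[n --> \oo] --> 0%E) -> ((u n `^ k)%E @[n --> \oo] --> 0%E).
Proof.
move=> k0 u0 /(cvg0_ereal u0) H; apply/cvg0_ereal => [n|e e0]; first exact: poweR_ge0.
apply: filterS (H (e `^ k^-1) (powR_gt0 _ e0)) => n h.
apply: le_trans (ge0_le_poweR (ltW k0) (u0 n) h) _.
by rewrite poweR_EFin -powRrM mulVf ?gt_eqF// powRr1// ltW.
Qed.

Lemma power_tail (k : R) (T : nat -> X -> \bar R) (S : X -> \bar R) : 0 < k ->
  (forall n x, (0 <= T n x)%E) -> (forall n, measurable_fun setT (T n)) ->
  measurable_fun setT S -> (forall n x, (T n x <= S x)%E) ->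
  (forall x, (S x < +oo)%E -> (T n x @[n --> \oo] --> 0%E)) ->
  (\int[mu]_x (S x `^ k) < +oo)%E ->
  forall e, 0 < e -> exists N, forall n, (N <= n)%N -> (\int[mu]_x (T n x `^ k) <= e%:E)%E.
Proof.
move=> k0 T0 mT mS TS lim0 fin e e0.
have S0 x : (0 <= S x)%E by exact: le_trans (T0 0%N x) (TS 0%N x).
have mSk : measurable_fun setT (fun x => S x `^ k)%E.
  exact: (measurableT_comp (measurable_poweR _)).
have mTk n : measurable_fun setT (fun x => T n x `^ k)%E.
  exact: (measurableT_comp (measurable_poweR _)).
have iS : mu.-integrable setT (fun x => S x `^ k)%E.
  apply/integrableP; split => //.
  by under eq_integral do rewrite gee0_abs ?poweR_ge0//.
have cvgS : {ae mu, forall x, setT x -> (fun n => T n x `^ k)%E @ \oo --> 0%E}.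
  have := integrable_ae measurableT iS; apply: filterS => x /(_ I) fx _.
  apply: cvg0_poweR => //; apply: lim0; apply: (@lty_poweRy _ _ k).
    by rewrite gt_eqF.
  by rewrite -ge0_fin_numE// poweR_ge0.
have bdS : {ae mu, forall x n, setT x -> (`|T n x `^ k| <= S x `^ k)%E}.
  apply: aeW => x n _; rewrite gee0_abs ?poweR_ge0//.
  exact: ge0_le_poweR (ltW k0) _ (TS n x).
have [_ _] := @dominated_convergence _ _ _ mu setT measurableT (fun n x => T n x `^ k)%E
  (cst 0%E) _ mTk (measurable_cst _) cvgS iS bdS.
have I0 n : (0 <= \int[mu]_x (T n x `^ k))%E by apply: integral_ge0 => x _; exact: poweR_ge0.
rewrite integral0 => /(cvg0_ereal I0) H; have [N _ HN] := H e e0.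
by exists N => n /HN.
Qed.

(** Dominated convergence twice: inside each cone with finite integral, then over the vertices. At
    the Carleson endpoint such truncations do not converge in norm in general, whence i > 0. *)
Lemma tent_tail (i r : R) (g : X * R -> R) (G : nat -> set (X * R)) : 0 < i -> 0 < r ->
  (forall z, 0 <= g z) -> measurable_fun setT g -> (forall n, measurable (G n)) ->
  (forall m n, (m <= n)%N -> G m `<=` G n) ->
  (forall z, 0 < z.2 -> g z != 0 -> exists n, G n z) ->
  (\int[mu]_x (cone_int (fun z => g z `^ r)%R x `^ (i * r)^-1) < +oo)%E ->
  forall e, 0 < e -> exists N, forall n, (N <= n)%N ->
  (\int[mu]_x (cone_int (fun z => (g z * \1_(~` G n) z) `^ r)%R x `^ (i * r)^-1) <= e%:E)%E.
Proof.
move=> i0 r0 g0 mg mG Gnd Gcov fin e e0.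
have k0 : 0 < (i * r)^-1 by rewrite invr_gt0 mulr_gt0.
have mgr : measurable_fun setT (fun z => g z `^ r) by exact: measurable_fun_powR.
have gr0 z : 0 <= g z `^ r by exact: powR_ge0.
pose h n z := (g z * \1_(~` G n) z) `^ r.
have h0 n z : 0 <= h n z by exact: powR_ge0.
have mh n : measurable_fun setT (h n).
  apply: measurable_fun_powR; apply: measurable_funM => //.
  by apply: measurable_indic; exact: measurableC.
have hg n z : h n z <= g z `^ r.
  by rewrite /h ge0_ler_powR ?nnegrE ?(ltW r0) ?mulr_ge0// ler_piMr// indicE; case: (_ \in _).
pose S x := cone_int (fun z => g z `^ r) x.
have S0 x : (0 <= S x)%E by exact: cone_int_ge0.
have mS : measurable_fun setT S by exact: measurable_cone_int.
have Sh0 n x : (0 <= cone_int (h n) x)%E by exact: cone_int_ge0.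
have mSh n : measurable_fun setT (cone_int (h n)) by exact: measurable_cone_int.
have hgS n x : (cone_int (h n) x <= S x)%E by apply: le_cone_int => // z _; exact: hg.
have lim0 x : (S x < +oo)%E -> (cone_int (h n) x @[n --> \oo] --> 0%E).
  move=> Sx.
  pose F n z := (h n z * cone_ker x z * W z)%:E.
  pose H z := (g z `^ r * cone_ker x z * W z)%:E.
  have F0 n z : (0 <= F n z)%E by rewrite lee_fin (@cone_integrand_ge0 (h n)).
  have mF n : measurable_fun setT (F n) by apply: (@measurable_cone_integrand (h n)).
  have H0 z : (0 <= H z)%E by rewrite lee_fin (@cone_integrand_ge0 (fun z => g z `^ r)).
  have mH : measurable_fun setT H by apply: (@measurable_cone_integrand (fun z => g z `^ r)).
  have iH : lam.-integrable setT H.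
    apply/integrableP; split => //.
    by under eq_integral do rewrite gee0_abs//.
  have cF : {ae lam, forall z, setT z -> F ^~ z @ \oo --> 0%E}.
    apply: aeW => z _.
    have [z0|z0] := pselect (0 < z.2); last first.
      rewrite (_ : F ^~ z = cst 0%E); first exact: cvg_cst.
      by apply/funext => n; rewrite /F dt_weight_out// mulr0.
    have [gz|gz] := eqVneq (g z) 0.
      rewrite (_ : F ^~ z = cst 0%E); first exact: cvg_cst.
      by apply/funext => n; rewrite /F /h gz mul0r powR0 ?gt_eqF// !mul0r.
    have [N GN] := Gcov z z0 gz.
    apply/cvg0_ereal => [n|e' e'0]; first exact: F0.
    exists N => // n Nn; rewrite /F /h indicE memNset; last by apply; exact: Gnd GN.
    by rewrite mulr0 powR0 ?gt_eqF// !mul0r lee_fin ltW.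
  have FH : {ae lam, forall z n, setT z -> (`|F n z| <= H z)%E}.
    apply: aeW => z n _; rewrite gee0_abs// lee_fin.
    apply: ler_wpM2r; first exact: dt_weight_ge0.
    by apply: ler_wpM2r; [exact: cone_ker_ge0|exact: hg].
  have [_ _] := @dominated_convergence _ _ _ lam setT measurableT F (cst 0%E) H mF (measurable_cst _) cF iH FH.
  by rewrite integral0.
have [N HN] := power_tail k0 Sh0 mSh mS hgS lim0 fin e0.
by exists N.
Qed.

Lemma first_index {d'} {T : measurableType d'} (A : nat -> set T) :
  (forall k, measurable (A k)) -> exists kk : T -> nat,
  [/\ forall k, measurable [set t | kk t = k],
      forall t, (exists k, A k t) -> A (kk t) t &
      forall t k, (k < kk t)%N -> ~ A k t].
Proof.
move=> mA; pose P t : pred nat := fun k => `[< A k t >].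
have ex t : (exists k, A k t) -> exists k, P t k by move=> [k Ak]; exists k; exact/asboolP.
(* Points lying in none of the sets receive the index 0, so the level set of 0 also contains their
   common complement. *)
pose kk t := match pselect (exists k, A k t) with
  | left h => ex_minn (ex t h) | right _ => 0%N end.
have kkin t : (exists k, A k t) -> A (kk t) t.
  rewrite /kk; case: pselect => // h _; by case: ex_minnP => m /asboolP.
have kkmin t k : (k < kk t)%N -> ~ A k t.
  rewrite /kk; case: pselect => // h; case: ex_minnP => m _ mmin km Ak.
  by have := mmin k (asboolT Ak); rewrite leqNgt km.
exists kk; split => // k.
pose N := \bigcap_j ~` A j.
have mN : measurable N by apply: bigcapT_measurable => j; exact: measurableC.
pose B k := A k `\` \big[setU/set0]_(j < k) A j.
have mB : measurable (B k).
  by apply: measurableD => //; apply: bigsetU_measurable => j _.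
have inB t : (exists j, A j t) -> B (kk t) t.
  move=> h; split; first exact: kkin.
  by rewrite -bigcup_mkord => -[j /= jk Aj]; exact: kkmin jk Aj.
have Buniq t j l : B j t -> B l t -> j = l.
  move=> [Aj nj] [Al nl]; case: (ltngtP j l) => // h.
    by exfalso; apply: nl; rewrite -bigcup_mkord; exists j.
  by exfalso; apply: nj; rewrite -bigcup_mkord; exists l.
rewrite (_ : [set t | kk t = k] = B k `|` (if k == 0%N then N else set0)).
  by apply: measurableU => //; case: ifP.
apply/seteqP; split => t /=.
  move=> kt; have [h|h] := pselect (exists j, A j t); first by left; rewrite -kt; exact: inB.
  right; rewrite -kt /kk; case: pselect => [//|_] /=.
  by move=> j _ Aj; apply: h; exists j.
case=> [Bk|]; first by apply: (Buniq t _ _ (inB t _) Bk); exists k; case: Bk.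
case: eqP => // -> Nt; rewrite /kk; case: pselect => // -[j Aj].
by exfalso; exact: Nt Aj.
Qed.

Lemma measurable_fun_index {d'} {T : measurableType d'} (kk : T -> nat) (h : nat -> T -> R) :
  (forall k, measurable [set t | kk t = k]) -> (forall k, measurable_fun setT (h k)) ->
  measurable_fun setT (fun t => h (kk t) t).
Proof.
move=> mkk mh _ Y mY; rewrite setTI.
rewrite (_ : _ @^-1` Y = \bigcup_k ([set t | kk t = k] `&` (h k @^-1` Y))).
  apply: bigcupT_measurable => k; apply: measurableI => //.
  by rewrite -[_ @^-1` _]setTI; exact: mh.
apply/seteqP; split => t /=; first by move=> ht; exists (kk t).
by move=> [k _ [<-]].
Qed.

Lemma powR_le_inv (r x y : R) : 0 < r -> 0 <= x -> 0 <= y -> x `^ r <= y `^ r -> x <= y.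
Proof.
move=> r0 x0 y0; apply: contraTT; rewrite -!ltNge => yx.
by apply: gt0_ltr_powR; rewrite ?nnegrE.
Qed.

Section weight_bounds.
Variables (p rho : R) (A : X -> R).
Hypotheses (rho_gt0 : 0 < rho) (rho_lt : rho < p).
Hypothesis A_gt0 : forall x, 0 < A x.
Hypothesis mA : measurable_fun setT A.
Hypothesis A_fin : (\int[mu]_x (A x `^ p)%:E < +oo)%E.

Lemma wgt_le (M : R) z : 0 < z.2 -> (forall x, A x <= M) -> wgt rho A z <= M.
Proof.
move=> z0 AM; have M0 : 0 < M := lt_le_trans (A_gt0 o) (AM o).
have w0 := wgt_gt0 rho_gt0 rho_lt A_gt0 mA A_fin z0.
have : (cavg (fun x => A x `^ rho)%R z <= cavg (cst (M `^ rho)%R) z)%E.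
  apply: le_cavg => // [x||x _]; first exact: powR_ge0.
    exact: measurable_fun_powR.
  by rewrite /= ge0_ler_powR ?nnegrE ?(ltW rho_gt0) ?(ltW M0) ?(ltW (A_gt0 x)).
rewrite (cavg_wgt rho_gt0 rho_lt A_gt0 mA A_fin z0) cavg_cst ?powR_ge0// lee_fin.
exact: powR_le_inv rho_gt0 (ltW w0) (ltW M0).
Qed.

Lemma wgt_ge (c : R) z : 0 < z.2 -> 0 < c -> (forall x, cone alpha x z -> c <= A x) ->
  c <= wgt rho A z.
Proof.
move=> z0 c0 AM.
have w0 := wgt_gt0 rho_gt0 rho_lt A_gt0 mA A_fin z0.
have : (cavg (cst (c `^ rho)%R) z <= cavg (fun x => A x `^ rho)%R z)%E.
  apply: le_cavg => // [x||x xz]; first exact: powR_ge0.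
    exact: measurable_fun_powR.
  by rewrite /= ge0_ler_powR ?nnegrE ?(ltW rho_gt0) ?(ltW c0) ?(ltW (A_gt0 x))// AM.
rewrite (cavg_wgt rho_gt0 rho_lt A_gt0 mA A_fin z0) cavg_cst ?powR_ge0// lee_fin.
exact: powR_le_inv rho_gt0 (ltW c0) (ltW w0).
Qed.

End weight_bounds.

(** For functions bounded by K and supported in a cylinder, the upper bound comes from the cone
    integral of the cylinder and the lower one from w at the vertices of cones meeting it. The
    constants are uniform in f; through [wgt_le] and [wgt_ge] they bound the logarithm of the
    weight. *)
Lemma area_wgt_bounds (q K : R) (w : X -> R) (n : nat) : 0 < q -> 0 <= K ->
  measurable_fun setT w -> (forall x, 0 < w x <= 1) ->
  (forall m : nat, exists2 c : R, 0 < c & forall x, ball o m.+1%:R x -> c <= w x) ->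
  exists c M : R, [/\ 0 < c, 0 < M & forall f : X * R -> R,
    (forall z, 0 <= f z) -> measurable_fun setT f ->
    (forall z, f z <= K * \1_(cylinder n) z) ->
    (forall x, area_wgt q w f x <= M) /\
    (forall x z, cylinder n z -> cone alpha x z -> c <= area_wgt q w f x)].
Proof.
move=> q0 K0 mw w01 wlow.
have [N [C C0 HC]] := cone_int_cylinder n; have [N' HN'] := cone_cylinder n.
have [c c0 Hc] := wlow N'.
have q4 : 0 < 4^-1 :> R by rewrite invr_gt0.
exists (4^-1 * c), (4^-1 * ((K `^ q * C) `^ q^-1 + 1)); split; first by rewrite mulr_gt0.
  by rewrite mulr_gt0// ltr_wpDl// powR_ge0.
move=> f f0 mf fK; split => [x|x z zn xz]; rewrite /area_wgt; apply: ler_wpM2l; rewrite ?(ltW q4)//.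
  apply: lerD; last by case/andP: (w01 x).
  have mI : measurable_fun setT (\1_(cylinder n) : X * R -> R).
    exact: measurable_indic (measurable_cylinder n).
  have S1 : (cone_int (fun z => f z `^ q)%R x <= (K `^ q * C)%:E)%E.
    apply: (@le_trans _ _ (cone_int (fun z => K `^ q * \1_(cylinder n) z)%R x)).
      apply: le_cone_int.
      - by move=> z; exact: powR_ge0.
      - exact: measurable_fun_powR.
      - exact: measurable_funM.
      move=> z _; apply: (@le_trans _ _ ((K * \1_(cylinder n) z) `^ q)).
        rewrite ge0_ler_powR ?nnegrE ?(ltW q0)// mulr_ge0//.
      rewrite indicE; case: (z \in _); first by rewrite !mulr1.
      by rewrite !mulr0 powR0// gt_eqF.
    rewrite (cone_intZ x (powR_ge0 _ _) _ mI); last by move=> z.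
    rewrite EFinM; apply: lee_wpmul2l; first by rewrite lee_fin powR_ge0.
    by apply: le_trans (HC x) _; rewrite lee_fin ler_piMr// indicE.
  rewrite ge0_ler_powR ?nnegrE ?invr_ge0 ?(ltW q0)//.
  - by rewrite fine_ge0// cone_int_ge0// => z; exact: powR_ge0.
  - by rewrite mulr_ge0 ?powR_ge0.
  rewrite -lee_fin fineK// ge0_fin_numE; first by rewrite (le_lt_trans S1)// ltry.
  by apply: cone_int_ge0 => z; exact: powR_ge0.
apply: (@le_trans _ _ (w x)); first exact: Hc _ (HN' _ _ zn xz).
by rewrite lerDr powR_ge0.
Qed.

Lemma ln_between (c M x : R) : 0 < c -> c <= x -> x <= M -> `|ln x| <= `|ln c| + `|ln M|.
Proof.
move=> c0 cx xM; have x0 := lt_le_trans c0 cx; have M0 := lt_le_trans x0 xM.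
have h1 : ln c <= ln x by rewrite ler_ln ?posrE.
have h2 : ln x <= ln M by rewrite ler_ln ?posrE.
have := ler_norm (ln M); have := ler_norm (- ln c); rewrite normrN ler_norml => h3 h4.
have := normr_ge0 (ln c); have := normr_ge0 (ln M).
by move=> ? ?; apply/andP; split; lra.
Qed.

(** On such a set ln g is bounded; the sets increase with n and exhaust the part of the half-space
    where g is not 0. *)
Definition plateau g n : set (X * R) :=
  cylinder n `&` (g @^-1` `[n.+1%:R^-1, n.+1%:R]%classic).

Lemma plateauP g n z : plateau g n z <-> cylinder n z /\ n.+1%:R^-1 <= g z <= n.+1%:R.
Proof. by split; rewrite /plateau /= in_itv. Qed.

Lemma measurable_plateau g n : measurable_fun setT g -> measurable (plateau g n).
Proof.
move=> mg; apply: measurableI; first exact: measurable_cylinder.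
by rewrite -[_ @^-1` _]setTI; exact: mg.
Qed.

Lemma le_plateau g m n : (m <= n)%N -> plateau g m `<=` plateau g n.
Proof.
move=> mn z /plateauP[zm /andP[a b]]; have h : m.+1%:R <= n.+1%:R :> R by rewrite ler_nat.
apply/plateauP; split; first exact: le_cylinder zm.
by rewrite (le_trans b h) andbT (le_trans _ a)// lef_pV2 ?posrE.
Qed.

Lemma plateau_cover g z : (forall z, 0 <= g z) -> 0 < z.2 -> g z != 0 -> exists n, plateau g n z.
Proof.
move=> g0 z0 gz; have gz0 : 0 < g z by rewrite lt_neqAle eq_sym gz /= g0.
have [n zn] := cylinder_cover z0.
pose l := maxn n (maxn (Num.truncn (g z)) (Num.truncn (g z)^-1)); exists l.
have : (l <= l)%N by []; rewrite {1}/l !geq_max => /and3P[h1 h2 h3].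
have lt (x : R) : (Num.truncn x <= l)%N -> x < l.+1%:R.
  by move=> xn; rewrite (lt_le_trans (truncnS_gt _))// ler_nat ltnS.
apply/plateauP; split; first exact: le_cylinder zn.
rewrite (ltW (lt _ h2)) andbT -[leRHS]invrK lef_pV2 ?posrE ?invr_gt0//; exact/ltW/lt.
Qed.

Lemma area_scale (i r c : R) (g : X * R -> R) : 0 < i -> 0 < r -> 0 <= c ->
  (forall z, 0 <= g z) -> measurable_fun setT g ->
  (\int[mu]_x (cone_int (fun z => (c * g z) `^ r)%R x `^ (i * r)^-1) =
   (c `^ i^-1)%:E * \int[mu]_x (cone_int (fun z => g z `^ r)%R x `^ (i * r)^-1))%E.
Proof.
move=> i0 r0 c0 g0 mg.
have mgr : measurable_fun setT (fun z => g z `^ r) by exact: measurable_fun_powR.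
have gr0 z : 0 <= g z `^ r by exact: powR_ge0.
have E x : (cone_int (fun z => (c * g z) `^ r)%R x `^ (i * r)^-1 =
    (c `^ i^-1)%:E * cone_int (fun z => g z `^ r)%R x `^ (i * r)^-1)%E.
  rewrite (@eq_cone_int _ (fun z => c `^ r * g z `^ r)); last by move=> z; rewrite powRM.
  rewrite cone_intZ ?powR_ge0// poweRM ?lee_fin ?powR_ge0 ?cone_int_ge0// poweR_EFin -powRrM.
  by congr (_%:E * _)%E; congr (_ `^ _); field; rewrite !gt_eqF.
rewrite -ge0_integralZlT ?powR_ge0//; first by apply: eq_integral => x _; exact: E.
  by move=> x; exact: poweR_ge0.
by apply: (measurableT_comp (measurable_poweR _)); exact: measurable_cone_int.
Qed.

(** * Factorisation of a tent function between the two end spaces *)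

Section calderon_product.
Variables (theta i0 q0 i1 q1 i q : R).
Hypotheses (theta01 : 0 <= theta <= 1) (i0_01 : 0 <= i0 <= 1) (i1_01 : 0 <= i1 <= 1).
Hypotheses (q0_gt1 : 1 < q0) (q1_gt1 : 1 < q1) (i_gt0 : 0 < i) (q_gt0 : 0 < q).
Hypothesis iE : i = (1 - theta) * i0 + theta * i1.
Hypothesis qE : q^-1 = (1 - theta) * q0^-1 + theta * q1^-1.

(** The m k-th plateau is chosen so large that the part of g off it has norm at most 8^{-(k + 1)},
    and kk z is the first k whose plateau contains z. Piece k + 1 lies off the m k-th plateau, hence
    has that smallness; piece 0 inherits the norm of g. *)
Lemma calderon_pieces (g : X * R -> R) : (forall z, 0 <= g z) -> measurable_fun setT g ->
  (forall z, ~ 0 < z.2 -> g z = 0) -> tent_bd i q 1 g ->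
  exists kk : X * R -> nat, exists m : nat -> nat,
  [/\ forall k, measurable [set z | kk z = k],
     forall z, g z != 0 -> cylinder (m (kk z)) z /\ (m (kk z)).+1%:R^-1 <= g z <= (m (kk z)).+1%:R &
     forall k, tent_bd i q 1 (fun z => 8 ^+ k * g z * \1_[set z | kk z = k] z)].
Proof.
move=> g0 mg gout tg.
have tg' := tg; rewrite /tent_bd (gt_eqF i_gt0) in tg'.
pose G := plateau g.
have mG n : measurable (G n) by exact: measurable_plateau.
have GP n z : G n z <-> cylinder n z /\ n.+1%:R^-1 <= g z <= n.+1%:R := plateauP g n z.
have Gnd m n : (m <= n)%N -> G m `<=` G n by exact: le_plateau.
have Gcov z : 0 < z.2 -> g z != 0 -> exists n, G n z by exact: plateau_cover.
have fin : (\int[mu]_x (cone_int (fun z => g z `^ q)%R x `^ (i * q)^-1) < +oo)%E.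
  by apply: le_lt_trans tg' _; rewrite ltry.
have tail := tent_tail i_gt0 q_gt0 g0 mg mG Gnd Gcov fin.
have e0 k : 0 < (8 ^- k.+1) `^ i^-1 :> R by rewrite powR_gt0// invr_gt0 exprn_gt0.
have /choice[m0 Hm0] : forall k, exists N, forall n, (N <= n)%N ->
    (\int[mu]_x (cone_int (fun z => (g z * \1_(~` G n) z) `^ q)%R x `^ (i * q)^-1)
      <= ((8 ^- k.+1) `^ i^-1)%:E)%E.
  by move=> k; exact: tail.
(* The maximum with k makes m unbounded, so that the chosen plateaus still exhaust the support of
   g. *)
pose m k := maxn (m0 k) k.
have [kk [mkk kin kmin]] := first_index (fun k => mG (m k)).
have kg z : g z != 0 -> cylinder (m (kk z)) z /\ (m (kk z)).+1%:R^-1 <= g z <= (m (kk z)).+1%:R.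
  move=> gz; apply/GP; apply: kin.
  have [z0|z0] := pselect (0 < z.2); last by rewrite gout// eqxx in gz.
  by have [n Gn] := Gcov z z0 gz; exists n; apply: Gnd Gn; exact: leq_maxr.
exists kk, m; split; [exact: mkk|exact: kg|].
have mI k : measurable_fun setT (\1_[set z | kk z = k] : X * R -> R) by exact: measurable_indic.
have mIg k : measurable_fun setT (fun z => 8 ^+ k * g z * \1_[set z | kk z = k] z).
  by apply: measurable_funM => //; exact: measurable_funM.
have Ig0 k z : 0 <= 8 ^+ k * g z * \1_[set z | kk z = k] z.
  by rewrite !mulr_ge0// exprn_ge0.
case=> [|k].
  apply: (le_tent_bd (ltW i_gt0) (ltW q_gt0) (Ig0 0%N) (mIg 0%N) mg _ tg).
  by move=> z _; rewrite expr0 mul1r ler_piMr// indicE; case: (_ \in _).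
pose h z := 8 ^+ k.+1 * (g z * \1_(~` G (m k)) z).
have h0 z : 0 <= h z by rewrite !mulr_ge0// exprn_ge0.
have mh : measurable_fun setT h.
  apply: measurable_funM => //; apply: measurable_funM => //.
  by apply: measurable_indic; exact: measurableC.
apply: (le_tent_bd (ltW i_gt0) (ltW q_gt0) (Ig0 k.+1) (mIg k.+1) mh).
  move=> z _; rewrite /h -mulrA ler_wpM2l ?exprn_ge0// ler_wpM2l// !indicE ler_nat.
  have [/set_mem/= kz|_] := boolP (z \in [set z | kk z = k.+1]); last by case: (_ \in _).
  by rewrite mem_set//; apply: kmin; rewrite kz.
rewrite /tent_bd (gt_eqF i_gt0).
have mgI : measurable_fun setT (fun z => g z * \1_(~` G (m k)) z).
  by apply: measurable_funM => //; apply: measurable_indic; exact: measurableC.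
have gI0 z : 0 <= g z * \1_(~` G (m k)) z by exact: mulr_ge0.
rewrite (area_scale i_gt0 q_gt0 _ gI0 mgI) ?exprn_ge0//.
apply: le_trans (lee_wpmul2l _ (Hm0 k (m k) (leq_maxl _ _))) _; first by rewrite lee_fin powR_ge0.
by rewrite -EFinM lee_fin -powRM ?invr_ge0 ?exprn_ge0// mulfV ?powR1//.
Qed.

Let p := i^-1.
Let rho := p / 2.
Let wg (w : X -> R) (h : X * R -> R) z := wgt rho (area_wgt q w h) z.

Lemma calderon_factor (j r : R) (x a lx la : R) : x = expR lx -> a = expR la ->
  x `^ (q / r) * a `^ (p * j - q / r) = expR ((q / r) * lx + (p * j - q / r) * la).
Proof. by move=> -> ->; rewrite -!expRM -expRD; congr expR; ring. Qed.

Lemma calderon_const (a b C l v : R) : 0 <= a -> 0 <= b -> 0 <= C -> C <= a + b ->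
  0 < l -> 0 <= v -> (4 * (1 + a + (1 + b)) * l)^-1 * (4 * l * v) <= (1 + C)^-1 * v.
Proof.
move=> a0 b0 C0 Cab l0 v0.
have ab : 0 < 1 + a + (1 + b) by lra.
have -> : (4 * (1 + a + (1 + b)) * l)^-1 * (4 * l * v) = (1 + a + (1 + b))^-1 * v.
  by field; rewrite (gt_eqF l0) (gt_eqF ab).
by rewrite ler_wpM2r// lef_pV2 ?posrE//; lra.
Qed.

(* L = ln (G.2 / G.1) is unbounded in general. It is bounded on each of the pieces
   [kk z = k] cut out so that 8 ^ k g has norm at most lmb there; this leaves room for
   the factor 2 ^ kk, which makes the pieces with k > n uniformly small. *)
Lemma calderon_decomposition : exists2 C : R, 0 < C & forall (g : X * R -> R) (lmb : R),
  0 < lmb -> (forall z, 0 <= g z) -> measurable_fun setT g ->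
  (forall z, ~ 0 < z.2 -> g z = 0) -> tent_bd i q 1 (fun z => lmb^-1 * g z) ->
  exists (kk : X * R -> nat) (L : X * R -> R),
  [/\ measurable_fun setT L,
      forall n, exists M, forall z, g z != 0 -> (kk z <= n)%N -> `|L z| <= M &
      exists G : (X * R -> R) * (X * R -> R),
      [/\ measurable_fun setT G.1 /\ measurable_fun setT G.2,
          forall z, G.1 z = 2 ^+ kk z * (g z * expR (- theta * L z)),
          forall z, G.2 z = 2 ^+ kk z * (g z * expR ((1 - theta) * L z)),
          tent_bd i0 q0 1 (fun z => (C * lmb)^-1 * G.1 z) &
          tent_bd i1 q1 1 (fun z => (C * lmb)^-1 * G.2 z)]].
Proof.
have p0 : 0 < p by rewrite invr_gt0.
have rho0 : 0 < rho by rewrite divr_gt0.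
have rhop : rho < p by rewrite ltr_pdivrMr// ltr_pMr// ltr1n.
have [i00 i01] := andP i0_01; have [i10 i11] := andP i1_01.
have q00 : 0 < q0 := lt_trans ltr01 q0_gt1.
have q10 : 0 < q1 := lt_trans ltr01 q1_gt1.
have ile1 : 0 < i <= 1.
  rewrite i_gt0 iE /=; have [t0 t1] := andP theta01.
  have := ler_wpM2l t0 i11; have := ler_wpM2l (_ : 0 <= 1 - theta) i01.
  by rewrite subr_ge0 => /(_ t1); lra.
have [w [mw w01 wint wlow]] := localizing_weight.
have [D0 D00 H0] := weighted_tent_bd rho0 rhop q_gt0 i00 q00.
have [D1 D10 H1] := weighted_tent_bd rho0 rhop q_gt0 i10 q10.
have [C0 C00 S0] := tent_bd_sum i0_01 (ltW q0_gt1).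
have [C1 C10 S1] := tent_bd_sum i1_01 (ltW q1_gt1).
have CD0 : 0 <= C0 * D0 by exact: mulr_ge0.
have CD1 : 0 <= C1 * D1 by exact: mulr_ge0.
have Kp : 0 < 4 * (1 + C0 * D0 + (1 + C1 * D1)) by lra.
exists (4 * (1 + C0 * D0 + (1 + C1 * D1))) => //.
move=> g lmb lmb0 g0 mg gout tg.
have lV0 : 0 < lmb^-1 by rewrite invr_gt0.
pose g' z := lmb^-1 * g z.
have g'0 z : 0 <= g' z by rewrite mulr_ge0// ltW.
have mg' : measurable_fun setT g' by exact: measurable_funM.
have g'out z : ~ 0 < z.2 -> g' z = 0 by move=> z0; rewrite /g' gout// mulr0.
have [kk [m [mkk kin tkk]]] := calderon_pieces g'0 mg' g'out tg.
pose h k z := 8 ^+ k * g' z * \1_[set z | kk z = k] z.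
have h0 k z : 0 <= h k z by rewrite /h mulr_ge0// mulr_ge0// exprn_ge0.
have mI k : measurable_fun setT (\1_[set z | kk z = k] : X * R -> R) by exact: measurable_indic.
have mh k : measurable_fun setT (h k) by apply: measurable_funM => //; exact: measurable_funM.
have AM k : area_majorant p q (fun z => 4^-1 * h k z) (area_wgt q w (h k)) :=
  area_majorant_tent_bd ile1 q_gt0 mw w01 wint (h0 k) (mh k) (tkk k).
pose x k z := 4^-1 * h k z.
have x0 k z : 0 <= x k z by rewrite mulr_ge0// invr_ge0.
have mx k : measurable_fun setT (x k) by exact: measurable_funM.
pose a k z := wg w (h k) z.
have ma k : measurable_fun setT (a k).
  by have [_ mA _ _] := AM k; apply: measurable_wgt mA.
(* The function of the key estimate for the exponents (j, r), built from the k-th piece and its own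
   weight. *)
pose Gm r j k z := x k z `^ (q / r) * a k z `^ (p * j - q / r).
have Gm0 r j k z : 0 <= Gm r j k z by rewrite mulr_ge0 ?powR_ge0.
have mGm r j k : measurable_fun setT (Gm r j k).
  by apply: measurable_funM; [exact: measurable_fun_powR|exact: measurable_fun_powR].
have T0 k : tent_bd i0 q0 D0 (Gm q0 i0 k)
    := H0 _ _ (x0 k) (mx k) (AM k).
have T1 k : tent_bd i1 q1 D1 (Gm q1 i1 k) := H1 _ _ (x0 k) (mx k) (AM k).
(* These exponents make [Lk] the logarithm of the quotient of the end functions [Gm q1 i1] and
   [Gm q0 i0], where both are positive. *)
pose e1 := q / q1 - q / q0; pose e2 := p * (i1 - i0) - e1.
pose Lk k z := e1 * ln (x k z) + e2 * ln (a k z).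
have mLk k : measurable_fun setT (Lk k).
  by apply: measurable_funD; apply: measurable_funM => //; apply: measurableT_comp.
pose L z := Lk (kk z) z.
have mL : measurable_fun setT L by exact: measurable_fun_index.
have bounds k : exists M, forall z, g z != 0 -> kk z = k ->
    [/\ 0 < x k z, 0 < a k z & `|Lk k z| <= M].
  pose K := 8 ^+ k * (m k).+1%:R : R.
  have K0 : 0 <= K by rewrite mulr_ge0// exprn_ge0.
  have [c [M [c0 M0 HcM]]] := area_wgt_bounds (m k) q_gt0 K0 mw w01 wlow.
  have hK z : h k z <= K * \1_(cylinder (m k)) z.
    rewrite /h !indicE; have [/set_mem/= kz|_] := boolP (z \in [set z | kk z = k]); last first.
      by rewrite mulr0 mulr_ge0.
    have [gz|gz] := eqVneq (g' z) 0; first by rewrite gz mulr0 mul0r mulr_ge0.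
    have [zm /andP[_ gm]] := kin z gz; rewrite kz in zm gm.
    by rewrite mem_set// !mulr1 /K ler_wpM2l// exprn_ge0.
  have [AM1 AM2] := HcM (h k) (h0 k) (mh k) hK.
  have [A0 mA _ _] := AM k; have Afin := area_majorant_lty (AM k).
  pose xc := 4^-1 * (8 ^+ k * (m k).+1%:R^-1) : R.
  pose xM := 4^-1 * K.
  have xc0 : 0 < xc by rewrite !mulr_gt0 ?invr_gt0 ?exprn_gt0.
  exists (`|e1| * (`|ln xc| + `|ln xM|) + `|e2| * (`|ln c| + `|ln M|)) => z gz kz.
  have gz' : g' z != 0 by rewrite mulf_neq0// gt_eqF.
  have [zm /andP[gm1 gm2]] := kin z gz'; rewrite kz in zm gm1 gm2.
  have z0 := cylinder_gt0 zm.
  have hz : h k z = 8 ^+ k * g' z by rewrite /h indicE mem_set// mulr1.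
  have xz1 : xc <= x k z.
    by rewrite /xc /x hz ler_wpM2l ?invr_ge0// ler_wpM2l ?exprn_ge0.
  have xz2 : x k z <= xM.
    by rewrite /xM /x hz /K ler_wpM2l ?invr_ge0// ler_wpM2l ?exprn_ge0.
  have az1 : c <= a k z by apply: (wgt_ge rho0 rhop) => // y yz; exact: AM2 zm yz.
  have az2 : a k z <= M by exact: (wgt_le rho0 rhop).
  split; [exact: lt_le_trans xz1|exact: lt_le_trans az1|].
  rewrite /Lk (le_trans (ler_normD _ _))// !normrM.
  by apply: lerD; apply: ler_wpM2l => //; apply: ln_between.
have [Mk HMk] := choice bounds.
exists kk, L; split => //.
  move=> n; exists (\sum_(k < n.+1) `|Mk k|) => z gz kn.
  have [_ _ h1] := HMk (kk z) z gz erefl.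
  apply: le_trans h1 _; rewrite (bigD1 (Ordinal (kn : (kk z < n.+1)%N)))//=.
  by rewrite (le_trans (ler_norm _))// lerDl sumr_ge0.
have [t0 t1] := andP theta01.
have pi1 : p * ((1 - theta) * i0 + theta * i1) = 1 by rewrite -iE mulVf ?gt_eqF.
have qq1 : q * ((1 - theta) * q0^-1 + theta * q1^-1) = 1 by rewrite -qE mulfV ?gt_eqF.
(* On piece k, g is 4 lmb 8^{-k} x, and 2^k 8^{-k} is the coefficient 4^{-k} of [tent_bd_sum]. The
   two relations between the exponents, [pi1] and [qq1], identify x exp(s L) with [Gm r j]. *)
have expand (s : R) (j r : R) z : (s = - theta /\ j = i0 /\ r = q0) \/ (s = 1 - theta /\ j = i1 /\ r = q1) ->
    0 < r -> 2 ^+ kk z * (g z * expR (s * L z)) = 4 * lmb * (4^-1 ^+ kk z * Gm r j (kk z) z).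
  move=> sjr r0; pose k := kk z; rewrite -/k.
  have hz : h k z = 8 ^+ k * g' z by rewrite /h indicE mem_set// mulr1.
  have [gz|gz] := eqVneq (g z) 0.
    rewrite gz mul0r mulr0 /Gm /x hz /g' gz !mulr0 powR0 ?mul0r ?mulr0//.
    by rewrite gt_eqF// divr_gt0.
  have [xz az _] := HMk k z gz erefl.
  have gE : g z = 4 * lmb * (8 ^- k * x k z).
    rewrite /x hz /g'; have e8 : (8 ^+ k : R) != 0 by rewrite expf_neq0.
    by field; rewrite e8 gt_eqF.
  rewrite gE /Gm (@calderon_factor j r (x k z) (a k z) (ln (x k z)) (ln (a k z))) ?lnK ?posrE//.
  have -> : 2 ^+ k * (4 * lmb * (8 ^- k * x k z) * expR (s * L z)) =
      4 * lmb * ((2 ^+ k * 8 ^- k) * (x k z * expR (s * L z))) by ring.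
  congr (_ * _); congr (_ * _).
    by rewrite -exprVn -exprMn; congr (_ ^+ _); field.
  rewrite -{1}(lnK xz) -expRD; congr expR; rewrite /L -/k /Lk.
  move: (ln (x k z)) (ln (a k z)) => lx la.
  have E1 : 1 + s * e1 = q / r.
    rewrite -qq1 /e1; case: sjr => -[-> [_ ->]]; ring.
  have E2 : s * e2 = p * j - q / r.
    rewrite /e2 mulrBr -E1; have -> : p * j = 1 + s * (p * (i1 - i0)).
      by rewrite -pi1; case: sjr => -[-> [-> _]]; ring.
    ring.
  have -> : lx + s * (e1 * lx + e2 * la) = (1 + s * e1) * lx + s * e2 * la by ring.
  by rewrite E1 E2.
pose G1 z := 2 ^+ kk z * (g z * expR (- theta * L z)).
pose G2 z := 2 ^+ kk z * (g z * expR ((1 - theta) * L z)).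
have m2 : measurable_fun setT (fun z => 2 ^+ kk z : R).
  by apply: (measurable_fun_index (h := fun k _ => 2 ^+ k)).
have m4 r j : measurable_fun setT (fun z => 4^-1 ^+ kk z * Gm r j (kk z) z).
  apply: measurable_funM; last exact: measurable_fun_index.
  by apply: (measurable_fun_index (h := fun k _ => 4^-1 ^+ k)).
have mG (s : R) : measurable_fun setT (fun z => 2 ^+ kk z * (g z * expR (s * L z))).
  apply: measurable_funM => //; apply: measurable_funM => //.
  by apply: measurableT_comp => //; exact: measurable_funM.
have Gk0 r j z : 0 <= 4^-1 ^+ kk z * Gm r j (kk z) z by rewrite mulr_ge0// exprn_ge0 ?invr_ge0.
have fin (j r C s : R) : 0 <= j <= 1 -> 1 < r -> 0 <= C -> C <= C0 * D0 + C1 * D1 ->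
    (s = - theta /\ j = i0 /\ r = q0) \/ (s = 1 - theta /\ j = i1 /\ r = q1) ->
    tent_bd j r C (fun z => 4^-1 ^+ kk z * Gm r j (kk z) z) ->
    tent_bd j r 1 (fun z => (4 * (1 + C0 * D0 + (1 + C1 * D1)) * lmb)^-1 *
      (2 ^+ kk z * (g z * expR (s * L z)))).
  move=> j01 r1 CC0 CC sjr H; have r0 : 0 < r := lt_trans ltr01 r1.
  have j0 : 0 <= j by case/andP: j01.
  have := tent_bd_normalize j01 (ltW r1) CC0 (Gk0 r j) (m4 r j) H.
  have den : 0 < 4 * (1 + C0 * D0 + (1 + C1 * D1)) * lmb := mulr_gt0 Kp lmb0.
  apply: le_tent_bd => //; first exact: ltW.
  - by move=> z; rewrite mulr_ge0 ?invr_ge0 ?(ltW den)// mulr_ge0 ?exprn_ge0// mulr_ge0// expR_ge0.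
  - exact: measurable_funM.
  - exact: measurable_funM.
  move=> z _; rewrite (expand _ _ _ _ sjr r0).
  exact: (calderon_const CD0 CD1 CC0 CC lmb0 (Gk0 r j z)).
exists (G1, G2); split => //=.
- by split; exact: mG.
- apply: fin CD0 _ _ _ => //; first by rewrite lerDl.
    by left.
  by apply: S0 => // k; exact: T0.
- apply: fin CD1 _ _ _ => //; first by rewrite lerDr.
    by right.
  by apply: S1 => // k; exact: T1.
Qed.

End calderon_product.

(** f + g is at most twice the larger of the two, and choosing the larger pointwise is an instance
    of [tent_bd_sum] with two pieces. The factor 8 is this 2 times the 4 that undoes the coefficient
    1 / 4 of the second piece. *)
Lemma tent_bd_add (i r : R) : 0 <= i <= 1 -> 1 <= r -> exists2 K : R, 0 < K &
  forall f g : X * R -> R, (forall z, 0 <= f z) -> (forall z, 0 <= g z) ->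
  measurable_fun setT f -> measurable_fun setT g -> tent_bd i r 1 f -> tent_bd i r 1 g ->
  tent_bd i r 1 (fun z => K^-1 * (f z + g z)).
Proof.
move=> i01 r1; have [i0 i1] := andP i01; have r0 : 0 < r := lt_le_trans ltr01 r1.
have [C C0 S] := tent_bd_sum i01 r1.
have K0 : 0 < 1 + C by lra.
exists (8 * (1 + C)) => [|f g f0 g0 mf mg tf tg]; first by rewrite mulr_gt0.
pose u (k : nat) : X * R -> R := match k with 0%N => f | 1%N => g | _ => cst 0 end.
pose kk z : nat := (f z < g z)%R.
have u0 k z : 0 <= u k z by case: k => [|[|k]]; [exact: f0|exact: g0|exact: lexx].
have mu' k : measurable_fun setT (u k) by case: k => [|[|k]]; [exact: mf|exact: mg|exact: measurable_cst].
have mkk k : measurable [set z | kk z = k].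
  have mfg : measurable [set z | f z < g z].
    rewrite (_ : [set z | _] = setT `&` (fun z => f z < g z) @^-1` [set true]).
      exact: (measurable_fun_ltr mf mg).
    by rewrite setTI; apply/seteqP; split.
  case: k => [|[|k]].
  - rewrite (_ : [set z | _] = ~` [set z | f z < g z]); first exact: measurableC.
    by apply/seteqP; split => z /=; rewrite /kk; case: (_ < _).
  - rewrite (_ : [set z | _] = [set z | f z < g z])//.
    by apply/seteqP; split => z /=; rewrite /kk; case: (_ < _).
  - rewrite (_ : [set z | _] = set0)//.
    by apply/seteqP; split => z //=; rewrite /kk; case: (_ < _).
have t0 : tent_bd i r 1 (cst 0).
  by apply: (le_tent_bd i0 (ltW r0) (fun _ => lexx _) (measurable_cst _) mf _ tf) => z _; exact: f0.
have tu k : tent_bd i r 1 (u k) by case: k => [|[|k]]; [exact: tf|exact: tg|exact: t0].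
have mh : measurable_fun setT (fun z => 4^-1 ^+ kk z * u (kk z) z).
  apply: measurable_funM; last exact: measurable_fun_index.
  by apply: (measurable_fun_index (h := fun k _ => 4^-1 ^+ k)).
have h0 z : 0 <= 4^-1 ^+ kk z * u (kk z) z by rewrite mulr_ge0// exprn_ge0 ?invr_ge0.
have := S 1 u kk ler01 u0 mu' mh tu; rewrite mulr1 => th.
have := tent_bd_normalize i01 r1 C0 h0 mh th.
apply: (le_tent_bd i0 (ltW r0)).
- by move=> z; rewrite mulr_ge0 ?addr_ge0// invr_ge0 mulr_ge0// ltW.
- by apply: measurable_funM => //; exact: measurable_funD.
- exact: measurable_funM.
move=> z _; rewrite invfM (mulrC 8^-1) -mulrA ler_wpM2l ?invr_ge0 ?(ltW K0)//.
rewrite /u /kk; move: (f0 z) (g0 z); case: ltP => /= fg ? ?; rewrite ?expr1 ?expr0; lra.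
Qed.

Lemma nd_cvg_poweR (u : nat -> \bar R) (l : \bar R) (k : R) : 0 < k -> (forall n, (0 <= u n)%E) ->
  nondecreasing_seq u -> u @ \oo --> l -> (u n `^ k)%E @[n --> \oo] --> (l `^ k)%E.
Proof.
move=> k0 u0 und ul.
have nd : nondecreasing_seq (fun n => u n `^ k)%E.
  by move=> m n mn; apply: ge0_le_poweR (ltW k0) (u0 m) (und _ _ mn).
have lE : l = ereal_sup (range u).
  by rewrite -(cvg_lim _ ul)//; apply: cvg_lim => //; exact: ereal_nondecreasing_cvgn.
have := ereal_nondecreasing_cvgn nd; rewrite (_ : ereal_sup _ = (l `^ k)%E)//.
have l0 : (0 <= l)%E by rewrite lE; apply: le_ereal_sup_tmp; exists (u 0%N) => //; exists 0%N.
apply/eqP; rewrite eq_le; apply/andP; split.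
  apply: ge_ereal_sup => _ [n _ <-]; apply: ge0_le_poweR (ltW k0) (u0 n) _.
  by rewrite lE; apply: ereal_sup_ubound; exists n.
set s := ereal_sup _.
have s0 : (0 <= s)%E by apply: le_ereal_sup_tmp; exists (u 0%N `^ k)%E; [exists 0%N|exact: poweR_ge0].
have kV (x : \bar R) : (0 <= x)%E -> ((x `^ k) `^ k^-1 = x)%E.
  by move=> x0; rewrite -poweRrM mulfV ?gt_eqF// poweRe1.
have : (l <= s `^ k^-1)%E.
  rewrite lE; apply: ge_ereal_sup => _ [n _ <-]; rewrite -[leLHS](kV _ (u0 n)).
  apply: ge0_le_poweR; [by rewrite invr_ge0 ltW|exact: poweR_ge0|].
  by apply: ereal_sup_ubound; exists n.
move=> /(ge0_le_poweR (ltW k0) l0); rewrite -poweRrM mulVf ?gt_eqF// poweRe1//.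
Qed.

(** A Fatou property: monotone convergence inside the cones and then over the vertices. *)
Lemma tent_bd_lim (i r c : R) (g : X * R -> R) (G : nat -> set (X * R)) : 0 < i -> 0 < r ->
  (forall z, 0 <= g z) -> measurable_fun setT g -> (forall n, measurable (G n)) ->
  (forall m n, (m <= n)%N -> G m `<=` G n) ->
  (forall z, 0 < z.2 -> g z != 0 -> exists n, G n z) ->
  (forall n, tent_bd i r c (fun z => g z * \1_(G n) z)) -> tent_bd i r c g.
Proof.
move=> i0 r0 g0 mg mG Gnd Gcov tG.
have k0 : 0 < (i * r)^-1 by rewrite invr_gt0 mulr_gt0.
have I0 n z : 0 <= \1_(G n) z :> R by [].
have mgr : measurable_fun setT (fun z => g z `^ r) by exact: measurable_fun_powR.
have gr0 z : 0 <= g z `^ r by exact: powR_ge0.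
pose h n z := (g z * \1_(G n) z) `^ r.
have h0 n z : 0 <= h n z by exact: powR_ge0.
have mh n : measurable_fun setT (h n).
  by apply: measurable_fun_powR; apply: measurable_funM => //; exact: measurable_indic.
have hnd z m n : (m <= n)%N -> h m z <= h n z.
  move=> mn; apply: ge0_ler_powR; rewrite ?nnegrE ?(ltW r0) ?mulr_ge0//.
  rewrite ler_wpM2l// !indicE ler_nat; have [/set_mem/(Gnd _ _ mn) zn|_] := boolP (z \in G m) => //.
  by rewrite mem_set.
pose S x := cone_int (fun z => g z `^ r) x.
have lim x : (cone_int (h n) x @[n --> \oo] --> S x).
  pose F n z := (h n z * cone_ker x z * W z)%:E.
  pose H z := (g z `^ r * cone_ker x z * W z)%:E.
  have F0 n z : (0 <= F n z)%E by rewrite lee_fin (@cone_integrand_ge0 (h n)).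
  have mF n : measurable_fun setT (F n) by apply: (@measurable_cone_integrand (h n)).
  have Fnd z : nondecreasing_seq (F ^~ z).
    move=> m n mn; rewrite lee_fin ler_wpM2r ?dt_weight_ge0// ler_wpM2r ?cone_ker_ge0//.
    exact: hnd.
  have := @cvg_monotone_convergence _ _ _ lam setT measurableT F mF (fun n z _ => F0 n z) (fun z _ => Fnd z).
  suff -> : (fun z => limn (F ^~ z)) = H by [].
  apply/funext => z; apply: cvg_lim => //.
  have [z0|z0] := pselect (0 < z.2); last first.
    rewrite (_ : F ^~ z = cst (H z)); first exact: cvg_cst.
    by apply/funext => n; rewrite /F /H dt_weight_out// !mulr0.
  have [gz|gz] := eqVneq (g z) 0.
    rewrite (_ : F ^~ z = cst (H z)); first exact: cvg_cst.
    by apply/funext => n; rewrite /F /H /h gz mul0r.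
  have [N GN] := Gcov z z0 gz.
  apply: cvg_near_cst; exists N => // n Nn; rewrite /F /H /h indicE mem_set ?mulr1//.
  exact: Gnd GN.
have Sh0 n x : (0 <= cone_int (h n) x)%E by exact: cone_int_ge0.
have mSh n : measurable_fun setT (fun x => cone_int (h n) x `^ (i * r)^-1)%E.
  by apply: (measurableT_comp (measurable_poweR _)); exact: measurable_cone_int.
have Shnd x : nondecreasing_seq (fun n => cone_int (h n) x).
  by move=> m n mn; apply: le_cone_int => // z _; exact: hnd.
have Sknd x : nondecreasing_seq (fun n => cone_int (h n) x `^ (i * r)^-1)%E.
  by move=> m n mn; apply: ge0_le_poweR (ltW k0) (Sh0 m x) (Shnd x _ _ mn).
have := @cvg_monotone_convergence _ _ _ mu setT measurableT (fun n x => cone_int (h n) x `^ (i * r)^-1)%E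
  mSh (fun n x _ => poweR_ge0 _ _) (fun x _ => Sknd x).
rewrite /tent_bd (gt_eqF i0).
under eq_integral => x _ do rewrite (cvg_lim _ (nd_cvg_poweR k0 (Sh0 ^~ x) (Shnd x) (lim x)))//.
move=> Hl; rewrite -(cvg_lim _ Hl)//; apply: lime_le; first by apply/cvg_ex; eexists; exact: Hl.
by apply: nearW => n; have := tG n; rewrite /tent_bd (gt_eqF i0).
Qed.

Local Open Scope complex_scope.

(** * Tent norms *)

(** The values of f at t <= 0 are arbitrary, and measurability is known on the upper half-space;
    cutting off there yields a function measurable on the whole product. *)
Definition uabs (f : X * R -> R[i]^o) z : R := modc (f z) * \1_(upper : set (X * R)) z.

Lemma uabs_ge0 f z : 0 <= uabs f z. Proof. by rewrite mulr_ge0// modc_ge0. Qed.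

Lemma uabsE f z : 0 < z.2 -> uabs f z = modc (f z).
Proof. by move=> z0; rewrite /uabs indicE mem_set// mulr1. Qed.

Lemma uabs_out f z : ~ 0 < z.2 -> uabs f z = 0.
Proof. by move=> z0; rewrite /uabs indicE memNset// mulr0. Qed.

Lemma measurable_on_upper (g : X * R -> R) : measurable_fun upper g ->
  measurable_fun setT (fun z => g z * \1_(upper : set (X * R)) z).
Proof.
move=> mg; have -> : (fun z => g z * \1_(upper : set (X * R)) z) = g \_ upper.
  by rewrite patch_indic.
by apply/(measurable_restrictT _ measurable_upper_set).
Qed.

Lemma measurable_modc {d'} {T : measurableType d'} (D : set T) (f : T -> R[i]) :
  measurable_fun D (fun t => complex.Re (f t)) -> measurable_fun D (fun t => complex.Im (f t)) ->
  measurable_fun D (fun t => modc (f t)).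
Proof.
move=> mR mI; rewrite (_ : (fun t => modc (f t)) =
  (fun t => (complex.Re (f t) ^+ 2 + complex.Im (f t) ^+ 2) `^ 2^-1)); last first.
  by apply/funext => t; rewrite modcE powR12_sqrt// addr_ge0// sqr_ge0.
apply: (measurableT_comp (measurable_powR _)).
by apply: measurable_funD; apply: measurable_funX.
Qed.

Lemma measurable_uabs (f : X * R -> R[i]^o) : measurable_upper f -> measurable_fun setT (uabs f).
Proof.
move=> [mR mI]; by apply: measurable_on_upper; exact: measurable_modc.
Qed.

Lemma conicalE (q : R) (f : X * R -> R[i]^o) x : 0 < q ->
  (conical mu q alpha f x = cone_int (fun z => uabs f z `^ q)%R x `^ q^-1)%E.
Proof.
move=> q0; rewrite /conical; congr (_ `^ _)%E.
rewrite /upper_integral integral_mkcond; apply: eq_integral => z _; rewrite patchE.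
have [/set_mem xz|xz] := boolP (z \in cone alpha x); last first.
  by rewrite /cone_ker /cone_ind indicE (negbTE xz) mul0r mulr0 mul0r.
have z0 : 0 < z.2 by have [] := xz.
have v0 := cone_vol_gt0 z0.
rewrite uabsE// dt_weightE// /cone_ker cone_ind_in// mul1r powR_inv1 ?(ltW v0)//.
have -> : vol mu z.1 (alpha * z.2) = (cone_vol z)%:E.
  rewrite cone_volE// fineK//; apply: (vol_fin mu_ball); exact: mulr_gt0.
by rewrite inver gt_eqF// -!EFinM.
Qed.

Lemma upper_integral_tentE (q : R) (f : X * R -> R[i]^o) (B : set X) : 0 < q ->
  (upper_integral mu (tent alpha B) (fun z => (modc (f z) `^ q)%:E) =
   \int[lam]_(z in tent alpha B) (uabs f z `^ q * W z)%:E)%E.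
Proof.
move=> q0; apply: eq_integral => z /set_mem[z0 _].
by rewrite uabsE// dt_weightE.
Qed.

Lemma le_poweRV (x : \bar R) (l s : R) : 0 < s -> 0 < l -> (0 <= x)%E ->
  (x `^ s^-1 <= l%:E)%E <-> ((l^-1 `^ s)%:E * x <= 1)%E.
Proof.
move=> s0 l0 x0; have ls : 0 < l `^ s by exact: powR_gt0.
have -> : l^-1 `^ s = (l `^ s)^-1 by rewrite -powR_inv1 ?(ltW l0)// -powRrM mulN1r powRN.
have -> : (((l `^ s)^-1)%:E * x <= 1)%E = (x <= (l `^ s)%:E)%E.
  by rewrite muleC lee_pdivrMr// mul1e.
split=> h.
  have := ge0_le_poweR (ltW s0) (poweR_ge0 _ _) h.
  by rewrite -poweRrM mulVf ?gt_eqF// poweRe1// poweR_EFin.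
have := ge0_le_poweR (_ : 0 <= s^-1) x0 h; rewrite poweR_EFin -powRrM mulfV ?gt_eqF//.
by rewrite powRr1 ?(ltW l0)//; apply; rewrite invr_ge0 ltW.
Qed.

Lemma tent_norm_fin_le (s q : R) (f : X * R -> R[i]^o) (l : R) : 1 <= s -> 0 < q ->
  measurable_upper f -> 0 < l ->
  (tent_norm mu s%:E q alpha f <= l%:E)%E <-> tent_bd s^-1 q 1 (fun z => l^-1 * uabs f z).
Proof.
move=> s1 q0 mf l0; have s0 : 0 < s := lt_le_trans ltr01 s1.
have sV0 : 0 < s^-1 by rewrite invr_gt0.
rewrite /tent_norm asboolT//= unlock /tent_bd gt_eqF//.
rewrite area_scale ?invr_ge0 ?(ltW l0)//; [|exact: uabs_ge0|exact: measurable_uabs].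
rewrite invrK.
have -> : (\int[mu]_x `|conical mu q alpha f x| `^ s =
    \int[mu]_x (cone_int (fun z => uabs f z `^ q)%R x `^ (s^-1 * q)^-1))%E.
  apply: eq_integral => x _; rewrite conicalE// gee0_abs ?poweR_ge0// -poweRrM.
  by rewrite invfM invrK mulrC.
by apply: le_poweRV => //; apply: integral_ge0 => x _; exact: poweR_ge0.
Qed.

(** The essential supremum loses no ball: every ball has positive measure, so it contains a point
    where the Carleson function is at most l, and that supremum takes this very ball into
    account. *)
Lemma tent_norm_infty_le (q : R) (f : X * R -> R[i]^o) (l : R) : 0 < q ->
  measurable_upper f -> 0 < l ->
  (tent_norm mu +oo%E q alpha f <= l%:E)%E <-> tent_bd 0 q 1 (fun z => l^-1 * uabs f z).
Proof.
move=> q0 mf l0.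
have mT : (0 < mu [set: X])%E.
  have /andP[B0 _] := mu_ball o ltr01; apply: lt_le_trans B0 _.
  by apply: le_measure; rewrite ?inE//; exact: measurable_ball_borel.
rewrite /tent_norm asboolT//= unlock mT /tent_bd eqxx.
pose J B := (\int[lam]_(z in tent alpha B) (uabs f z `^ q * W z)%:E)%E.
have J0 B : (0 <= J B)%E.
  by apply: integral_ge0 => z _; rewrite lee_fin (mulr_ge0 (powR_ge0 _ _) (dt_weight_ge0 z)).
have E y s : 0 < s -> (\int[lam]_(z in tent alpha (ball y s)) ((l^-1 * uabs f z) `^ q * W z)%:E
    <= 1%:E * vol mu y s)%E <->
    (((mu (ball y s))^-1 * upper_integral mu (tent alpha (ball y s)) (fun z => (modc (f z) `^ q)%:E))
      `^ q^-1 <= l%:E)%E.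
  move=> s0; rewrite upper_integral_tentE// -/(J _).
  have v0 := fine_vol_gt0 mu_ball y s0.
  have vE : mu (ball y s) = (fine (vol mu y s))%:E by rewrite fineK// (vol_fin mu_ball).
  rewrite mul1e -[vol mu y s]/(mu (ball y s)) vE.
  have -> : (\int[lam]_(z in tent alpha (ball y s)) ((l^-1 * uabs f z) `^ q * W z)%:E =
      (l^-1 `^ q)%:E * J (ball y s))%E.
    rewrite /J -ge0_integralZl//.
    - apply: eq_integral => z _; rewrite powRM ?uabs_ge0 ?invr_ge0 ?(ltW l0)//.
      by rewrite -(mulrA (l^-1 `^ q)) (EFinM (l^-1 `^ q)).
    - exact: (measurable_tent alpha_gt0).
    - apply/measurable_EFinP; apply: measurable_funTS; apply: measurable_funM; last exact: measurable_dt_weight.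
      by apply: measurable_fun_powR; exact: measurable_uabs.
    - by move=> z _; rewrite lee_fin (mulr_ge0 (powR_ge0 _ _) (dt_weight_ge0 z)).
    - by rewrite lee_fin powR_ge0.
  rewrite inver gt_eqF//; rewrite le_poweRV//; last first.
    by apply: mule_ge0 => //; rewrite lee_fin invr_ge0 ltW.
  rewrite [X in _ <-> (X <= _)%E]muleCA [X in _ <-> (X <= _)%E]muleC.
  by rewrite lee_pdivrMr// mul1e; exact: iff_refl.
split.
  move=> /ess_supP H y s s0; apply/E => //.
  have [x [Bx Hx]] : exists x, ball y s x /\ (`|carleson mu q alpha f x| <= l%:E)%E.
    apply: contrapT => nex; case: H => N [mN N0 HN].
    have : (0 < mu (ball y s))%E by have /andP[] := mu_ball y s0.
    rewrite ltNge => /negP; apply; rewrite -N0; apply: le_measure; rewrite ?inE//.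
      exact: measurable_ball_borel.
    by move=> x Bx; apply: HN => /= hx; apply: nex; exists x.
  apply: le_trans Hx; apply: le_trans (lee_abs _); apply: ereal_sup_ubound.
  by exists (ball y s) => //; split => //; exists y, s.
move=> H; apply/ess_supP; apply: aeW => x /=.
rewrite gee0_abs; last first.
  apply: (le_trans (poweR_ge0 ((mu (ball x 1))^-1 * upper_integral mu (tent alpha (ball x 1)) (fun z => (modc (f z) `^ q)%:E)) q^-1)).
  apply: ereal_sup_ubound; exists (ball x 1) => //; split; first exact: ballxx.
  by exists x, 1.
apply: ge_ereal_sup => _ [B [_ [y [s [s0 ->]]]] <-].
by apply/E => //; exact: H.
Qed.

Lemma inve_ge1 (p : \bar R) : (1 <= p)%E -> 0 <= fine p^-1 <= 1.
Proof.
case: p => [s s1|_|//]; last by rewrite invey /= lexx ler01.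
rewrite lee_fin in s1; have s0 : 0 < s by rewrite (lt_le_trans ltr01).
by rewrite inver gt_eqF//= invr_ge0 (ltW s0) invf_le1.
Qed.

(** The dictionary between the norms and [tent_bd], uniform in p in [1, +oo] through i = 1 / p; all
    estimates above are used through it. *)
Lemma tent_norm_le (p : \bar R) (q : R) (f : X * R -> R[i]^o) (l : R) : (1 <= p)%E -> 0 < q ->
  measurable_upper f -> 0 < l ->
  (tent_norm mu p q alpha f <= l%:E)%E <-> tent_bd (fine p^-1) q 1 (fun z => l^-1 * uabs f z).
Proof.
case: p => [s s1|_|//] q0 mf l0; last by rewrite invey; exact: tent_norm_infty_le.
rewrite lee_fin in s1.
by rewrite inver gt_eqF ?(lt_le_trans ltr01 s1)//=; exact: tent_norm_fin_le.
Qed.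

Lemma tent_norm_mble (p : \bar R) (q : R) (f : X * R -> R[i]^o) :
  (tent_norm mu p q alpha f < +oo)%E -> measurable_upper f.
Proof. by rewrite /tent_norm; case: asboolP => //; rewrite ltxx. Qed.

Lemma tent_norm_ge0 (p : \bar R) (q : R) (f : X * R -> R[i]^o) : (0 <= tent_norm mu p q alpha f)%E.
Proof.
rewrite /tent_norm; case: asboolP => _; last by rewrite leey.
by case: ifP => _; exact: Lnorm_ge0.
Qed.

(** * A Calderon function through a given tent function *)

Lemma nbhs_modcP (z : R[i]^o) (A : set R[i]^o) :
  nbhs z A <-> exists2 e : R, 0 < e & forall w : R[i], modc (w - z) < e -> A w.
Proof.
have bE (e : R) (w : R[i]^o) : ball z e%:C w <-> modc (w - z) < e.
  by rewrite /ball /= normc_def -modcE ltcR modc_distC.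
split=> [/nbhs_ballP[[e e'] /=]|[e e0 H]].
  rewrite ltcE /= => /andP[/eqP e'0 e0] H; exists e => // w /bE wz.
  by apply: H; rewrite e'0 in wz *.
by apply/nbhs_ballP; exists e%:C; [rewrite /= ltcR|move=> w /bE; exact: H].
Qed.

Lemma near_strip (z : R[i]^o) (A : R[i]^o -> Prop) :
  (\forall w \near within strip (nbhs z), A w) <->
  exists2 e : R, 0 < e & forall w : R[i], 0 <= complex.Re w <= 1 -> modc (w - z) < e -> A w.
Proof.
split.
  by move=> /nbhs_modcP[e e0 H]; exists e => // w sw wz; exact: H.
by move=> [e e0 H]; apply/nbhs_modcP; exists e => // w wz sw; exact: H.
Qed.

Lemma near_punctured (A : R[i]^o -> Prop) :
  (\forall h \near (0 : R[i]^o)^', A h) <->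
  exists2 e : R, 0 < e & forall h : R[i], h != 0 -> modc h < e -> A h.
Proof.
split.
  by move=> /nbhs_modcP[e e0 H]; exists e => // w w0 wz; apply: H => //; rewrite subr0.
by move=> [e e0 H]; apply/nbhs_modcP; exists e => // w; rewrite subr0 => wz /= w0; exact: H.
Qed.

Lemma measurable_upperM (f g : X * R -> R[i]^o) : measurable_upper f -> measurable_upper g ->
  measurable_upper (fun z => f z * g z).
Proof.
move=> [mfR mfI] [mgR mgI]; split.
  rewrite (_ : (fun z => _) = (fun z => complex.Re (f z) * complex.Re (g z) -
      complex.Im (f z) * complex.Im (g z))).
    by apply: measurable_funB; apply: measurable_funM.
  by apply/funext => z; case: (f z) => a b; case: (g z).
rewrite (_ : (fun z => _) = (fun z => complex.Re (f z) * complex.Im (g z) +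
    complex.Im (f z) * complex.Re (g z))).
  by apply: measurable_funD; apply: measurable_funM.
by apply/funext => z; case: (f z) => a b; case: (g z).
Qed.

Lemma measurable_upperD (f g : X * R -> R[i]^o) : measurable_upper f -> measurable_upper g ->
  measurable_upper (fun z => f z + g z).
Proof.
move=> [mfR mfI] [mgR mgI]; split.
  rewrite (_ : (fun z => _) = (fun z => complex.Re (f z) + complex.Re (g z))).
    exact: measurable_funD.
  by apply/funext => z; case: (f z) => a b; case: (g z).
rewrite (_ : (fun z => _) = (fun z => complex.Im (f z) + complex.Im (g z))).
  exact: measurable_funD.
by apply/funext => z; case: (f z) => a b; case: (g z).
Qed.

Lemma measurable_upper_cst (c : R[i]) : measurable_upper (fun _ : X * R => c : R[i]^o).
Proof. by split; exact: measurable_cst. Qed.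

Lemma measurable_upper_real (g : X * R -> R) : measurable_fun upper g ->
  measurable_upper (fun z => (g z)%:C : R[i]^o).
Proof. by move=> mg; split => //=; exact: measurable_cst. Qed.

Lemma measurable_upperB (f g : X * R -> R[i]^o) : measurable_upper f -> measurable_upper g ->
  measurable_upper (fun z => f z - g z).
Proof.
move=> mf mg; rewrite (_ : (fun z => _) = (fun z => f z + (-1) * g z)).
  by apply: measurable_upperD => //; apply: measurable_upperM => //; exact: measurable_upper_cst.
by apply/funext => z; rewrite mulN1r.
Qed.

Lemma measurable_upper_cexp (f : X * R -> R[i]^o) : measurable_upper f ->
  measurable_upper (fun z => cexp (f z) : R[i]^o).
Proof.
have mc : measurable_fun setT (@cos R) by apply: continuous_measurable_fun; exact: continuous_cos.
have ms : measurable_fun setT (@sin R) by apply: continuous_measurable_fun; exact: continuous_sin.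
move=> [mR mI]; split => /=; apply: measurable_funM; try exact: measurableT_comp.
Qed.

Lemma expR_between (theta x L : R) : 0 <= x <= 1 ->
  expR ((x - theta) * L) <= expR (- theta * L) + expR ((1 - theta) * L).
Proof.
move=> /andP[x0 x1]; have h1 := expR_ge0 (- theta * L); have h2 := expR_ge0 ((1 - theta) * L).
have [L0|L0] := leP 0 L.
  apply: (@le_trans _ _ (expR ((1 - theta) * L))); last by rewrite lerDr.
  by rewrite ler_expR ler_wpM2r// lerD2r.
apply: (@le_trans _ _ (expR (- theta * L))); last by rewrite lerDl.
by rewrite ler_expR ler_wnM2r ?(ltW L0)// lerDr.
Qed.

(** * Difference quotients of exponentials *)

Section calderon_estimates.

Lemma modc_exponent_le (h l : R[i]) : modc (h * (l + h)) <= modc h * (modc l + modc h).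
Proof. by rewrite modcM ler_wpM2l ?modc_ge0// modcD. Qed.

Lemma cexp_quotient_small (h l : R[i]) : h != 0 ->
  modc (h^-1 * (cexp (h * (l + h)) - 1) - l) <=
  20 * modc h * (modc l + modc h) ^+ 2 * expR (modc h * (modc l + modc h)) + modc h.
Proof.
move=> h0; set D := h * (l + h).
have -> : h^-1 * (cexp D - 1) - l = h^-1 * (cexp D - 1 - D) + h.
  by rewrite /D; field.
apply: le_trans (modcD _ _) _; rewrite lerD2r modcM modcV.
have mh : 0 < modc h by rewrite modc_gt0.
have Dle : modc D <= modc h * (modc l + modc h) := modc_exponent_le h l.
rewrite ler_pdivrMl//; apply: le_trans (cexp_taylor2 D) _.
have -> (m s e : R) : m * (20 * m * s ^+ 2 * e) = 20 * (m * s) ^+ 2 * e by ring.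
apply: ler_pM; [by rewrite mulr_ge0 ?sqr_ge0|exact: expR_ge0| |by rewrite ler_expR].
by rewrite ler_wpM2l// ler_pXn2r ?nnegrE ?modc_ge0// mulr_ge0 ?addr_ge0 ?modc_ge0.
Qed.

Lemma cexp_quotient_bound (A : R) (h l : R[i]) : h != 0 -> modc h <= 1 -> modc l + modc h <= A ->
  modc (h^-1 * (cexp (h * (l + h)) - 1) - l) <= modc h * (20 * A ^+ 2 * expR A + 1).
Proof.
move=> h0 h1 lA; have hh := modc_ge0 h; have ll := modc_ge0 l.
have s0 : 0 <= modc l + modc h by exact: addr_ge0.
have hA : modc h * (modc l + modc h) <= A.
  by apply: le_trans lA; rewrite ler_piMl.
apply: le_trans (cexp_quotient_small l h0) _.
have -> : modc h * (20 * A ^+ 2 * expR A + 1) = 20 * modc h * A ^+ 2 * expR A + modc h by ring.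
rewrite lerD2r; apply: ler_pM; [|exact: expR_ge0| |by rewrite ler_expR].
  by rewrite (mulr_ge0 _ (sqr_ge0 _))// mulr_ge0.
rewrite ler_wpM2l ?mulr_ge0// ler_pXn2r ?nnegrE//.
exact: le_trans lA.
Qed.

Lemma cexp_quotient_le (h l : R[i]) : h != 0 ->
  modc (h^-1 * (cexp (h * (l + h)) - 1) - l) <=
  4 * (modc l + modc h) * expR (modc h * (modc l + modc h)) + modc l.
Proof.
move=> h0; apply: le_trans (modcB _ _) _; rewrite lerD2r modcM modcV.
have mh : 0 < modc h by rewrite modc_gt0.
have Dle := modc_exponent_le h l.
rewrite ler_pdivrMl//; apply: le_trans (cexp_taylor1 _) _.
have -> (m s e : R) : m * (4 * s * e) = 4 * (m * s) * e by ring.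
apply: ler_pM; rewrite ?expR_ge0 ?mulr_ge0 ?modc_ge0 ?ler_expR//.
by rewrite ler_wpM2l.
Qed.

(** Globally the difference quotient grows at most like exp(2 e |L|), where e is fixed and small.
    This replaces the second-order estimate where L is large, and [expR_between_abs] absorbs the
    growth. *)
Lemma quotient_growth (e a L : R) (h l : R[i]) : 0 < e <= 1 -> 0 <= a -> h != 0 -> modc h <= e ->
  modc l <= `|L| + a ->
  modc (h^-1 * (cexp (h * (l + h)) - 1) - l) <=
    (4 * expR (a + 1) + 1) * (e^-1 + a + 1) * expR (2 * e * `|L|).
Proof.
move=> /andP[e0 e1] a0 h0 he lL; apply: le_trans (cexp_quotient_le l h0) _.
have L0 := normr_ge0 L; have h1 := modc_ge0 h; have l1 := modc_ge0 l.
have E1 : 1 <= expR (e * `|L|) by rewrite -expR0 ler_expR mulr_ge0// ltW.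
have Eg0 : 0 < expR (e * `|L|) := expR_gt0 _.
have A : modc l + modc h <= (e^-1 + a + 1) * expR (e * `|L|).
  have LE : `|L| <= e^-1 * expR (e * `|L|).
    rewrite mulrC ler_pdivlMr// mulrC; have := expR_ge1Dx (e * `|L|); lra.
  have aE : a + 1 <= (a + 1) * expR (e * `|L|) by rewrite ler_peMr// addr_ge0.
  by rewrite -addrA mulrDl; lra.
have B : expR (modc h * (modc l + modc h)) <= expR (a + 1) * expR (e * `|L|).
  rewrite -expRD ler_expR; have hl : modc h * (modc l + modc h) <= e * (`|L| + a + 1).
    by apply: ler_pM => //; [rewrite addr_ge0|lra].
  have : e * (a + 1) <= 1 * (a + 1) by rewrite ler_wpM2r// addr_ge0.
  lra.
have s0 : 0 <= modc l + modc h by rewrite addr_ge0.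
have K0 : 0 <= e^-1 + a + 1 by rewrite !addr_ge0// invr_ge0 ltW.
have H1 : (modc l + modc h) * expR (modc h * (modc l + modc h)) <=
    (e^-1 + a + 1) * expR (e * `|L|) * (expR (a + 1) * expR (e * `|L|)).
  by apply: ler_pM; rewrite ?expR_ge0.
have H2 : modc l <= (e^-1 + a + 1) * expR (e * `|L|) * expR (e * `|L|).
  apply: (@le_trans _ _ ((e^-1 + a + 1) * expR (e * `|L|))); first by lra.
  by rewrite ler_peMr// mulr_ge0// ltW.
have -> : 2 * e * `|L| = e * `|L| + e * `|L| by ring.
rewrite (expRD (e * `|L|)) -(mulrA 4); move: H1 H2; move: (_ * expR (modc h * _)) (expR (e * _)) => u v.
set k := e^-1 + a + 1; set b := expR (a + 1) => H1 H2.
have -> : (4 * b + 1) * k * (v * v) = 4 * (k * v * (b * v)) + k * v * v by ring.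
lra.
Qed.

(** The factor exp(e |L|) moves x by e in the direction of the sign of L, and x + e and x - e both
    stay in [0, 1]. *)
Lemma expR_between_abs (theta x e L : R) : 0 <= e -> e <= x -> x + e <= 1 ->
  expR ((x - theta) * L) * expR (e * `|L|) <= expR (- theta * L) + expR ((1 - theta) * L).
Proof.
move=> e0 ex xe; rewrite -expRD.
have [L0|L0] := leP 0 L; [rewrite ger0_norm//|rewrite ltr0_norm//].
  have -> : (x - theta) * L + e * L = (x + e - theta) * L by ring.
  by apply: expR_between; rewrite xe addr_ge0// (le_trans e0).
have -> : (x - theta) * L + e * - L = (x - e - theta) * L by ring.
by apply: expR_between; apply/andP; split; lra.
Qed.

End calderon_estimates.

(** Convergence without a uniform bound on L. On the pieces kk <= n, [U t] is uniformly small
    relative to b; on the others the crude bound K' b is at most dl 2^kk b once 2^{n + 1} >= K' /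
    dl. *)
Lemma cvg0_split {T : Type} {F : set_system T} {FF : Filter F} (N : (X * R -> R[i]^o) -> \bar R)
    (U : T -> X * R -> R[i]^o) (b : X * R -> R) (kk : X * R -> nat) (K K' : R) :
  (forall u, 0 <= N u)%E -> 0 <= K -> 0 <= K' -> (forall z, 0 <= b z) ->
  (forall u dl, 0 < dl -> measurable_upper u ->
    (forall z, 0 < z.2 -> modc (u z) <= dl * (2 ^+ kk z * b z)) -> (N u <= (K * dl)%:E)%E) ->
  (forall t, measurable_upper (U t)) ->
  (\forall t \near F, forall z, 0 < z.2 -> modc (U t z) <= K' * b z) ->
  (forall n dl, 0 < dl -> \forall t \near F, forall z, 0 < z.2 -> (kk z <= n)%N ->
     modc (U t z) <= dl * b z) ->
  N (U t) @[t --> F] --> 0%E.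
Proof.
move=> N0 K0 K'0 b0 HN mU big small; apply/cvg0_ereal => // e e0.
have K1 : 0 < K + 1 by lra.
pose dl := e / (K + 1); have dl0 : 0 < dl by rewrite divr_gt0.
pose n := Num.truncn (K' / dl).
have K'n : K' <= dl * 2 ^+ n.+1.
  rewrite mulrC -ler_pdivrMr// (le_trans (ltW (truncnS_gt _)))//.
  by rewrite -natrX ler_nat; exact/ltnW/ltn_expl.
apply: filterS2 big (small n dl dl0) => t Hb Hs.
apply: (@le_trans _ _ (K * dl)%:E); last first.
  by rewrite lee_fin /dl mulrA ler_pdivrMr// mulrC ler_wpM2l ?(ltW e0)//; lra.
apply: HN => // z z0; rewrite mulrA.
have [kn|nk] := leqP (kk z) n.
  apply: le_trans (Hs z z0 kn) _; rewrite ler_wpM2r// ler_peMr ?(ltW dl0)//.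
  by rewrite exprn_ege1// ler1n.
apply: le_trans (Hb z z0) _; rewrite ler_wpM2r//; apply: le_trans K'n _.
by rewrite ler_wpM2l ?(ltW dl0)// ler_weXn2l// ler1n.
Qed.

Section calderon_function.
Variables (f : X * R -> R[i]^o) (L : X * R -> R) (kk : X * R -> nat) (theta : R).
Variables (N0 N1 : (X * R -> R[i]^o) -> \bar R) (K : R).
Hypothesis mf : measurable_upper f.
Hypothesis mL : measurable_fun setT L.
Hypothesis Lbd : forall n, exists M, forall z, 0 < z.2 -> f z != 0 -> (kk z <= n)%N -> `|L z| <= M.
Hypothesis K_ge0 : 0 <= K.
Hypothesis N0_ge0 : forall u, (0 <= N0 u)%E.
Hypothesis N1_ge0 : forall u, (0 <= N1 u)%E.

Let b0 z := modc (f z) * expR (- theta * L z).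
Let b1 z := modc (f z) * expR ((1 - theta) * L z).
(** The majorant b may be enlarged by 2^kk and still controls the norm: this is the room kept by
    [calderon_decomposition], and [cvg0_split] spends it. *)
Let bounded_by (N : (X * R -> R[i]^o) -> \bar R) (b : X * R -> R) := forall u dl, 0 < dl ->
  measurable_upper u -> (forall z, 0 < z.2 -> modc (u z) <= dl * (2 ^+ kk z * b z)) ->
  (N u <= (K * dl)%:E)%E.

Hypothesis N0b : bounded_by N0 b0.
Hypothesis N1b : bounded_by N1 b1.
Hypothesis N01b : bounded_by (sum_norm N0 N1) (fun z => b0 z + b1 z).

(* The term z ^ 2 makes the traces vanish at infinity. *)
Definition calderon_exponent (z : R[i]) (w : X * R) : R[i] :=
  (z - theta%:C) * (L w)%:C + (z ^+ 2 - (theta ^+ 2)%:C).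

Definition calderon_fun (z : R[i]^o) (w : X * R) : R[i]^o := f w * cexp (calderon_exponent z w).

Let b0_ge0 z : 0 <= b0 z. Proof. by rewrite mulr_ge0 ?modc_ge0 ?expR_ge0. Qed.
Let b1_ge0 z : 0 <= b1 z. Proof. by rewrite mulr_ge0 ?modc_ge0 ?expR_ge0. Qed.

Lemma sum_norm_ge0 u : (0 <= sum_norm N0 N1 u)%E.
Proof. by apply: le_ereal_inf_tmp => _ [v _ <-]; exact: adde_ge0. Qed.

Lemma calderon_fun_theta : calderon_fun theta%:C = f.
Proof.
apply/funext => w; rewrite /calderon_fun /calderon_exponent subrr mul0r add0r.
by rewrite (rmorphXn (real_complex R)) subrr cexp0 mulr1.
Qed.

Lemma calderon_fun_shift (z h : R[i]) w :
  calderon_fun (z + h) w = calderon_fun z w * cexp (h * ((L w)%:C + 2 * z + h)).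
Proof.
rewrite /calderon_fun -mulrA -cexpD; congr (_ * cexp _); rewrite /calderon_exponent; ring.
Qed.

Lemma Re_calderon_exponent (z : R[i]) w : complex.Re (calderon_exponent z w) =
  (complex.Re z - theta) * L w + (complex.Re z ^+ 2 - complex.Im z ^+ 2 - theta ^+ 2).
Proof. by case: z => x y; rewrite /calderon_exponent /= !expr2 /=; ring. Qed.

Lemma modc_calderon_fun (z : R[i]) w : modc (calderon_fun z w) =
  modc (f w) * expR ((complex.Re z - theta) * L w) *
  expR (complex.Re z ^+ 2 - complex.Im z ^+ 2 - theta ^+ 2).
Proof. by rewrite /calderon_fun modcM modc_cexp Re_calderon_exponent expRD mulrA. Qed.

Lemma calderon_fun_le (z : R[i]) w : 0 <= complex.Re z <= 1 ->
  modc (calderon_fun z w) <= expR 1 * (modc (f w) * expR ((complex.Re z - theta) * L w)).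
Proof.
move=> /andP[z0 z1]; rewrite modc_calderon_fun mulrC ler_wpM2r ?mulr_ge0 ?modc_ge0 ?expR_ge0//.
rewrite ler_expR; have := sqr_ge0 (complex.Im z); have := sqr_ge0 theta.
have : complex.Re z ^+ 2 <= 1 by rewrite expr_le1.
by move=> h1 h2 h3; lra.
Qed.

Lemma calderon_fun_strip (z : R[i]) w : 0 <= complex.Re z <= 1 ->
  modc (calderon_fun z w) <= expR 1 * (b0 w + b1 w).
Proof.
move=> z01; apply: le_trans (calderon_fun_le w z01) _; rewrite ler_wpM2l ?expR_ge0//.
by rewrite -mulrDr ler_wpM2l ?modc_ge0// expR_between.
Qed.

Lemma calderon_fun_left t w : modc (calderon_fun (0 +i* t) w) <= expR (- t ^+ 2) * b0 w.
Proof.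
rewrite modc_calderon_fun mulrC /= sub0r -/(b0 w); apply: ler_wpM2r => //; rewrite ler_expR.
by rewrite expr0n /= sub0r gerDl oppr_le0 sqr_ge0.
Qed.

Lemma calderon_fun_right t w :
  modc (calderon_fun (1 +i* t) w) <= expR 1 * expR (- t ^+ 2) * b1 w.
Proof.
rewrite modc_calderon_fun mulrC /= -/(b1 w); apply: ler_wpM2r => //; rewrite -expRD ler_expR.
by rewrite expr1n gerDl oppr_le0 sqr_ge0.
Qed.

Lemma measurable_L : measurable_upper (fun w => (L w)%:C : R[i]^o).
Proof. by apply: measurable_upper_real; exact: measurable_funTS. Qed.

Lemma measurable_calderon_fun (z : R[i]) : measurable_upper (calderon_fun z).
Proof.
apply: measurable_upperM => //; apply: measurable_upper_cexp.
apply: (measurable_upperD (f := fun w => (z - theta%:C) * (L w)%:C)).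
  by apply: (measurable_upperM (measurable_upper_cst _)); exact: measurable_L.
exact: measurable_upper_cst.
Qed.

Lemma calderon_fun_small (z : R[i]) n (dl : R) : 0 < dl -> exists2 e : R, 0 < e &
  forall z' : R[i], modc (z' - z) < e -> forall w, 0 < w.2 -> (kk w <= n)%N ->
  modc (calderon_fun z' w - calderon_fun z w) <= dl * modc (calderon_fun z w).
Proof.
move=> dl0; have [M HM] := Lbd n.
pose A := `|M| + 2 * modc z + 1.
have A0 : 0 < A by rewrite ltr_wpDl// addr_ge0// mulr_ge0// modc_ge0.
pose B := 4 * A * expR A; have B0 : 0 < B by rewrite !mulr_gt0// expR_gt0.
exists (Num.min 1 (dl / B)); first by rewrite lt_min ltr01 divr_gt0.
move=> z' ; rewrite lt_min => /andP[h1 h2] w w0 kw; set h := z' - z in h1 h2.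
have -> : z' = z + h by rewrite /h addrC subrK.
rewrite calderon_fun_shift -{2}[calderon_fun z w]mulr1 -mulrBr modcM mulrC.
have [fw|fw] := eqVneq (f w) 0; first by rewrite /calderon_fun fw mul0r modc0 !mulr0.
rewrite ler_wpM2r ?modc_ge0//.
have hh := modc_ge0 h.
have DA : modc (h * ((L w)%:C + 2 * z + h)) <= modc h * A.
  apply: le_trans (modc_exponent_le _ _) _; rewrite ler_wpM2l//.
  have := modcD (L w)%:C (2 * z); rewrite modcM modc_real modc2.
  have := HM w w0 fw kw; have := ler_norm M; rewrite /A; lra.
have DA' : modc (h * ((L w)%:C + 2 * z + h)) <= A.
  by apply: le_trans DA _; rewrite ler_piMl ?ltW.
apply: le_trans (cexp_taylor1 _) _; apply: (@le_trans _ _ (4 * (modc h * A) * expR A)).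
  apply: ler_pM; rewrite ?expR_ge0 ?ler_expR ?mulr_ge0 ?modc_ge0//.
  by rewrite ler_wpM2l.
have -> : 4 * (modc h * A) * expR A = modc h * B by rewrite /B; ring.
by rewrite -ler_pdivlMr// ltW.
Qed.

Let pow2_ge (c : R) z : 0 <= c -> c <= 2 ^+ kk z * c.
Proof. by move=> c0; rewrite ler_peMl// exprn_ege1// ler1n. Qed.

Lemma fin_of_bounded (N : (X * R -> R[i]^o) -> \bar R) (b : X * R -> R) (c : R) u :
  bounded_by N b -> (forall z, 0 <= b z) -> 0 < c -> measurable_upper u ->
  (forall z, 0 < z.2 -> modc (u z) <= c * b z) -> (N u <= (K * c)%:E)%E.
Proof.
move=> Nb b_ge0 c0 mu' ub; apply: Nb => // z z0; apply: le_trans (ub z z0) _.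
by rewrite ler_wpM2l ?(ltW c0)// pow2_ge.
Qed.

Let b01_ge0 z : 0 <= b0 z + b1 z. Proof. exact: addr_ge0. Qed.

Lemma calderon_fun_continuous (N : (X * R -> R[i]^o) -> \bar R) (b : X * R -> R) (c : R)
    {T : Type} {F : set_system T} {FF : Filter F} (s : T -> R[i]) (z : R[i]) :
  bounded_by N b -> (forall u, 0 <= N u)%E -> (forall w, 0 <= b w) -> 0 < c ->
  (forall w, modc (calderon_fun z w) <= c * b w) ->
  (\forall t \near F, forall w, modc (calderon_fun (s t) w) <= c * b w) ->
  (forall e : R, 0 < e -> \forall t \near F, modc (s t - z) < e) ->
  N (fun w => calderon_fun (s t) w - calderon_fun z w) @[t --> F] --> 0%E.
Proof.
move=> Nb N_ge0 b_ge0 c0 zb sb sz.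
apply: (@cvg0_split _ _ _ N _ b kk K (c + c)) => //.
- by rewrite addr_ge0// ltW.
- by move=> t; apply: measurable_upperB; exact: measurable_calderon_fun.
- apply: filterS sb => t sb w _; apply: le_trans (modcB _ _) _.
  by rewrite mulrDl lerD.
move=> n dl dl0; have [e e0 He] := calderon_fun_small z n (divr_gt0 dl0 c0).
apply: filterS (sz e e0) => t ht w w0 kw; apply: le_trans (He _ ht w w0 kw) _.
apply: le_trans (ler_wpM2l (ltW (divr_gt0 dl0 c0)) (zb w)) _.
by rewrite mulrA divfK// gt_eqF.
Qed.

Lemma vertical_near (x t e : R) : 0 < e -> \forall s \near t, modc ((x +i* s) - (x +i* t)) < e.
Proof.
move=> e0; apply/nbhs_ballP; exists e => // s ts0; have ts : `|t - s| < e := ts0.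
apply: le_lt_trans (modc_le_ReIm ((x - x) +i* (s - t))) _.
by rewrite /= subrr normr0 add0r distrC.
Qed.

Lemma expR_sqr_vanish (dl : R) : 0 < dl -> exists A : R, forall t : R, A < `|t| -> expR (- t ^+ 2) <= dl.
Proof.
move=> dl0; exists (1 + dl^-1) => t At; have d0 : 0 < dl^-1 by rewrite invr_gt0.
have t2 : dl^-1 <= `|t| ^+ 2.
  have t1 : 1 <= `|t| by lra.
  by rewrite expr2; apply: (@le_trans _ _ (`|t| * 1)); [lra|rewrite ler_wpM2l].
rewrite expRN -[leRHS]invrK lef_pV2 ?posrE ?expR_gt0//.
by have := expR_ge1Dx (t ^+ 2); rewrite -real_normK ?num_real//; lra.
Qed.

Lemma calderon_fun_trace (N : (X * R -> R[i]^o) -> \bar R) (b : X * R -> R) (x : R) :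
  bounded_by N b -> (forall u, 0 <= N u)%E -> (forall w, 0 <= b w) -> 
  (forall t w, modc (calderon_fun (x +i* t) w) <= expR 1 * expR (- t ^+ 2) * b w) ->
  C0_trace N (fun t => calderon_fun (x +i* t)).
Proof.
move=> Nb N_ge0 b_ge0 H.
have H1 t w : modc (calderon_fun (x +i* t) w) <= expR 1 * b w.
  apply: le_trans (H t w) _; rewrite ler_wpM2r// ger_pMr ?expR_gt0//.
  by rewrite -expR0 ler_expR oppr_le0 sqr_ge0.
have vanish (e : R) : 0 < e -> exists A : R, forall t, A < `|t| -> (N (calderon_fun (x +i* t)) <= e%:E)%E.
  move=> e0; pose dl := e / (K + 1).
  have K1 : 0 < K + 1 := ltr_wpDl K_ge0 ltr01.
  have dl0 : 0 < dl by rewrite divr_gt0.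
  have [A HA] := expR_sqr_vanish (divr_gt0 dl0 (expR_gt0 1)).
  exists A => t At; apply: (@le_trans _ _ (K * dl)%:E); last first.
    by rewrite lee_fin /dl mulrA ler_pdivrMr// mulrC ler_wpM2l ?(ltW e0)//; lra.
  apply: (fin_of_bounded Nb b_ge0 dl0 (measurable_calderon_fun _)) => w _.
  apply: le_trans (H t w) _; apply: (ler_wpM2r (b_ge0 w)).
  rewrite (mulrC (expR 1)) -ler_pdivlMr ?expR_gt0//.
  exact: HA.
split.
- move=> t; apply: (@le_lt_trans _ _ (K * expR 1)%:E); last exact: ltry.
  apply: (fin_of_bounded Nb b_ge0 (expR_gt0 1) (measurable_calderon_fun _)) => w _.
  exact: H1.
- move=> t; apply: (calderon_fun_continuous Nb N_ge0 b_ge0 (expR_gt0 1)) => //.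
    by apply: nearW => s.
  by move=> e e0; exact: vertical_near.
- apply/cvg0_ereal => // e e0; have [A HA] := vanish e e0.
  apply: filterS (nbhs_pinfty_gt (num_real A)) => t At; apply: HA.
  exact: lt_le_trans At (ler_norm t).
- apply/cvg0_ereal => // e e0; have [A HA] := vanish e e0.
  apply: filterS (nbhs_ninfty_lt (num_real (- A))) => t At; apply: HA; rewrite -normrN.
  by apply: lt_le_trans (ler_norm _); rewrite ltrNr.
Qed.

Lemma calderon_fun_left1 t w :
  modc (calderon_fun (0 +i* t) w) <= expR 1 * expR (- t ^+ 2) * b0 w.
Proof.
apply: le_trans (calderon_fun_left t w) _; rewrite ler_wpM2r// ler_peMl ?expR_ge0//.
by rewrite -expR0 ler_expR.
Qed.

Lemma calderon_fun_growth (z : R[i]) (e c : R) w : 0 <= e -> e <= complex.Re z ->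
  complex.Re z + e <= 1 -> 0 <= c ->
  modc (calderon_fun z w) * (c * expR (e * `|L w|)) <= expR 1 * c * (b0 w + b1 w).
Proof.
move=> e0 ez ze c0.
have z01 : 0 <= complex.Re z <= 1 by apply/andP; split; lra.
apply: le_trans (ler_wpM2r _ (calderon_fun_le w z01)) _; first by rewrite mulr_ge0// expR_ge0.
have -> (a m u v : R) : a * (m * u) * (c * v) = a * c * (m * (u * v)) by ring.
apply: ler_wpM2l; first by rewrite mulr_ge0// expR_ge0.
by rewrite -mulrDr ler_wpM2l ?modc_ge0// expR_between_abs.
Qed.

Lemma calderon_fun_quotient (z h : R[i]) w : h != 0 ->
  h^-1 * (calderon_fun (z + h) w - calderon_fun z w) - calderon_fun z w * ((L w)%:C + 2 * z) =
  calderon_fun z w * (h^-1 * (cexp (h * ((L w)%:C + 2 * z + h)) - 1) - ((L w)%:C + 2 * z)).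
Proof. by move=> h0; rewrite calderon_fun_shift; ring. Qed.

Lemma modc_L2 (z : R[i]) w : modc ((L w)%:C + 2 * z) <= `|L w| + 2 * modc z.
Proof. by apply: le_trans (modcD _ _) _; rewrite modcM modc_real modc2. Qed.

(** The derivative is F(z) (L + 2 z). The quotients converge by [cvg0_split]: the second-order
    estimate applies where L is bounded, and elsewhere the growth estimate applies, which only needs
    z to stay away from the two boundary lines. *)
Lemma calderon_fun_analytic (z : R[i]^o) : strip_interior z ->
  exists2 f'z : X * R -> R[i]^o, fin_space (sum_norm N0 N1) f'z &
    sum_norm N0 N1 (h^-1 *: (calderon_fun (z + h) - calderon_fun z) - f'z)%R
      @[h --> (0%R : R[i]^o)^'] --> 0%E.
Proof.
move=> /andP[z0 z1].
(* 2 e is the distance from z to the boundary of the strip, the room available for the growth exp(2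
   e |L|). *)
pose e := Num.min (complex.Re z) (1 - complex.Re z) / 2.
have e2 : 2 * e = Num.min (complex.Re z) (1 - complex.Re z) by rewrite /e mulrC divfK.
have e0 : 0 < e by rewrite divr_gt0// lt_min z0 subr_gt0.
have ez : 2 * e <= complex.Re z by rewrite e2 ge_min lexx.
have ze : 2 * e <= 1 - complex.Re z by rewrite e2 ge_min lexx orbT.
have ze' : complex.Re z + 2 * e <= 1 by lra.
have e1 : e <= 1 by lra.
have ee0 : 0 <= 2 * e by rewrite mulr_ge0// ltW.
pose a := 2 * modc z; have a0 : 0 <= a by rewrite mulr_ge0// modc_ge0.
pose k := (4 * expR (a + 1) + 1) * (e^-1 + a + 1).
have k0 : 0 < k.
  by rewrite mulr_gt0 ?ltr_wpDl ?mulr_ge0 ?expR_ge0 ?addr_ge0 ?invr_ge0 ?(ltW e0).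
pose f' : X * R -> R[i]^o := fun w => calderon_fun z w * ((L w)%:C + 2 * z).
have mf' : measurable_upper f'.
  apply: measurable_upperM; first exact: measurable_calderon_fun.
  by apply: measurable_upperD; [exact: measurable_L|exact: measurable_upper_cst].
exists f'.
  apply: (@le_lt_trans _ _ (K * (expR 1 * (e^-1 + a)))%:E); last exact: ltry.
  have c0 : 0 < e^-1 + a by rewrite ltr_pwDl// invr_gt0.
  apply: fin_of_bounded N01b b01_ge0 _ mf' _ => [|w _]; first by rewrite mulr_gt0// expR_gt0.
  apply: le_trans (calderon_fun_growth w ee0 ez ze' (ltW c0)).
  rewrite /f' modcM ler_wpM2l ?modc_ge0//; apply: le_trans (modc_L2 z w) _.
  have E1 : 1 <= expR (2 * e * `|L w|) by rewrite -[leLHS]expR0 ler_expR (mulr_ge0 ee0).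
  have LE : `|L w| <= e^-1 * expR (2 * e * `|L w|).
    rewrite mulrC ler_pdivlMr// mulrC; have := expR_ge1Dx (2 * e * `|L w|).
    have : 0 <= e * `|L w| by rewrite mulr_ge0// ltW.
    lra.
  rewrite (mulrDl e^-1); apply: lerD => //; exact: ler_peMr.
pose U (h : R[i]^o) : X * R -> R[i]^o := h^-1 *: (calderon_fun (z + h) - calderon_fun z) - f'.
have UE (h : R[i]) w : h != 0 -> U h w = calderon_fun z w *
    (h^-1 * (cexp (h * ((L w)%:C + 2 * z + h)) - 1) - ((L w)%:C + 2 * z)).
  by move=> h0; rewrite -calderon_fun_quotient.
apply: (@cvg0_split _ _ _ (sum_norm N0 N1) U (fun w => b0 w + b1 w) kk K (expR 1 * k)) => //.
- exact: sum_norm_ge0.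
- by rewrite mulr_ge0 ?expR_ge0// ltW.
- move=> h; apply: (measurable_upperB (f := fun w => h^-1 * (calderon_fun (z + h) w - calderon_fun z w))) => //.
  apply: (measurable_upperM (measurable_upper_cst _)).
  by apply: measurable_upperB; exact: measurable_calderon_fun.
- apply/near_punctured; exists e => // h h0 he w _; rewrite UE// modcM.
  apply: le_trans (calderon_fun_growth w ee0 ez ze' (ltW k0)).
  rewrite ler_wpM2l ?modc_ge0//.
  by apply: quotient_growth => //; [rewrite e0|exact: ltW|exact: modc_L2].
move=> n dl dl0; have [M HM] := Lbd n.
pose A := `|M| + a + 1; have A0 : 0 < A by rewrite ltr_wpDl// addr_ge0.
pose B := expR 1 * (20 * A ^+ 2 * expR A + 1).
have B0 : 0 < B.
  have B1 : 0 <= 20 * A ^+ 2 * expR A by rewrite mulr_ge0 ?expR_ge0// mulr_ge0// sqr_ge0.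
  by rewrite mulr_gt0 ?expR_gt0// (ltr_wpDl B1 ltr01).
apply/near_punctured; exists (Num.min 1 (dl / B)); first by rewrite lt_min ltr01 divr_gt0.
move=> h h0; rewrite lt_min => /andP[h1 h2] w w0 kw; rewrite UE// modcM.
have hh := modc_ge0 h.
have [fw|fw] := eqVneq (f w) 0.
  by rewrite /calderon_fun fw mul0r modc0 mul0r mulr_ge0// ltW.
have lA : modc ((L w)%:C + 2 * z) + modc h <= A.
  by have := modc_L2 z w; have := HM w w0 fw kw; have := ler_norm M; rewrite /A -/a; lra.
have z01 : 0 <= complex.Re z <= 1 by rewrite !ltW.
have Q := cexp_quotient_bound h0 (ltW h1) lA.
apply: le_trans (ler_pM (modc_ge0 _) (modc_ge0 _) (calderon_fun_strip w z01) Q) _.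
have -> (E b h' c : R) : E * b * (h' * c) = h' * (E * c) * b by ring.
by rewrite -/B ler_wpM2r// -ler_pdivlMr// ltW.
Qed.

Lemma calderon_calderon_fun : calderon N0 N1 calderon_fun.
Proof.
have sb (z : R[i]) w : strip z -> modc (calderon_fun z w) <= expR 1 * (b0 w + b1 w) := @calderon_fun_strip z w.
have sN (z : R[i]) : strip z -> (sum_norm N0 N1 (calderon_fun z) <= (K * expR 1)%:E)%E.
  move=> sz; apply: fin_of_bounded N01b b01_ge0 (expR_gt0 1) (measurable_calderon_fun _) _ => w _.
  exact: sb.
split.
- by move=> z sz; apply: le_lt_trans (sN z sz) _; exact: ltry.
- by exists (K * expR 1).
- move=> z sz; apply: (calderon_fun_continuous N01b sum_norm_ge0 b01_ge0 (expR_gt0 1)).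
  + by move=> w; exact: sb.
  + by apply/near_strip; exists 1 => // w' sw' _ w; exact: sb.
  + by move=> e e0; apply/near_strip; exists e.
- exact: calderon_fun_analytic.
- exact: calderon_fun_trace N0b N0_ge0 b0_ge0 calderon_fun_left1.
- exact: calderon_fun_trace N1b N1_ge0 b1_ge0 calderon_fun_right.
Qed.

Lemma calderon_norm_calderon_fun : (calderon_norm N0 N1 calderon_fun <= (K * expR 1)%:E)%E.
Proof.
have H (x t : R) b w : 0 <= b -> modc (calderon_fun (x +i* t) w) <= expR 1 * expR (- t ^+ 2) * b ->
    modc (calderon_fun (x +i* t) w) <= expR 1 * b.
  move=> b_ge0 h; apply: le_trans h _; rewrite ler_wpM2r// ger_pMr ?expR_gt0//.
  by rewrite -expR0 ler_expR oppr_le0 sqr_ge0.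
rewrite /calderon_norm ge_max; apply/andP; split; apply: ge_ereal_sup => _ [t _ <-].
  apply: fin_of_bounded N0b b0_ge0 (expR_gt0 1) (measurable_calderon_fun _) _ => w _.
  exact/H/calderon_fun_left1.
apply: fin_of_bounded N1b b1_ge0 (expR_gt0 1) (measurable_calderon_fun _) _ => w _.
exact/H/calderon_fun_right.
Qed.

End calderon_function.

(** * The lower bound by duality *)

Section dual_weights.
Variables (theta i0 q0 i1 q1 i q : R).
Hypotheses (i0_01 : 0 <= i0 <= 1) (i1_01 : 0 <= i1 <= 1).
Hypotheses (q0_gt1 : 1 < q0) (q1_gt1 : 1 < q1) (i01 : 0 < i <= 1) (q_gt1 : 1 < q).
Hypothesis iE : i = (1 - theta) * i0 + theta * i1.
Hypothesis qE : q^-1 = (1 - theta) * q0^-1 + theta * q1^-1.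

Let p := i^-1.
(** Below p, positive because p >= 1, and at least p - q because q > 1, as [weighted_pairing]
    requires. *)
Let rho := p - 2^-1.
Let s0 := q0 / (q0 - 1).
Let s1 := q1 / (q1 - 1).

Lemma dual_exponent_inv (r : R) : 1 < r -> 0 < r / (r - 1) /\ (r / (r - 1))^-1 = 1 - r^-1.
Proof.
move=> r1; have r0 : 0 < r := lt_trans ltr01 r1.
split; first by rewrite divr_gt0// subr_gt0.
by field; rewrite (gt_eqF r0) subr_eq0 (gt_eqF r1).
Qed.

(** With x the scaled f and a its weight, this is the identity x w0 exp(theta Lam) = x^q a^{p - q}
    in the logarithms lx = ln x and la = ln a. It expresses that the reciprocals of the dual
    exponents are interpolated by the same theta. *)
Lemma dual_weights_exponents (lx la : R) :
  let e1 := q / s1 - q / s0 in let e2 := p * (i0 - i1) - e1 in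
  lx + (q / s0 * lx + (p * (1 - i0) - q / s0) * la) + theta * (e1 * lx + e2 * la) =
  q * lx + (p - q) * la.
Proof.
have [i00 _] := andP i01; have qpos : 0 < q := lt_trans ltr01 q_gt1.
have [_ E0] := dual_exponent_inv q0_gt1; have [_ E1] := dual_exponent_inv q1_gt1.
have pi1 : p * ((1 - theta) * i0 + theta * i1) = 1 by rewrite -iE mulVf ?gt_eqF.
have qq1 : q * ((1 - theta) * q0^-1 + theta * q1^-1) = 1 by rewrite -qE mulfV ?gt_eqF.
rewrite /= /s0 /s1 E0 E1.
have -> : lx + (q * (1 - q0^-1) * lx + (p * (1 - i0) - q * (1 - q0^-1)) * la) +
    theta * ((q * (1 - q1^-1) - q * (1 - q0^-1)) * lx +
    (p * (i0 - i1) - (q * (1 - q1^-1) - q * (1 - q0^-1))) * la) =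
    lx + (q - q * ((1 - theta) * q0^-1 + theta * q1^-1)) * lx +
    (p - p * ((1 - theta) * i0 + theta * i1) -
      (q - q * ((1 - theta) * q0^-1 + theta * q1^-1))) * la by ring.
by rewrite pi1 qq1; ring.
Qed.

Lemma le_inv1D (C D : R) : 0 <= C -> C <= D -> (1 + D)^-1 <= (1 + C)^-1.
Proof. by move=> C0 CD; rewrite lef_pV2 ?posrE ?lerD2l// ltr_pwDl// (le_trans C0). Qed.

(* The test function f^(q-1) a^(p-q) of the extremal pairing is w0 e^(theta Lam), where w0
   and w0 e^Lam lie in the duals of the two end spaces. *)
Lemma dual_weights : exists c D : R, [/\ 0 < c, 0 < D & forall (g : X * R -> R) n (l : R),
  0 < l -> (forall z, 0 <= g z) -> measurable_fun setT g ->
  (\int[mu]_x (cone_int (fun z => (l^-1 * (g z * \1_(plateau g n) z)) `^ q)%R x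
    `^ (i * q)^-1) = 1)%E ->
  exists (w0 Lam : X * R -> R) (B : R),
  [/\ measurable_fun setT w0 /\ measurable_fun setT Lam,
      (forall z, 0 <= w0 z) /\ (forall z, ~ plateau g n z -> w0 z = 0),
      forall z, plateau g n z -> `|Lam z| <= B,
      tent_bd (1 - i0) s0 1 (fun z => D^-1 * w0 z) /\
      tent_bd (1 - i1) s1 1 (fun z => D^-1 * (w0 z * expR (Lam z))) &
      ((c * l)%:E <= \int[lam]_z (g z * (w0 z * expR (theta * Lam z)) * W z)%:E)%E]].
Proof.
have [i00 i1'] := andP i01; have q00 : 0 < q := lt_trans ltr01 q_gt1.
have p1 : 1 <= p by rewrite invf_ge1.
have p0 : 0 < p := lt_le_trans ltr01 p1.
have rho0 : 0 < rho by rewrite subr_gt0; lra.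
have rhop : rho < p by rewrite /rho; lra.
have pqr : p - q <= rho by have := q_gt1; rewrite /rho; lra.
have [s00 E0] := dual_exponent_inv q0_gt1; have [s10 E1] := dual_exponent_inv q1_gt1.
rewrite -/s0 in s00 E0; rewrite -/s1 in s10 E1.
have s0_ge1 : 1 <= s0.
  by rewrite /s0 ler_pdivlMr ?subr_gt0// mul1r gerBl.
have s1_ge1 : 1 <= s1.
  by rewrite /s1 ler_pdivlMr ?subr_gt0// mul1r gerBl.
have j0_01 : 0 <= 1 - i0 <= 1 by have /andP[? ?] := i0_01; apply/andP; split; lra.
have j1_01 : 0 <= 1 - i1 <= 1 by have /andP[? ?] := i1_01; apply/andP; split; lra.
have [j00 _] := andP j0_01; have [j10 _] := andP j1_01.
have [w [mw w01 wint wlow]] := localizing_weight.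
have [D0 D00 H0] := weighted_tent_bd rho0 rhop q00 j00 s00.
have [D1 D10 H1] := weighted_tent_bd rho0 rhop q00 j10 s10.
(* The truncated function is normalised to have area integral 1; the factor 1 / 4 of the majorant
   lemma turns this into 4^{-p}. *)
have eta0 : 0 < 4^-1 `^ p :> R by rewrite powR_gt0// invr_gt0.
have [c c0 Hc] := weighted_pairing rho0 rhop q00 eta0 pqr.
exists (4 * c), (1 + (D0 + D1)); split; [by rewrite mulr_gt0|lra|].
move=> g n l l0 g0 mg I1.
have lV0 : 0 < l^-1 by rewrite invr_gt0.
pose P := plateau g n.
have mP : measurable P by exact: measurable_plateau.
pose f z := l^-1 * (g z * \1_P z).
have f0 z : 0 <= f z by rewrite mulr_ge0 ?(ltW lV0)// mulr_ge0.
have mf : measurable_fun setT f.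
  by apply: measurable_funM => //; apply: measurable_funM => //; exact: measurable_indic.
have tf : tent_bd i q 1 f by rewrite /tent_bd gt_eqF// I1.
have AM : area_majorant p q (fun z => 4^-1 * f z) (area_wgt q w f) :=
  area_majorant_tent_bd i01 q00 mw w01 wint f0 mf tf.
set A := area_wgt q w f in AM.
have [A0 mA _ _] := AM; have Afin := area_majorant_lty AM.
pose x z := 4^-1 * f z.
have x0 z : 0 <= x z by rewrite mulr_ge0// invr_ge0.
have mx : measurable_fun setT x by exact: measurable_funM.
pose a z := wgt rho A z.
have ma : measurable_fun setT a by exact: measurable_wgt.
pose Gm (r j : R) z := x z `^ (q / r) * a z `^ (p * j - q / r).
have Gm0 r j z : 0 <= Gm r j z by rewrite mulr_ge0 ?powR_ge0.
have mGm r j : measurable_fun setT (Gm r j).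
  by apply: measurable_funM; exact: measurable_fun_powR.
have T0 : tent_bd (1 - i0) s0 D0 (Gm s0 (1 - i0)) := H0 _ _ x0 mx AM.
have T1 : tent_bd (1 - i1) s1 D1 (Gm s1 (1 - i1)) := H1 _ _ x0 mx AM.
pose e1 := q / s1 - q / s0; pose e2 := p * (i0 - i1) - e1.
pose Lam z := e1 * ln (x z) + e2 * ln (a z).
have mLam : measurable_fun setT Lam.
  by apply: measurable_funD; apply: measurable_funM => //; apply: measurableT_comp.
have xout z : ~ P z -> x z = 0.
  by move=> nP; rewrite /x /f indicE memNset// !mulr0.
have Gmout r j z : 0 < r -> ~ P z -> Gm r j z = 0.
  by move=> r0 nP; rewrite /Gm xout// powR0 ?mul0r// gt_eqF// divr_gt0.
pose K := l^-1 * n.+1%:R : R.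
have K0 : 0 <= K by rewrite mulr_ge0// ltW.
have [cc [M [cc0 M0 HcM]]] := area_wgt_bounds n q00 K0 mw w01 wlow.
have fK z : f z <= K * \1_(cylinder n) z.
  rewrite /f /K -mulrA ler_wpM2l ?(ltW lV0)// !indicE.
  have [/set_mem/plateauP[zn /andP[_ gn]]|_] := boolP (z \in P); last by rewrite mulr0 mulr_ge0.
  by rewrite mem_set// !mulr1.
have [AM1 AM2] := HcM f f0 mf fK.
pose xc := 4^-1 * (l^-1 * n.+1%:R^-1) : R.
pose xM := 4^-1 * K.
have xc0 : 0 < xc by rewrite !mulr_gt0 ?invr_gt0.
have onP z : P z -> [/\ 0 < x z, 0 < a z &
    `|Lam z| <= `|e1| * (`|ln xc| + `|ln xM|) + `|e2| * (`|ln cc| + `|ln M|)].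
  move=> Pz; have /plateauP[zn /andP[gn1 gn2]] := Pz; have z0 := cylinder_gt0 zn.
  have fE : f z = l^-1 * g z by rewrite /f indicE mem_set// mulr1.
  have xz1 : xc <= x z by rewrite /xc /x fE ler_wpM2l ?invr_ge0// ler_wpM2l ?(ltW lV0).
  have xz2 : x z <= xM by rewrite /xM /x fE /K ler_wpM2l ?invr_ge0// ler_wpM2l ?(ltW lV0).
  have az1 : cc <= a z.
    by apply: (wgt_ge rho0 rhop A0 mA Afin z0 cc0) => y yz; exact: AM2 zn yz.
  have az2 : a z <= M := wgt_le rho0 rhop A0 mA Afin z0 AM1.
  split; [exact: lt_le_trans xz1|exact: lt_le_trans az1|].
  rewrite /Lam (le_trans (ler_normD _ _))// !normrM.
  by apply: lerD; apply: ler_wpM2l => //; apply: ln_between.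
have factor (r j : R) z : P z -> Gm r j z =
    expR ((q / r) * ln (x z) + (p * j - q / r) * ln (a z)).
  by move=> /onP[xz az _]; apply: calderon_factor; rewrite lnK ?posrE.
have w1E z : Gm s0 (1 - i0) z * expR (Lam z) = Gm s1 (1 - i1) z.
  have [Pz|nP] := pselect (P z); last by rewrite !Gmout// mul0r.
  rewrite !factor// -expRD /Lam; congr expR.
  by rewrite /e2 /e1; move: (ln _) (ln _) => lx la; ring.
exists (Gm s0 (1 - i0)), Lam,
  (`|e1| * (`|ln xc| + `|ln xM|) + `|e2| * (`|ln cc| + `|ln M|)); split.
- by split; [exact: mGm|exact: mLam].
- by split; [exact: Gm0|move=> z; exact: Gmout].
- by move=> z /onP[].
- have scale (j r C : R) : 0 <= j <= 1 -> 1 <= r -> 0 <= C -> C <= D0 + D1 ->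
      tent_bd j r C (Gm r j) -> tent_bd j r 1 (fun z => (1 + (D0 + D1))^-1 * Gm r j z).
    move=> j01 r1 CC0 CD H; have [jj0 _] := andP j01; have r0 := lt_le_trans ltr01 r1.
    have V0 : 0 <= (1 + (D0 + D1))^-1 by rewrite invr_ge0 addr_ge0// addr_ge0.
    have P1 z : 0 <= (1 + (D0 + D1))^-1 * Gm r j z by rewrite mulr_ge0.
    have m1 (k : R) : measurable_fun setT (fun z => k * Gm r j z) by exact: measurable_funM.
    have := tent_bd_normalize j01 r1 CC0 (Gm0 r j) (mGm r j) H.
    apply: (le_tent_bd jj0 (ltW r0) P1 (m1 _) (m1 _)) => z _.
    exact: (ler_wpM2r (Gm0 r j z) (le_inv1D CC0 CD)).
  split; first by apply: (scale _ _ D0) => //; rewrite lerDl.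
  have -> : (fun z => (1 + (D0 + D1))^-1 * (Gm s0 (1 - i0) z * expR (Lam z))) =
      (fun z => (1 + (D0 + D1))^-1 * Gm s1 (1 - i1) z) by apply/funext => z; rewrite w1E.
  by apply: (scale _ _ D1) => //; rewrite lerDr.
have pair : ((4^-1 `^ p)%:E <= \int[mu]_y (cone_int (fun z => x z `^ q)%R y `^ (p / q)))%E.
  have -> : p / q = (i * q)^-1 by rewrite invfM.
  by rewrite area_scale ?invr_ge0// I1 mule1.
have := Hc x A x0 mx AM pair.
have l4 : 0 <= 4 * l by rewrite mulr_ge0// ltW.
have XE z : g z * (Gm s0 (1 - i0) z * expR (theta * Lam z)) * W z =
    4 * l * (x z `^ q * a z `^ (p - q) * W z).
  have [Pz|nP] := pselect (P z); last first.
    by rewrite Gmout// xout// powR0 ?gt_eqF// mul0r mulr0 !mul0r mulr0.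
  have [xz az _] := onP z Pz.
  have gE : g z = 4 * l * x z.
    by rewrite /x /f indicE mem_set// mulr1; field; rewrite gt_eqF.
  have core : x z * (Gm s0 (1 - i0) z * expR (theta * Lam z)) = x z `^ q * a z `^ (p - q).
    have [lx lxE] : exists lx, ln (x z) = lx by exists (ln (x z)).
    have [la laE] : exists la, ln (a z) = la by exists (ln (a z)).
    have xE : x z = expR lx by rewrite -lxE lnK.
    have aE : a z = expR la by rewrite -laE lnK.
    have LE : Lam z = e1 * lx + e2 * la by rewrite /Lam lxE laE.
    rewrite factor// lxE laE LE xE aE -!expRM -!expRD; congr expR.
    have := dual_weights_exponents lx la; rewrite /= -/e1 -/e2 => E2.
    by rewrite (mulrC lx) (mulrC la) -E2; ring.
  rewrite -core gE; move: (Gm _ _ _) (expR _) (x z) (W z) => u1 u2 u3 u4; ring.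
have -> : (\int[lam]_z (g z * (Gm s0 (1 - i0) z * expR (theta * Lam z)) * W z)%:E =
    (4 * l)%:E * \int[lam]_z (x z `^ q * a z `^ (p - q) * W z)%:E)%E.
  rewrite -ge0_integralZlT//.
  - by apply: eq_integral => z _; rewrite XE EFinM.
  - by move=> z; rewrite lee_fin (mulr_ge0 (mulr_ge0 (powR_ge0 _ _) (powR_ge0 _ _)) (dt_weight_ge0 z)).
  - apply/measurable_EFinP; apply: measurable_funM; last exact: measurable_dt_weight.
    by apply: measurable_funM; exact: measurable_fun_powR.
move=> H; apply: le_trans (lee_wpmul2l _ H); last by rewrite lee_fin.
by rewrite -EFinM lee_fin le_eqVlt; apply/orP; left; apply/eqP; ring.
Qed.

End dual_weights.

(** * Complex integrals and the pairing functionals *)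

Section complex_integral.
Context {d' : measure_display} {T : measurableType d'}.
Variable nu : {measure set T -> \bar R}.
Implicit Types (f k : T -> R[i]).

Definition cintegrable f : Prop :=
  nu.-integrable setT (EFin \o (fun t => complex.Re (f t))) /\
  nu.-integrable setT (EFin \o (fun t => complex.Im (f t))).

Definition cint f : R[i] :=
  (Rintegral nu setT (fun t => complex.Re (f t))) +i* (Rintegral nu setT (fun t => complex.Im (f t))).

Lemma eq_cint f k : f =1 k -> cint f = cint k.
Proof. by move=> fk; rewrite /cint; congr (_ +i* _); apply: eq_Rintegral => t _; rewrite fk. Qed.

Lemma cintegrable_bound f (m : R) : measurable_fun setT (fun t => complex.Re (f t)) ->
  measurable_fun setT (fun t => complex.Im (f t)) ->
  (\int[nu]_t (modc (f t))%:E <= m%:E)%E -> cintegrable f /\ modc (cint f) <= 2 * m.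
Proof.
move=> mR mI fm.
have bd (g : T -> R) : measurable_fun setT g -> (forall t, `|g t| <= modc (f t)) ->
    nu.-integrable setT (EFin \o g) /\ `|Rintegral nu setT g| <= m.
  move=> mg gf; have gm : (\int[nu]_t `|(g t)%:E| <= m%:E)%E.
    apply: le_trans fm; apply: ge0_le_integral => //.
    - by apply/measurable_EFinP; exact: measurableT_comp.
    - by apply/measurable_EFinP; exact: measurable_modc.
    - by move=> t _; rewrite lee_fin.
  have ig : nu.-integrable setT (EFin \o g).
    apply/integrableP; split; first exact/measurable_EFinP.
    exact: le_lt_trans gm (ltry _).
  split => //; rewrite -lee_fin EFin_normr_Rintegral//.
  exact: le_trans (le_abse_integral _ measurableT (measurable_int _ ig)) gm.
have [iR bR] := bd _ mR (fun t => Re_le_modc (f t)).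
have [iI bI] := bd _ mI (fun t => Im_le_modc (f t)).
split; first by split.
by apply: le_trans (modc_le_ReIm (cint f)) _; rewrite mulr2n mulrDl mul1r; apply: lerD.
Qed.

Lemma cintD f k : cintegrable f -> cintegrable k -> cint (fun t => f t + k t) = cint f + cint k.
Proof.
move=> [fR fI] [kR kI]; rewrite /cint; congr (_ +i* _).
  rewrite -(RintegralD measurableT fR kR); apply: eq_Rintegral => t _.
  by case: (f t) => a b; case: (k t).
rewrite -(RintegralD measurableT fI kI); apply: eq_Rintegral => t _.
by case: (f t) => a b; case: (k t).
Qed.

Lemma cintegrableZ f (c : R[i]) : cintegrable f -> cintegrable (fun t => c * f t).
Proof.
move=> [fR fI]; have Z (r : R) (g : T -> R) : nu.-integrable setT (EFin \o g) ->
    nu.-integrable setT (EFin \o (fun t => r * g t)).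
  by move=> ig; apply: eq_integrable (integrableZl measurableT r ig).
case: c => a b; split.
  apply: eq_integrable (integrableB measurableT (Z a _ fR) (Z b _ fI)) => // t _ /=.
  by case: (f t).
apply: eq_integrable (integrableD measurableT (Z a _ fI) (Z b _ fR)) => // t _ /=.
by case: (f t).
Qed.

Lemma cintZ f (c : R[i]) : cintegrable f -> cint (fun t => c * f t) = c * cint f.
Proof.
move=> [fR fI]; have Z (r : R) (g : T -> R) : nu.-integrable setT (EFin \o g) ->
    nu.-integrable setT (EFin \o (fun t => r * g t)).
  by move=> ig; apply: eq_integrable (integrableZl measurableT r ig).
case: c => a b; rewrite /cint /=; congr (_ +i* _).
  rewrite -!RintegralZl// -RintegralB//; [|exact: Z|exact: Z].
  by apply: eq_Rintegral => t _; case: (f t).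
rewrite -!RintegralZl// -RintegralD//; [|exact: Z|exact: Z].
by apply: eq_Rintegral => t _; case: (f t).
Qed.

End complex_integral.

Lemma measurable_vanish (g : X * R -> R) : measurable_fun upper g ->
  (forall z, ~ 0 < z.2 -> g z = 0) -> measurable_fun setT g.
Proof.
move=> mg g0; have := measurable_on_upper mg; apply: eq_measurable_fun => z _.
rewrite indicE; have [_|/negP nz] := boolP (z \in upper); first by rewrite mulr1.
by rewrite mulr0 g0// => z0; apply: nz; rewrite inE.
Qed.

(** v is conj(f) / |f|, with value 0 where f vanishes since the inverse of 0 is 0. *)
Lemma conj_upper (f : X * R -> R[i]^o) : measurable_upper f ->
  exists2 v : X * R -> R[i]^o, measurable_upper v &
    forall z, modc (v z) <= 1 /\ f z * v z = (modc (f z))%:C.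
Proof.
move=> mf; have mm : measurable_fun upper (fun z => (modc (f z))^-1).
  have : measurable_fun setT (fun z => uabs f z `^ (-1)).
    by apply: measurable_fun_powR; exact: measurable_uabs.
  move=> /(measurable_funTS (D := upper)); apply: eq_measurable_fun => z /set_mem z0.
  by rewrite uabsE// powR_inv1// modc_ge0.
have mc : measurable_upper (fun z => conjc (f z) : R[i]^o).
  have [mR mI] := mf; split.
    by apply: eq_measurable_fun mR => z _; case: (f z).
  by apply: (eq_measurable_fun (fun z => - complex.Im (f z))); [move=> z _; case: (f z)|exact: measurable_funN].
exists (fun z => ((modc (f z))^-1)%:C * conjc (f z)).
  by apply: (measurable_upperM (measurable_upper_real mm) mc).
move=> z; have E : modc (conjc (f z)) = modc (f z) by rewrite !modcE; case: (f z) => a b /=; rewrite sqrrN.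
split.
  rewrite modcM modc_real ger0_norm ?invr_ge0 ?modc_ge0// E.
  have [->|m0] := eqVneq (modc (f z)) 0; first by rewrite mulr0 ler01.
  by rewrite mulVf.
have [f0|f0] := eqVneq (f z) 0; first by rewrite f0 mul0r modc0.
have m0 : modc (f z) != 0 by rewrite modc_eq0.
have fE : f z * conjc (f z) = (modc (f z) ^+ 2)%:C.
  rewrite modcE sqr_sqrtr ?addr_ge0 ?sqr_ge0//; case: (f z) => a b /=.
  by apply/eqP; rewrite eq_complex /= !expr2; apply/andP; split; apply/eqP; ring.
rewrite mulrCA fE -(rmorphM (real_complex R)); congr (_%:C).
by rewrite expr2 mulrA mulVf// mul1r.
Qed.

Definition paired (Gam : X * R -> R) (u : X * R -> R[i]^o) : Prop :=
  measurable_upper u /\ exists m : R, (\int[lam]_z (uabs u z * Gam z * W z)%:E <= m%:E)%E.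

(** u is integrated against Gam times the conjugate phase of f. At u = f the value is the integral
    of |f| Gam, so that lower bounds for nonnegative integrals become lower bounds for a linear
    functional. *)
Lemma dual_functional (f : X * R -> R[i]^o) (Gam : X * R -> R) : measurable_upper f ->
  (forall z, 0 <= Gam z) -> measurable_fun setT Gam ->
  exists ell : (X * R -> R[i]^o) -> R[i],
  [/\ forall u v (c : R[i]), paired Gam u -> paired Gam v -> ell (u + c *: v) = ell u + c * ell v,
      forall u (m : R), paired Gam u -> (\int[lam]_z (uabs u z * Gam z * W z)%:E <= m%:E)%E ->
        modc (ell u) <= 2 * m &
      paired Gam f -> ell f = (fine (\int[lam]_z (uabs f z * Gam z * W z)%:E))%:C].
Proof.
move=> mf G0 mG; have [v mv vE] := conj_upper mf.
pose k z : R[i] := v z * (Gam z * W z)%:C.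
have mk : measurable_upper (k : X * R -> R[i]^o).
  apply: (measurable_upperM mv); apply: measurable_upper_real; apply: measurable_funTS.
  by apply: measurable_funM => //; exact: measurable_dt_weight.
have k0 z : ~ 0 < z.2 -> k z = 0 by move=> z0; rewrite /k dt_weight_out// mulr0 mulr0.
have GW0 z : 0 <= Gam z * W z := mulr_ge0 (G0 z) (dt_weight_ge0 z).
have kle z : modc (k z) <= Gam z * W z.
  by rewrite /k modcM modc_real ger0_norm// ler_piMl//; have [] := vE z.
have uk u : measurable_upper u -> measurable_fun setT (fun z => complex.Re (u z * k z)) /\
    measurable_fun setT (fun z => complex.Im (u z * k z)).
  move=> mu'; have [mR mI] := measurable_upperM mu' mk.
  by split; apply: measurable_vanish => // z z0; rewrite k0// mulr0.
have ule (u : X * R -> R[i]^o) (m : R) : measurable_upper u ->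
    (\int[lam]_z (uabs u z * Gam z * W z)%:E <= m%:E)%E ->
    cintegrable lam (fun z => u z * k z) /\ modc (cint lam (fun z => u z * k z)) <= 2 * m.
  move=> mu' um; have [mR mI] := uk u mu'; apply: cintegrable_bound => //.
  apply: le_trans um; apply: ge0_le_integralT.
  - by move=> z; rewrite lee_fin modc_ge0.
  - apply/measurable_EFinP.
    rewrite (_ : (fun z => modc (u z * k z)) = uabs (fun z => u z * k z)).
      by apply: measurable_uabs; exact: measurable_upperM.
    apply/funext => z; have [z0|z0] := pselect (0 < z.2); first by rewrite uabsE.
    by rewrite uabs_out// k0// mulr0 modc0.
  - apply/measurable_EFinP; apply: measurable_funM; last exact: measurable_dt_weight.
    by apply: measurable_funM => //; exact: measurable_uabs.
  move=> z; rewrite lee_fin modcM; have [z0|z0] := pselect (0 < z.2).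
    by rewrite uabsE// -mulrA ler_wpM2l ?modc_ge0.
  by rewrite k0// modc0 mulr0 dt_weight_out// mulr0.
exists (fun u => cint lam (fun z => u z * k z)); split.
- move=> u u' c [mu' [m um]] [mu1 [m' um']].
  have [iu _] := ule u m mu' um; have [iu' _] := ule u' m' mu1 um'.
  rewrite -cintZ// -cintD//.
    by apply: eq_cint => z; rewrite -[(u + c *: u') z]/(u z + c * u' z) mulrDl mulrA.
  exact: cintegrableZ.
- by move=> u m [mu' _] um; have [] := ule u m mu' um.
- move=> _.
  rewrite /cint; apply/eqP; rewrite eq_complex /=; apply/andP; split; apply/eqP.
    congr fine; apply: eq_integral => z _; congr (_%:E).
    have [z0|z0] := pselect (0 < z.2).
      by rewrite /k mulrA (vE z).2 uabsE//= mul0r subr0 mulrA.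
    by rewrite k0// mulr0 dt_weight_out// mulr0.
  rewrite /Rintegral (_ : (fun z => _) = cst 0%E) ?integral0//.
  by apply/funext => z; rewrite /k mulrA (vE z).2 /= mulr0 mul0r addr0.
Qed.

(** Supplies the continuity of the exponential factors up to the boundary lines; that of the
    functionals of F comes from [strip_cont_functional]. *)
Lemma cdiff_strip_cont (g : R[i] -> R[i]) (z : R[i]) : cdiff g z -> strip_cont g z.
Proof.
move=> dg e e0; have [K [d0 d00 [K0 HK]]] := cdiff_lipschitz dg.
have K1 : 0 < K + 1 by rewrite ltr_wpDl.
exists (Num.min d0 (e / (K + 1))); first by rewrite lt_min d00 divr_gt0.
move=> w _; rewrite lt_min => /andP[h1 h2]; apply: le_trans (HK w h1) _.
have := ltW h2; rewrite ler_pdivlMr// mulrC => h3; apply: le_trans h3.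
by rewrite ler_wpM2r ?modc_ge0// lerDl.
Qed.

Lemma strip_contM (g k : R[i] -> R[i]) (z : R[i]) : strip_cont g z -> strip_cont k z ->
  strip_cont (fun w => g w * k w) z.
Proof.
move=> cg ck e e0.
have A0 : 0 < modc (k z) + 1 by rewrite ltr_wpDl// modc_ge0.
have B0 : 0 < modc (g z) + 1 by rewrite ltr_wpDl// modc_ge0.
have [d1 d10 H1] := cg _ (divr_gt0 (divr_gt0 e0 (@ltr0Sn R 1)) A0).
have [d2 d20 H2] := ck _ (divr_gt0 (divr_gt0 e0 (@ltr0Sn R 1)) B0).
have [d3 d30 H3] := ck 1 ltr01.
exists (Num.min d1 (Num.min d2 d3)); first by rewrite !lt_min d10 d20.
move=> w sw; rewrite !lt_min => /and3P[w1 w2 w3].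
have -> : g w * k w - g z * k z = (g w - g z) * k w + g z * (k w - k z) by ring.
apply: le_trans (modcD _ _) _; rewrite !modcM.
have kw : modc (k w) <= modc (k z) + 1.
  have -> : k w = k z + (k w - k z) by ring.
  by apply: le_trans (modcD _ _) _; rewrite lerD2l; exact: H3.
have h1 : modc (g w - g z) * modc (k w) <= e / 2.
  apply: le_trans (ler_pM (modc_ge0 _) (modc_ge0 _) (H1 w sw w1) kw) _.
  by rewrite divfK// gt_eqF.
have h2 : modc (g z) * modc (k w - k z) <= e / 2.
  have gz : modc (g z) <= modc (g z) + 1 by rewrite lerDl.
  apply: le_trans (ler_pM (modc_ge0 _) (modc_ge0 _) gz (H2 w sw w2)) _.
  by rewrite mulrC divfK// gt_eqF.
lra.
Qed.

Lemma strip_cont_sum m (g : nat -> R[i] -> R[i]) (z : R[i]) : (forall k, strip_cont (g k) z) ->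
  strip_cont (fun w => \sum_(k < m) g k w) z.
Proof.
move=> cg; elim: m => [e e0|m IH e e0].
  by exists 1 => // w _ _; rewrite !big_ord0 subrr modc0 ltW.
have e20 : 0 < e / 2 by rewrite divr_gt0.
have [d1 d10 H1] := IH _ e20; have [d2 d20 H2] := cg m _ e20.
exists (Num.min d1 d2); first by rewrite lt_min d10.
move=> w sw; rewrite lt_min => /andP[w1 w2]; rewrite !big_ord_recr/= opprD addrACA.
apply: le_trans (modcD _ _) _; have := H1 w sw w1; have := H2 w sw w2; lra.
Qed.

Lemma cdiff_sum m (g : nat -> R[i] -> R[i]) (z : R[i]) : (forall k, cdiff (g k) z) ->
  cdiff (fun w => \sum_(k < m) g k w) z.
Proof.
move=> dg; elim: m => [|m IH].
  by apply: (eq_cdiff ltr01) (cdiff_cst 0 z) => w _; rewrite big_ord0.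
by apply: (eq_cdiff ltr01) (cdiffD IH (dg m)) => w _; rewrite big_ord_recr.
Qed.

Lemma modc_sum m (g : nat -> R[i]) : modc (\sum_(k < m) g k) <= \sum_(k < m) modc (g k).
Proof.
elim: m => [|m IH]; first by rewrite !big_ord0 modc0.
by rewrite !big_ord_recr/=; apply: le_trans (modcD _ _) _; rewrite lerD2r.
Qed.

(** * The three lines theorem for functionals of a Calderon function *)

Section functional_three_lines.
Variables (N0 N1 : (X * R -> R[i]^o) -> \bar R) (F : R[i]^o -> X * R -> R[i]^o) (theta : R).
Hypothesis theta01 : 0 < theta < 1.
Hypothesis cF : calderon N0 N1 F.
Variables (good : (X * R -> R[i]^o) -> Prop) (K : R).
Hypothesis good_fin : forall u, fin_space (sum_norm N0 N1) u -> good u.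
Hypothesis goodD : forall u v (c : R[i]), good u -> good v -> good (u + c *: v).
Hypothesis K_ge0 : 0 <= K.

Section one_functional.
Variable ell : (X * R -> R[i]^o) -> R[i].
Hypothesis ellD : forall u v (c : R[i]), good u -> good v -> ell (u + c *: v) = ell u + c * ell v.
Hypothesis ell_bd : forall u s, 0 < s -> (sum_norm N0 N1 u <= s%:E)%E -> modc (ell u) <= K * s.

Let scaleE (v : X * R -> R[i]^o) (c : R[i]) : c *: v = v + (c - 1) *: v.
Proof. by rewrite scalerBl scale1r subrKC. Qed.

Let goodZ (v : X * R -> R[i]^o) (c : R[i]) : good v -> good (c *: v).
Proof. by move=> gv; rewrite scaleE; exact: goodD. Qed.

Let ellZ (v : X * R -> R[i]^o) (c : R[i]) : good v -> ell (c *: v) = c * ell v.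
Proof. by move=> gv; rewrite scaleE ellD//; ring. Qed.

Let goodB (u v : X * R -> R[i]^o) : good u -> good v -> good (u - v).
Proof. by move=> gu gv; rewrite -scaleN1r; exact: goodD. Qed.

Let ellB (u v : X * R -> R[i]^o) : good u -> good v -> ell (u - v) = ell u - ell v.
Proof. by move=> gu gv; rewrite -scaleN1r ellD// mulN1r. Qed.

Let K1 : 0 < K + 1. Proof. exact: ltr_wpDl. Qed.

Let ell_small u e : 0 < e -> (sum_norm N0 N1 u <= (e / (K + 1))%:E)%E -> modc (ell u) <= e.
Proof.
move=> e0 ue; apply: le_trans (ell_bd (divr_gt0 e0 K1) ue) _.
by rewrite mulrA ler_pdivrMr// mulrC ler_wpM2l ?(ltW e0)// lerDl.
Qed.

Let sum_norm0 u : (forall v, 0 <= N0 v)%E -> (forall v, 0 <= N1 v)%E -> (0 <= sum_norm N0 N1 u)%E.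
Proof. by move=> n0 n1; apply: le_ereal_inf_tmp => _ [v _ <-]; exact: adde_ge0. Qed.

Hypothesis N0_ge0 : forall u, (0 <= N0 u)%E.
Hypothesis N1_ge0 : forall u, (0 <= N1 u)%E.

Let snge0 u : (0 <= sum_norm N0 N1 u)%E. Proof. exact: sum_norm0. Qed.

Lemma strip_cont_functional (z : R[i]) : 0 <= complex.Re z <= 1 ->
  strip_cont (fun w => ell (F w)) z.
Proof.
move=> sz e e0; have := calderon_continuous cF sz.
move=> /(cvg0_ereal (fun w => snge0 _)) /(_ _ (divr_gt0 e0 K1)) /near_strip[d0 d00 H].
exists d0 => // w sw wz; rewrite -ellB; [|exact/good_fin/(calderon_range cF)|exact/good_fin/(calderon_range cF)].
by apply: ell_small => //; exact: H.
Qed.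

Lemma cdiff_functional (z : R[i]) : 0 < complex.Re z < 1 -> cdiff (fun w => ell (F w)) z.
Proof.
move=> sz; have [f' ff' H] := calderon_analytic cF sz.
have [z0 z1] := andP sz.
exists (ell f') => e e0.
move: H => /(cvg0_ereal (fun w => snge0 _)) /(_ _ (divr_gt0 e0 K1)) /near_punctured[d0 d00 H].
exists (Num.min d0 (Num.min (complex.Re z) (1 - complex.Re z))).
  by rewrite !lt_min d00 z0 subr_gt0.
move=> w; rewrite !lt_min => /and3P[w1 w2 w3].
have [->|wz] := eqVneq w z; first by rewrite !subrr mulr0 subr0 modc0 mulr0.
have ReB : complex.Re (w - z) = complex.Re w - complex.Re z by case: (w) => a b; case: (z).
have := Re_le_modc (w - z); rewrite ReB ler_norml => /andP[h1 h2].
have sw : 0 <= complex.Re w <= 1 by apply/andP; split; lra.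
have sz' : 0 <= complex.Re z <= 1 by rewrite !ltW.
have gw : good (F w) by exact/good_fin/(calderon_range cF).
have gz : good (F z) by exact/good_fin/(calderon_range cF).
have gf' : good f' by exact: good_fin.
have h0 : w - z != 0 by rewrite subr_eq0.
have := H (w - z) h0 w1; rewrite (addrC z) subrK => /(ell_small e0).
rewrite ellB//; last by apply: goodZ; exact: goodB.
rewrite ellZ; last exact: goodB.
rewrite ellB// => h; rewrite (_ : _ - _ = (w - z) * ((w - z)^-1 * (ell (F w) - ell (F z)) - ell f')).
  by rewrite modcM mulrC ler_wpM2r ?modc_ge0.
by rewrite [RHS]mulrBr [in RHS]mulrA mulfV// mul1r [ell f' * _]mulrC.
Qed.

End one_functional.

Hypothesis N0_ge0 : forall u, (0 <= N0 u)%E.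
Hypothesis N1_ge0 : forall u, (0 <= N1 u)%E.

Variables (m : nat) (ell : nat -> (X * R -> R[i]^o) -> R[i]) (s : nat -> R).
Hypothesis ellD : forall k u v (c : R[i]), good u -> good v ->
  ell k (u + c *: v) = ell k u + c * ell k v.
Hypothesis ell_bd : forall k u r, 0 < r -> (sum_norm N0 N1 u <= r%:E)%E ->
  modc (ell k u) <= K * r.

(** In the application [ell k] pairs with the k-th slice of w0 and s k is the level of Lam there, so
    this is the pairing of F(z) with w0 exp(z Lam), Lam being rounded. *)
Definition functional_sum (z : R[i]) : R[i] := \sum_(k < m) cexp (z * (s k)%:C) * ell k (F z).

Lemma functional_three_lines (A : R) :
  (forall t : R, modc (functional_sum (0 +i* t)) <= A) ->
  (forall t : R, modc (functional_sum (1 +i* t)) <= A) ->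
  modc (functional_sum theta%:C) <= A.
Proof.
have [B HB] := calderon_bounded cF.
have dexp (c : R) (z : R[i]) : cdiff (fun w => cexp (w * c%:C)) z.
  apply: (@cdiff_comp _ (fun w => w * c%:C) cexp); last exact: cdiff_cexp.
  exact: cdiffM (cdiff_id z) (cdiff_cst _ z).
have sc (z : R[i]) : 0 <= complex.Re z <= 1 -> strip_cont functional_sum z.
  move=> sz; apply: (@strip_cont_sum m (fun k w => cexp (w * (s k)%:C) * ell k (F w)) z) => k.
  apply: strip_contM; first exact/cdiff_strip_cont/dexp.
  exact: (strip_cont_functional (ellD k) (ell_bd k) N0_ge0 N1_ge0).
apply: (@three_lines _ functional_sum (\sum_(k < m) expR `|s k| * (K * (`|B| + 1)))) => //.
- move=> z sz; apply: (@cdiff_sum m (fun k w => cexp (w * (s k)%:C) * ell k (F w)) z) => k.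
  apply: cdiffM; first exact: dexp.
  exact: (cdiff_functional (ellD k) (ell_bd k) N0_ge0 N1_ge0).
- move=> z sz; apply: le_trans (modc_sum _ (fun k => cexp (z * (s k)%:C) * ell k (F z))) _.
  apply: ler_sum => k _; rewrite modcM; apply: ler_pM; rewrite ?modc_ge0//.
    rewrite modc_cexp ler_expR.
    have -> : complex.Re (z * (s k)%:C) = complex.Re z * s k by case: (z) => a b /=; ring.
    apply: le_trans (ler_norm _) _; rewrite normrM.
    by have /andP[? ?] := sz; rewrite ler_piMl// ger0_norm.
  apply: ell_bd; first by rewrite ltr_wpDl.
  apply: le_trans (HB z sz) _; rewrite lee_fin.
  by apply: le_trans (ler_norm _) _; rewrite lerDl.
- by move=> t; apply: sc; rewrite /= lexx ler01.
- by move=> t; apply: sc; rewrite /= lexx ler01.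
Qed.

End functional_three_lines.

Lemma measurable_set_le (F G : X * R -> R) : measurable_fun setT F -> measurable_fun setT G ->
  measurable [set z | F z <= G z].
Proof.
move=> mF mG; rewrite (_ : [set z | _] = setT `&` (fun z => F z <= G z) @^-1` [set true]).
  exact: (measurable_fun_ler mF mG).
by rewrite setTI; apply/seteqP; split.
Qed.

(* Rounding Lam down to an integer turns w0 e^(z Lam) into a finite sum, whose
   coefficients are then scalar functionals of F z. *)
Section slices.
Variables (w0 Lam : X * R -> R) (N : nat).
Hypothesis w0_ge0 : forall z, 0 <= w0 z.
Hypothesis mw0 : measurable_fun setT w0.
Hypothesis mLam : measurable_fun setT Lam.
Hypothesis Lam_lt : forall z, w0 z != 0 -> `|Lam z| < N%:R.

(** The offset N makes Lam + N nonnegative on the support of w0, so that natural numbers index all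
    slices. *)
Definition slice (k : nat) z : R :=
  w0 z * \1_[set z | k%:R <= Lam z + N%:R < k.+1%:R] z.

Definition slice_level (k : nat) : R := k%:R - N%:R.

Lemma slice_ge0 k z : 0 <= slice k z. Proof. exact: mulr_ge0. Qed.

Lemma measurable_slice k : measurable_fun setT (slice k).
Proof.
apply: measurable_funM => //; apply: measurable_indic.
have mN : measurable_fun setT (fun z => Lam z + N%:R) by exact: measurable_funD.
rewrite (_ : [set z | _] = [set z | k%:R <= Lam z + N%:R] `&` ~` [set z | k.+1%:R <= Lam z + N%:R]).
  apply: measurableI; first exact: (measurable_set_le (measurable_cst _) mN).
  by apply: measurableC; exact: (measurable_set_le (measurable_cst _) mN).
apply/seteqP; split => z /=; first by move=> /andP[-> h]; split => //; apply/negP; rewrite -ltNge.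
by move=> [-> /negP]; rewrite -ltNge.
Qed.

Lemma slice_le k z : slice k z <= w0 z.
Proof. by rewrite /slice ler_piMr// indicE; case: (_ \in _). Qed.

(** Each slice is thus dominated by both dual weights, hence pairs with both end spaces and with
    their sum. *)
Lemma slice_le_exp k z : slice k z <= expR N%:R * (w0 z * expR (Lam z)).
Proof.
apply: le_trans (slice_le k z) _.
have [->|wz] := eqVneq (w0 z) 0; first by rewrite mul0r mulr0.
rewrite mulrCA ler_peMr// -expRD -[leLHS]expR0 ler_expR.
by have := Lam_lt wz; rewrite ltr_norml => /andP[h _]; lra.
Qed.

Lemma slice_index z : w0 z != 0 -> exists2 k : nat, (k < N + N)%N &
  slice_level k <= Lam z < slice_level k + 1 /\
  forall a : nat -> R, \sum_(j < N + N) a j * slice j z = a k * w0 z.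
Proof.
move=> wz; have := Lam_lt wz; rewrite ltr_norml => /andP[h1 h2].
have L0 : 0 <= Lam z + N%:R by lra.
have /andP[k1 k2] := truncn_itv L0; set k := Num.truncn _ in k1 k2.
have kN : (k < N + N)%N.
  by rewrite -(ltr_nat R) natrD; apply: le_lt_trans k1 _; lra.
exists k => //; split.
  by rewrite /slice_level; move: k2; rewrite -natr1 => k2; apply/andP; split; lra.
move=> a; rewrite (bigD1 (Ordinal kN))//= big1 ?addr0; last first.
  move=> j jk; rewrite /slice indicE memNset ?mulr0//= => /truncn_def jE.
  by move/negP: jk; apply; apply/eqP/val_inj; rewrite /= -jE.
by rewrite /slice indicE mem_set ?mulr1//= k1.
Qed.

Lemma slice_sum_out (a : nat -> R) z : w0 z = 0 -> \sum_(j < N + N) a j * slice j z = 0.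
Proof. by move=> wz; rewrite big1// => j _; rewrite /slice wz mul0r mulr0. Qed.

End slices.

Lemma uabs_add (u v : X * R -> R[i]^o) (c : R[i]) z :
  uabs (u + c *: v) z <= uabs u z + modc c * uabs v z.
Proof.
rewrite /uabs mulrA -mulrDl ler_wpM2r// -modcM.
exact: (modcD (u z) (c * v z)).
Qed.

Lemma measurable_upper_lin (u v : X * R -> R[i]^o) (c : R[i]) : measurable_upper u ->
  measurable_upper v -> measurable_upper (u + c *: v).
Proof.
move=> mu' mv; apply: (measurable_upperD mu').
exact: (measurable_upperM (measurable_upper_cst c) mv).
Qed.

Lemma measurable_pairing (u : X * R -> R[i]^o) (w : X * R -> R) : measurable_upper u ->
  measurable_fun setT w -> measurable_fun setT (fun z => (uabs u z * w z * W z)%:E).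
Proof.
move=> mu' mw; apply/measurable_EFinP; apply: measurable_funM; last exact: measurable_dt_weight.
by apply: measurable_funM => //; exact: measurable_uabs.
Qed.

Lemma pairing_ge0 (u : X * R -> R[i]^o) (w : X * R -> R) z : 0 <= w z ->
  (0 <= (uabs u z * w z * W z)%:E)%E.
Proof.
move=> w0; rewrite lee_fin; apply: mulr_ge0; last exact: dt_weight_ge0.
by rewrite mulr_ge0// uabs_ge0.
Qed.

Lemma le_pairing (u : X * R -> R[i]^o) (w v : X * R -> R) : measurable_upper u ->
  measurable_fun setT w -> measurable_fun setT v -> (forall z, 0 <= w z) ->
  (forall z, w z <= v z) ->
  (\int[lam]_z (uabs u z * w z * W z)%:E <= \int[lam]_z (uabs u z * v z * W z)%:E)%E.
Proof.
move=> mu' mw mv w0 wv; apply: ge0_le_integralT.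
- by move=> z; exact: pairing_ge0.
- exact: measurable_pairing.
- exact: measurable_pairing.
move=> z; rewrite lee_fin; apply: ler_wpM2r; first exact: dt_weight_ge0.
by rewrite ler_wpM2l ?uabs_ge0.
Qed.

Lemma pairing_lin (u v : X * R -> R[i]^o) (c : R[i]) (w : X * R -> R) (m m' : R) :
  measurable_upper u -> measurable_upper v -> measurable_fun setT w -> (forall z, 0 <= w z) ->
  (\int[lam]_z (uabs u z * w z * W z)%:E <= m%:E)%E ->
  (\int[lam]_z (uabs v z * w z * W z)%:E <= m'%:E)%E ->
  (\int[lam]_z (uabs (u + c *: v) z * w z * W z)%:E <= (m + modc c * m')%:E)%E.
Proof.
move=> mu' mv mw w0 um vm.
have c0 := modc_ge0 c.
apply: (@le_trans _ _ (\int[lam]_z ((uabs u z * w z * W z)%:E + (modc c)%:E * (uabs v z * w z * W z)%:E))%E).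
  apply: ge0_le_integralT.
  - by move=> z; exact: pairing_ge0.
  - by apply: measurable_pairing => //; exact: measurable_upper_lin.
  - apply: emeasurable_funD; first exact: measurable_pairing.
    by apply: measurable_funeM; exact: measurable_pairing.
  move=> z; rewrite -EFinM -EFinD lee_fin.
  have -> : uabs u z * w z * W z + modc c * (uabs v z * w z * W z) =
    (uabs u z + modc c * uabs v z) * (w z * W z) by ring.
  rewrite -mulrA ler_wpM2r ?uabs_add//.
  exact: (mulr_ge0 (w0 z) (dt_weight_ge0 z)).
rewrite ge0_integralDT.
- rewrite ge0_integralZlT//.
  + by rewrite EFinD EFinM leeD// lee_wpmul2l.
  + by move=> z; exact: pairing_ge0.
  + exact: measurable_pairing.
- by move=> z; exact: pairing_ge0.
- by move=> z; rewrite mule_ge0// pairing_ge0.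
- exact: measurable_pairing.
- by apply: measurable_funeM; exact: measurable_pairing.
Qed.

Lemma pairing_sum (u : X * R -> R[i]^o) (w : nat -> X * R -> R) (a : nat -> R) m :
  measurable_upper u -> (forall k, measurable_fun setT (w k)) -> (forall k z, 0 <= w k z) ->
  (forall k, 0 <= a k) -> (forall k, paired (w k) u) ->
  ((\sum_(k < m) a k * fine (\int[lam]_z (uabs u z * w k z * W z)%:E))%:E =
   \int[lam]_z (uabs u z * (\sum_(k < m) a k * w k z) * W z)%:E)%E.
Proof.
move=> mu' mw w0 a0 pu.
have I0 k : (0 <= \int[lam]_z (uabs u z * w k z * W z)%:E)%E.
  by apply: integral_ge0 => z _; exact: pairing_ge0.
have Ifin k : (\int[lam]_z (uabs u z * w k z * W z)%:E)%E \is a fin_num.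
  by have [_ [M HM]] := pu k; rewrite ge0_fin_numE// (le_lt_trans HM)// ltry.
elim: m => [|m IH].
  by rewrite big_ord0 integral0_eq// => z _; rewrite big_ord0 mulr0 mul0r.
have s0 z : 0 <= \sum_(k < m) a k * w k z by apply: sumr_ge0 => k _; rewrite mulr_ge0.
have ms : measurable_fun setT (fun z => \sum_(k < m) a k * w k z).
  by apply: measurable_sum => k; exact: measurable_funM.
rewrite big_ord_recr/= EFinD IH EFinM fineK// -ge0_integralZlT//; last 2 first.
- by move=> z; exact: pairing_ge0.
- exact: measurable_pairing.
rewrite -ge0_integralDT; last 4 first.
- by move=> z; exact: (@pairing_ge0 u (fun z => \sum_(k < m) a k * w k z) z (s0 z)).
- by move=> z; apply: mule_ge0; [rewrite lee_fin|exact: (@pairing_ge0 u (w m))].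
- exact: (measurable_pairing mu' ms).
- by apply: measurable_funeM; exact: measurable_pairing.
apply: eq_integral => z _; rewrite -EFinM -EFinD big_ord_recr/=; congr (_%:E); ring.
Qed.

Lemma tent_pairing (p : \bar R) (q : R) : (1 <= p)%E -> 1 < q -> exists2 C : R, 0 < C &
  forall (u : X * R -> R[i]^o) (w : X * R -> R) (D m : R), measurable_upper u ->
  (forall z, 0 <= w z) -> measurable_fun setT w -> 0 < D -> 0 < m ->
  tent_bd (1 - fine p^-1) (q / (q - 1)) 1 (fun z => D^-1 * w z) ->
  (tent_norm mu p q alpha u <= m%:E)%E ->
  (\int[lam]_z (uabs u z * w z * W z)%:E <= (C * D * m)%:E)%E.
Proof.
move=> p1 q1; have q0 : 0 < q := lt_trans ltr01 q1.
have [C C0 HC] := tent_duality q1 (inve_ge1 p1).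
exists (C + 1) => [|u w D m mu' w0 mw D0 m0 tw um]; first by rewrite ltr_wpDl.
have tu := (tent_norm_le p1 q0 mu' m0).1 um.
have mV : 0 <= m^-1 by rewrite invr_ge0 ltW.
have DV : 0 <= D^-1 by rewrite invr_ge0 ltW.
have F0 z : 0 <= m^-1 * uabs u z by rewrite mulr_ge0// uabs_ge0.
have G0 z : 0 <= D^-1 * w z by rewrite mulr_ge0.
have mF : measurable_fun setT (fun z => m^-1 * uabs u z).
  by apply: measurable_funM => //; exact: measurable_uabs.
have mG : measurable_fun setT (fun z => D^-1 * w z) by exact: measurable_funM.
have H := HC _ _ F0 G0 mF mG tu tw.
have E : (\int[lam]_z (uabs u z * w z * W z)%:E =
    (D * m)%:E * \int[lam]_z (m^-1 * uabs u z * (D^-1 * w z) * W z)%:E)%E.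
  rewrite -ge0_integralZlT.
  - apply: eq_integral => z _; rewrite -EFinM; congr (_%:E).
    by field; rewrite (gt_eqF D0) (gt_eqF m0).
  - by rewrite mulr_ge0// ltW.
  - move=> z; rewrite lee_fin; apply: mulr_ge0; last exact: dt_weight_ge0.
    exact: mulr_ge0.
  apply/measurable_EFinP; apply: measurable_funM; last exact: measurable_dt_weight.
  exact: measurable_funM.
rewrite E; apply: le_trans (lee_wpmul2l _ H) _; first by rewrite lee_fin mulr_ge0 ?ltW.
rewrite -EFinM lee_fin -mulrA mulrC ler_wpM2r ?mulr_ge0 ?(ltW D0) ?(ltW m0)//.
by rewrite lerDl.
Qed.

Lemma tent_norm_dominated (p : \bar R) (q c dl : R) (u : X * R -> R[i]^o) (G : X * R -> R) :
  (1 <= p)%E -> 0 < q -> measurable_upper u -> measurable_fun setT G ->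
  0 < c -> 0 < dl -> tent_bd (fine p^-1) q 1 (fun z => c^-1 * G z) ->
  (forall z, 0 < z.2 -> modc (u z) <= dl * G z) ->
  (tent_norm mu p q alpha u <= (c * dl)%:E)%E.
Proof.
move=> p1 q0 mu' mG c0 dl0 tG uG; apply/(tent_norm_le p1 q0 mu' (mulr_gt0 c0 dl0)).
have [i0 _] := andP (inve_ge1 p1).
have cd0 : 0 <= (c * dl)^-1 by rewrite invr_ge0 ltW// mulr_gt0.
have u0 z : 0 <= (c * dl)^-1 * uabs u z by rewrite mulr_ge0// uabs_ge0.
have mu1 : measurable_fun setT (fun z => (c * dl)^-1 * uabs u z).
  by apply: measurable_funM => //; exact: measurable_uabs.
have mG1 : measurable_fun setT (fun z => c^-1 * G z) by exact: measurable_funM.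
apply: (le_tent_bd i0 (ltW q0) u0 mu1 mG1 _ tG) => z z0.
rewrite uabsE// invfM -mulrA ler_wpM2l ?invr_ge0 ?(ltW c0)//.
by rewrite mulrC ler_pdivrMr// mulrC; exact: uG.
Qed.

Lemma sum_norm_le (N0 N1 : (X * R -> R[i]^o) -> \bar R) (u v : X * R -> R[i]^o) (a b : \bar R) :
  (N0 u <= a)%E -> (N1 v <= b)%E -> (sum_norm N0 N1 (u + v) <= a + b)%E.
Proof.
move=> ua vb; apply: ge_ereal_inf; exists (N0 u + N1 v)%E; last exact: leeD.
by exists (u, v).
Qed.

(** u is split according to which of G0 and G1 is larger; each half is dominated by twice the larger
    one. *)
Lemma tent_sum_dominated (p0 p1 : \bar R) (q0 q1 c dl : R) (u : X * R -> R[i]^o)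
    (G0 G1 : X * R -> R) :
  (1 <= p0)%E -> (1 <= p1)%E -> 0 < q0 -> 0 < q1 -> measurable_upper u ->
  measurable_fun setT G0 -> measurable_fun setT G1 -> 0 < c -> 0 < dl ->
  (forall z, 0 <= G0 z) -> (forall z, 0 <= G1 z) ->
  tent_bd (fine p0^-1) q0 1 (fun z => c^-1 * G0 z) ->
  tent_bd (fine p1^-1) q1 1 (fun z => c^-1 * G1 z) ->
  (forall z, 0 < z.2 -> modc (u z) <= dl * (G0 z + G1 z)) ->
  (sum_norm (tent_norm mu p0 q0 alpha) (tent_norm mu p1 q1 alpha) u <= (4 * c * dl)%:E)%E.
Proof.
move=> p01 p11 q00 q10 mu' mG0 mG1 c0 dl0 G00 G10 t0 t1 uG.
pose S := [set z | G1 z <= G0 z].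
have mS : measurable S by exact: measurable_set_le.
have m1 (A : set (X * R)) : measurable A -> measurable_upper (fun z => (\1_A z : R)%:C : R[i]^o).
  by move=> mA; apply: measurable_upper_real; apply: measurable_funTS; exact: measurable_indic.
pose u0 : X * R -> R[i]^o := fun z => u z * (\1_S z)%:C.
pose u1 : X * R -> R[i]^o := fun z => u z * (\1_(~` S) z)%:C.
have mu0 : measurable_upper u0 by apply: measurable_upperM => //; exact: m1.
have mu1 : measurable_upper u1.
  by apply: measurable_upperM => //; apply: m1; exact: measurableC.
have -> : u = u0 + u1.
  apply/funext => z; rewrite /u0 /u1 /= -[RHS]/(u z * (\1_S z)%:C + u z * (\1_(~` S) z)%:C).
  rewrite !indicE in_setC; case: (z \in S) => /=; ring.
have -> : (4 * c * dl)%:E = ((c * (2 * dl))%:E + (c * (2 * dl))%:E)%E.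
  by rewrite -EFinD; congr (_%:E); ring.
have d20 : 0 < 2 * dl by rewrite mulr_gt0.
apply: sum_norm_le.
  apply: (tent_norm_dominated p01 q00 mu0 mG0 c0 d20 t0) => z z0.
  rewrite /u0 modcM modc_real indicE.
  have [/set_mem zS|_] := boolP (z \in S); last first.
    by rewrite normr0 mulr0 mulr_ge0// ltW.
  rewrite normr1 mulr1; apply: le_trans (uG z z0) _.
  rewrite (mulrC 2) -mulrA ler_wpM2l ?(ltW dl0)//.
  by have : G1 z <= G0 z by []; lra.
apply: (tent_norm_dominated p11 q10 mu1 mG1 c0 d20 t1) => z z0.
rewrite /u1 modcM modc_real indicE.
have [/set_mem zS|_] := boolP (z \in ~` S); last first.
  by rewrite normr0 mulr0 mulr_ge0// ltW.
rewrite normr1 mulr1; apply: le_trans (uG z z0) _.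
rewrite (mulrC 2) -mulrA ler_wpM2l ?(ltW dl0)//.
by have /negP : ~ (G1 z <= G0 z) by []; rewrite -ltNge => /ltW; lra.
Qed.

(** * The two inclusions and the equivalence of norms *)

Section interpolation.
Variables (p0 p1 p : \bar R) (q0 q1 q theta : R).
Hypotheses (p0_ge1 : (1 <= p0)%E) (p1_ge1 : (1 <= p1)%E) (p_ge1 : (1 <= p)%E).
Hypotheses (q0_gt1 : 1 < q0) (q1_gt1 : 1 < q1) (q_gt1 : 1 < q).
Hypothesis theta01 : 0 <= theta <= 1.
Hypothesis i_gt0 : 0 < fine p^-1.
Hypothesis iE : fine p^-1 = (1 - theta) * fine p0^-1 + theta * fine p1^-1.
Hypothesis qE : q^-1 = (1 - theta) * q0^-1 + theta * q1^-1.

Let N0 := tent_norm mu p0 q0 alpha.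
Let N1 := tent_norm mu p1 q1 alpha.
Let N := tent_norm mu p q alpha.

Lemma tent_interp_fun : exists2 C : R, 0 < C & forall (f : X * R -> R[i]^o) (l : R),
  0 < l -> (N f <= l%:E)%E ->
  exists F, [/\ calderon N0 N1 F, F theta%:C = f & (calderon_norm N0 N1 F <= (C * l)%:E)%E].
Proof.
have q00 : 0 < q0 := lt_trans ltr01 q0_gt1.
have q10 : 0 < q1 := lt_trans ltr01 q1_gt1.
have q0' : 0 < q := lt_trans ltr01 q_gt1.
have [C C0 HC] := calderon_decomposition theta01 (inve_ge1 p0_ge1) (inve_ge1 p1_ge1)
  q0_gt1 q1_gt1 i_gt0 q0' iE qE.
exists (4 * C * expR 1) => [|f l l0 Nf]; first by rewrite !mulr_gt0// expR_gt0.
have mf : measurable_upper f by apply: (tent_norm_mble (le_lt_trans Nf (ltry _))).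
have tf := (tent_norm_le p_ge1 q0' mf l0).1 Nf.
have [kk [L [mL HL [[G0 G1] [/= [mG0 mG1] G0E G1E t0 t1]]]]] :=
  HC _ l l0 (uabs_ge0 f) (measurable_uabs mf) (@uabs_out f) tf.
have cl0 : 0 < C * l by exact: mulr_gt0.
have K0 : 0 <= 4 * (C * l) by rewrite mulr_ge0// ltW.
have pos3 (x y : R) k : 0 <= x -> 0 <= 2 ^+ k * (x * expR y).
  by move=> x0; rewrite mulr_ge0 ?exprn_ge0// mulr_ge0// expR_ge0.
have G00 z : 0 <= G0 z by rewrite G0E pos3 ?uabs_ge0.
have G10 z : 0 <= G1 z by rewrite G1E pos3 ?uabs_ge0.
have Lbd n : exists M, forall z, 0 < z.2 -> f z != 0 -> (kk z <= n)%N -> `|L z| <= M.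
  have [M HM] := HL n; exists M => z z0 fz kz; apply: HM => //.
  by rewrite uabsE// gt_eqF// modc_gt0.
have E4 (dl : R) : 0 < dl -> ((C * l * dl)%:E <= (4 * (C * l) * dl)%:E)%E.
  move=> dl0; rewrite lee_fin ler_wpM2r ?(ltW dl0)//; lra.
have b0 : forall (u : X * R -> R[i]^o) (dl : R), 0 < dl -> measurable_upper u ->
    (forall z, 0 < z.2 -> modc (u z) <= dl * (2 ^+ kk z * (modc (f z) * expR (- theta * L z)))) ->
    (N0 u <= (4 * (C * l) * dl)%:E)%E.
  move=> u dl dl0 mu' ub; apply: le_trans (E4 _ dl0).
  apply: (tent_norm_dominated p0_ge1 q00 mu' mG0 cl0 dl0 t0) => z z0.
  by rewrite G0E uabsE//; exact: ub.
have b1 : forall (u : X * R -> R[i]^o) (dl : R), 0 < dl -> measurable_upper u ->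
    (forall z, 0 < z.2 -> modc (u z) <= dl * (2 ^+ kk z * (modc (f z) * expR ((1 - theta) * L z)))) ->
    (N1 u <= (4 * (C * l) * dl)%:E)%E.
  move=> u dl dl0 mu' ub; apply: le_trans (E4 _ dl0).
  apply: (tent_norm_dominated p1_ge1 q10 mu' mG1 cl0 dl0 t1) => z z0.
  by rewrite G1E uabsE//; exact: ub.
have b01 : forall (u : X * R -> R[i]^o) (dl : R), 0 < dl -> measurable_upper u ->
    (forall z, 0 < z.2 -> modc (u z) <= dl * (2 ^+ kk z *
      (modc (f z) * expR (- theta * L z) + modc (f z) * expR ((1 - theta) * L z)))) ->
    (sum_norm N0 N1 u <= (4 * (C * l) * dl)%:E)%E.
  move=> u dl dl0 mu' ub.
  apply: (tent_sum_dominated p0_ge1 p1_ge1 q00 q10 mu' mG0 mG1 cl0 dl0 G00 G10 t0 t1) => z z0.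
  by rewrite G0E G1E uabsE// -mulrDr; exact: ub.
have N0_ge0 u : (0 <= N0 u)%E := tent_norm_ge0 p0 q0 u.
have N1_ge0 u : (0 <= N1 u)%E := tent_norm_ge0 p1 q1 u.
exists (calderon_fun f L theta); split.
- exact: (calderon_calderon_fun mf mL Lbd K0 N0_ge0 N1_ge0 b0 b1 b01).
- exact: calderon_fun_theta.
have -> : 4 * C * expR 1 * l = 4 * (C * l) * expR 1 by ring.
exact: (calderon_norm_calderon_fun mf mL b0 b1).
Qed.

Let i := fine p^-1.

Lemma i_le1 : i <= 1. Proof. by have /andP[] := inve_ge1 p_ge1. Qed.

Let N0_ge0 u : (0 <= N0 u)%E. Proof. exact: tent_norm_ge0. Qed.
Let N1_ge0 u : (0 <= N1 u)%E. Proof. exact: tent_norm_ge0. Qed.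

Lemma sum_norm_decomp u (r : R) : 0 < r -> (sum_norm N0 N1 u <= r%:E)%E ->
  exists v : (X * R -> R[i]^o) * (X * R -> R[i]^o),
  [/\ u = v.1 + v.2, (N0 v.1 <= (2 * r)%:E)%E & (N1 v.2 <= (2 * r)%:E)%E].
Proof.
move=> r0 ur; have : (sum_norm N0 N1 u < (2 * r)%:E)%E.
  by apply: le_lt_trans ur _; rewrite lte_fin; lra.
move=> /ereal_inf_lt[_ [v uE <-] vr]; exists v; split => //.
  by apply: le_trans (ltW vr); rewrite leeDl.
by apply: le_trans (ltW vr); rewrite leeDr.
Qed.

Lemma sum_norm_mble u : (sum_norm N0 N1 u < +oo)%E -> measurable_upper u.
Proof.
move=> /ereal_inf_lt[_ [v -> <-] vr].
have v1 : (N0 v.1 < +oo)%E by apply: le_lt_trans vr; rewrite leeDl.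
have v2 : (N1 v.2 < +oo)%E by apply: le_lt_trans vr; rewrite leeDr.
exact: (measurable_upperD (tent_norm_mble v1) (tent_norm_mble v2)).
Qed.

(** Since Lam is rounded down, the sliced weight is at most w0 on Re z = 0 and at most w0 exp(Lam)
    on Re z = 1, so the pairing inequality bounds the sum of functionals there by a multiple of M.
    At theta rounding loses at most a factor e, and the value is at least c l / e by
    [dual_weights]. *)
Lemma tent_interp_truncated : 0 < theta < 1 -> exists2 C : R, 0 < C &
  forall (F : R[i]^o -> X * R -> R[i]^o) (M : R), calderon N0 N1 F -> 0 < M ->
  (forall t : R, (N0 (F (0 +i* t)%R) <= M%:E)%E) -> (forall t : R, (N1 (F (1 +i* t)%R) <= M%:E)%E) ->
  forall n (l : R), 0 < l ->
  (\int[mu]_x (cone_int (fun z => (l^-1 * (uabs (F theta%:C) z *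
     \1_(plateau (uabs (F theta%:C)) n) z)) `^ q)%R x `^ (i * q)^-1) = 1)%E ->
  l <= C * M.
Proof.
move=> th01.
have i01 : 0 < i <= 1 by rewrite i_gt0 i_le1.
have [c [D [c0 D0 HcD]]] := dual_weights (inve_ge1 p0_ge1) (inve_ge1 p1_ge1)
  q0_gt1 q1_gt1 i01 q_gt1 iE qE.
have [C0 C00 HC0] := tent_pairing p0_ge1 q0_gt1.
have [C1 C10 HC1] := tent_pairing p1_ge1 q1_gt1.
exists (2 * (C0 + C1) * D * expR 1 / c).
  by rewrite divr_gt0// mulr_gt0 ?expR_gt0// mulr_gt0// mulr_gt0// addr_gt0.
move=> F M cF M0 F0 F1 n l l0 I1.
set f := F theta%:C in I1.
have [th0 th1] := andP th01.
have ff : fin_space (sum_norm N0 N1) f by apply: (calderon_range cF); rewrite /strip /= !ltW.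
have mf : measurable_upper f := sum_norm_mble ff.
have [w0 [Lam [B [[mw0 mLam] [w0_ge0 w0_out] LamB [tw0 tw1] low]]]] :=
  HcD _ n l l0 (uabs_ge0 f) (measurable_uabs mf) I1.
(* An integer above the bound of |Lam| on the plateau; there are m + m slices. *)
pose m := (Num.truncn B).+1.
have Lam_lt z : w0 z != 0 -> `|Lam z| < m%:R.
  move=> wz; apply: le_lt_trans (truncnS_gt B); apply: LamB.
  by apply: contrapT => nz; rewrite w0_out// eqxx in wz.
pose w1 z := w0 z * expR (Lam z).
have w1_ge0 z : 0 <= w1 z by rewrite mulr_ge0// expR_ge0.
have mw1 : measurable_fun setT w1.
  by apply: measurable_funM => //; exact: measurableT_comp.
pose Ga := slice w0 Lam m.
have Ga0 k z : 0 <= Ga k z by exact: slice_ge0.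
have mGa k : measurable_fun setT (Ga k) by exact: measurable_slice.
have em0 : 0 < expR m%:R :> R by exact: expR_gt0.
have em1 : 1 <= expR m%:R :> R by rewrite -[leLHS]expR0 ler_expR.
have CD : 0 < (C0 + C1) * D by rewrite mulr_gt0// addr_gt0.
(* This constant depends on the truncation through m. It gives continuity and the a priori bound in
   the strip, while the final bound A is free of it. *)
pose K1 := expR m%:R * ((C0 + C1) * D); have K10 : 0 < K1 by rewrite mulr_gt0.
have CD0 : C0 * D <= (C0 + C1) * D by rewrite ler_wpM2r ?(ltW D0)// lerDl ltW.
have CD1 : C1 * D <= (C0 + C1) * D by rewrite ler_wpM2r ?(ltW D0)// lerDr ltW.
have pw0 u (s : R) : 0 < s -> (N0 u <= s%:E)%E ->
    (\int[lam]_z (uabs u z * w0 z * W z)%:E <= ((C0 + C1) * D * s)%:E)%E.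
  move=> s0 us; have mu' : measurable_upper u by apply: (tent_norm_mble (le_lt_trans us (ltry _))).
  apply: le_trans (HC0 u w0 D s mu' w0_ge0 mw0 D0 s0 tw0 us) _.
  by rewrite lee_fin ler_wpM2r// ltW.
have pw1 u (s : R) : 0 < s -> (N1 u <= s%:E)%E ->
    (\int[lam]_z (uabs u z * w1 z * W z)%:E <= ((C0 + C1) * D * s)%:E)%E.
  move=> s0 us; have mu' : measurable_upper u by apply: (tent_norm_mble (le_lt_trans us (ltry _))).
  apply: le_trans (HC1 u w1 D s mu' w1_ge0 mw1 D0 s0 tw1 us) _.
  by rewrite lee_fin ler_wpM2r// ltW.
have pG0 k u (s : R) : 0 < s -> (N0 u <= s%:E)%E ->
    (\int[lam]_z (uabs u z * Ga k z * W z)%:E <= (K1 * s)%:E)%E.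
  move=> s0 us; have mu' : measurable_upper u by apply: (tent_norm_mble (le_lt_trans us (ltry _))).
  apply: le_trans (le_pairing mu' (mGa k) mw0 (Ga0 k) (slice_le Lam m w0_ge0 k)) _.
  apply: le_trans (pw0 u s s0 us) _; rewrite lee_fin ler_wpM2r ?(ltW s0)//.
  by rewrite /K1 ler_peMl// ltW.
have pG1 k u (s : R) : 0 < s -> (N1 u <= s%:E)%E ->
    (\int[lam]_z (uabs u z * Ga k z * W z)%:E <= (K1 * s)%:E)%E.
  move=> s0 us; have mu' : measurable_upper u by apply: (tent_norm_mble (le_lt_trans us (ltry _))).
  have mew : measurable_fun setT (fun z => expR m%:R * w1 z) by exact: measurable_funM.
  apply: le_trans (le_pairing mu' (mGa k) mew (Ga0 k) (slice_le_exp w0_ge0 Lam_lt k)) _.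
  have -> : (\int[lam]_z (uabs u z * (expR m%:R * w1 z) * W z)%:E =
      (expR m%:R)%:E * \int[lam]_z (uabs u z * w1 z * W z)%:E)%E.
    rewrite -ge0_integralZlT ?expR_ge0//.
    - by apply: eq_integral => z _; rewrite -EFinM; congr (_%:E); ring.
    - by move=> z; exact: pairing_ge0.
    - exact: measurable_pairing.
  apply: le_trans (lee_wpmul2l _ (pw1 u s s0 us)) _; first by rewrite lee_fin expR_ge0.
  by rewrite -EFinM lee_fin /K1 -(mulrA (expR m%:R)).
have pG k u (r : R) : 0 < r -> (sum_norm N0 N1 u <= r%:E)%E ->
    (\int[lam]_z (uabs u z * Ga k z * W z)%:E <= (4 * K1 * r)%:E)%E.
  move=> r0 ur; have [[u0 u1] [/= uE h0 h1]] := sum_norm_decomp r0 ur.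
  have r20 : 0 < 2 * r by rewrite mulr_gt0.
  have m0 : measurable_upper u0 by apply: (tent_norm_mble (le_lt_trans h0 (ltry _))).
  have m1 : measurable_upper u1 by apply: (tent_norm_mble (le_lt_trans h1 (ltry _))).
  have := pairing_lin 1 m0 m1 (mGa k) (Ga0 k) (pG0 k u0 _ r20 h0) (pG1 k u1 _ r20 h1).
  rewrite scale1r -uE modc1 mul1r => h; apply: le_trans h _.
  by rewrite lee_fin le_eqVlt; apply/orP; left; apply/eqP; ring.
pose good u := forall k, paired (Ga k) u.
have good_fin u : fin_space (sum_norm N0 N1) u -> good u.
  move=> fu k; split; first exact: sum_norm_mble.
  have s0 : (0 <= sum_norm N0 N1 u)%E by apply: le_ereal_inf_tmp => _ [v _ <-]; exact: adde_ge0.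
  have fn : sum_norm N0 N1 u \is a fin_num by rewrite ge0_fin_numE.
  exists (4 * K1 * (fine (sum_norm N0 N1 u) + 1)); apply: pG; first by rewrite ltr_wpDl// fine_ge0.
  by rewrite -{1}(fineK fn) lee_fin lerDl.
have goodD u v (a : R[i]) : good u -> good v -> good (u + a *: v).
  move=> gu gv k; have [mu' [r ur]] := gu k; have [mv [r' vr]] := gv k.
  split; first exact: measurable_upper_lin.
  by exists (r + modc a * r'); exact: pairing_lin.
have /choice[ell Hell] k := dual_functional mf (Ga0 k) (mGa k).
have ellD k u v (a : R[i]) : good u -> good v -> ell k (u + a *: v) = ell k u + a * ell k v.
  by move=> gu gv; have [H _ _] := Hell k; exact: H.
have ell_bd k u r : 0 < r -> (sum_norm N0 N1 u <= r%:E)%E -> modc (ell k u) <= 8 * K1 * r.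
  move=> r0 ur; have gu : good u by apply: good_fin; exact: le_lt_trans ur (ltry _).
  have [_ H _] := Hell k; apply: le_trans (H u _ (gu k) (pG k u r r0 ur)) _.
  by rewrite le_eqVlt; apply/orP; left; apply/eqP; ring.
have K80 : 0 <= 8 * K1 by rewrite mulr_ge0// ltW.
pose s := slice_level m : nat -> R.
pose A := 2 * ((C0 + C1) * D * M).
pose I u k := fine (\int[lam]_z (uabs u z * Ga k z * W z)%:E)%E.
have bound (z : R[i]) (w : X * R -> R) : strip z -> measurable_fun setT w ->
    (forall k, modc (cexp (z * (s k)%:C)) = expR (complex.Re z * s k)) ->
    (forall y, \sum_(k < m + m) expR (complex.Re z * s k) * Ga k y <= w y) ->
    (\int[lam]_y (uabs (F z) y * w y * W y)%:E <= ((C0 + C1) * D * M)%:E)%E ->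
    modc (functional_sum F (m + m) ell s z) <= A.
  move=> sz mw Ez wle wM; have gz : good (F z) by exact/good_fin/(calderon_range cF).
  have mz : measurable_upper (F z) by have [] := gz 0%N.
  apply: le_trans (modc_sum _ (fun k => cexp (z * (s k)%:C) * ell k (F z))) _.
  apply: (@le_trans _ _ (2 * \sum_(k < m + m) expR (complex.Re z * s k) * I (F z) k)).
    rewrite mulr_sumr; apply: ler_sum => k _; rewrite modcM Ez mulrCA.
    rewrite ler_wpM2l ?expR_ge0//; have [_ H _] := Hell k; apply: H => //.
    have [_ [r Hr]] := gz k; rewrite /I fineK// ge0_fin_numE ?(le_lt_trans Hr) ?ltry//.
    by apply: integral_ge0 => y _; exact: pairing_ge0.
  rewrite /A; apply: ler_wpM2l => //; rewrite -lee_fin /I.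
  rewrite (@pairing_sum (F z) Ga (fun k => expR (complex.Re z * s k)) (m + m) mz mGa Ga0 (fun k => expR_ge0 _) gz).
  apply: le_trans wM; apply: le_pairing => //.
    by apply: measurable_sum => k; exact: measurable_funM.
  by move=> y; apply: sumr_ge0 => k _; rewrite mulr_ge0// expR_ge0.
have mexp (z : R[i]) k : modc (cexp (z * (s k)%:C)) = expR (complex.Re z * s k).
  by rewrite modc_cexp; congr expR; case: (z) => a b /=; ring.
have le0 y : \sum_(k < m + m) expR (0 * s k) * Ga k y <= w0 y.
  have [wy|wy] := eqVneq (w0 y) 0; first by rewrite wy (slice_sum_out Lam m (fun k => expR (0 * s k)) wy).
  have [k km [_ E]] := slice_index Lam_lt wy.
  by rewrite (E (fun k => expR (0 * s k))) mul0r expR0 mul1r.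
have le1 y : \sum_(k < m + m) expR (1 * s k) * Ga k y <= w1 y.
  have [wy|wy] := eqVneq (w0 y) 0.
    by rewrite (slice_sum_out Lam m (fun k => expR (1 * s k)) wy).
  have [k km [/andP[h _] E]] := slice_index Lam_lt wy.
  by rewrite (E (fun k => expR (1 * s k))) mul1r /w1 mulrC ler_wpM2l// ler_expR.
have := functional_three_lines th01 cF good_fin goodD K80 N0_ge0 N1_ge0 ellD ell_bd (m := m + m) (s := s) (A := A).
have st0 (t : R) : strip (0 +i* t) by rewrite /strip /= lexx ler01.
have st1 (t : R) : strip (1 +i* t) by rewrite /strip /= lexx ler01.
move=> /(_ (fun t => bound _ w0 (st0 t) mw0 (mexp _) le0 (pw0 _ _ M0 (F0 t)))).
move=> /(_ (fun t => bound _ w1 (st1 t) mw1 (mexp _) le1 (pw1 _ _ M0 (F1 t)))).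
have gf : good f := good_fin f ff.
have -> : functional_sum F (m + m) ell s theta%:C =
    (\sum_(k < m + m) expR (theta * s k) * I f k)%:C.
  rewrite /functional_sum (raddf_sum (real_complex R)); apply: eq_bigr => k _.
  have [_ _ ->] := Hell k => //.
  by rewrite -(rmorphM (real_complex R)) cexp_real -(rmorphM (real_complex R)).
rewrite modc_real => /(le_trans (ler_norm _)).
rewrite -lee_fin /I.
rewrite (@pairing_sum f Ga (fun k => expR (theta * s k)) (m + m) mf mGa Ga0 (fun k => expR_ge0 _) gf).
move=> up.
have low2 : ((expR (- 1) * (c * l))%:E <= A%:E)%E.
  apply: le_trans up; rewrite EFinM.
  apply: (@le_trans _ _ ((expR (- 1))%:E * \int[lam]_z (uabs f z * (w0 z * expR (theta * Lam z)) * W z)%:E)%E).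
    by apply: lee_wpmul2l => //; rewrite lee_fin expR_ge0.
  have mwt : measurable_fun setT (fun z => w0 z * expR (theta * Lam z)).
    by apply: measurable_funM => //; apply: measurableT_comp => //; exact: measurable_funM.
  have wt0 z : 0 <= w0 z * expR (theta * Lam z) by rewrite mulr_ge0// expR_ge0.
  rewrite -ge0_integralZlT ?expR_ge0//; last 2 first.
  - by move=> z; exact: (@pairing_ge0 f (fun z => w0 z * expR (theta * Lam z))).
  - exact: (measurable_pairing mf mwt).
  have -> : (\int[lam]_z ((expR (- 1))%:E * (uabs f z * (w0 z * expR (theta * Lam z)) * W z)%:E) =
     \int[lam]_z (uabs f z * (expR (- 1) * (w0 z * expR (theta * Lam z))) * W z)%:E)%E.
    by apply: eq_integral => z _; rewrite -EFinM; congr (_%:E); ring.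
  apply: le_pairing => //.
  - exact: measurable_funM.
  - by apply: measurable_sum => k; exact: measurable_funM.
  - by move=> z; rewrite mulr_ge0// expR_ge0.
  move=> z; have [wz|wz] := eqVneq (w0 z) 0.
    by rewrite wz mul0r mulr0 (slice_sum_out Lam m (fun k => expR (theta * s k)) wz).
  have [k km [/andP[_ h] E]] := slice_index Lam_lt wz.
  rewrite (E (fun k => expR (theta * s k))) mulrCA mulrC ler_wpM2r// -expRD ler_expR.
  have : theta * Lam z <= theta * (s k + 1) by rewrite ler_wpM2l ?(ltW th0)// ltW.
  lra.
move: low2; rewrite lee_fin expRN mulrC ler_pdivrMr ?expR_gt0// => h.
rewrite mulrAC ler_pdivlMr// mulrC.
apply: le_trans h _; rewrite /A le_eqVlt; apply/orP; left; apply/eqP; ring.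
Qed.

(** The truncation of F(theta) to a plateau is bounded and supported in a cylinder, so its area
    integral is finite and can be normalised. The bound C M is the same for all plateaus, and
    [tent_bd_lim] passes to the limit. *)
Lemma tent_interp_lower : 0 < theta < 1 -> exists2 C : R, 0 < C &
  forall (F : R[i]^o -> X * R -> R[i]^o) (M : R), calderon N0 N1 F -> 0 < M ->
  (forall t : R, (N0 (F (0 +i* t)%R) <= M%:E)%E) -> (forall t : R, (N1 (F (1 +i* t)%R) <= M%:E)%E) ->
  (N (F theta%:C) <= (C * M)%:E)%E.
Proof.
move=> th01; have [C C0 HC] := tent_interp_truncated th01.
have [th0 th1] := andP th01.
have qpos : 0 < q := lt_trans ltr01 q_gt1.
exists C => // F M cF M0 F0 F1; have CM0 : 0 < C * M by exact: mulr_gt0.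
have ff : fin_space (sum_norm N0 N1) (F theta%:C).
  by apply: (calderon_range cF); rewrite /strip /= !ltW.
have mf : measurable_upper (F theta%:C) := sum_norm_mble ff.
apply/(tent_norm_le p_ge1 qpos mf CM0); rewrite -/i.
set g := uabs (F theta%:C).
have g0 z : 0 <= g z := uabs_ge0 _ z.
have mg : measurable_fun setT g := measurable_uabs mf.
have CMV : 0 <= (C * M)^-1 by rewrite invr_ge0 ltW.
have Cg0 z : 0 <= (C * M)^-1 * g z by rewrite mulr_ge0.
have mCg : measurable_fun setT (fun z => (C * M)^-1 * g z) by exact: measurable_funM.
apply: (tent_bd_lim i_gt0 qpos Cg0 mCg (fun n => measurable_plateau n mg) (@le_plateau g)).
  move=> z z0 gz; apply: plateau_cover => //.
  by apply: contraNneq gz => ->; rewrite mulr0.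
move=> n; pose h z := g z * \1_(plateau g n) z.
have mI : measurable_fun setT (\1_(plateau g n) : X * R -> R).
  by apply: measurable_indic; exact: measurable_plateau.
have h0 z : 0 <= h z by rewrite mulr_ge0.
have mh : measurable_fun setT h by exact: measurable_funM.
pose I := (\int[mu]_x (cone_int (fun z => h z `^ q)%R x `^ (i * q)^-1))%E.
have I0 : (0 <= I)%E by apply: integral_ge0 => x _; exact: poweR_ge0.
have Ifin : I \is a fin_num.
  rewrite ge0_fin_numE//.
  have [B B0 tB] := tent_bd_cylinder n (ltW i_gt0) qpos.
  have mc : measurable_fun setT (\1_(cylinder n) : X * R -> R).
    by apply: measurable_indic; exact: measurable_cylinder.
  have mnc : measurable_fun setT (fun z => n.+1%:R * \1_(cylinder n) z : R).
    exact: measurable_funM.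
  have hc z : 0 < z.2 -> h z <= n.+1%:R * \1_(cylinder n) z.
    move=> _; rewrite /h !indicE.
    have [/set_mem/plateauP[zn /andP[_ gn]]|_] := boolP (z \in plateau g n); last first.
      by rewrite mulr0 mulr_ge0.
    by rewrite mem_set// !mulr1.
  have : tent_bd i q (n.+1%:R `^ i^-1 * B) (fun z => n.+1%:R * \1_(cylinder n) z).
    rewrite /tent_bd gt_eqF ?i_gt0// in tB *; rewrite area_scale//.
    by rewrite EFinM lee_wpmul2l ?lee_fin ?powR_ge0.
  move=> /(le_tent_bd (ltW i_gt0) (ltW qpos) h0 mh mnc hc).
  rewrite /tent_bd gt_eqF ?i_gt0// -/I => hI; exact: le_lt_trans hI (ltry _).
have -> : (fun z => (C * M)^-1 * g z * \1_(plateau g n) z) = (fun z => (C * M)^-1 * h z).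
  by apply/funext => z; rewrite /h -[LHS]mulrA.
rewrite /tent_bd gt_eqF ?i_gt0// area_scale// -/I -(fineK Ifin) -EFinM lee_fin.
have [If|If] := eqVneq (fine I) 0; first by rewrite If mulr0 ler01.
have I1 : 0 < fine I by rewrite lt_neqAle eq_sym If fine_ge0.
(* The norm of the truncated function: dividing by it makes the area integral exactly 1, the
   normalisation of [tent_interp_truncated]. *)
pose l := fine I `^ i; have l0 : 0 < l by exact: powR_gt0.
have lI : l^-1 `^ i^-1 * fine I = 1.
  rewrite /l -powR_inv1 ?powR_ge0// -!powRrM.
  have -> : i * (-1 / i) = -1 by rewrite mulN1r mulrN mulfV// gt_eqF// i_gt0.
  by rewrite powR_inv1 ?(ltW I1)// mulVf.
have lCM : l <= C * M.
  apply: (HC F M cF M0 F0 F1 n l l0).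
  by rewrite area_scale ?invr_ge0 ?(ltW l0)// -/I -(fineK Ifin) -EFinM lI.
rewrite -lI ler_wpM2r ?(ltW I1)//; apply: ge0_ler_powR; rewrite ?nnegrE ?invr_ge0 ?(ltW l0)//.
- exact: ltW i_gt0.
- exact: ltW CM0.
- by rewrite lef_pV2 ?posrE.
Qed.

Lemma tent_norm_add (r : \bar R) (s : R) : (1 <= r)%E -> 1 < s -> exists2 K : R, 0 < K &
  forall (u v : X * R -> R[i]^o) (l : R), 0 < l -> (tent_norm mu r s alpha u <= l%:E)%E ->
  (tent_norm mu r s alpha v <= l%:E)%E -> (tent_norm mu r s alpha (u + v)%R <= (K * l)%:E)%E.
Proof.
move=> r1 s1; have s0 : 0 < s := lt_trans ltr01 s1.
have [r0 _] := andP (inve_ge1 r1).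
have [K K0 HK] := tent_bd_add (inve_ge1 r1) (ltW s1).
exists K => // u v l l0 ul vl.
have mu' : measurable_upper u by apply: (tent_norm_mble (le_lt_trans ul (ltry _))).
have mv : measurable_upper v by apply: (tent_norm_mble (le_lt_trans vl (ltry _))).
have muv : measurable_upper (u + v) by exact: (measurable_upperD mu' mv).
have Kl0 : 0 < K * l by exact: mulr_gt0.
have lV0 : 0 <= l^-1 by rewrite invr_ge0 ltW.
have P w z : 0 <= l^-1 * uabs w z by rewrite mulr_ge0// uabs_ge0.
have mP w : measurable_upper w -> measurable_fun setT (fun z => l^-1 * uabs w z).
  by move=> mw; apply: measurable_funM => //; exact: measurable_uabs.
apply/(tent_norm_le r1 s0 muv Kl0).
have := HK _ _ (P u) (P v) (mP u mu') (mP v mv) ((tent_norm_le r1 s0 mu' l0).1 ul)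
  ((tent_norm_le r1 s0 mv l0).1 vl).
have Q z : 0 <= (K * l)^-1 * uabs (u + v) z.
  by apply: mulr_ge0; [rewrite invr_ge0 ltW|exact: uabs_ge0].
have mQ : measurable_fun setT (fun z => (K * l)^-1 * uabs (u + v) z).
  by apply: measurable_funM => //; exact: measurable_uabs.
have mS : measurable_fun setT (fun z => K^-1 * (l^-1 * uabs u z + l^-1 * uabs v z)).
  by apply: measurable_funM => //; apply: measurable_funD; exact: mP.
apply: (le_tent_bd r0 (ltW s0) Q mQ mS) => z _.
rewrite invfM -mulrA ler_wpM2l ?invr_ge0 ?(ltW K0)// -mulrDr ler_wpM2l//.
by have := uabs_add u v 1 z; rewrite scale1r modc1 mul1r.
Qed.

(** The definition of a trace asks for finite values only pointwise, whereas the lower bound needs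
    one M for the whole line. Decay settles large |t|; on the remaining segment continuity and
    compactness do, with the triangle inequality up to the constant K. *)
Lemma trace_bounded (Nj : (X * R -> R[i]^o) -> \bar R) (K : R) (g : R -> X * R -> R[i]^o) :
  0 < K -> (forall u, 0 <= Nj u)%E ->
  (forall u v l, 0 < l -> (Nj u <= l%:E)%E -> (Nj v <= l%:E)%E -> (Nj (u + v)%R <= (K * l)%:E)%E) ->
  C0_trace Nj g -> exists M : R, forall t, (Nj (g t) <= M%:E)%E.
Proof.
move=> K0 Nj0 Nadd [gfin gcont gp gn].
have Nfin t : Nj (g t) \is a fin_num by rewrite ge0_fin_numE//; exact: gfin.
move: gp gn => /(cvg0_ereal (fun t => Nj0 _))/(_ 1 ltr01)[A [_ HA]].
move=> /(cvg0_ereal (fun t => Nj0 _))/(_ 1 ltr01)[B [_ HB]].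
pose P (n : nat) (t : R) := (Nj (g t) <= n%:R%:E)%E.
have /compact_near_coveringP cov : compact (`[B, A]%classic : set R) by exact: segment_compact.
have [n _ Hn] : \forall n \near \oo, `[B, A]%classic `<=` P n.
  apply: (cov _ _ P) => t0 _.
  have gt0 := gcont t0; move: gt0 => /(cvg0_ereal (fun t => Nj0 _))/(_ 1 ltr01) Ht0.
  pose l := fine (Nj (g t0)) + 1.
  have l0 : 0 < l by rewrite ltr_wpDl// fine_ge0.
  pose n0 := (Num.truncn (K * l)).+1.
  exists ([set t | (Nj (g t - g t0)%R <= 1%:E)%E], [set n | (n0 <= n)%N]); first by split => //; exists n0.
  move=> [t n] [/= Nt nn]; rewrite /P.
  have -> : g t = (g t - g t0) + g t0 by rewrite subrK.
  apply: (@le_trans _ _ (K * l)%:E).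
    apply: Nadd => //.
      by apply: le_trans Nt _; rewrite lee_fin lerDr fine_ge0.
    by rewrite -(fineK (Nfin t0)) lee_fin lerDl.
  rewrite lee_fin; apply: le_trans (ltW (truncnS_gt _)) _.
  by rewrite ler_nat.
exists (Num.max 1 n%:R) => t.
have [tA|At] := leP t A; last by apply: le_trans (HA t At) _; rewrite lee_fin le_max lexx.
have [Bt|tB] := leP B t; last by apply: le_trans (HB t tB) _; rewrite lee_fin le_max lexx.
have : P n t by apply: (Hn n (leqnn n)); rewrite /= in_itv/= Bt.
by move=> h; apply: le_trans h _; rewrite lee_fin le_max lexx orbT.
Qed.

(** The lower bound is a premise, because for theta = 0 and theta = 1 it comes from the trace itself
    and in between from [tent_interp_lower]. *)
Lemma tent_interp_equiv :
  (exists2 C : R, 0 < C & forall (F : R[i]^o -> X * R -> R[i]^o) (M : R), calderon N0 N1 F -> 0 < M ->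
   (forall t : R, (N0 (F (0 +i* t)%R) <= M%:E)%E) -> (forall t : R, (N1 (F (1 +i* t)%R) <= M%:E)%E) ->
   (N (F theta%:C) <= (C * M)%:E)%E) ->
  interp_space N0 N1 theta = tent_space mu p q alpha /\
  exists c C : R, [/\ 0 < c, 0 < C & forall f, tent_space mu p q alpha f ->
    (c%:E * N f <= interp_norm N0 N1 theta f)%E /\ (interp_norm N0 N1 theta f <= C%:E * N f)%E].
Proof.
move=> [c c0 Hc]; have [C C0 HC] := tent_interp_fun.
have N_ge0 u : (0 <= N u)%E := tent_norm_ge0 p q u.
have finN f : tent_space mu p q alpha f -> N f \is a fin_num.
  by move=> ff; rewrite ge0_fin_numE.
split.
  apply/seteqP; split.
    move=> _ [F /= cF <-].
    have [K0 K00 HK0] := tent_norm_add p0_ge1 q0_gt1.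
    have [K1 K10 HK1] := tent_norm_add p1_ge1 q1_gt1.
    have [M0 HM0] := trace_bounded K00 N0_ge0 HK0 (calderon_trace0 cF).
    have [M1 HM1] := trace_bounded K10 N1_ge0 HK1 (calderon_trace1 cF).
    pose M := `|M0| + `|M1| + 1.
    have Mp : 0 < M by rewrite ltr_wpDl// addr_ge0.
    apply: (@le_lt_trans _ _ (c * M)%:E); last exact: ltry.
    apply: Hc => // t.
      apply: le_trans (HM0 t) _; rewrite lee_fin; apply: le_trans (ler_norm _) _.
      by rewrite /M -addrA lerDl addr_ge0.
    apply: le_trans (HM1 t) _; rewrite lee_fin; apply: le_trans (ler_norm _) _.
    by rewrite /M addrAC lerDr addr_ge0.
  move=> f ff; have [F [cF Ff _]] : exists F, [/\ calderon N0 N1 F, F theta%:C = f &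
      (calderon_norm N0 N1 F <= (C * (fine (N f) + 1))%:E)%E].
    apply: HC; first by rewrite ltr_wpDl// fine_ge0.
    by rewrite -{1}(fineK (finN f ff)) lee_fin lerDl.
  by exists F.
exists c^-1, C; split; [by rewrite invr_gt0|by []|move=> f ff; split].
  apply: le_ereal_inf_tmp => _ [F [cF Ff] <-].
  set n := calderon_norm N0 N1 F.
  have H0 t : (N0 (F (0 +i* t)%R) <= n)%E.
    by rewrite le_max; apply/orP; left; apply: ereal_sup_ubound; exists t.
  have H1 t : (N1 (F (1 +i* t)%R) <= n)%E.
    by rewrite le_max; apply/orP; right; apply: ereal_sup_ubound; exists t.
  have n0 : (0 <= n)%E by apply: le_trans (H0 0); exact: N0_ge0.
  have [->|noo] := eqVneq n +oo%E; first by rewrite leey.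
  have nfin : n \is a fin_num by rewrite ge0_fin_numE// ltey.
  apply/lee_addgt0Pr => e e0.
  have Mp : 0 < fine n + e by rewrite ltr_wpDl// fine_ge0.
  have nM : (n <= (fine n + e)%:E)%E by rewrite -{1}(fineK nfin) lee_fin lerDl ltW.
  have := Hc F (fine n + e) cF Mp (fun t => le_trans (H0 t) nM) (fun t => le_trans (H1 t) nM).
  rewrite -[F theta%:C]/(F (theta +i* 0)) Ff -(fineK (finN f ff)) -{2}(fineK nfin) -EFinD -EFinM !lee_fin => h.
  by rewrite mulrC ler_pdivrMr// mulrC.
apply/lee_addgt0Pr => e e0.
(* The margin e / C keeps l positive when the norm of f is 0, and costs exactly e after
   multiplication by C. *)
pose l := fine (N f) + e / C.
have l0 : 0 < l by rewrite ltr_wpDl ?fine_ge0// divr_gt0.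
have [F [cF Ff Fl]] : exists F, [/\ calderon N0 N1 F, F theta%:C = f &
    (calderon_norm N0 N1 F <= (C * l)%:E)%E].
  by apply: HC => //; rewrite -{1}(fineK (finN f ff)) lee_fin lerDl ltW// divr_gt0.
apply: (@le_trans _ _ (calderon_norm N0 N1 F)).
  by apply: ereal_inf_lbound; exists F.
apply: le_trans Fl _; rewrite -{1}(fineK (finN f ff)) -EFinM -EFinD lee_fin /l mulrDr lerD2l.
by rewrite mulrC divfK// gt_eqF.
Qed.

End interpolation.

End tent_kernel.

(** * The empty space and the final reductions *)

Lemma interp_equiv_trivial {R : realType} {V : lmodType R[i]} (theta : R) :
  let Z : V -> \bar R := fun _ => 0%E in
  interp_space Z Z theta = fin_space Z /\
  exists c C : R, [/\ 0 < c, 0 < C & forall f, fin_space Z f ->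
    (c%:E * Z f <= interp_norm Z Z theta f)%E /\ (interp_norm Z Z theta f <= C%:E * Z f)%E].
Proof.
move=> Z; have Z0 u : (0 <= Z u)%E by [].
have sumZ : sum_norm Z Z = Z.
  apply/funext => u; apply/eqP; rewrite eq_le; apply/andP; split.
    by apply: ge_ereal_inf; exists (Z u + Z 0%R)%E; [exists (u, 0) => //=; rewrite addr0|rewrite /Z adde0].
  by apply: le_ereal_inf_tmp => _ [v _ <-]; rewrite /Z adde0.
have finZ u : fin_space Z u by exact: ltry.
have cF (f : V) : calderon Z Z (fun _ => f).
  split; rewrite ?sumZ.
  - by move=> z _; exact: finZ.
  - by exists 0.
  - by move=> z _; exact: cvg_cst.
  - by move=> z _; exists 0 => //; exact: cvg_cst.
  - by split => [t|t||]; [exact: finZ|exact: cvg_cst|exact: cvg_cst|exact: cvg_cst].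
  - by split => [t|t||]; [exact: finZ|exact: cvg_cst|exact: cvg_cst|exact: cvg_cst].
split.
  apply/seteqP; split => [u _|u _]; first exact: finZ.
  by exists (fun _ => u).
exists 1, 1; split => // f _; rewrite !mul1e; split.
  apply: le_ereal_inf_tmp => _ [F _ <-]; rewrite le_max; apply/orP; left.
  by apply: ereal_sup_ubound; exists 0.
apply: (@le_trans _ _ (calderon_norm Z Z (fun _ => f))).
  by apply: ereal_inf_lbound; exists (fun _ => f).
by rewrite ge_max; apply/andP; split; apply: ge_ereal_sup => _ [t _ <-].
Qed.

Section sigma_finite_copy.
Context {d : measure_display} {R : realType} {X : measurableType d}.
Variable mu : {measure set X -> \bar R}.
Hypothesis mu_sigma_finite : sigma_finite setT mu.

(* HB instances cannot be attached to the variable mu itself. *)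
Definition measure_copy : set X -> \bar R := mu.

HB.instance Definition _ := Measure.on measure_copy.
HB.instance Definition _ := Measure_isSigmaFinite.Build _ _ _ measure_copy mu_sigma_finite.

Lemma sigma_finite_eq : exists nu : {sigma_finite_measure set X -> \bar R},
  mu = nu :> {measure set X -> \bar R}.
Proof. by exists measure_copy; exact: eq_measure. Qed.

End sigma_finite_copy.

Lemma convex_inv_gt1 {R : realType} (theta q0 q1 q : R) : 0 <= theta <= 1 -> 1 < q0 -> 1 < q1 ->
  q^-1 = (1 - theta) * q0^-1 + theta * q1^-1 -> 1 < q.
Proof.
move=> /andP[t0 t1] h0 h1.
have q00 : 0 < q0 := lt_trans ltr01 h0; have q10 : 0 < q1 := lt_trans ltr01 h1.
have u0 : 0 < q0^-1 by rewrite invr_gt0.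
have v0 : 0 < q1^-1 by rewrite invr_gt0.
have u1 : q0^-1 < 1 by rewrite invf_lt1.
have v1 : q1^-1 < 1 by rewrite invf_lt1.
move: (q0^-1) (q1^-1) u0 v0 u1 v1 => u v u0 v0 u1 v1 qE.
have t1' : 0 <= 1 - theta by rewrite subr_ge0.
have m0 : 0 < Num.min u v by rewrite lt_min u0.
have M1 : Num.max u v < 1 by rewrite gt_max u1.
have lo : (1 - theta) * Num.min u v + theta * Num.min u v <= (1 - theta) * u + theta * v.
  by apply: lerD; rewrite ler_wpM2l// ge_min lexx ?orbT.
have up : (1 - theta) * u + theta * v <= (1 - theta) * Num.max u v + theta * Num.max u v.
  by apply: lerD; rewrite ler_wpM2l// le_max lexx ?orbT.
rewrite -!mulrDl subrK !mul1r -qE in lo up.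
have qV0 : 0 < q^-1 := lt_le_trans m0 lo.
have qpos : 0 < q by rewrite -invr_gt0.
by rewrite -(invf_lt1 qpos); exact: le_lt_trans up M1.
Qed.

(** The constructions above start from a base point, so the empty space is treated apart: there
    [interp_equiv_trivial] applies to the zero norms. *)
Lemma tent_norm_empty {d : measure_display} {R : realType} {X : borelMetricType d R}
  (mu : {measure set X -> \bar R}) (r : \bar R) (q alpha : R) : (X -> False) -> (1 <= r)%E ->
  tent_norm mu r q alpha = (fun _ => 0%E).
Proof.
move=> nX r1; apply/funext => f.
have mE (A : set (X * R)) : measurable A.
  by rewrite (_ : A = set0)//; apply/seteqP; split => -[x t] //; case: (nX x).
have mf : measurable_upper f by split => mU Y mY; exact: mE.
have T0 : [set: X] = set0 by apply/seteqP; split => x //; case: (nX x).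
rewrite /tent_norm asboolT//=; case: r r1 => [r r1|_|//] /=; rewrite unlock.
  rewrite integral0_eq; last by move=> x; case: (nX x).
  by rewrite poweR0r// invr_eq0 gt_eqF// (lt_le_trans ltr01).
by rewrite T0 measure0 ltxx.
Qed.

(* theta0 and theta1 exclude p = +oo, where the identity fails: the space
   [B_0, B_1]_0 is always the closure of the intersection of B_0 and B_1 in B_0,
   which is in general a proper subspace of a tent space T^{oo,q_0,alpha}. *)
Theorem proposition3p18 (d : measure_display) (R : realType)
  (X : borelMetricType d R) (mu : {measure set X -> \bar R})
  (mu_ball : forall (x : X) (r : R), 0 < r -> (0 < vol mu x r < +oo)%E)
  (mu_doubling : doubling mu)
  (p0 p1 p : \bar R) (q0 q1 q theta alpha : R)
  (p0_ge1 : (1 <= p0)%E) (p1_ge1 : (1 <= p1)%E)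
  (p01 : ~ (p0 = +oo%E /\ p1 = +oo%E))
  (q0_gt1 : 1 < q0) (q1_gt1 : 1 < q1)
  (theta01 : 0 <= theta <= 1)
  (theta0 : theta = 0 -> p0 <> +oo%E) (theta1 : theta = 1 -> p1 <> +oo%E)
  (alpha_gt0 : 0 < alpha)
  (pE : (p^-1 = (1 - theta)%:E * p0^-1 + theta%:E * p1^-1)%E)
  (qE : q^-1 = (1 - theta) * q0^-1 + theta * q1^-1) :
  let N0 := tent_norm mu p0 q0 alpha in
  let N1 := tent_norm mu p1 q1 alpha in
  let N := tent_norm mu p q alpha in
  interp_space N0 N1 theta = tent_space mu p q alpha /\
  exists c C : R, [/\ 0 < c, 0 < C &
    forall f, tent_space mu p q alpha f ->
      (c%:E * N f <= interp_norm N0 N1 theta f)%E /\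
      (interp_norm N0 N1 theta f <= C%:E * N f)%E].

Proof.
have finV (r : \bar R) : (1 <= r)%E -> r^-1%E = (fine r^-1)%:E.
  case: r => [r r1|_|//]; last by rewrite invey.
  by rewrite inver gt_eqF// (lt_le_trans ltr01).
have [t0 t1] := andP theta01.
have [a00 a01] := andP (inve_ge1 p0_ge1); have [a10 a11] := andP (inve_ge1 p1_ge1).
have iE' : (p^-1 = ((1 - theta) * fine p0^-1 + theta * fine p1^-1)%:E)%E.
  by rewrite pE (finV p0)// (finV p1)// EFinD !EFinM.
have iE : fine p^-1 = (1 - theta) * fine p0^-1 + theta * fine p1^-1 by rewrite iE'.
have infty (r : \bar R) : (1 <= r)%E -> fine r^-1 = 0 -> r = +oo%E.
  by move=> r1 rE; apply/eqP; rewrite -inve_eq0 finV// rE.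
have t1' : 0 <= 1 - theta by rewrite subr_ge0.
(* If 1 / p vanished, both nonnegative summands would. The four ways for this to happen are theta
   equal to both 1 and 0, the two endpoint cases excluded by [theta1] and [theta0], and both
   exponents infinite, excluded by [p01]. *)
have i_gt0 : 0 < fine p^-1.
  rewrite iE lt_neqAle addr_ge0 ?mulr_ge0// andbT eq_sym.
  rewrite paddr_eq0 ?mulr_ge0// !mulf_eq0 subr_eq0; apply/negP => /andP[h0 h1].
  case/orP: h0 => [/eqP h0|/eqP/(infty _ p0_ge1) h0]; case/orP: h1 => [/eqP h1|/eqP/(infty _ p1_ge1) h1].
  - by move: (oner_eq0 R); rewrite h0 h1 eqxx.
  - by apply: theta1.
  - by apply: theta0.
  - by apply: p01.
have i_le1 : fine p^-1 <= 1.
  rewrite iE; have := ler_wpM2l t1' a01; have := ler_wpM2l t0 a11; lra.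
have p_ge1 : (1 <= p)%E.
  by rewrite -(inveK p) iE' -iE inver gt_eqF// lee_fin invf_ge1.
have q_gt1 : 1 < q := convex_inv_gt1 theta01 q0_gt1 q1_gt1 qE.
move=> N0 N1 N.
have [[y _]|nX] := pselect (exists y : X, True); last first.
  have nX' : X -> False by move=> x; apply: nX; exists x.
  rewrite /N0 /N1 /N /tent_space !tent_norm_empty//.
  exact: interp_equiv_trivial.
have [mu' muE] := sigma_finite_eq (sigma_finite_balls mu_ball y).
rewrite /N0 /N1 /N; rewrite muE in mu_ball mu_doubling *.
apply: (tent_interp_equiv mu_ball mu_doubling y) => //.
(* At an endpoint the intermediate space is the corresponding end space and F(theta) is a value of
   the trace, so the lower bound holds with constant 1. *)
have [th0|th0] := eqVneq theta 0.
  have pE0 : p = p0 by rewrite -[p]inveK pE th0 subr0 mul1e mul0e adde0 inveK.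
  have qE0 : q = q0 by apply: invr_inj; rewrite qE th0 subr0 mul1r mul0r addr0.
  by exists 1 => // F M _ _ F0 _; rewrite pE0 qE0 th0 mul1r; exact: F0.
have [th1|th1] := eqVneq theta 1.
  have pE1 : p = p1 by rewrite -[p]inveK pE th1 subrr mul1e mul0e add0e inveK.
  have qE1 : q = q1 by apply: invr_inj; rewrite qE th1 subrr mul1r mul0r add0r.
  by exists 1 => // F M _ _ _ F1; rewrite pE1 qE1 th1 mul1r; exact: F1.
apply: (tent_interp_lower mu_ball mu_doubling y) => //.
by rewrite !lt_neqAle t0 t1 th1 eq_sym th0.
Qed.
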